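(* Let $X_1,X_2,\ldots$ be i.i.d. real random variables with law $P$ on $\mathbb R$ that has a bounded density $p_0$. Let $(j_n)$ be a sequence of positive integers with $j_n\to\infty$, $n/(j_n2^{j_n})\to\infty$, $j_n/\log\log n\to\infty$ and $j_{2n}-j_n\le\tau$ for some $\tau>0$. Let $r\ge 1$ be an integer and let $p_n(y)=p_n(y,j_n)$ be the spline projection density estimator of order $r$ at resolution level $j_n$. Then $$\limsup_n\sqrt{\frac{n}{2^{j_n}j_n}}\,\sup_{y\in\mathbb R}|p_n(y)-Ep_n(y)|=C\quad\text{a.s.}$$ and, for $1\le p<\infty$, $$\sup_n\sqrt{\frac{n}{2^{j_n}j_n}}\Bigl(E\sup_{y\in\mathbb R}|p_n(y)-Ep_n(y)|^p\Bigr)^{1/p}\le C',$$ where $C$ and $C'$ depend only on $\|p_0\|_\infty$ and on $r,p,\tau$. Moreover, if $p_0\in\mathsf C^t(\mathbb R)$ for some $0<t\le r$, then $$\sup_{y\in\mathbb R}|p_n(y)-p_0(y)|=O\Bigl(\sqrt{\frac{2^{j_n}j_n}{n}}+2^{-tj_n}\Bigr)\quad\text{a.s. and in }L^p(P).$$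
   Context: B-splines: $N_{0,r}=1_{[0,1)}*\cdots*1_{[0,1)}$ ($r$ factors), $N_{k,r}(x)=N_{0,r}(x-k)$, $N_{j,k,r}(x)=N_{k,r}(2^jx)$ for $k\in\mathbb Z$. Let $A=(a_{kl})_{k,l\in\mathbb Z}$, $a_{kl}=\int N_{k,r}(x)N_{l,r}(x)\,dx$, and let $b_{kl}$ be the entries of $A^{-1}$. The spline projection kernel of order $r$ is $\kappa(x,y)=\sum_k\sum_l b_{kl}N_{l,r}(x)N_{k,r}(y)$ and $\kappa_j(x,y)=2^j\kappa(2^jx,2^jy)$; it is the kernel of the $L^2(\mathbb R)$-orthogonal projection onto $\mathcal S_r(2^{-j}\mathbb Z)\cap L^2(\mathbb R)$, where $\mathcal S_r(2^{-j}\mathbb Z)$ is the (Schoenberg) space of splines of order $r$ (degree $r-1$) with knots at $2^{-j}\mathbb Z$. The spline projection density estimator is $$p_n(y,j)=\frac1n\sum_{i=1}^n\kappa_j(y,X_i),\qquad y\in\mathbb R.$$ Function spaces: for $h:\mathbb R\to\mathbb R$, $\|h\|_\infty=\sup_{x}|h(x)|$. For an integer $s\ge 0$, $\mathsf C^s(\mathbb R)$ is the space of bounded uniformly continuous functions that are $s$-times differentiable with bounded uniformly continuous derivatives $D^\alpha f$, $0<\alpha\le s$, normed by $\|f\|_{s,\infty}=\sum_{0\le\alpha\le s}\|D^\alpha f\|_\infty$ (with $D^0f=f$). For non-integer $s>0$ with integer part $[s]$, $\mathsf C^s(\mathbb R)$ is the set of $f\in\mathsf C^{[s]}(\mathbb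 R)$ with $\|f\|_{s,\infty}:=\sum_{0\le\alpha\le[s]}\|D^\alpha f\|_\infty+\sup_{x\ne y}|D^{[s]}f(x)-D^{[s]}f(y)|/|x-y|^{s-[s]}<\infty$. A statement ''$Z_n=O(a_n)$ in $L^p(P)$'' means $(E|Z_n|^p)^{1/p}=O(a_n)$, for $1\le p<\infty$.
   Formalization: The moment bound with C' depending only on ‖p0‖∞, r, p, τ is stated for n with j_n 2^{j_n} ≤ n; for the sup over all n the constant may also depend on (j_n), since j_1 is unconstrained. ‖p0‖∞ is the essential supremum. *)

(* Defs.v *)
From HB Require Import structures.
From mathcomp Require Import all_boot all_order all_algebra.
From mathcomp Require Import finmap.
From mathcomp Require Import all_classical all_reals all_analysis.

Set Implicit Arguments.
Unset Strict Implicit.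
Unset Printing Implicit Defensive.

Import Order.TTheory GRing.Theory Num.Theory.
Import numFieldNormedType.Exports.

Local Open Scope classical_set_scope.
Local Open Scope ring_scope.

Section Splines.
Context {R : realType}.

Definition convolution (f g : R -> R) (x : R) : R :=
  \int[lebesgue_measure]_y (f (x - y) * g y).

(* N_{0,r}, the convolution of r copies of 1_[0,1); only used for r >= 1
   (the value at r = 0 is a dummy). *)
Definition bspline0 (r : nat) : R -> R :=
  iter r.-1 (fun f => convolution f \1_`[0, 1[) \1_`[0, 1[.

Definition bspline (k : int) (r : nat) (x : R) : R := bspline0 r (x - k%:~R).

(* Sum over Z, as the limit of the sums over |k| <= n. It is only applied to
   finitely supported or absolutely summable families. *)
Definition sumZ (u : int -> R) : R :=
  limn (fun n : nat => \sum_(i < n.*2.+1) u (i%:Z - n%:Z)).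

Definition l2Z (u : int -> R) : Prop :=
  (\esum_(k in [set: int]) (u k ^+ 2)%:E < +oo)%E.

Definition mulZ (a : int -> int -> R) (u : int -> R) : int -> R :=
  fun k => sumZ (fun l => a k l * u l).

(* b is the matrix of the inverse of a, seen as an operator on l^2(Z). The
   space has to be fixed: bi-infinite matrices b with a b = b a = 1 entrywise
   are not unique. On l^2(Z) the identities determine b, the l-th column of b
   being the preimage of the l-th unit vector. *)
Definition l2_inverse (a b : int -> int -> R) : Prop :=
  forall u, l2Z u ->
    [/\ l2Z (mulZ b u), mulZ a (mulZ b u) = u & mulZ b (mulZ a u) = u].

Definition gram (r : nat) (k l : int) : R :=
  \int[lebesgue_measure]_x (bspline k r x * bspline l r x).

Definition gram_inv (r : nat) : int -> int -> R :=
  xget (fun _ _ => 0) [set b | l2_inverse (gram r) b].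

Definition spline_kernel (r : nat) (x y : R) : R :=
  sumZ (fun k => sumZ (fun l =>
    gram_inv r k l * bspline l r x * bspline k r y)).

Definition spline_kernel_at (r j : nat) (x y : R) : R :=
  2 ^+ j * spline_kernel r (2 ^+ j * x) (2 ^+ j * y).

End Splines.

Section Estimator.
Context {R : realType} {d : measure_display} {T : measurableType d}.

(* The sample X_1, ..., X_n is X 0, ..., X (n - 1). *)
Definition spline_estimator (X : nat -> T -> R) (r n j : nat) (y : R) (w : T)
    : R :=
  n%:R^-1 * \sum_(i < n) spline_kernel_at r j y (X i w).

(* sup_y |p_n(y, j) - E p_n(y, j)| *)
Definition sup_centered (Pr : probability T R) (X : nat -> T -> R)
    (r n j : nat) (w : T) : \bar R :=
  ereal_sup (range (fun y : R =>
    `|(spline_estimator X r n j y w)%:E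
      - 'E_Pr[spline_estimator X r n j y]|%E)).

(* sup_y |p_n(y, j) - p0(y)| *)
Definition sup_error (p0 : R -> R) (X : nat -> T -> R) (r n j : nat) (w : T)
    : \bar R :=
  ereal_sup (range (fun y : R =>
    `|spline_estimator X r n j y w - p0 y|%:E)).

Definition mutually_independent (Pr : probability T R)
    (X : nat -> {RV Pr >-> R}) : Prop :=
  forall (J : {fset nat}) (B : nat -> set R),
    (forall i, measurable (B i)) ->
    Pr (\bigcap_(i in [set` J]) (X i @^-1` B i)) =
      (\prod_(i <- J) Pr (X i @^-1` B i))%E.

Definition iid_with_law (Pr : probability T R) (X : nat -> {RV Pr >-> R})
    (P : probability R R) : Prop :=
  mutually_independent X /\
  (forall i A, measurable A -> distribution Pr (X i) A = P A).

End Estimator.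

Section Densities.
Context {R : realType}.

Definition has_bounded_density (P : probability R R) (p0 : R -> R) : Prop :=
  [/\ measurable_fun [set: R] p0,
      forall x, 0 <= p0 x,
      exists M : R, forall x, p0 x <= M &
      forall A, measurable A ->
        P A = (\int[lebesgue_measure]_(x in A) (p0 x)%:E)%E].

(* ||p0||_oo of a density, as an element of L^oo: a density is only determined
   almost everywhere, so the norm is the essential supremum, which agrees with
   sup_x |p0 x| when p0 is continuous. *)
Definition density_norm (p0 : R -> R) : R :=
  fine ('N[lebesgue_measure]_+oo[EFin \o p0])%E.

Definition bounded_unif_continuous (f : R -> R) : Prop :=
  (exists M : R, forall x, `|f x| <= M) /\ unif_continuous f.

Definition Cnat (s : nat) (f : R -> R) : Prop :=
  (forall a, (a < s)%N -> forall x, derivable (derive1n a f) x 1) /\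
  (forall a, (a <= s)%N -> bounded_unif_continuous (derive1n a f)).

(* Membership in C^t(R), t > 0. The Hoelder condition is void for integer t. *)
Definition Cspace (t : R) (f : R -> R) : Prop :=
  let m := Num.truncn t in
  Cnat m f /\
  (t != m%:R -> exists L : R, forall x y : R, x != y ->
     `|derive1n m f x - derive1n m f y| / `|x - y| `^ (t - m%:R) <= L).

End Densities.

Section Rates.
Context {R : realType}.

Definition bigO_seq (z : nat -> \bar R) (a : nat -> R) : Prop :=
  exists K : R, \forall n \near \oo, (`|z n| <= (K * a n)%:E)%E.

Definition rate (j : nat -> nat) (n : nat) : R :=
  Num.sqrt (2 ^+ j n * (j n)%:R / n%:R).

Definition scaling (j : nat -> nat) (n : nat) : R :=
  Num.sqrt (n%:R / (2 ^+ j n * (j n)%:R)).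

Definition admissible_levels (tau : R) (j : nat -> nat) : Prop :=
  [/\ (forall n, (0 < n)%N -> (0 < j n)%N),
      (fun n => (j n)%:R : R) @ \oo --> +oo,
      (fun n => n%:R / ((j n)%:R * 2 ^+ j n) : R) @ \oo --> +oo,
      (fun n => (j n)%:R / ln (ln n%:R) : R) @ \oo --> +oo &
      forall n, (0 < n)%N -> (j n.*2)%:R - (j n)%:R <= tau].

End Rates.

(* Main.v *)
Require Import Defs.
From HB Require Import structures.
From mathcomp Require Import all_boot all_order all_algebra.
From mathcomp Require Import finmap.
From mathcomp Require Import all_classical all_reals all_analysis.
From mathcomp Require Import measurable_realfun ess_sup_inf.
From mathcomp Require Import ring lra zify.
Set Implicit Arguments.
Unset Strict Implicit.
Unset Printing Implicit Defensive.
Import Order.TTheory GRing.Theory Num.Theory.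
Import numFieldNormedType.Exports.
Local Open Scope classical_set_scope.
Local Open Scope ring_scope.

(** Write [r = m + 1] and [M0] for the norm of the density.

    The kernel.  The Gram matrix of the B-splines is a banded Toeplitz matrix.
    Local stability of B-splines ([spline_stability]) makes it coercive, so a
    Neumann series inverts it with geometrically decaying entries
    ([gram_inverse_seq]), and uniqueness on square-summable sequences identifies
    these entries with [gram_inv] ([gram_invE]).  If [D] is the dual spline
    [\sum_k b_k N (z - k)], then [kappa y x = K_u (x - k)] where [k] and [u] are
    the integer and fractional parts of [y] and
    [K_u z = \sum_(a < r) N (u + a) * D (z + a)] ([spline_kernel_cell]).  Up to
    the factor [2 ^ j / n] the centred estimator at [y] is therefore a cell sum:
    the centred sum over the sample of [K_u (2 ^ j * x - k)], and its supremum is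
    one over the cells [k] and the phases [u] ([sup_centeredE]).

    Upper bound.  For a bounded [g] with exponential decay, the cell sums of [g]
    have variance at most [n * 2 ^ (- j) * M0 * s] with [s = \int g ^ 2], and the
    variances of all the cells together are at most [n] times a constant.  The
    maximal inequality [maximal_seq_exp] is linear in the variance, so it can be
    summed over the infinitely many cells as if there were [2 ^ j] of them.  The
    maximum over the cells and over a block of sample sizes then exceeds
    [x * sqrt (j * n / 2 ^ j)] with probability exponentially small in [j] as
    soon as [2 * ln 2 * M0 * s < x ^ 2] ([level_tail]), and Borel-Cantelli along
    geometric blocks applies, because [j n] dominates [ln (ln n)]
    ([upper_cells_nat]).  Finitely many phases suffice, the increments in the
    phase being controlled by the sums of [D] ([upper_sup]).

    Lower bound.  Cut [g] to a window and keep cells that are a window apart.  By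
    the definition of [M0], a fixed proportion of [2 ^ j] of these tiles carry
    nearly the largest possible mass ([good_tiles]).  Poissonization makes the
    tiles independent at the price of a factor [e * n] ([blocks_bound]), and
    exponential tilting bounds from below the probability that one tile exceeds
    the threshold ([block_tail]).  If [x ^ 2 < 2 * ln 2 * M0 * s], the probability
    that no tile exceeds [x * sqrt (j * n / 2 ^ j)] is at most
    [e * n * exp (- c * exp (c' * j))], which tends to zero since [j n] dominates
    [ln (ln n)] ([lower_prob]).  For a limit superior this is enough, and the
    constant is [sqrt (2 * ln 2 * M0 * sup_u \int K_u ^ 2)] ([limsup_centered]).

    Moments.  The [p]-th power of the largest dual sum is bounded by a constant
    plus a small multiple of the sum over the cells of
    [psi x = exp x + exp (- x) - 2] at the dual sums; the expectations are again
    linear in the variances and can be summed ([Lnorm_sup_centered]).  The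
    bound holds when [j n * 2 ^ j n <= n]; the finitely many other sample sizes
    are treated crudely, with a constant that depends on the sequence [j].

    Bias.  The kernel reproduces splines with bounded coefficients, because the
    Gram matrix and its inverse cancel ([spline_biorthogonality]); the bias is
    thus a constant times the distance to such splines ([kernel_bias]).  A
    density of smoothness [t <= r] is within [2 ^ (- t * j)] of them, by
    induction on the number of derivatives: integrate a spline close to the
    derivative and correct the difference by quasi-interpolation
    ([spline_approximation]). *)

(** * B-splines and their local stability *)

Section LebesgueAffine.
Context {R : realType}.
Local Notation mu := (@lebesgue_measure R).

Lemma affine_measurable (a b : R) :
  measurable_fun [set: R] (fun x : R => a * x + b).
Proof. by apply: measurable_funD => //; apply: measurable_funM. Qed.

Lemma lebesgue_measure_affine (a b : R) (A : set R) : 0 < a -> measurable A ->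
  mu ((fun x => a * x + b) @^-1` A) = (a^-1%:E * mu A)%E.
Proof.
move=> a0 mA.
have aV0 : 0 <= a^-1 by rewrite invr_ge0 ltW.
have m1 : measurable_fun [set: measurableTypeR R]
    ((fun x => a * x + b) : measurableTypeR R -> measurableTypeR R).
  exact: affine_measurable.
have e X : ocitv X -> mu X = mscale (NngNum (ltW a0)) (pushforward mu ((fun x => a * x + b) : _ -> measurableTypeR R)) X.
  move=> [[c d] _ <-]; rewrite /mscale/= /pushforward.
  have -> : (fun x => a * x + b) @^-1` `]c, d]%classic = `]((c - b) / a), ((d - b) / a)]%classic.
    apply/seteqP; split => x /=; rewrite !in_itv/= ltr_pdivrMr// ler_pdivlMr//; lra.
  rewrite !lebesgue_measure_itv/= !lte_fin ltr_pM2r ?invr_gt0//.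
  have -> : (c - b < d - b) = (c < d) by rewrite ltrD2r.
  case: ifP => _; last by rewrite mule0.
  by rewrite -!EFinM; congr EFin; field; exact: lt0r_neq0.
have := lebesgue_measure_unique (e m1) mA.
rewrite /mscale/= => ->.
by rewrite muleA -EFinM mulVf ?gt_eqF// mul1e.
Qed.

Lemma ge0_integral_affine (a b : R) (f : R -> \bar R) : 0 < a ->
  measurable_fun [set: R] f -> (forall x, 0 <= f x)%E ->
  (\int[mu]_x f (a * x + b)%R = a^-1%:E * \int[mu]_x f x)%E.
Proof.
move=> a0 mf f0.
have aV0 : 0 <= a^-1 by rewrite invr_ge0 ltW.
have m1 : measurable_fun [set: measurableTypeR R]
    ((fun x => a * x + b) : measurableTypeR R -> measurableTypeR R).
  exact: affine_measurable.
have := @ge0_integral_pushforward _ _ _ _ R _ m1 mu setT f measurableT mf (fun y _ => f0 y).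
rewrite preimage_setT => <-.
rewrite -[a^-1]/((NngNum aV0)%:num) -ge0_integral_mscale//.
apply: eq_measure_integral => A mA _.
by first [exact: lebesgue_measure_affine|exact/esym/lebesgue_measure_affine].
Qed.

Lemma ge0_integral_opp (f : R -> \bar R) :
  measurable_fun [set: R] f -> (forall x, 0 <= f x)%E ->
  (\int[mu]_x f (- x)%R = \int[mu]_x f x)%E.
Proof.
move=> mf f0.
have m1 : measurable_fun [set: measurableTypeR R]
    (-%R : measurableTypeR R -> measurableTypeR R).
  exact: oppr_measurable.
have := @ge0_integral_pushforward _ _ _ _ R _ m1 mu setT f measurableT mf (fun y _ => f0 y).
rewrite preimage_setT => <-.
by apply: eq_measure_integral => A mA _; exact: lebesgue_measureN.
Qed.

End LebesgueAffine.

Section BoundedMeasurable.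
Context {d} {T : measurableType d} {R : realType}.
Implicit Types f g : T -> R.

(** Bounded measurable functions: stable under the operations used below and
    integrable against every finite measure. *)
Definition bmf f := measurable_fun [set: T] f /\ exists M, forall x, `|f x| <= M.

Lemma bmf_cst (c : R) : bmf (fun=> c).
Proof. by split; [exact: measurable_cst|exists `|c|]. Qed.

Lemma bmfD f g : bmf f -> bmf g -> bmf (fun x => f x + g x).
Proof.
move=> [mf [M fM]] [mg [L gL]]; split; first exact: measurable_funD.
by exists (M + L) => x; rewrite (le_trans (ler_normD _ _))// lerD.
Qed.

Lemma bmfN f : bmf f -> bmf (fun x => - f x).
Proof.
move=> [mf [M fM]]; split; first exact: measurable_funN.
by exists M => x; rewrite normrN.
Qed.

Lemma bmfB f g : bmf f -> bmf g -> bmf (fun x => f x - g x).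
Proof. by move=> bf bg; apply: bmfD => //; exact: bmfN. Qed.

Lemma bmfM f g : bmf f -> bmf g -> bmf (fun x => f x * g x).
Proof.
move=> [mf [M fM]] [mg [L gL]]; split; first exact: measurable_funM.
by exists (M * L) => x; rewrite normrM ler_pM.
Qed.

Lemma bmfX f n : bmf f -> bmf (fun x => f x ^+ n).
Proof.
move=> [mf [M fM]]; split; first exact: measurable_funX.
by exists (M ^+ n) => x; rewrite normrX lerXn2r// ?nnegrE ?(le_trans _ (fM x)).
Qed.

Lemma bmf_norm f : bmf f -> bmf (fun x => `|f x|).
Proof.
move=> [mf [M fM]]; split; first exact: measurableT_comp.
by exists M => x; rewrite normr_id.
Qed.

Lemma bmfZ (c : R) f : bmf f -> bmf (fun x => c * f x).
Proof. by apply: bmfM; exact: bmf_cst. Qed.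

Lemma bmf_sum (I : Type) (s : seq I) (h : I -> T -> R) :
  (forall i, bmf (h i)) -> bmf (fun x => \sum_(i <- s) h i x).
Proof.
move=> bh; elim: s => [|i s IH].
  by under eq_fun do rewrite big_nil; exact: bmf_cst.
by under eq_fun do rewrite big_cons; exact: bmfD.
Qed.

Lemma bmf_indic (A : set T) : measurable A -> bmf (\1_A : T -> R).
Proof.
move=> mA; split; first exact: measurable_indic.
by exists 1 => x; rewrite indicE; case: (_ \in _); rewrite ?normr1 ?normr0.
Qed.

Lemma bmf_integrable (mu : {measure set T -> \bar R}) (D : set T) f :
  measurable D -> (mu D < +oo)%E -> bmf f -> mu.-integrable D (EFin \o f).
Proof.
move=> mD muD [mf [M fM]]; apply: measurable_bounded_integrable => //.
  exact: measurable_funTS.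
exists M; split; first exact: num_real.
by move=> y My x _ /=; rewrite (le_trans (fM x))// ltW.
Qed.

Section Integral.
Variables (mu : {measure set T -> \bar R}) (D : set T).
Hypotheses (mD : measurable D) (muD : (mu D < +oo)%E).

Lemma Rintegral_bmf_sum (I : Type) (s : seq I) (h : I -> T -> R) :
  (forall i, bmf (h i)) ->
  \int[mu]_(x in D) (\sum_(i <- s) h i x) = \sum_(i <- s) \int[mu]_(x in D) h i x.
Proof.
move=> bh; elim: s => [|i s IH].
  under eq_Rintegral do rewrite big_nil.
  by rewrite Rintegral_cst// mul0r big_nil.
under eq_Rintegral do rewrite big_cons.
rewrite RintegralD// ?big_cons ?IH//; apply: bmf_integrable => //.
exact: bmf_sum.
Qed.

Lemma Rintegral_bmfZ (c : R) f : bmf f ->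
  \int[mu]_(x in D) (c * f x) = c * \int[mu]_(x in D) f x.
Proof. by move=> bf; rewrite RintegralZl//; exact: bmf_integrable. Qed.

Lemma Rintegral_bmfD f g : bmf f -> bmf g ->
  \int[mu]_(x in D) (f x + g x) = \int[mu]_(x in D) f x + \int[mu]_(x in D) g x.
Proof. by move=> bf bg; rewrite RintegralD//; exact: bmf_integrable. Qed.

Lemma Rintegral_bmfB f g : bmf f -> bmf g ->
  \int[mu]_(x in D) (f x - g x) = \int[mu]_(x in D) f x - \int[mu]_(x in D) g x.
Proof. by move=> bf bg; rewrite RintegralB//; exact: bmf_integrable. Qed.

Lemma le_Rintegral_bmf f g : bmf f -> bmf g -> (forall x, D x -> f x <= g x) ->
  \int[mu]_(x in D) f x <= \int[mu]_(x in D) g x.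
Proof. by move=> bf bg; apply: le_Rintegral => //; exact: bmf_integrable. Qed.

Lemma EFin_Rintegral_bmf f : bmf f ->
  (\int[mu]_(x in D) f x)%:E = (\int[mu]_(x in D) (f x)%:E)%E.
Proof.
move=> bf; rewrite fineK//; apply: integrable_fin_num => //.
exact: bmf_integrable.
Qed.

Lemma normr_Rintegral_le f (M : R) : bmf f -> (forall x, D x -> `|f x| <= M) ->
  `|\int[mu]_(x in D) f x| <= M * fine (mu D).
Proof.
move=> bf fM; rewrite (le_trans (le_normr_Rintegral _ _))//.
  exact: bmf_integrable.
rewrite -Rintegral_cst//; apply: le_Rintegral_bmf => //.
  exact: bmf_norm.
exact: bmf_cst.
Qed.

End Integral.
End BoundedMeasurable.

Section Splines.
Context {R : realType}.
Local Notation mu := (@lebesgue_measure R).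
Local Notation N m := (@bspline0 R m.+1).
Implicit Types (f : R -> R).

Lemma itvoc_mu (a b : R) : a <= b -> mu `]a, b] = (b - a)%:E.
Proof.
move=> ab; rewrite lebesgue_measure_itv/= lte_fin; case: ltP => //.
by move=> ba; have -> : a = b by [apply/eqP; rewrite eq_le ab ba]; rewrite subrr.
Qed.

Lemma itvoc_fin (a b : R) : (mu `]a, b] < +oo)%E.
Proof.
by rewrite lebesgue_measure_itv/=; case: ifP => // _; rewrite -EFinB ltry.
Qed.

Lemma Rintegral_itvoc_cst (a b c : R) : a <= b ->
  \int[mu]_(z in `]a, b]) c = c * (b - a).
Proof.
move=> ab; rewrite Rintegral_cst//; congr (_ * _).
by transitivity (fine (b - a)%:E) => //; congr fine; exact: itvoc_mu.
Qed.

Lemma normr_Rintegral_itvoc f (a b M : R) : bmf f -> a <= b ->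
  (forall x, a < x -> x <= b -> `|f x| <= M) ->
  `|\int[mu]_(x in `]a, b]) f x| <= M * (b - a).
Proof.
move=> bf ab fM; have -> : b - a = fine (mu `]a, b]) by rewrite itvoc_mu.
apply: normr_Rintegral_le => //; first exact: itvoc_fin.
by move=> x /=; rewrite in_itv/= => /andP[]; exact: fM.
Qed.

Lemma measurable_restrictR (D : set R) (g : R -> \bar R) : measurable D ->
  measurable_fun [set: R] g -> measurable_fun [set: R] (g \_ D).
Proof.
move=> mD mg; apply: (measurable_restrictT g mD).1.
exact: measurable_funTS.
Qed.

Lemma Rintegral_shift f (a b c : R) : bmf f -> (forall x, 0 <= f x) ->
  \int[mu]_(x in `]a, b]) f (x + c) = \int[mu]_(x in `]a + c, b + c]) f x.
Proof.
move=> [mf _] f0; rewrite /Rintegral; congr fine.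
rewrite [LHS]integral_mkcond [RHS]integral_mkcond.
pose g : R -> \bar R := (fun x => (f x)%:E) \_ `]a + c, b + c].
have mg : measurable_fun setT g.
  by apply: measurable_restrictR => //; exact: measurableT_comp.
have g0 x : (0 <= g x)%E by apply: erestrict_ge0 => y _; rewrite lee_fin.
have := @ge0_integral_affine R 1 c g ltr01 mg g0.
rewrite invr1 mul1e => <-; apply: eq_integral => x _.
rewrite /g !patchE mul1r; congr (if _ then _ else _).
by apply/idP/idP; rewrite !inE/= !in_itv/=; lra.
Qed.

Lemma Rintegral_split f (a b c : R) : bmf f -> a <= b -> b <= c ->
  \int[mu]_(x in `]a, c]) f x =
  \int[mu]_(x in `]a, b]) f x + \int[mu]_(x in `]b, c]) f x.
Proof.
move=> bf ab bc.
rewrite -(@Rintegral_itvB R f (BRight a) (BRight c) b)//.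
- by rewrite addrC subrK.
- by apply: bmf_integrable => //; exact: itvoc_fin.
Qed.

(** Convolution with the indicator of the unit interval is a moving average. *)
Lemma bspline_integral m x : bmf (N m) -> (forall z, 0 <= N m z) ->
  N m.+1 x = \int[mu]_(z in `]x - 1, x]) N m z.
Proof.
move=> [mN _] N0; rewrite [LHS]/bspline0 /= -/(N m) /convolution /Rintegral.
congr fine; rewrite [RHS]integral_mkcond.
pose h : R -> \bar R := (fun z => (N m z)%:E) \_ `]x - 1, x].
have mh : measurable_fun setT h.
  by apply: measurable_restrictR => //; exact: measurableT_comp.
have h0 z : (0 <= h z)%E by apply: erestrict_ge0 => y _; rewrite lee_fin.
have := @ge0_integral_affine R 1 x h ltr01 mh h0.
rewrite invr1 mul1e => <-.
rewrite -[RHS](@ge0_integral_opp R (fun y => h (1 * y + x)%R)); last 2 first.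
- by apply: (measurableT_comp mh); exact: affine_measurable.
- by [].
apply: eq_integral => y _; rewrite /h patchE mul1r indicE (addrC x).
have -> : (- y + x \in `]x - 1, x]%classic) = (y \in `[0, 1[%classic).
  by apply/idP/idP; rewrite !inE/= !in_itv/=; lra.
by case: (y \in _); rewrite ?mulr1 ?mulr0.
Qed.

Lemma Rintegral_bspline_diff m x y : bmf (N m) -> (forall z, 0 <= N m z) ->
  y <= x ->
  N m.+1 x - N m.+1 y = \int[mu]_(z in `]y, x]) (N m z - N m (z - 1)).
Proof.
move=> bN N0 yx; rewrite !bspline_integral//.
have bN1 : bmf (fun z : R => N m (z - 1)).
  case: bN => mN [M NM]; split; last by exists M.
  by apply: (measurableT_comp mN); apply: measurable_funB.
rewrite Rintegral_bmfB//; last exact: itvoc_fin.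
rewrite Rintegral_shift//.
have := @Rintegral_split (N m) (y - 1) (x - 1) x bN.
have := @Rintegral_split (N m) (y - 1) y x bN.
have y1 : y - 1 <= y by rewrite gerBl.
have yx1 : y - 1 <= x - 1 by rewrite lerD2r.
have x1 : x - 1 <= x by rewrite gerBl.
move=> /(_ y1 yx) -> /(_ yx1 x1) E.
have lin (A B C D : R) : B + C = D + A -> A - B = C - D by lra.
exact: lin.
Qed.

(** The properties are proved together, since the moving average of order
    [m + 2] is handled through the measurability and the bounds of order [m + 1].
    Measurability comes from the Lipschitz bound [|N x - N y| <= |x - y|]. *)
Lemma bspline_spec m :
  [/\ bmf (N m), forall x, 0 <= N m x <= 1 &
      forall x, x < 0 \/ m.+1%:R <= x -> N m x = 0].
Proof.
elim: m => [|m [bN N01 Nsupp]].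
  have bN : bmf (N 0) by exact: bmf_indic.
  split => // x; rewrite /bspline0/= indicE.
    by case: (_ \in _); rewrite ?lexx ?ler01.
  by move=> H; rewrite memNset//= in_itv/= => /andP[? ?]; lra.
have N0 z : 0 <= N m z by have /andP[] := N01 z.
have N1 z : N m z <= 1 by have /andP[] := N01 z.
have N01' x : 0 <= N m.+1 x <= 1.
  rewrite bspline_integral// Rintegral_ge0//=.
  have E : \int[mu]_(z in `]x - 1, x]) 1 = 1 :> R.
    by rewrite Rintegral_itvoc_cst; lra.
  rewrite -[leRHS]E; apply: le_Rintegral_bmf => //.
  - exact: itvoc_fin.
  - exact: bmf_cst.
have lip x y : `|N m.+1 x - N m.+1 y| <= `|x - y|.
  wlog yx : x y / y <= x.
    by move=> H; case: (leP y x) => [/H//|/ltW/H]; rewrite distrC (distrC y).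
  rewrite Rintegral_bspline_diff//.
  have -> : `|x - y| = 1 * fine (mu `]y, x]).
    by rewrite itvoc_mu//= ger0_norm ?subr_ge0// mul1r.
  apply: normr_Rintegral_le => //; first exact: itvoc_fin.
    apply: bmfB => //; case: bN => mN [M NM]; split; last by exists M.
    by apply: (measurableT_comp mN); apply: measurable_funB.
  move=> z _; rewrite ler_norml; have /andP[] := N01 z.
  by have /andP[] := N01 (z - 1); lra.
split => //.
  split; last by exists 1 => x; rewrite ger0_norm; have /andP[] := N01' x.
  apply: continuous_measurable_fun => x.
  apply/cvgrPdist_le => e e0; apply: filterS (nbhsx_ballx x e e0) => t.
  by rewrite /ball/= => /ltW; apply: le_trans; exact: lip.
move=> x xm; rewrite bspline_integral//.
transitivity (\int[mu]_(z in `]x - 1, x]) (0 : R)); last first.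
  by rewrite Rintegral_itvoc_cst ?mul0r// gerBl.
apply: eq_Rintegral => z; rewrite inE/= in_itv/= => /andP[? ?].
apply: Nsupp; case: xm => xm; [left; lra|right].
by move: xm; rewrite -(natr1 m.+1); lra.
Qed.

Lemma bmf_bspline m : bmf (N m). Proof. by have [] := bspline_spec m. Qed.

Lemma bspline_ge0 m x : 0 <= N m x.
Proof. by have [_ /(_ x)/andP[]] := bspline_spec m. Qed.

Lemma bspline_le1 m x : N m x <= 1.
Proof. by have [_ /(_ x)/andP[]] := bspline_spec m. Qed.

Lemma normr_bspline_le1 m x : `|N m x| <= 1.
Proof. by rewrite ger0_norm ?bspline_ge0 ?bspline_le1. Qed.

Lemma bspline_lt0 m x : x < 0 -> N m x = 0.
Proof. by move=> x0; have [_ _] := bspline_spec m; apply; left. Qed.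

Lemma bspline_supp m x : m.+1%:R <= x -> N m x = 0.
Proof. by move=> x0; have [_ _] := bspline_spec m; apply; right. Qed.

Lemma bmf_shift (f : R -> R) (c : R) : bmf f -> bmf (fun x : R => f (x + c)).
Proof.
move=> [mf [M fM]]; split; last by exists M.
by apply: (measurableT_comp mf); apply: measurable_funD.
Qed.

Lemma bspline_diff_shift m (c x y : R) : y <= x ->
  N m.+1 (x + c) - N m.+1 (y + c) =
  \int[mu]_(z in `]y, x]) (N m (z + c) - N m (z + c - 1)).
Proof.
move=> yx; rewrite Rintegral_bspline_diff ?lerD2r//; last 2 first.
- exact: bmf_bspline.
- exact: bspline_ge0.
have bN1 : bmf (fun z : R => N m (z - 1)).
  by apply: bmf_shift; exact: bmf_bspline.
have sN : bmf (fun z : R => N m (z + c)) by apply: bmf_shift; exact: bmf_bspline.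
have sN1 : bmf (fun z : R => N m (z + c - 1)) by exact: (bmf_shift c bN1).
rewrite (Rintegral_bmfB _ (itvoc_fin _ _) (bmf_bspline m) bN1)//.
rewrite (Rintegral_bmfB _ (itvoc_fin _ _) sN sN1)//.
rewrite -(Rintegral_shift y x c (bmf_bspline m) (@bspline_ge0 m)).
by rewrite -(Rintegral_shift y x c bN1)// => z; exact: bspline_ge0.
Qed.

(** The [m + 2] moving averages add up to the moving average of the partition of
    unity of the previous order. *)
Lemma bspline_unity m x : 0 <= x < 1 -> \sum_(a < m.+1) N m (x + a%:R) = 1.
Proof.
elim: m x => [|m IH] x x01.
  by rewrite big_ord1 addr0 /bspline0/= indicE mem_set.
under eq_bigr => a _.
  rewrite (bspline_integral _ (bmf_bspline m) (@bspline_ge0 m)).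
  rewrite -addrA (addrC a%:R) addrA -Rintegral_shift; last 2 first.
  - exact: bmf_bspline.
  - exact: bspline_ge0.
  over.
rewrite -Rintegral_bmf_sum//; last 2 first.
- exact: itvoc_fin.
- by move=> a; apply: bmf_shift; exact: bmf_bspline.
have E : \int[mu]_(z in `]x - 1, x]) 1 = 1 :> R.
  by rewrite Rintegral_itvoc_cst; lra.
rewrite -[RHS]E; apply: eq_Rintegral => z.
rewrite inE/= in_itv/= => /andP[z1 z2].
case: (ltP z 0) => z0.
  rewrite big_ord_recl/= addr0 bspline_lt0// add0r -[RHS](IH (z + 1)); last by lra.
  by apply: eq_bigr => a _; rewrite /bump/= add1n -natr1 (addrC _ 1) addrA.
rewrite big_ord_recr/= IH ?z0/=; last by lra.
by rewrite bspline_supp ?addr0// lerDr.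
Qed.

(** The point [1] is excluded because [N 0] jumps there: within one unit cell
    even the order one is Lipschitz. *)
Lemma bspline_lipschitz m (a : nat) x y : 0 <= x < 1 -> 0 <= y < 1 ->
  `|N m (x + a%:R) - N m (y + a%:R)| <= `|x - y|.
Proof.
wlog yx : x y / y <= x.
  by move=> H X Y; case: (leP y x) => [/H|/ltW/H];[|rewrite distrC (distrC y)]; apply.
move=> x01 y01; case: m => [|m].
  case: a => [|a]; last first.
    rewrite !bspline_supp ?subrr ?normr0// -natr1.
      by have := ler0n R a; lra.
    by have := ler0n R a; lra.
  by rewrite !addr0 /bspline0/= !indicE !mem_set// subrr normr0.
rewrite Rintegral_bspline_diff ?lerD2r//; last 2 first.
- exact: bmf_bspline.
- exact: bspline_ge0.
have -> : `|x - y| = 1 * fine (mu `]y + a%:R, x + a%:R]).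
  by rewrite itvoc_mu ?lerD2r//= ger0_norm ?subr_ge0//; lra.
apply: normr_Rintegral_le => //; first exact: itvoc_fin.
  by apply: bmfB; [|apply: bmf_shift]; exact: bmf_bspline.
move=> z _; rewrite ler_norml.
have := bspline_ge0 m z; have := bspline_le1 m z.
have := bspline_ge0 m (z - 1); have := bspline_le1 m (z - 1); lra.
Qed.


Lemma exists_max_norm n (q : nat -> R) : (0 < n)%N ->
  exists2 b, (b < n)%N & forall a, (a < n)%N -> `|q a| <= `|q b|.
Proof.
case: n => // n _; have [b _ bP] := @arg_maxP _ R 'I_n.+1 ord0 xpredT (fun i : 'I_n.+1 => `|q i|) isT.
by exists b => // a an; exact: (bP (Ordinal an)).
Qed.

Lemma spline_lipschitz m (p : nat -> R) (Q x y : R) :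
  (forall a, (a < m.+1)%N -> `|p a| <= Q) -> 0 <= x < 1 -> 0 <= y < 1 ->
  `|\sum_(a < m.+1) p a * N m (x + a%:R) - \sum_(a < m.+1) p a * N m (y + a%:R)|
    <= m.+1%:R * Q * `|x - y|.
Proof.
move=> pQ x01 y01; rewrite -sumrB (le_trans (ler_norm_sum _ _ _))//.
rewrite (le_trans (_ : _ <= \sum_(a < m.+1) Q * `|x - y|))//.
  apply: ler_sum => a _; rewrite -mulrBr normrM ler_pM//; first exact: pQ.
  exact: bspline_lipschitz.
by rewrite sumr_const card_ord -mulrA mulr_natl.
Qed.

(** Length on which a combination whose coefficients are at most [Q] varies by
    at most [Q / (4 * K)]. *)
Definition step_len (m : nat) (K : R) : R := (4 * K * m.+1%:R)^-1.

Lemma step_lenP m (K : R) : 1 <= K ->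
  0 < step_len m K <= 4^-1 /\ m.+1%:R * step_len m K = (4 * K)^-1.
Proof.
move=> K1; have m1 : 1 <= m.+1%:R :> R by rewrite ler1n.
have K0 : 0 < 4 * K * m.+1%:R by rewrite !mulr_gt0//; lra.
rewrite /step_len invr_gt0 K0 lef_pV2 ?posrE//; split; last first.
  by field; rewrite ?pnatr_eq0//; lra.
by nra.
Qed.

(** A combination as large as [|p b| / (2 * K)] at one point stays of that size
    on an interval of length [step_len m K], because it is Lipschitz with a
    constant proportional to [|p b|]; the interval lies to the right or to the
    left of the point so as to remain in the unit cell. *)
Lemma large_on_interval m (K : R) (p : nat -> R) (b : nat) : 1 <= K ->
  (forall S : R, (forall x, 0 <= x < 1 ->
      `|\sum_(a < m.+1) p a * N m (x + a%:R)| <= S) -> `|p b| <= K * S) ->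
  (forall a, (a < m.+1)%N -> `|p a| <= `|p b|) ->
  exists y x, [/\ 0 <= y, y + step_len m K < 1, 0 <= x < 1,
    `|p b| / (2 * K) <= `|\sum_(a < m.+1) p a * N m (x + a%:R)| &
    forall z, y <= z <= y + step_len m K ->
      `|\sum_(a < m.+1) p a * N m (z + a%:R)
        - \sum_(a < m.+1) p a * N m (x + a%:R)| <= `|p b| / (4 * K)].
Proof.
move=> K1 KS pb; have [/andP[l0 l4] lE] := step_lenP m K1.
set l := step_len m K in l0 l4 lE *.
pose w x := \sum_(a < m.+1) p a * N m (x + a%:R).
have [x [x01 wx]] : exists x, 0 <= x < 1 /\ `|p b| / (2 * K) <= `|w x|.
  apply: contrapT => H.
  have : `|p b| <= K * (`|p b| / (2 * K)).
    apply: KS => x x01; rewrite leNgt; apply/negP => wx; apply: H.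
    by exists x; split => //; exact: ltW.
  have -> : K * (`|p b| / (2 * K)) = `|p b| / 2 by field; lra.
  move=> pb2; have pb0 : `|p b| = 0 by apply/eqP; rewrite eq_le normr_ge0; lra.
  by apply: H; exists 0; rewrite lexx ltr01 pb0 mul0r normr_ge0.
have near z : 0 <= z < 1 -> `|z - x| <= l -> `|w z - w x| <= `|p b| / (4 * K).
  move=> z01 zx; rewrite (le_trans (spline_lipschitz (Q := `|p b|) _ z01 x01))//.
  by rewrite -lE [leRHS]mulrCA [leRHS]mulrA ler_wpM2l// mulr_ge0.
have [x2|x2] := ltP x (2^-1).
  exists x, x; split => //; [lra|lra|move=> z zx].
  by apply: near; [lra|rewrite ger0_norm; lra].
exists (x - l), x; split => //; [lra|lra|move=> z zx].
by apply: near; [lra|rewrite ler_norml; lra].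
Qed.

Lemma bmf_spline m (p : nat -> R) (c : R) :
  bmf (fun x : R => \sum_(a < m.+1) p a * N m (x + a%:R + c)).
Proof.
apply: bmf_sum => a; apply: bmfZ.
under eq_fun do rewrite -addrA.
by apply: bmf_shift; exact: bmf_bspline.
Qed.

(** Local stability of B-splines: differentiating turns a combination of order
    [m + 2] into one of order [m + 1] whose coefficients are the successive
    differences, so control of the latter bounds the oscillation of the
    coefficients, and partition of unity recovers their size. *)
Lemma spline_stability m : exists2 K : R, 1 <= K &
  forall (p : nat -> R) (S : R),
    (forall x, 0 <= x < 1 -> `|\sum_(a < m.+1) p a * N m (x + a%:R)| <= S) ->
    forall a, (a < m.+1)%N -> `|p a| <= K * S.
Proof.
elim: m => [|m [K K1 IH]].
  exists 1 => // p S pS [|//] _; have := pS 0; rewrite lexx ltr01 => /(_ isT).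
  by rewrite big_ord1 addr0 /bspline0/= indicE mem_set/= ?mulr1 ?mul1r// in_itv/= lexx ltr01.
have [/andP[l0 l4] lE] := step_lenP m K1.
set l := step_len m K in l0 l4 lE.
pose K' := 8 * K / l.
have K'0 : 0 <= K' by rewrite /K' divr_ge0//; lra.
exists (1 + m.+2%:R * K'); first by rewrite lerDl mulr_ge0.
move=> p S pS.
have S0 : 0 <= S.
  by rewrite (le_trans _ (pS 0 _)) ?lexx ?ltr01//.
pose q a := p a - p a.+1.
have [b bm qb] := exists_max_norm q (ltn0Sn m).
have [y [x [y0 yl x01 wx near]]] := large_on_interval K1 (fun S H => IH q S H b bm) qb.
set w := fun x => \sum_(a < m.+1) q a * N m (x + a%:R) in wx near.
have bw : bmf w.
  have := bmf_spline m q 0; congr bmf; apply/funext => z.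
  by apply: eq_bigr => a _; rewrite addr0.
pose s x := \sum_(a < m.+2) p a * N m.+1 (x + a%:R).
(* [s] is a primitive of [w]. *)
have sw : s (y + l) - s y = \int[mu]_(z in `]y, y + l]) w z.
  have yl0 : y <= y + l by rewrite lerDl ltW.
  rewrite /s -sumrB.
  under eq_bigr do rewrite -mulrBr bspline_diff_shift//.
  have bd (a : 'I_m.+2) : bmf (fun z : R => N m (z + a%:R) - N m (z + a%:R - 1)).
    apply: bmfB; first by apply: bmf_shift; exact: bmf_bspline.
    under eq_fun do rewrite -addrA; apply: bmf_shift; exact: bmf_bspline.
  rewrite (eq_bigr (fun a : 'I_m.+2 => \int[mu]_(z in `]y, y + l])
      (p a * (N m (z + a%:R) - N m (z + a%:R - 1))))); last first.
    by move=> a _; rewrite (Rintegral_bmfZ _ (itvoc_fin _ _) _ (bd a)).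
  rewrite -Rintegral_bmf_sum//; last 2 first.
  - exact: itvoc_fin.
  - by move=> a; exact: (bmfZ (p a) (bd a)).
  apply: eq_Rintegral => z; rewrite inE/= in_itv/= => /andP[z1 z2].
  under eq_bigr do rewrite mulrBr.
  rewrite sumrB big_ord_recr/= bspline_supp ?mulr0 ?addr0; last by rewrite lerDr; lra.
  rewrite [X in _ - X]big_ord_recl/= addr0 bspline_lt0 ?mulr0 ?add0r; last by rewrite subr_lt0 (le_lt_trans z2).
  rewrite -sumrB; apply: eq_bigr => a _; rewrite /q mulrBl.
  by rewrite /bump/= add1n -natr1 addrA addrK.
have K0 : K != 0 by apply: lt0r_neq0; lra.
rewrite -/l in yl near; clearbody l.
(* On the interval [w] keeps its sign and half of its size at [x], so that its
   integral does not cancel. *)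
have wl : `|q b| * l / (4 * K) <= `|\int[mu]_(z in `]y, y + l]) w z|.
  have e : \int[mu]_(z in `]y, y + l]) (w z - w x) =
      \int[mu]_(z in `]y, y + l]) w z - w x * l.
    rewrite Rintegral_bmfB//; [|exact: itvoc_fin|exact: bmf_cst].
    by rewrite Rintegral_itvoc_cst ?lerDl ?ltW// (addrC y) addrK.
  have : `|\int[mu]_(z in `]y, y + l]) (w z - w x)| <= `|q b| / (4 * K) * l.
    have -> : `|q b| / (4 * K) * l = `|q b| / (4 * K) * (y + l - y).
      by congr (_ * _); rewrite (addrC y) addrK.
    apply: normr_Rintegral_itvoc; [by apply: bmfB => //; exact: bmf_cst|by rewrite lerDl ltW|].
    by move=> z z1 z2; apply: near; rewrite (ltW z1) z2.
  rewrite e => H.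
  have : `|w x * l| <= `|\int[mu]_(z in `]y, y + l]) w z| + `|q b| / (4 * K) * l.
    rewrite -[w x * l](subKr (\int[mu]_(z in `]y, y + l]) w z)).
    by rewrite (le_trans (ler_normB _ _))// lerD2l.
  rewrite normrM (gtr0_norm l0).
  have : `|q b| / (2 * K) * l <= `|w x| * l by rewrite ler_pM2r.
  have -> : `|q b| / (2 * K) * l = `|q b| * l / (4 * K) + `|q b| / (4 * K) * l.
    by field.
  by move=> H1 H2; rewrite -(lerD2r (`|q b| / (4 * K) * l)) (le_trans H1).
have qS : `|q b| <= K' * S.
  have yl0 : y <= y + l by rewrite lerDl ltW.
  have s1 : `|s y| <= S by apply: pS; lra.
  have s2 : `|s (y + l)| <= S by apply: pS; lra.
  have : `|q b| * l / (4 * K) <= 2 * S.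
    by rewrite (le_trans wl)// -sw (le_trans (ler_normB _ _))//; lra.
  rewrite ler_pdivrMr ?mulr_gt0//; last by lra.
  by rewrite /K' -ler_pdivlMr// => H; rewrite (le_trans H)// le_eqVlt; apply/orP; left; apply/eqP; ring.
have tele a c : (a + c < m.+2)%N -> `|p a - p (a + c)%N| <= c%:R * (K' * S).
  elim: c => [|c IHc] acm; first by rewrite addn0 subrr normr0 mul0r.
  rewrite addnS !ltnS in acm.
  rewrite -natr1 mulrDl mul1r -(subrK (p (a + c)%N) (p a)) -addrA.
  rewrite (le_trans (ler_normD _ _))// lerD//; first by apply: IHc; exact: ltnW.
  by rewrite addnS (le_trans _ qS)//; exact: qb.
have tele2 a c : (a < m.+2)%N -> (c < m.+2)%N -> `|p a - p c| <= m.+2%:R * (K' * S).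
  wlog ac : a c / (a <= c)%N.
    by move=> H am cm; case: (leqP a c) => [/H|/ltnW/H]; [|rewrite distrC]; apply.
  move=> am cm; have := tele a (c - a)%N; rewrite subnKC// => /(_ cm)/le_trans; apply.
  by apply: ler_wpM2r; [exact: mulr_ge0|rewrite ler_nat (leq_trans (leq_subr a c))// ltnW].
move=> a am.
have -> : p a = s 0 + \sum_(c < m.+2) (p a - p c) * N m.+1 (0 + c%:R).
  under eq_bigr do rewrite mulrBl.
  by rewrite sumrB -mulr_sumr bspline_unity ?lexx ?ltr01// mulr1 /s addrC subrK.
rewrite (le_trans (ler_normD _ _))// mulrDl mul1r lerD//.
  by apply: pS; rewrite lexx ltr01.
rewrite (le_trans (ler_norm_sum _ _ _))//.
rewrite (le_trans (_ : _ <= \sum_(c < m.+2) m.+2%:R * (K' * S) * N m.+1 (0 + c%:R)))//.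
  apply: ler_sum => c _; rewrite normrM (ger0_norm (bspline_ge0 _ _)).
  by rewrite ler_wpM2r ?bspline_ge0//; exact: tele2.
by rewrite -mulr_sumr bspline_unity ?lexx ?ltr01// mulr1 mulrA.
Qed.

Lemma ge0_le_Rintegral_sub (f : R -> R) (a b c d : R) : bmf f ->
  (forall x, 0 <= f x) -> a <= b -> b <= c -> c <= d ->
  \int[mu]_(x in `]b, c]) f x <= \int[mu]_(x in `]a, d]) f x.
Proof.
move=> bf f0 ab bc cd.
rewrite (@Rintegral_split f a b d)//; last exact: le_trans cd.
rewrite (@Rintegral_split f b c d)// addrCA lerDl addr_ge0//.
  by apply: Rintegral_ge0 => x _; exact: f0.
by apply: Rintegral_ge0 => x _; exact: f0.
Qed.

(** Square-integral form of the stability, which makes the Gram matrix coercive. *)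
Lemma spline_stability2 m : exists2 g : R, 0 < g &
  forall (p : nat -> R) (f : R -> R), bmf f ->
    (forall x, 0 <= x < 1 -> f x = \sum_(a < m.+1) p a * N m (x + a%:R)) ->
    forall a, (a < m.+1)%N -> g * p a ^+ 2 <= \int[mu]_(x in `]0, 1]) f x ^+ 2.
Proof.
have [K K1 KS] := spline_stability m.
have [/andP[l0 l4] lE] := step_lenP m K1.
set l := step_len m K in l0 l4 lE.
exists (l / (4 * K) ^+ 2); first by rewrite divr_gt0// exprn_gt0//; lra.
move=> p f bf fE a am.
have [b bm pb] := exists_max_norm p (ltn0Sn m).
have [y [x [y0 yl x01 wx near]]] := large_on_interval K1 (fun S H => KS p S H b bm) pb.
have bf2 : bmf (fun x => f x ^+ 2) by exact: bmfX.
rewrite -/l in yl near.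
apply: (@le_trans _ _ (\int[mu]_(z in `]y, y + l]) f z ^+ 2)); last first.
  by apply: ge0_le_Rintegral_sub => //; [move=> z; rewrite sqr_ge0|lra|lra].
apply: (@le_trans _ _ (\int[mu]_(z in `]y, y + l]) ((`|p b| / (4 * K)) ^+ 2))).
  have yl1 : y <= y + l by rewrite lerDl ltW.
  rewrite Rintegral_itvoc_cst// (addrC y) addrK expr_div_n mulrAC.
  rewrite [leRHS]mulrC [leRHS]mulrA -[p a ^+ 2]real_normK ?num_real// ler_wpM2r//.
    by rewrite invr_ge0 exprn_ge0//; lra.
  by rewrite ler_wpM2l ?(ltW l0)// lerXn2r// ?nnegrE//; exact: pb.
apply: le_Rintegral_bmf => //; first exact: itvoc_fin.
  exact: bmf_cst.
move=> z /=; rewrite in_itv/= => /andP[z1 z2].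
have zy : y <= z <= y + l by rewrite (ltW z1) z2.
rewrite -[leRHS]real_normK ?num_real// lerXn2r// ?nnegrE ?divr_ge0//; first by lra.
rewrite fE; last by lra.
have := near z zy; set A := bigop _ _ _; set B := bigop _ _ _ in wx *.
move=> H; have : `|B| <= `|A| + `|A - B|.
  by rewrite -{1}[B](subKr A); exact: ler_normB.
have : `|p b| / (2 * K) = `|p b| / (4 * K) + `|p b| / (4 * K) by field; lra.
by move: wx H; lra.
Qed.

End Splines.

(** * The Gram matrix: coercivity and the Richardson iteration *)

Lemma big_ord_trunc (V : nmodType) (a b : nat) (F : nat -> V) : (a <= b)%N ->
  (forall i, (a <= i)%N -> (i < b)%N -> F i = 0) ->
  \sum_(i < b) F i = \sum_(i < a) F i.
Proof.
move=> ab F0; rewrite -(big_mkord xpredT F) (big_cat_nat (leq0n a) ab)/= big_mkord.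
by rewrite [X in _ + X]big_nat_cond [X in _ + X]big1 ?addr0// => i /andP[/andP[? ?] _]; exact: F0.
Qed.

Section Gram.
Context {R : realType}.
Variable m : nat.
Local Notation mu := (@lebesgue_measure R).
Local Notation N := (@bspline0 R m.+1).

(** The Gram matrix is a Toeplitz matrix; this is its symbol. *)
Definition spline_gram (k : int) : R := gram m.+1 0 k.

Lemma gram_toeplitz k l : gram m.+1 k l = spline_gram (l - k).
Proof.
rewrite /spline_gram /gram /Rintegral; congr fine.
pose f : R -> \bar R := fun x => (bspline k m.+1 x * bspline l m.+1 x)%:E.
have mN c : measurable_fun [set: R] (fun x : R => N (x + c)).
  by have [] := bmf_shift c (bmf_bspline m).
have mf : measurable_fun setT f.
  apply/measurable_EFinP; apply: measurable_funM; exact: mN.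
have f0 x : (0 <= f x)%E by rewrite lee_fin mulr_ge0// bspline_ge0.
have := @ge0_integral_affine R 1 k%:~R f ltr01 mf f0.
rewrite invr1 mul1e => <-; apply: eq_integral => x _.
by rewrite /f /bspline; congr (_ * _)%:E; congr (bspline0 _ _); rewrite ?intrD ?rmorphN/=; ring.
Qed.

Lemma spline_gramN k : spline_gram (- k) = spline_gram k.
Proof.
have -> : spline_gram (- k) = gram m.+1 k 0 by rewrite gram_toeplitz sub0r.
by rewrite /spline_gram /gram; apply: eq_Rintegral => x _; rewrite mulrC.
Qed.

Lemma bsplineZ_supp (x : R) (k : int) :
  x - k%:~R < 0 \/ m.+1%:R <= x - k%:~R -> bspline k m.+1 x = 0.
Proof. by case=> H; rewrite /bspline; [exact: bspline_lt0|exact: bspline_supp]. Qed.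

Lemma RintegralT_itvoc (f : R -> R) (a b : R) :
  (forall x, x <= a \/ b < x -> f x = 0) ->
  \int[mu]_x f x = \int[mu]_(x in `]a, b]) f x.
Proof.
move=> f0; rewrite [RHS]Rintegral_mkcond; apply: eq_Rintegral => x _.
rewrite patchE; case: ifPn => //; rewrite notin_setE/= in_itv/= => /negP.
by rewrite negb_and -!leNgt -ltNge => /orP xab; apply: f0; case: xab; [left|right].
Qed.

Lemma bmf_bsplineZ k : bmf (@bspline R k m.+1).
Proof. by rewrite /bspline; apply: bmf_shift; exact: bmf_bspline. Qed.

Lemma spline_gram_supp (k : int) : (m < `|k|)%N -> spline_gram k = 0.
Proof.
wlog k0 : k / 0 <= k.
  move=> H mk; have [k0|/ltW k0] := leP 0 k; first exact: H.
  by rewrite -spline_gramN H ?oppr_ge0// abszN.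
move=> mk; rewrite /spline_gram /gram.
rewrite (RintegralT_itvoc (a := -1) (b := -1)).
  by rewrite set_itvoc0 ?Rintegral_set0// ltxx.
move=> x _; have [xk|xk] := ltP x k%:~R.
  by rewrite [X in _ * X]bsplineZ_supp ?mulr0//; left; rewrite subr_lt0.
rewrite [X in X * _]bsplineZ_supp ?mul0r//; right; rewrite subr0 (le_trans _ xk)//.
by rewrite -(gez0_abs k0) -[X in _ <= X]pmulrn ler_nat.
Qed.

Lemma norm_spline_gram (k : int) : `|spline_gram k| <= m.+2%:R.
Proof.
rewrite /spline_gram /gram (RintegralT_itvoc (a := -1) (b := m.+1%:R)); last first.
  move=> x xab; rewrite [X in X * _]bsplineZ_supp ?mul0r// subr0.
  by case: xab => xab; [left; lra|right; exact: ltW].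
rewrite (le_trans (normr_Rintegral_itvoc (M := 1) _ _ _))//.
- by apply: bmfM; exact: bmf_bsplineZ.
- by have := ler0n R m.+1; lra.
- by move=> x _ _; rewrite normrM mulr_ile1// normr_bspline_le1.
- by rewrite mul1r opprK natr1.
Qed.

(** Coercivity of the Gram matrix: on each unit interval the local stability
    bounds the coefficient of the spline starting there. *)
Lemma gram_coercive : exists2 g : R, 0 < g & forall (n : nat) (p : nat -> R),
  g * \sum_(i < n) p i ^+ 2 <=
  \sum_(i < n) p i * \sum_(l < n) p l * spline_gram (i%:Z - l%:Z).
Proof.
have [g g0 gP] := @spline_stability2 R m; exists g => // n p.
pose f x : R := \sum_(i < n) p i * bspline i%:Z m.+1 x.
have bf : bmf f by apply: bmf_sum => i; apply: bmfZ; exact: bmf_bsplineZ.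
have bf2 : bmf (fun x => f x ^+ 2) by exact: bmfX.
have f20 x : 0 <= f x ^+ 2 by rewrite sqr_ge0.
pose b : R := (n + m.+1)%:R.
have -> : \sum_(i < n) p i * \sum_(l < n) p l * spline_gram (i%:Z - l%:Z) =
    \int[mu]_(x in `](-1), b]) f x ^+ 2.
  have -> : (fun x => f x ^+ 2) = (fun x => \sum_(i < n) p i * \sum_(l < n) p l * (bspline i%:Z m.+1 x * bspline l%:Z m.+1 x)).
    apply/funext => x; rewrite expr2 /f mulr_suml; apply: eq_bigr => i _.
    rewrite -mulrA; congr (_ * _); rewrite mulr_sumr; apply: eq_bigr => l _; ring.
  have b2 (i l : 'I_n) : bmf (fun x : R => bspline i%:Z m.+1 x * bspline l%:Z m.+1 x).
    by apply: bmfM; exact: bmf_bsplineZ.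
  have b3 (i : 'I_n) : bmf (fun x : R => \sum_(l < n) p l * (bspline i%:Z m.+1 x * bspline l%:Z m.+1 x)).
    by apply: bmf_sum => l; apply: bmfZ.
  rewrite Rintegral_bmf_sum//; last 2 first.
  - exact: itvoc_fin.
  - by move=> i; exact: (bmfZ (p i) (b3 i)).
  apply: eq_bigr => i _; rewrite (Rintegral_bmfZ _ (itvoc_fin _ _) _ (b3 i))//; congr (_ * _).
  rewrite Rintegral_bmf_sum//; last 2 first.
  - exact: itvoc_fin.
  - by move=> l; exact: (bmfZ (p l) (b2 i l)).
  apply: eq_bigr => l _; rewrite (Rintegral_bmfZ _ (itvoc_fin _ _) _ (b2 i l))//; congr (_ * _).
  rewrite -gram_toeplitz /gram (RintegralT_itvoc (a := -1) (b := b)).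
    by apply: eq_Rintegral => x _; rewrite mulrC.
  move=> x xab; rewrite [X in X * _]bsplineZ_supp ?mul0r//.
  have ln : l%:Z%:~R <= n%:R :> R by rewrite -[leLHS]pmulrn ler_nat ltnW.
  have l0 : 0 <= l%:Z%:~R :> R by rewrite -[leRHS]pmulrn ler0n.
  by move: xab; rewrite /b natrD => -[?|?]; [left; lra|right; lra].
apply: (@le_trans _ _ (\int[mu]_(x in `]0, n%:R]) f x ^+ 2)); last first.
  by apply: ge0_le_Rintegral_sub => //; rewrite ?ler_nat ?leq_addr//; lra.
have shiftf k : \int[mu]_(x in `]k%:R, k.+1%:R]) f x ^+ 2 =
    \int[mu]_(x in `]0, 1]) f (x + k%:R) ^+ 2.
  rewrite (@Rintegral_shift _ (fun x => f x ^+ 2) 0 1 k%:R)//.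
  by rewrite add0r -(natr1 k) (addrC 1).
have : forall k, (k <= n)%N -> g * \sum_(i < k) p i ^+ 2 <= \int[mu]_(x in `]0, k%:R]) f x ^+ 2.
  elim=> [|k IH] kn.
    by rewrite big_ord0 mulr0 Rintegral_ge0.
  rewrite big_ord_recr/= mulrDr (@Rintegral_split _ _ 0 k%:R)// ?ler0n ?ler_nat//.
  apply: lerD; first by apply: IH; exact: ltnW.
  rewrite shiftf.
  pose p' a := if (a <= k)%N then p (k - a)%N else 0.
  have := gP p' (fun x : R => f (x + k%:R)) (bmf_shift k%:R bf) _ 0%N isT.
  rewrite /p' subn0/=; apply => x x01.
  pose F i := p i * N (x + k%:R - i%:R).
  have -> : f (x + k%:R) = \sum_(i < n) F i.
    by apply: eq_bigr => i _; rewrite /F /bspline -pmulrn.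
  rewrite (big_ord_trunc kn); last first.
    move=> i ki _; rewrite /F bspline_lt0 ?mulr0//.
    have : k.+1%:R <= i%:R :> R by rewrite ler_nat.
    by rewrite -natr1; lra.
  pose G a := p' a * N (x + a%:R).
  have -> : \sum_(i < k.+1) F i = \sum_(i < k.+1) G i.
    rewrite (reindex_inj rev_ord_inj)/=; apply: eq_bigr => a _.
    have ak : (a <= k)%N by rewrite -ltnS.
    rewrite /F /G /p' subSS ak natrB//; congr (_ * N _); ring.
  rewrite -(@big_ord_trunc _ k.+1 (maxn k.+1 m.+1) G) ?leq_maxl//; last first.
    by move=> i ki _; rewrite /G /p' leqNgt ki mul0r.
  rewrite (@big_ord_trunc _ m.+1 _ G) ?leq_maxr// => i mi _.
  rewrite /G bspline_supp ?mulr0//.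
  by have : m.+1%:R <= i%:R :> R by [rewrite ler_nat]; lra.
by apply.
Qed.

Lemma sum_sqr_le n (x : nat -> R) :
  (\sum_(i < n) x i) ^+ 2 <= n%:R * \sum_(i < n) x i ^+ 2.
Proof.
elim: n => [|n IH]; first by rewrite !big_ord0 expr0n/= mul0r.
rewrite !big_ord_recr/=; set S := bigop _ _ _ in IH *; set Q := bigop _ _ _ in IH *.
rewrite -natr1 mulrDl mul1r mulrDr.
case: n => [|n] in S Q IH *.
  by rewrite /S /Q !big_ord0 !mul0r !add0r.
have n0 : 0 < n.+1%:R :> R by rewrite ltr0n.
move: (x n.+1) => y; clearbody S Q; move: n0 IH; move: (n.+1%:R) => w w0 IH.
have : 2 * S * y <= w * y ^+ 2 + Q.
  have : S ^+ 2 / w <= Q by rewrite ler_pdivrMr// mulrC.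
  have : 0 <= (S - w * y) ^+ 2 / w by rewrite divr_ge0 ?sqr_ge0// ltW.
  have -> : (S - w * y) ^+ 2 / w = S ^+ 2 / w - 2 * S * y + w * y ^+ 2.
    by field; rewrite gt_eqF.
  lra.
rewrite sqrrD; lra.
Qed.

Definition dotp n (u v : {poly R}) := \sum_(i < n) u`_i * v`_i.

(** The symbol moved to nonnegative exponents: multiplication by [gram_poly] is
    the Gram matrix followed by a translation by [m]. *)
Definition gram_poly : {poly R} :=
  \poly_(i < m.*2.+1) spline_gram (i%:Z - m%:Z).

Lemma coef_gram_poly i : gram_poly`_i = spline_gram (i%:Z - m%:Z).
Proof.
rewrite coef_poly; case: ltnP => // im; rewrite spline_gram_supp//.
lia.
Qed.

Lemma size_gram_poly : (size gram_poly <= m.*2.+1)%N.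
Proof. exact: size_poly. Qed.

Lemma coef_mul_gram_poly (p : {poly R}) s i : (size p <= s)%N ->
  (p * gram_poly)`_i = \sum_(l < s) p`_l * spline_gram (i%:Z - m%:Z - l%:Z).
Proof.
move=> ps; rewrite coefM.
pose F l := p`_l * spline_gram (i%:Z - m%:Z - l%:Z).
have -> : \sum_(l < i.+1) p`_l * gram_poly`_(i - l) = \sum_(l < i.+1) F l.
  apply: eq_bigr => l _; rewrite coef_gram_poly /F; congr (_ * spline_gram _).
  by have := ltn_ord l; rewrite ltnS => li; rewrite -subzn//; lia.
rewrite -(@big_ord_trunc _ i.+1 (maxn i.+1 s) F) ?leq_maxl//; last first.
  by move=> l il _; rewrite /F spline_gram_supp ?mulr0//; lia.
rewrite (@big_ord_trunc _ s _ F) ?leq_maxr// => l sl _.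
by rewrite /F nth_default ?mul0r// (leq_trans ps).
Qed.

Lemma dotp_ge0 n u : 0 <= dotp n u u.
Proof. by apply: sumr_ge0 => i _; rewrite -expr2 sqr_ge0. Qed.

Lemma dotpXn n k u : dotp (n + k) ('X^k * u) ('X^k * u) = dotp n u u.
Proof.
rewrite /dotp addnC big_split_ord/= big1 ?add0r; last first.
  by move=> i _; rewrite coefXnM ltn_ord mul0r.
by apply: eq_bigr => i _; rewrite coefXnM ltnNge leq_addr/= addKn.
Qed.

Lemma dotp_size n (u : {poly R}) : (size u <= n)%N -> dotp n u u = dotp (size u) u u.
Proof.
move=> un; rewrite /dotp (@big_ord_trunc _ _ _ (fun i => u`_i * u`_i) un)// => i si _.
by rewrite nth_default ?mul0r.
Qed.

Lemma dotp_gram_coercive : exists2 g : R, 0 < g & forall (u : {poly R}) n,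
  (size u <= n)%N ->
  g * dotp n u u <= dotp (n + m) ('X^m * u) (u * gram_poly).
Proof.
have [g g0 gP] := gram_coercive; exists g => // u n un.
have := gP n (fun i => u`_i).
have -> : \sum_(i < n) u`_i ^+ 2 = dotp n u u by [].
move=> /le_trans; apply; rewrite le_eqVlt; apply/orP; left; apply/eqP.
rewrite /dotp addnC big_split_ord/= [X in _ = X + _]big1 ?add0r; last first.
  by move=> i _; rewrite coefXnM ltn_ord mul0r.
apply: eq_bigr => i _; rewrite coefXnM ltnNge leq_addr/= addKn; congr (_ * _).
rewrite (coef_mul_gram_poly _ un); apply: eq_bigr => l _.
by congr (_ * spline_gram _); rewrite PoszD; ring.
Qed.

Lemma dotp_gram_bound (u : {poly R}) n : (size u + m.*2.+1 <= n)%N ->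
  dotp n (u * gram_poly) (u * gram_poly) <=
  (m.*2.+1%:R * m.+2%:R) ^+ 2 * dotp n u u.
Proof.
move=> un; set M := m.*2.+1 in un *.
pose c k := spline_gram (k%:Z - m%:Z).
have uE i : (u * gram_poly)`_i = \sum_(k < M) c k * ('X^k * u)`_i.
  rewrite mulrC /gram_poly poly_def mulr_suml coef_sum; apply: eq_bigr => k _.
  by rewrite -scalerAl coefZ.
apply: (@le_trans _ _ (\sum_(i < n) M%:R * \sum_(k < M) (c k * ('X^k * u)`_i) ^+ 2)).
  by apply: ler_sum => i _; rewrite uE -expr2; exact: (sum_sqr_le M (fun k => c k * ('X^k * u)`_i)).
rewrite -mulr_sumr exchange_big/= exprMn expr2 -!mulrA ler_wpM2l//.
apply: (@le_trans _ _ (\sum_(k < M) m.+2%:R ^+ 2 * dotp n u u)); last first.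
  by rewrite sumr_const card_ord -[leLHS]mulr_natl expr2 !mulrA.
apply: ler_sum => k _; rewrite /dotp.
apply: (@le_trans _ _ (m.+2%:R ^+ 2 * dotp n ('X^k * u) ('X^k * u))).
  rewrite /dotp mulr_sumr; apply: ler_sum => i _; rewrite exprMn -expr2 ler_wpM2r ?sqr_ge0//.
  rewrite -[leLHS]real_normK ?num_real// lerXn2r// ?nnegrE//; exact: norm_spline_gram.
rewrite ler_wpM2l ?sqr_ge0// dotp_size; last first.
  rewrite (leq_trans (size_polyMleq _ _))// size_polyXn.
  by have := ltn_ord k; lia.
rewrite -/(dotp n u u); have -> : dotp n u u = dotp (n - k + k) ('X^k * u) ('X^k * u).
  rewrite dotpXn dotp_size 1?[RHS]dotp_size//; have := ltn_ord k; lia.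
rewrite [leRHS]dotp_size// (leq_trans (size_polyMleq _ _))// size_polyXn.
by have := ltn_ord k; lia.
Qed.

(** Richardson iteration: with the step [g / L ^ 2] the operator
    [1 - tau * A] contracts the square norm, since [A] is coercive with
    constant [g] and bounded by [L]. *)
Lemma neumann_contraction : exists tau q : R, [/\ 0 < tau, 0 <= q < 1 &
  forall n i, `|(('X^m - tau *: gram_poly) ^+ n)`_i| <= q ^+ n].
Proof.
have [g g0 gP] := dotp_gram_coercive.
set L : R := m.*2.+1%:R * m.+2%:R.
have L0 : 0 < L by rewrite mulr_gt0// ltr0n.
pose tau := g / L ^+ 2; have tau0 : 0 < tau by rewrite divr_gt0// exprn_gt0.
set T := 'X^m - tau *: gram_poly.
pose q2 := 1 - g ^+ 2 / L ^+ 2.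
have step (u : {poly R}) n : (size u + m.*2.+1 <= n)%N ->
    dotp (n + m) (u * T) (u * T) <= q2 * dotp (n + m) u u.
  move=> un.
  have -> : dotp (n + m) (u * T) (u * T) = dotp (n + m) ('X^m * u) ('X^m * u)
      - 2 * tau * dotp (n + m) ('X^m * u) (u * gram_poly)
      + tau ^+ 2 * dotp (n + m) (u * gram_poly) (u * gram_poly).
    rewrite /dotp !mulr_sumr -sumrB -big_split/=; apply: eq_bigr => i _.
    rewrite /T mulrBr -scalerAr (mulrC u 'X^m) coefB coefZ; ring.
  have un' : (size u <= n)%N by lia.
  have e : dotp (n + m) u u = dotp n u u.
    by rewrite dotp_size 1?[RHS]dotp_size//; lia.
  rewrite dotpXn e.
  have := gP u n un'; have := @dotp_gram_bound u (n + m) _.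
  rewrite -/L e => /(_ ltac:(lia)) H1 H2.
  have -> : q2 * dotp n u u = dotp n u u - 2 * tau * (g * dotp n u u) + tau ^+ 2 * (L ^+ 2 * dotp n u u).
    by rewrite /q2 /tau; field; rewrite gt_eqF.
  rewrite lerD//; last by rewrite ler_wpM2l ?sqr_ge0.
  by rewrite lerD2l lerN2 ler_wpM2l// mulr_ge0// ltW.
have q20 : 0 <= q2.
  have := step 1 (1 + m.*2.+1)%N; rewrite size_poly1 => /(_ (leqnn _)).
  have -> : dotp (1 + m.*2.+1 + m) 1 1 = 1.
    rewrite dotp_size size_poly1; last by lia.
    by rewrite /dotp big_ord1 coef1 mulr1.
  by rewrite mulr1; apply: le_trans; exact: dotp_ge0.
have q21 : q2 < 1 by rewrite /q2 gtrBl divr_gt0// exprn_gt0.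
have sT n : (size (T ^+ n) <= n * m.*2 + 1)%N.
  elim: n => [|n IH]; first by rewrite expr0 size_poly1.
  rewrite exprS (leq_trans (size_polyMleq _ _))//.
  have : (size T <= m.*2.+1)%N.
    rewrite (leq_trans (size_polyD _ _))// geq_max size_polyXn size_polyN.
    rewrite (leq_trans (size_scale_leq _ _)) ?size_gram_poly// andbT; lia.
  rewrite mulSn; lia.
have pw n k : (n * m.*2 + 1 + m.*2.+1 <= k)%N -> dotp (k + m) (T ^+ n) (T ^+ n) <= q2 ^+ n.
  elim: n => [|n IH] kn.
    rewrite !expr0 dotp_size size_poly1; last by lia.
    by rewrite /dotp big_ord1 coef1 mulr1.
  rewrite exprSr (le_trans (step _ _ _))//; last first.
    by rewrite exprS ler_wpM2l// IH//; rewrite mulSn in kn; lia.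
  rewrite (leq_trans (leq_add (sT n) (leqnn _)))//; rewrite mulSn in kn; lia.
exists tau, (Num.sqrt q2); split => //.
  rewrite sqrtr_ge0/= -[X in _ < X]sqrtr1 ltr_sqrt//.
move=> n i.
rewrite -(@ler_pXn2r _ 2)// ?nnegrE ?exprn_ge0 ?sqrtr_ge0//.
rewrite real_normK ?num_real// exprAC sqr_sqrtr//.
pose k := (n * m.*2 + 1 + m.*2.+1 + i)%N.
have ik : (i < k + m)%N by rewrite /k; lia.
apply: (le_trans _ (@pw n k _)); last by rewrite /k; lia.
by rewrite /dotp (bigD1 (Ordinal ik))//= -expr2 lerDl sumr_ge0// => l _; rewrite -expr2 sqr_ge0.
Qed.

End Gram.

(** * The inverse of the Gram matrix *)

Section Limits.
Context {R : realType}.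

Lemma cvgn_norm_le (u : nat -> R) (l M : R) :
  u @ \oo --> l -> (forall n, `|u n| <= M) -> `|l| <= M.
Proof.
move=> ul uM; have nl : `|u n| @[n --> \oo] --> `|l| by apply: cvg_norm.
rewrite -(cvg_lim _ nl)//; apply: limr_le; first by apply: cvgP nl.
by apply: nearW => n; exact: uM.
Qed.

Lemma cvgn_le (u : nat -> R) (l M : R) :
  u @ \oo --> l -> (forall n, u n <= M) -> l <= M.
Proof.
move=> ul uM; rewrite -(cvg_lim _ ul)//; apply: limr_le; first exact: cvgP ul.
by apply: nearW => n; exact: uM.
Qed.

Lemma cvgn_sum (I : Type) (s : seq I) (u : I -> nat -> R) (l : I -> R) :
  (forall i, u i @ \oo --> l i) ->
  (fun n => \sum_(i <- s) u i n) @ \oo --> \sum_(i <- s) l i.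
Proof.
move=> ul; elim: s => [|i s IH].
  by rewrite big_nil; under eq_fun do rewrite big_nil; exact: cvg_cst.
by rewrite big_cons; under eq_fun do rewrite big_cons; exact: cvgD.
Qed.


Lemma bernoulli_le (x : R) n : 0 <= x <= 1 -> 1 - n%:R * x <= (1 - x) ^+ n.
Proof.
move=> x01; elim: n => [|n IH]; first by rewrite mul0r subr0 expr0.
rewrite exprS -natr1; have n0 := ler0n R n.
have : (1 - x) * (1 - n%:R * x) <= (1 - x) * (1 - x) ^+ n.
  by apply: ler_wpM2l => //; lra.
apply: le_trans; nra.
Qed.

Lemma geometric_sum_le (rho : R) n : 0 <= rho < 1 ->
  \sum_(i < n) rho ^+ i <= (1 - rho)^-1.
Proof.
move=> /andP[r0 r1]; have d0 : 0 < 1 - rho by rewrite subr_gt0.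
rewrite -[leRHS]mul1r ler_pdivlMr// mulrC.
have -> : (1 - rho) * (\sum_(i < n) rho ^+ i) = 1 - rho ^+ n.
  elim: n => [|n IH]; first by rewrite big_ord0 expr0 mulr0 subrr.
  by rewrite big_ord_recr/= mulrDr IH exprS; ring.
by rewrite gerBl exprn_ge0.
Qed.

Lemma geometric_dominated_cvg (u : nat -> R) (c rho : R) : 0 <= rho < 1 ->
  (forall n, `|u n| <= c * rho ^+ n) -> cvgn (series u).
Proof.
move=> /andP[r0 r1] uc; apply: normed_cvg.
apply: (@series_le_cvg _ _ (geometric c rho)) => //.
- by move=> n; rewrite /= normr_ge0.
- by move=> n; apply: le_trans (uc n).
- by apply: is_cvg_geometric_series; rewrite ger0_norm.
Qed.

End Limits.

Section GramInverse.
Context {R : realType}.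
Variable m : nat.
Local Notation N := (@bspline0 R m.+1).
Local Notation alpha := (@spline_gram R m).

(** Coefficients of a polynomial as a sequence over the integers, so that
    multiplication by powers of the variable becomes translation. *)
Definition zcoef (p : {poly R}) (k : int) : R := if k is Posz i then p`_i else 0.

Lemma zcoefB p q k : zcoef (p - q) k = zcoef p k - zcoef q k.
Proof. by case: k => k /=; rewrite ?coefB ?subr0. Qed.

Lemma zcoefZ c p k : zcoef (c *: p) k = c * zcoef p k.
Proof. by case: k => k /=; rewrite ?coefZ ?mulr0. Qed.

Lemma zcoef_sum n (p : 'I_n -> {poly R}) k :
  zcoef (\sum_(i < n) p i) k = \sum_(i < n) zcoef (p i) k.
Proof. by case: k => k /=; [rewrite coef_sum|rewrite big1]. Qed.

Lemma zcoef1 k : zcoef 1 k = (k == 0)%:R.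
Proof. by case: k => [[|k]|k] //=; rewrite coef1. Qed.

Lemma zcoefXnM i p k : zcoef ('X^i * p) k = zcoef p (k - i%:Z).
Proof.
case: k => k /=.
  rewrite coefXnM; case: ltnP => ik.
    by have [j ->] : exists j, (k%:Z - i%:Z) = Negz j; [exists (i - k).-1; lia|].
  by have -> : (k%:Z - i%:Z) = (k - i)%N%:Z by lia.
by have [j ->] : exists j, (Negz k - i%:Z) = Negz j; [exists (k + i)%N; lia|].
Qed.

Lemma zcoef_norm_le (p : {poly R}) (M : R) k : (forall i, `|p`_i| <= M) -> `|zcoef p k| <= M.
Proof. by move=> pM; case: k => k //=; rewrite normr0 (le_trans _ (pM 0%N)). Qed.

Lemma zcoef_supp (p : {poly R}) s k : (size p <= s.+1)%N -> zcoef p k != 0 -> 0 <= k <= s%:Z.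
Proof.
case: k => k /= ps; last by rewrite eqxx.
move=> pk; rewrite lez_nat; rewrite leqNgt; apply: contraNN pk => sk.
by rewrite nth_default// (leq_trans ps).
Qed.

Lemma size_neumann (tau : R) n :
  (size (('X^m - tau *: @gram_poly R m) ^+ n) <= (n * m.*2).+1)%N.
Proof.
elim: n => [|n IH]; first by rewrite expr0 size_poly1.
rewrite exprS (leq_trans (size_polyMleq _ _))//.
have : (size ('X^m - tau *: @gram_poly R m)%R <= m.*2.+1)%N.
  rewrite (leq_trans (size_polyD _ _))// geq_max size_polyXn size_polyN.
  by rewrite (leq_trans (size_scale_leq _ _)) ?size_gram_poly// andbT; lia.
by move=> H; rewrite -subn1 leq_subLR (leq_trans (leq_add H IH))// mulSn; lia.
Qed.

(** The Neumann series [tau * \sum_n T ^ n] of [T := 'X^m - tau *: gram_poly],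
    each [T ^ n] being translated back by [n * m].  Its [n]-th term is at most
    [q ^ n] and is supported in [|k| <= n * (m + 1)], so that the series decays
    geometrically in [k] as well. *)
Lemma gram_inverse_seq : exists (b : int -> R) (C rho : R),
  [/\ 0 <= C, 0 < rho < 1, forall k, `|b k| <= C * rho ^+ `|k|%N &
      forall k, \sum_(i < m.*2.+1) alpha (i%:Z - m%:Z) * b (k + m%:Z - i%:Z)
        = (k == 0)%:R].
Proof.
have [tau [q [tau0 /andP[q0 q1] qP]]] := @neumann_contraction R m.
set T := 'X^m - tau *: @gram_poly R m in qP.
pose x : R := (1 - q) / (2 * m.+1%:R).
have m0 : 1 <= m.+1%:R :> R by rewrite ler1n.
have x0 : 0 < x by rewrite divr_gt0//; lra.
have x1 : x <= 2^-1.
  rewrite /x ler_pdivrMr; last by lra.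
  by rewrite mulrA mulVf ?mul1r ?pnatr_eq0//; lra.
pose rho := 1 - x; have r01 : 0 < rho < 1 by rewrite /rho; lra.
have [r0 r1] : 0 <= rho /\ rho <= 1 by rewrite /rho; lra.
(* The exponent lets [q ^ n] pay for the spread of [T ^ n] and for the
   summation over [n]. *)
have qr : q <= rho ^+ (2 * m.+1).
  apply: le_trans (bernoulli_le _ _); last by lra.
  by rewrite /x natrM mulrC divfK ?mulf_neq0 ?pnatr_eq0//; lra.
pose t n k := zcoef (T ^+ n) (k + (n * m)%:Z).
have tb n k : `|t n k| <= rho ^+ `|k|%N * rho ^+ n.
  have [->|tk] := eqVneq (t n k) 0; first by rewrite normr0 mulr_ge0 ?exprn_ge0.
  have kn : (`|k| <= n * m.+1)%N.
    by move: (zcoef_supp (size_neumann tau n) tk); clear; lia.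
  apply: (le_trans (zcoef_norm_le _ (qP n))).
  rewrite (le_trans (lerXn2r n _ _ qr)) ?nnegrE ?exprn_ge0//.
  rewrite -exprM -exprD ler_wiXn2l//; move: kn; clear; lia.
have tcvg k : cvgn (series (t ^~ k)).
  by apply: (geometric_dominated_cvg (c := rho ^+ `|k|%N) (rho := rho)); first lra.
(* The symbol times [tau] is [1 - T] up to translation, so the sums
   telescope. *)
have trec n k : \sum_(i < m.*2.+1) alpha (i%:Z - m%:Z) * (tau * t n (k + m%:Z - i%:Z))
    = t n k - t n.+1 k.
  have ET : T * T ^+ n = 'X^m * T ^+ n - (tau *: gram_poly m) * T ^+ n.
    by rewrite {1}/T mulrBl.
  rewrite /t exprS ET zcoefB zcoefXnM opprB.
  have -> : k + (n.+1 * m)%:Z - m%:Z = k + (n * m)%:Z by rewrite mulSn; clear; lia.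
  rewrite [RHS]addrC subrK -scalerAl zcoefZ /gram_poly poly_def mulr_suml zcoef_sum mulr_sumr.
  apply: eq_bigr => i _; rewrite -scalerAl zcoefZ zcoefXnM mulrCA; congr (_ * (_ * zcoef _ _)).
  by rewrite mulSn; clear; lia.
exists (fun k => tau * limn (series (t ^~ k))), (tau * (1 - rho)^-1), rho; split => //.
- by rewrite mulr_ge0 ?invr_ge0 ?ltW//; lra.
- move=> k; rewrite normrM gtr0_norm// -mulrA ler_wpM2l ?(ltW tau0)//.
  apply: (cvgn_norm_le (tcvg k)) => n.
  rewrite seriesEord (le_trans (ler_norm_sum _ _ _))//.
  apply: (@le_trans _ _ (\sum_(i < n) rho ^+ `|k|%N * rho ^+ i)).
    by apply: ler_sum => i _; exact: tb.
  rewrite -mulr_sumr mulrC ler_wpM2r ?exprn_ge0// geometric_sum_le//; lra.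
- move=> k.
  have c1 : (fun n => \sum_(i < m.*2.+1) alpha (i%:Z - m%:Z) *
      (tau * series (t ^~ (k + m%:Z - i%:Z)) n)) @ \oo -->
      \sum_(i < m.*2.+1) alpha (i%:Z - m%:Z) * (tau * limn (series (t ^~ (k + m%:Z - i%:Z)))).
    by apply: cvgn_sum => i; do 2 apply: cvgMr; exact: tcvg.
  apply: (cvg_unique _ c1) => //=.
  have -> : (fun n => \sum_(i < m.*2.+1) alpha (i%:Z - m%:Z) *
      (tau * series (t ^~ (k + m%:Z - i%:Z)) n)) = (fun n => (k == 0)%:R - t n k).
    apply/funext; elim=> [|n IH].
      rewrite big1; last by move=> i _; rewrite /series/= big_geq// !mulr0.
      by rewrite /t expr0 mul0n addr0 zcoef1 subrr.
    under eq_bigr do rewrite seriesSr mulrDr mulrDr.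
    rewrite big_split/= IH trec; ring.
  rewrite -[X in _ --> X]subr0; apply: cvgB; first exact: cvg_cst.
  apply/norm_cvg0P; apply: (@squeeze_cvgr _ _ _ _ (cst 0) (fun n => rho ^+ `|k|%N * rho ^+ n)).
  + by apply: nearW => n; rewrite normr_ge0 tb.
  + exact: cvg_cst.
  + rewrite -(mulr0 (rho ^+ `|k|%N)); apply: cvgMr.
    by apply: cvg_expr; rewrite ger0_norm//; lra.
Qed.

End GramInverse.

Section SumZ.
Context {R : realType}.
Implicit Types u v : int -> R.

(** Symmetric partial sums: [hasZ u s] says that [sumZ u] converges to [s]. *)
Definition psumZ u n := \sum_(i < n.*2.+1) u (i%:Z - n%:Z).

Definition hasZ u (s : R) := psumZ u @ \oo --> s.

Lemma sumZ_eq u s : hasZ u s -> sumZ u = s.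
Proof. exact: cvg_lim. Qed.

Definition zrange n := [seq i%:Z - n%:Z | i <- iota 0 n.*2.+1].

Lemma psumZE u n : psumZ u n = \sum_(l <- zrange n) u l.
Proof. by rewrite /psumZ /zrange big_map -(big_mkord xpredT (fun i => u (i%:Z - n%:Z))) /index_iota subn0. Qed.

Lemma zrange_uniq n : uniq (zrange n).
Proof. by rewrite map_inj_uniq ?iota_uniq// => i k; lia. Qed.

Lemma mem_zrange n (l : int) : (l \in zrange n) = (`|l| <= n)%N.
Proof.
apply/mapP/idP => [[i]|ln]; first by rewrite mem_iota => + ->; lia.
by exists (absz (l + n%:Z)); [rewrite mem_iota|]; lia.
Qed.

Lemma eq_big_supp (s1 s2 : seq int) (F : int -> R) : uniq s1 -> uniq s2 ->
  (forall l, F l != 0 -> (l \in s1) && (l \in s2)) ->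
  \sum_(l <- s1) F l = \sum_(l <- s2) F l.
Proof.
move=> u1 u2 F12.
have red s : \sum_(l <- s) F l = \sum_(l <- [seq l <- s | F l != 0]) F l.
  rewrite big_filter (bigID (fun l => F l != 0))/= [X in _ + X]big1 ?addr0//.
  by move=> l /negPn/eqP.
rewrite red [RHS]red; apply: perm_big; apply: uniq_perm; rewrite ?filter_uniq//.
move=> l; rewrite !mem_filter; case: (boolP (F l != 0)) => //= Fl.
by have /andP[-> ->] := F12 l Fl.
Qed.

Lemma hasZ_fin (s : seq int) u : uniq s -> (forall l, u l != 0 -> l \in s) ->
  hasZ u (\sum_(l <- s) u l).
Proof.
move=> us supp; apply: cvg_near_cst; exists (\max_(l <- s) `|l|%N)%N => // n /= sn.
rewrite psumZE; apply: eq_big_supp => //; first exact: zrange_uniq.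
move=> l ul; rewrite (supp l ul) andbT mem_zrange (leq_trans _ sn)//.
by rewrite (big_rem l)/= ?leq_maxl//; exact: supp.
Qed.

Lemma hasZ_sum (I : Type) (s : seq I) (c : I -> R) (u : I -> int -> R) (l : I -> R) :
  (forall i, hasZ (u i) (l i)) ->
  hasZ (fun k => \sum_(i <- s) c i * u i k) (\sum_(i <- s) c i * l i).
Proof.
move=> ul; rewrite /hasZ.
have -> : psumZ (fun k => \sum_(i <- s) c i * u i k) =
    fun n => \sum_(i <- s) c i * psumZ (u i) n.
  apply/funext => n; rewrite /psumZ exchange_big/=.
  by apply: eq_bigr => i _; rewrite mulr_sumr.
by apply: cvgn_sum => i; apply: cvgMr; exact: ul.
Qed.

Lemma psumZS u n : psumZ u n.+1 = psumZ u n + (u n.+1%:Z + u (- n.+1%:Z)).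
Proof.
rewrite !psumZE addrC -addrA.
have -> : u n.+1%:Z + (u (- n.+1%:Z) + \sum_(l <- zrange n) u l) =
    \sum_(l <- n.+1%:Z :: - n.+1%:Z :: zrange n) u l by rewrite !big_cons.
apply: perm_big; apply: uniq_perm; first exact: zrange_uniq.
  by rewrite cons_uniq [uniq (_ :: zrange n)]cons_uniq zrange_uniq in_cons negb_or !mem_zrange; lia.
move=> l.
have -> : (l \in [:: n.+1%:Z, - n.+1%:Z & zrange n]) =
    (l == n.+1%:Z) || ((l == - n.+1%:Z) || (l \in zrange n)) by [].
by rewrite !mem_zrange; lia.
Qed.

Section Decay.
Variable rho : R.
Hypothesis rho01 : 0 < rho < 1.

Lemma rho_ge0 : 0 <= rho. Proof. by case/andP: rho01 => /ltW. Qed.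
Lemma rho_le1 : rho <= 1. Proof. by case/andP: rho01 => _ /ltW. Qed.
Lemma rho_bounds : 0 <= rho < 1. Proof. by case/andP: rho01 => /ltW -> ->. Qed.

Definition decay u := exists C : R, forall k, `|u k| <= C * rho ^+ `|k|%N.

Lemma decay_cvg u : decay u -> cvgn (psumZ u).
Proof.
move=> [C uC]; have [r0 r1] := (rho_ge0, rho_le1).
pose f i := u i.+1%:Z + u (- i.+1%:Z).
have -> : psumZ u = (fun n => u 0 + series f n).
  apply/funext; elim=> [|n IH].
    by rewrite /psumZ big_ord1 subrr /series/= big_geq// addr0.
  by rewrite psumZS IH seriesSr [RHS]addrA.
apply: is_cvgD; first exact: is_cvg_cst.
apply: (geometric_dominated_cvg (c := 2 * C * rho) (rho := rho)); first exact: rho_bounds.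
move=> i; rewrite (le_trans (ler_normD _ _))//.
have := uC i.+1%:Z; have := uC (- i.+1%:Z); rewrite abszN absz_nat exprS; lra.
Qed.

Lemma decay_sumZ u : decay u -> hasZ u (sumZ u).
Proof. exact: decay_cvg. Qed.

Lemma decay_shift u c : decay u -> decay (fun k => u (k + c)).
Proof.
have [r0 r1] := (rho_ge0, rho_le1).
move=> [C uC]; exists (`|C| / rho ^+ `|c|%N) => k; rewrite (le_trans (uC _))//.
rewrite mulrAC ler_pdivlMr ?exprn_gt0//; last by case/andP: rho01.
rewrite -mulrA -exprD (le_trans (ler_wpM2r _ (ler_norm C))) ?exprn_ge0//.
by rewrite ler_wpM2l// ler_wiXn2l//; lia.
Qed.

Lemma decayM u v (B : R) : (forall k, `|v k| <= B) -> decay u -> decay (fun k => u k * v k).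
Proof.
move=> vB [C uC]; exists (C * B) => k; rewrite normrM mulrAC ler_pM//.
Qed.

Lemma decay_cvg0 u (e : nat -> int) : decay u -> (forall n, (n <= `|e n|)%N) ->
  (fun n => u (e n)) @ \oo --> 0.
Proof.
have [r0 r1] := (rho_ge0, rho_le1).
move=> [C uC] eP; apply/norm_cvg0P.
apply: (@squeeze_cvgr _ _ _ _ (cst 0) (fun n => `|C| * rho ^+ n)).
- apply: nearW => n; rewrite normr_ge0/= (le_trans (uC _))//.
  rewrite (le_trans (ler_wpM2r _ (ler_norm C))) ?exprn_ge0//.
  by rewrite ler_wpM2l// ler_wiXn2l.
- exact: cvg_cst.
- rewrite -(mulr0 `|C|); apply: cvgMr.
  by apply: cvg_expr; rewrite ger0_norm//; case/andP: rho01.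
Qed.

Lemma hasZ_shift1 u s : decay u -> hasZ u s ->
  hasZ (fun k => u (k + 1)) s /\ hasZ (fun k => u (k - 1)) s.
Proof.
move=> du us.
have E1 n : psumZ (fun k => u (k + 1)) n = psumZ u n + (u n.+1%:Z - u (- n%:Z)).
  elim: n => [|n IH].
    by rewrite /psumZ !big_ord1 subrr add0r oppr0 addrCA subrr addr0.
  rewrite !psumZS IH.
  have -> : n.+1%:Z + 1 = n.+2%:Z by lia.
  have -> : - n.+1%:Z + 1 = - n%:Z by lia.
  ring.
have E2 n : psumZ (fun k => u (k - 1)) n = psumZ u n + (u (- n.+1%:Z) - u n%:Z).
  elim: n => [|n IH].
    by rewrite /psumZ !big_ord1 subrr sub0r addrCA subrr addr0.
  rewrite !psumZS IH.
  have -> : n.+1%:Z - 1 = n%:Z by lia.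
  have -> : - n.+1%:Z - 1 = - n.+2%:Z by lia.
  ring.
split; rewrite /hasZ.
- have -> : psumZ (fun k => u (k + 1)) = fun n => psumZ u n + (u n.+1%:Z - u (- n%:Z)) by apply/funext.
  rewrite -(addr0 s); apply: cvgD => //; rewrite -(subr0 0).
  by apply: cvgB; apply: decay_cvg0 => // n; rewrite ?abszN absz_nat.
- have -> : psumZ (fun k => u (k - 1)) = fun n => psumZ u n + (u (- n.+1%:Z) - u n%:Z) by apply/funext.
  rewrite -(addr0 s); apply: cvgD => //; rewrite -(subr0 0).
  by apply: cvgB; apply: decay_cvg0 => // n; rewrite ?abszN absz_nat.
Qed.

(** Symmetric partial sums are not translation invariant; the decay makes the
    boundary terms vanish. *)
Lemma hasZ_shift u s c : decay u -> hasZ u s -> hasZ (fun k => u (k + c)) s.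
Proof.
move=> du us; elim/int_rect: c => [|n IH|n IH].
- by under eq_fun do rewrite addr0.
- have [+ _] := hasZ_shift1 (decay_shift n%:Z du) IH.
  by congr (hasZ _ s); apply/funext => k; congr u; lia.
- have [_ +] := hasZ_shift1 (decay_shift (- n%:Z) du) IH.
  by congr (hasZ _ s); apply/funext => k; congr u; lia.
Qed.

Lemma sum_uniq_geometric_nat (t : seq nat) : uniq t ->
  \sum_(i <- t) rho ^+ i <= (1 - rho)^-1.
Proof.
move=> ut; have r0 := rho_ge0.
pose M := (\max_(i <- t) i).+1.
have -> : \sum_(i <- t) rho ^+ i = \sum_(i <- [seq i <- iota 0 M | i \in t]) rho ^+ i.
  apply: perm_big; apply: uniq_perm; rewrite ?filter_uniq ?iota_uniq// => i.
  rewrite mem_filter mem_iota add0n leq0n/=; have [it/=|//] := boolP (i \in t).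
  by rewrite /M ltnS (big_rem i it)/= leq_maxl.
rewrite big_filter.
apply: le_trans (geometric_sum_le M rho_bounds).
rewrite -(big_mkord xpredT (fun i => rho ^+ i)) /index_iota subn0.
by rewrite [leRHS](bigID (fun i => i \in t))/= lerDl sumr_ge0// => i _; rewrite exprn_ge0.
Qed.

Lemma sum_uniq_geometric (s : seq int) k : uniq s ->
  \sum_(l <- s) rho ^+ `|l - k|%N <= 2 / (1 - rho).
Proof.
move=> us; rewrite (bigID (fun l => k <= l))/=.
have -> : 2 / (1 - rho) = (1 - rho)^-1 + (1 - rho)^-1 by rewrite mulrDl mul1r.
have half (P : pred int) : {in P &, injective (fun l => `|l - k|%N)} ->
    \sum_(l <- s | P l) rho ^+ `|l - k|%N <= (1 - rho)^-1.
  move=> inj; rewrite -big_filter -(big_map (fun l : int => `|l - k|%N) xpredT (fun i => rho ^+ i)).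
  apply: sum_uniq_geometric_nat; rewrite map_inj_in_uniq ?filter_uniq// => x y.
  by rewrite !mem_filter => /andP[Px _] /andP[Py _]; apply: inj.
by apply: lerD; apply: half => x y; rewrite /in_mem/=; lia.
Qed.

End Decay.
End SumZ.

Section L2Inverse.
Context {R : realType}.
Implicit Types u v : int -> R.

Lemma l2Z_bound u : l2Z u <-> exists U : R, forall s : seq int, uniq s ->
  \sum_(l <- s) u l ^+ 2 <= U.
Proof.
split=> [ul|[U uU]].
  have e0 : (0 <= \esum_(k in [set: int]) (u k ^+ 2)%:E)%E.
    by apply: esum_ge0 => k _; rewrite lee_fin sqr_ge0.
  exists (fine (\esum_(k in [set: int]) (u k ^+ 2)%:E)) => s us.
  rewrite -lee_fin fineK ?ge0_fin_numE// -sumEFin.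
  rewrite fsbig_seq//; apply: ereal_sup_ubound.
  by exists [set` s] => //; split => //; exact: finite_seq.
rewrite /l2Z /esum; apply: (@le_lt_trans _ _ U%:E); last exact: ltry.
apply: ge_ereal_sup => _ [X [finX _] <-].
by rewrite fsbig_finite//= sumEFin lee_fin uU// finmap.fset_uniq.
Qed.

Lemma weighted_sqr_le (I : Type) (s : seq I) (w x : I -> R) : (forall i, 0 <= w i) ->
  (\sum_(i <- s) w i * x i) ^+ 2 <= (\sum_(i <- s) w i) * \sum_(i <- s) w i * x i ^+ 2.
Proof.
move=> w0; elim: s => [|i s IH]; first by rewrite !big_nil expr0n/= mul0r.
rewrite !big_cons; set A := bigop _ _ _ in IH *; set B := bigop _ _ _ in IH *; set D := bigop _ _ _ in IH *.
have B0 : 0 <= B by rewrite sumr_ge0.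
have wi := w0 i.
have D0 : 0 <= D by rewrite sumr_ge0// => k _; rewrite mulr_ge0 ?sqr_ge0.
have key : 2 * A * x i <= B * x i ^+ 2 + D.
  have [B0'|B0'] := eqVneq B 0.
    move: IH; rewrite B0' mul0r => A2.
    have -> : A = 0 by apply/eqP; rewrite -sqrf_eq0 eq_le A2 sqr_ge0.
    by rewrite mulr0 !mul0r add0r.
  have B1 : 0 < B by rewrite lt0r B0' B0.
  have H1 : A ^+ 2 / B <= D by rewrite ler_pdivrMr// mulrC.
  have H2 : 0 <= (A - B * x i) ^+ 2 / B by rewrite divr_ge0 ?sqr_ge0.
  have E : (A - B * x i) ^+ 2 / B = A ^+ 2 / B - 2 * A * x i + B * x i ^+ 2.
    by field.
  rewrite E in H2; lra.
have := ler_wpM2l wi key.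
rewrite sqrrD exprMn; move: IH; nra.
Qed.

Variable m : nat.
Local Notation alpha := (@spline_gram R m).

(** The rows of the Gram matrix are finite. *)
Lemma mulZ_gram u k : mulZ (gram m.+1) u k =
  \sum_(i < m.*2.+1) alpha (i%:Z - m%:Z) * u (k + m%:Z - i%:Z).
Proof.
rewrite /mulZ; set v := fun l : int => _.
pose s := [seq k + m%:Z - i%:Z | i <- iota 0 m.*2.+1].
have vE l : v l = alpha (k - l) * u l by rewrite /v gram_toeplitz -spline_gramN opprB.
rewrite (@sumZ_eq _ v (\sum_(l <- s) v l)).
  rewrite big_map -[iota 0 _]/(index_iota 0 m.*2.+1) big_mkord.
  by apply: eq_bigr => i _; rewrite vE; congr (alpha _ * _); lia.
apply: hasZ_fin; first by rewrite map_inj_uniq ?iota_uniq// => i j; lia.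
move=> l; rewrite vE; apply: contraNT => ls; rewrite spline_gram_supp ?mul0r//.
rewrite ltnNge; apply: contra ls => klm.
by apply/mapP; exists (absz (k + m%:Z - l)%R); [rewrite mem_iota|]; lia.
Qed.

Section Inverse.
Variables (b : int -> R) (C rho : R).
Hypotheses (C0 : 0 <= C) (rho01 : 0 < rho < 1).
Hypothesis bC : forall k, `|b k| <= C * rho ^+ `|k|%N.
Hypothesis ab : forall k,
  \sum_(i < m.*2.+1) alpha (i%:Z - m%:Z) * b (k + m%:Z - i%:Z) = (k == 0)%:R.

Let db : decay rho b. Proof. by exists C. Qed.

Let db_rev k : decay rho (fun l => b (k - l)).
Proof.
have [D bD] := decay_shift rho01 k db; exists D => l.
by have := bD (- l); rewrite addrC abszN.
Qed.

Let Cb := C * (2 / (1 - rho)).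

Let Cb0 : 0 <= Cb.
Proof. by rewrite /Cb mulr_ge0// divr_ge0// subr_ge0 (rho_le1 rho01). Qed.

Let sum_b k (s : seq int) : uniq s -> \sum_(l <- s) `|b (k - l)| <= Cb.
Proof.
move=> us; apply: (@le_trans _ _ (\sum_(l <- s) C * rho ^+ `|l - k|%N)).
  by apply: ler_sum => l _; rewrite distnC bC.
by rewrite -mulr_sumr ler_wpM2l// sum_uniq_geometric.
Qed.

Let sum_b' l (s : seq int) : uniq s -> \sum_(k <- s) `|b (k - l)| <= Cb.
Proof.
move=> us; apply: (@le_trans _ _ (\sum_(k <- s) C * rho ^+ `|k - l|%N)).
  by apply: ler_sum => k _; rewrite bC.
by rewrite -mulr_sumr ler_wpM2l// sum_uniq_geometric.
Qed.

Definition convZ u k := sumZ (fun l => b (k - l) * u l).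

Lemma convZ_has u k (B : R) : (forall l, `|u l| <= B) ->
  hasZ (fun l => b (k - l) * u l) (convZ u k).
Proof. by move=> uB; apply/decay_sumZ: (decayM uB (db_rev k)); exact: rho01. Qed.

Lemma hasZ_delta u k : hasZ (fun l => (k - l == 0)%:R * u l) (u k).
Proof.
have := @hasZ_fin R [:: k] (fun l => (k - l == 0)%:R * u l) isT.
rewrite big_seq1 subrr eqxx mul1r; apply => l.
have [->|kl] := eqVneq l k; first by rewrite inE eqxx.
by rewrite subr_eq0 (eq_sym k l) (negbTE kl) mul0r eqxx.
Qed.

Lemma hasZ_unique u (s t : R) : hasZ u s -> hasZ u t -> s = t.
Proof. by move=> us ut; exact: (cvg_unique _ us ut). Qed.

Lemma gram_convZ u (B : R) k : (forall l, `|u l| <= B) ->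
  \sum_(i < m.*2.+1) alpha (i%:Z - m%:Z) * convZ u (k + m%:Z - i%:Z) = u k.
Proof.
move=> uB.
have H := @hasZ_sum R 'I_m.*2.+1 (index_enum _) (fun i => alpha (i%:Z - m%:Z)) _ _
  (fun i => @convZ_has u (k + m%:Z - i%:Z) B uB).
apply: (hasZ_unique H); have := @hasZ_delta u k; congr hasZ.
apply/funext => l; rewrite -ab mulr_suml; apply: eq_bigr => i _.
by rewrite mulrA; congr (_ * b _ * _); lia.
Qed.

(** Shifting the summation index transfers the convolution by the Gram symbol
    from the sequence to the kernel. *)
Lemma convZ_gram u (B : R) k : (forall l, `|u l| <= B) ->
  hasZ (fun l => b (k - l) *
    \sum_(i < m.*2.+1) alpha (i%:Z - m%:Z) * u (l + m%:Z - i%:Z)) (u k).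
Proof.
move=> uB.
pose v (i : 'I_m.*2.+1) l := b (k - l) * u (l + (m%:Z - i%:Z)).
have vd i : decay rho (v i).
  by apply: (decayM (B := B)) => // l; exact: uB.
have vw (i : 'I_m.*2.+1) : hasZ (fun l => b (k + (m%:Z - i%:Z) - l) * u l) (sumZ (v i)).
  have := hasZ_shift rho01 (- (m%:Z - i%:Z)) (vd i) (decay_sumZ rho01 (vd i)).
  congr hasZ; apply/funext => l; rewrite /v subrK; congr (b _ * _); lia.
have H := @hasZ_sum R 'I_m.*2.+1 (index_enum _) (fun i => alpha (i%:Z - m%:Z)) _ _
  (fun i => decay_sumZ rho01 (vd i)).
have H' := @hasZ_sum R 'I_m.*2.+1 (index_enum _) (fun i => alpha (i%:Z - m%:Z)) _ _ vw.
have E : \sum_(i < m.*2.+1) alpha (i%:Z - m%:Z) * sumZ (v i) = u k.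
  apply: (hasZ_unique H'); have := @hasZ_delta u k; congr hasZ.
  apply/funext => l; rewrite -ab mulr_suml; apply: eq_bigr => i _.
  by rewrite mulrA; congr (_ * b _ * _); lia.
rewrite E in H; move: H; congr hasZ; apply/funext => l.
rewrite mulr_sumr; apply: eq_bigr => i _; rewrite /v mulrCA; congr (_ * (_ * u _)); lia.
Qed.

Lemma l2Z_norm_le u : l2Z u -> exists B : R, forall l, `|u l| <= B.
Proof.
move=> /l2Z_bound[U uU]; exists (U + 1) => l.
have := uU [:: l] isT; rewrite big_seq1 => ul.
have U0 : 0 <= U by rewrite (le_trans _ ul)// sqr_ge0.
rewrite -(@ler_pXn2r _ 2)// ?nnegrE//; last by lra.
by rewrite real_normK ?num_real//; nra.
Qed.

(** Schur test: the rows and columns of the inverse are summable. *)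
Lemma l2Z_convZ u : l2Z u -> l2Z (convZ u).
Proof.
move=> l2u; have [B uB] := l2Z_norm_le l2u; have /l2Z_bound[U uU] := l2u.
apply/l2Z_bound; exists (Cb * (Cb * U)) => s us.
have H : (fun n => \sum_(k <- s) (psumZ (fun l => b (k - l) * u l) n) ^+ 2) @ \oo -->
    \sum_(k <- s) convZ u k ^+ 2.
  by apply: cvgn_sum => k; rewrite expr2; under eq_fun do rewrite expr2; apply: cvgM; exact: (convZ_has uB).
apply: (cvgn_le H) => n.
apply: (@le_trans _ _ (\sum_(k <- s) Cb * \sum_(l <- zrange n) `|b (k - l)| * u l ^+ 2)).
  apply: ler_sum => k _; rewrite psumZE.
  apply: (@le_trans _ _ ((\sum_(l <- zrange n) `|b (k - l)| * `|u l|) ^+ 2)).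
    rewrite -[leLHS]real_normK ?num_real// lerXn2r// ?nnegrE// ?sumr_ge0//.
    by rewrite (le_trans (ler_norm_sum _ _ _))//; apply: ler_sum => l _; rewrite normrM.
  rewrite (le_trans (weighted_sqr_le _ _ _))//.
  under [X in _ * X <= _]eq_bigr do rewrite real_normK ?num_real//.
  apply: ler_wpM2r; last by apply: sum_b; exact: zrange_uniq.
  by apply: sumr_ge0 => l _; rewrite mulr_ge0 ?sqr_ge0.
rewrite -mulr_sumr ler_wpM2l// exchange_big/=.
apply: (@le_trans _ _ (\sum_(l <- zrange n) Cb * u l ^+ 2)).
  by apply: ler_sum => l _; rewrite -mulr_suml ler_wpM2r ?sqr_ge0// sum_b'.
by rewrite -mulr_sumr ler_wpM2l// uU// zrange_uniq.
Qed.

Lemma gram_l2_inverse : l2_inverse (gram m.+1) (fun k l => b (k - l)).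
Proof.
move=> u l2u; have [B uB] := l2Z_norm_le l2u; split.
- exact: l2Z_convZ.
- by apply/funext => k; rewrite mulZ_gram -[RHS](gram_convZ _ uB).
- apply/funext => k; rewrite /mulZ.
  under eq_fun do rewrite -/(mulZ (gram m.+1) u _) mulZ_gram.
  by apply: sumZ_eq; exact: (convZ_gram uB).
Qed.

(** A bounded inverse on square-summable sequences is determined by its
    columns, the preimages of the unit vectors. *)
Lemma gram_invE k l : gram_inv m.+1 k l = b (k - l).
Proof.
have inv : l2_inverse (gram m.+1) (gram_inv (R := R) m.+1).
  by rewrite /gram_inv; apply: xgetPex; exists (fun k l => b (k - l)); exact: gram_l2_inverse.
pose e := fun i : int => (i == l)%:R : R.
have e01 i : `|e i| <= 1 by rewrite /e normr_nat lern1 leq_b1.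
have l2e : l2Z e.
  apply/l2Z_bound; exists (2 / (1 - rho)) => s us.
  apply: le_trans (sum_uniq_geometric rho01 l us); apply: ler_sum => i _.
  rewrite /e; case: eqVneq => [->|_]; first by rewrite subrr expr1n expr0.
  by rewrite expr0n/= exprn_ge0// (rho_ge0 rho01).
have mulZe (g : int -> int -> R) : mulZ g e = g ^~ l.
  apply/funext => i; apply: sumZ_eq.
  have := @hasZ_fin R [:: l] (fun n => g i n * e n) isT.
  rewrite big_seq1 /e eqxx mulr1; apply => n.
  by have [->|nl] := eqVneq n l; [rewrite inE eqxx|rewrite mulr0 eqxx].
have [l2b be _] := gram_l2_inverse l2e; rewrite mulZe in l2b be.
have [_ _] := inv _ l2b; rewrite be mulZe => ge.
exact: (congr1 (fun f => f k) ge).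
Qed.

End Inverse.
End L2Inverse.

(** * The projection kernel seen from a unit cell *)

Section FloorFrac.
Context {R : realType}.

Definition frac (x : R) : R := x - (Num.floor x)%:~R.

Lemma frac_itv x : 0 <= frac x < 1.
Proof. by have := floor_itv x; rewrite /frac intrD; lra. Qed.

Lemma floor_eqP (x : R) (n : int) : n%:~R <= x < (n + 1)%:~R -> Num.floor x = n.
Proof. exact: floor_def. Qed.

Lemma floorBz (x : R) (k : int) : Num.floor (x - k%:~R) = Num.floor x - k.
Proof.
by apply: floor_eqP; have := floor_itv x; rewrite !intrD rmorphN/=; lra.
Qed.

Lemma floorDz (x : R) (k : int) : Num.floor (x + k%:~R) = Num.floor x + k.
Proof. by rewrite -[k in LHS]opprK rmorphN/= floorBz opprK. Qed.

Lemma floor_frac (u : R) (k : int) : 0 <= u < 1 -> Num.floor (u + k%:~R) = k.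
Proof. by move=> u01; apply: floor_eqP; rewrite intrD; lra. Qed.

End FloorFrac.

Section Localized.
Context {R : realType}.
Variable rho : R.
Hypothesis rho01 : 0 < rho < 1.
Local Notation mu := (@lebesgue_measure R).

(** Decay is measured cell by cell, which suits integer translations. *)
Definition localized (g : R -> R) := measurable_fun [set: R] g /\
  exists C : R, 0 <= C /\ forall z, `|g z| <= C * rho ^+ `|Num.floor z|%N.

Lemma localized_bmf g : localized g -> bmf g.
Proof.
move=> [mg [C [C0 gC]]]; split => //; exists C => z.
rewrite (le_trans (gC z))// ler_piMr// exprn_ile1//.
  exact: (rho_ge0 rho01).
exact: (rho_le1 rho01).
Qed.

Lemma localized_shift g (k : int) : localized g -> localized (fun z : R => g (z + k%:~R)).
Proof.
have [r0 r1] := (rho_ge0 rho01, rho_le1 rho01).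
move=> [mg [C [C0 gC]]]; split.
  by apply: (measurableT_comp mg); apply: measurable_funD.
have rk : 0 < rho ^+ `|k|%N by rewrite exprn_gt0//; case/andP: rho01.
exists (C / rho ^+ `|k|%N); split; first by rewrite divr_ge0// ltW.
move=> z; rewrite (le_trans (gC _))// mulrAC ler_pdivlMr// -mulrA -exprD floorDz.
by rewrite ler_wpM2l// ler_wiXn2l//; move: (Num.floor z) => n; clear; lia.
Qed.

Lemma localizedZ g (c : R) : localized g -> localized (fun z => c * g z).
Proof.
move=> [mg [C [C0 gC]]]; split; first exact: measurable_funM.
exists (`|c| * C); split; first by rewrite mulr_ge0.
by move=> z; rewrite normrM -mulrA ler_wpM2l.
Qed.

Lemma localizedD g h : localized g -> localized h -> localized (fun z => g z + h z).
Proof.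
move=> [mg [C [C0 gC]]] [mh [C' [C'0 hC]]]; split; first exact: measurable_funD.
exists (C + C'); split; first by rewrite addr_ge0.
by move=> z; rewrite (le_trans (ler_normD _ _))// mulrDl lerD.
Qed.

Lemma localized0 : localized (fun=> 0).
Proof.
split; first exact: measurable_cst.
by exists 0; split => // z; rewrite normr0 mul0r.
Qed.

Lemma localized_sum n (g : nat -> R -> R) :
  (forall i, localized (g i)) -> localized (fun z => \sum_(i < n) g i z).
Proof.
move=> lg; elim: n => [|n IH].
  by under eq_fun do rewrite big_ord0; exact: localized0.
by under eq_fun do rewrite big_ord_recr/=; exact: localizedD.
Qed.


(** The translates are evaluated in distinct cells, so a geometric series bounds
    the sum. *)
Lemma localized_sum_sqr g : localized g -> exists2 B : R, 0 <= B &
  forall (s : seq int) z, uniq s -> \sum_(k <- s) g (z - k%:~R) ^+ 2 <= B.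
Proof.
have [r0 r1] := (rho_ge0 rho01, rho_le1 rho01).
move=> [mg [C [C0 gC]]]; exists (C ^+ 2 * (2 / (1 - rho))).
  by rewrite mulr_ge0 ?sqr_ge0// divr_ge0// subr_ge0.
move=> s z us.
apply: (@le_trans _ _ (\sum_(k <- s) C ^+ 2 * rho ^+ `|k - Num.floor z|%N)); last first.
  by rewrite -mulr_sumr ler_wpM2l ?sqr_ge0// sum_uniq_geometric.
apply: ler_sum => k _; rewrite -[leLHS]real_normK ?num_real//.
apply: (@le_trans _ _ ((C * rho ^+ `|k - Num.floor z|%N) ^+ 2)).
  rewrite lerXn2r// ?nnegrE// ?mulr_ge0 ?exprn_ge0//.
  by rewrite (le_trans (gC _))// floorBz distnC.
rewrite exprMn ler_wpM2l ?sqr_ge0// expr2 ler_piMr ?exprn_ge0//.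
exact: exprn_ile1.
Qed.

(** Integrating over a cell the sum of the translates covers the line. *)
Lemma integral_itv_cells (f : R -> R) (B : R) : bmf f -> (forall z, 0 <= f z) ->
  (forall n z, \sum_(k <- [seq i%:Z - n%:Z | i <- iota 0 n.*2]) f (z + k%:~R) <= B) ->
  (\int[mu]_x (f x)%:E <= B%:E)%E.
Proof.
move=> bf f0 fB.
have cell n : \int[mu]_(x in `]- n%:R, n%:R]) f x <= B.
  have -> : \int[mu]_(x in `]- n%:R, n%:R]) f x =
      \int[mu]_(x in `]0, 1]) \sum_(k <- [seq i%:Z - n%:Z | i <- iota 0 n.*2]) f (x + k%:~R).
    rewrite Rintegral_bmf_sum//; last 2 first.
    - exact: itvoc_fin.
    - by move=> k; exact: bmf_shift.
    rewrite big_map.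
    have H q : \int[mu]_(x in `]- n%:R, - n%:R + q%:R]) f x =
        \sum_(i <- iota 0 q) \int[mu]_(x in `]0, 1]) f (x + (i%:Z - n%:Z)%:~R).
      elim: q => [|q IH].
        by rewrite big_nil addr0 set_itvoc0 ?Rintegral_set0// ltxx.
      rewrite -natr1 addrA (@Rintegral_split _ f _ (- n%:R + q%:R))//; last 2 first.
      - by rewrite lerDl.
      - by rewrite lerDl.
      rewrite -addn1 iotaD big_cat/= big_seq1 -IH; congr (_ + _).
      rewrite (@Rintegral_shift _ f 0 1)// add0n intrD rmorphN/= -!pmulrn add0r.
      by congr (\int[mu]_(x in _) f x); apply/seteqP; split => x /=; rewrite !in_itv/=; lra.
    rewrite -H; congr (\int[mu]_(x in _) f x).
    by apply/seteqP; split => x /=; rewrite !in_itv/= -addnn natrD; lra.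
  apply: (@le_trans _ _ (\int[mu]_(x in `]0, 1]) B)); last first.
    by rewrite Rintegral_itvoc_cst// subr0 mulr1.
  apply: le_Rintegral_bmf => //; first exact: itvoc_fin.
  - by apply: bmf_sum => k; exact: bmf_shift.
  - exact: bmf_cst.
pose F n : set R := `]- n%:R, n%:R]%classic.
have ndF : nondecreasing_seq F.
  move=> i j ij; rewrite subsetEset => x; rewrite /F/= !in_itv/=.
  by have : i%:R <= j%:R :> R by [rewrite ler_nat]; lra.
have mf : measurable_fun setT (EFin \o f) by apply/measurable_EFinP; case: bf.
have FT : \bigcup_i F i = setT.
  apply/seteqP; split => // x _; exists (Num.truncn `|x|).+1 => //.
  rewrite /F/= in_itv/=.
  have := truncnS_gt `|x|; rewrite ltr_norml => /andP[-> /ltW ->] //.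
have H : (fun i => \int[mu]_(x in F i) (f x)%:E)%E @ \oo -->
    (\int[mu]_(x in \bigcup_i F i) (f x)%:E)%E.
  apply: ge0_nondecreasing_set_cvg_integral => //.
  - by move=> i; exact: measurable_itv.
  - by move=> i; exact: measurable_funTS.
  - by move=> i x _; rewrite lee_fin.
rewrite FT in H; rewrite -(cvg_lim _ H)//; apply: lime_le; first by apply: cvgP H.
apply: nearW => n.
by rewrite /F -EFin_Rintegral_bmf// ?lee_fin//; exact: itvoc_fin.
Qed.

Lemma localized_sqr_integral g : localized g -> exists2 B : R, 0 <= B &
  (\int[mu]_x (g x ^+ 2)%:E <= B%:E)%E.
Proof.
move=> lg; have [B B0 gB] := localized_sum_sqr lg; exists B => //.
apply: integral_itv_cells.
- by apply: bmfX; exact: localized_bmf.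
- by move=> z; rewrite sqr_ge0.
- move=> n z; have := gB [seq - k | k <- [seq i%:Z - n%:Z | i <- iota 0 n.*2]] z.
  rewrite [X in X <= _]big_map; under eq_bigr do rewrite rmorphN/= opprK.
  apply; rewrite map_inj_uniq; last exact: oppr_inj.
  by rewrite map_inj_uniq ?iota_uniq// => i k; clear; lia.
Qed.

End Localized.

Section Kernel.
Context {R : realType}.
Variable m : nat.
Local Notation N := (@bspline0 R m.+1).
Local Notation alpha := (@spline_gram R m).
Variables (b : int -> R) (C rho : R).
Hypotheses (C0 : 0 <= C) (rho01 : 0 < rho < 1).
Hypothesis bC : forall k, `|b k| <= C * rho ^+ `|k|%N.
Hypothesis ab : forall k,
  \sum_(i < m.*2.+1) alpha (i%:Z - m%:Z) * b (k + m%:Z - i%:Z) = (k == 0)%:R.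

(** Only the [m + 1] B-splines starting in the cells before [z] do not vanish
    at [z]. *)
Lemma spline_local (c : int -> R) (z : R) :
  hasZ (fun k => c k * bspline k m.+1 z)
    (\sum_(a < m.+1) c (Num.floor z - a%:Z) * N (frac z + a%:R)).
Proof.
pose s := [seq Num.floor z - a%:Z | a <- iota 0 m.+1].
have := @hasZ_fin R s (fun k => c k * bspline k m.+1 z); rewrite big_map.
rewrite -[iota 0 _]/(index_iota 0 m.+1) big_mkord.
have -> : \sum_(a < m.+1) c (Num.floor z - a%:Z) * bspline (Num.floor z - a%:Z) m.+1 z =
    \sum_(a < m.+1) c (Num.floor z - a%:Z) * N (frac z + a%:R).
  apply: eq_bigr => a _; congr (_ * N _).
  by rewrite /frac intrD rmorphN/= -pmulrn; ring.
apply; first by rewrite map_inj_uniq ?iota_uniq// => i k; clear; lia.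
move=> l; apply: contraNT => ls; rewrite bsplineZ_supp ?mulr0//.
have lz : Num.floor z < l \/ l <= Num.floor z - m.+1%:Z.
  apply/orP; apply: contraNT ls; rewrite negb_or -leNgt -ltNge => H.
  by apply/mapP; exists (absz (Num.floor z - l)%R); [rewrite mem_iota|]; move: H; move: (Num.floor z); clear; lia.
case: lz => [zl|lz]; [left|right].
  rewrite subr_lt0; apply: (lt_le_trans (floorD1_gt z)).
  by rewrite ler_int; move: zl; move: (Num.floor z); clear; lia.
rewrite lerBrDr (le_trans _ (floor_le z))//.
by rewrite [m.+1%:R]pmulrn -intrD ler_int; move: lz; move: (Num.floor z); clear; lia.
Qed.

(** The cardinal spline with coefficients [b], as a finite sum.  For the inverse
    Gram sequence [b] it is the dual spline, whose translates are biorthogonal to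
    the B-splines. *)
Definition cardinal_spline (z : R) : R :=
  \sum_(a < m.+1) b (Num.floor z - a%:Z) * N (frac z + a%:R).

Lemma cardinal_spline_hasZ z : hasZ (fun k => b k * bspline k m.+1 z) (cardinal_spline z).
Proof. exact: spline_local. Qed.

Lemma fracBz (x : R) (k : int) : frac (x - k%:~R) = frac x.
Proof. by rewrite /frac floorBz intrD rmorphN/=; ring. Qed.

Lemma spline_kernelE x y : spline_kernel m.+1 x y =
  \sum_(a < m.+1) N (frac x + a%:R) * cardinal_spline (y - (Num.floor x - a%:Z)%:~R).
Proof.
rewrite /spline_kernel.
have inner k : sumZ (fun l => gram_inv m.+1 k l * bspline l m.+1 x * bspline k m.+1 y) =
    (\sum_(a < m.+1) b (k - (Num.floor x - a%:Z)) * N (frac x + a%:R)) * bspline k m.+1 y.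
  apply: sumZ_eq.
  have := @hasZ_sum R 'I_1 (index_enum _) (fun=> bspline k m.+1 y) _ _
    (fun=> @spline_local (fun l => b (k - l)) x).
  rewrite big_ord1 mulrC; congr hasZ; apply/funext => l.
  by rewrite big_ord1 (gram_invE C0 rho01 bC ab); ring.
under eq_fun do rewrite inner.
rewrite (sumZ_eq (@spline_local (fun k => \sum_(a < m.+1) b (k - (Num.floor x - a%:Z)) * N (frac x + a%:R)) y)).
under eq_bigr do rewrite mulr_suml.
rewrite exchange_big/=; apply: eq_bigr => a _; rewrite /cardinal_spline mulr_sumr.
apply: eq_bigr => a' _; rewrite fracBz floorBz [RHS]mulrCA -mulrA; congr (b _ * _).
by rewrite addrAC.
Qed.

Lemma cardinal_spline_localized : localized rho cardinal_spline.
Proof.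
have [r0 r1] := (rho_ge0 rho01, rho_le1 rho01).
split.
  apply: (@measurable_fun_cvg _ _ _ setT (fun n z => psumZ (fun k => b k * bspline k m.+1 z) n)).
    move=> n; rewrite /psumZ; apply: (proj1 _).
    by apply: bmf_sum => i; apply: bmfZ; exact: bmf_bsplineZ.
  by move=> z _; exact: cardinal_spline_hasZ.
have rm : 0 < rho ^+ m by rewrite exprn_gt0//; case/andP: rho01.
exists (C / rho ^+ m); split; first by rewrite divr_ge0// ltW.
move=> z; rewrite (le_trans (ler_norm_sum _ _ _))//.
apply: (@le_trans _ _ (\sum_(a < m.+1) C / rho ^+ m * rho ^+ `|Num.floor z|%N * N (frac z + a%:R))); last first.
  by rewrite -mulr_sumr bspline_unity ?mulr1// frac_itv.
apply: ler_sum => a _; rewrite normrM (ger0_norm (bspline_ge0 _ _)).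
apply: ler_wpM2r; first exact: bspline_ge0.
rewrite (le_trans (bC _))// mulrAC ler_pdivlMr// -mulrA -exprD ler_wpM2l// ler_wiXn2l//.
by have := ltn_ord a; move: (Num.floor z); clear; lia.
Qed.

Definition dual_partial n (z : R) := \sum_(k <- zrange n) b k * N (z - k%:~R).

(** The truncated dual splines converge uniformly, at a geometric speed. *)
Lemma cardinal_spline_approx n z : `|cardinal_spline z - dual_partial n z| <= C * rho ^+ n.
Proof.
have [r0 r1] := (rho_ge0 rho01, rho_le1 rho01).
have H := @spline_local (fun k => if (`|k| <= n)%N then b k else 0) z.
have H' := @hasZ_fin R (zrange n) (fun k => (if (`|k| <= n)%N then b k else 0) * bspline k m.+1 z) (zrange_uniq n).
have {}H' := H' _; have -> : dual_partial n z = \sum_(a < m.+1) (if (`|Num.floor z - a%:Z| <= n)%N then b (Num.floor z - a%:Z) else 0) * N (frac z + a%:R).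
  rewrite -(hasZ_unique (H' _) H); last first.
    by move=> l; rewrite mem_zrange; case: ifP => //; rewrite mul0r eqxx.
  rewrite /dual_partial !big_seq; apply: eq_bigr => k; rewrite mem_zrange => ->.
  by rewrite /bspline.
rewrite /cardinal_spline -sumrB (le_trans (ler_norm_sum _ _ _))//.
apply: (@le_trans _ _ (\sum_(a < m.+1) C * rho ^+ n * N (frac z + a%:R))); last first.
  by rewrite -mulr_sumr bspline_unity ?mulr1// frac_itv.
apply: ler_sum => a _; rewrite -mulrBl normrM (ger0_norm (bspline_ge0 _ _)).
apply: ler_wpM2r; first exact: bspline_ge0.
case: leqP => [_|nk]; first by rewrite subrr normr0 mulr_ge0 ?exprn_ge0.
by rewrite subr0 (le_trans (bC _))// ler_wpM2l// ler_wiXn2l// ltnW.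
Qed.

(** The kernel [kappa (u, .)] for [u] in the unit cell; translations by integers
    give it at every other point. *)
Definition cell_kernel (u z : R) : R :=
  \sum_(a < m.+1) N (u + a%:R) * cardinal_spline (z + a%:R).

Lemma cell_kernel_localized u : localized rho (cell_kernel u).
Proof.
apply: (@localized_sum R rho m.+1 (fun a z => N (u + a%:R) * cardinal_spline (z + a%:R))) => a.
apply: localizedZ.
by have := localized_shift rho01 a%:Z cardinal_spline_localized; rewrite -pmulrn.
Qed.

Lemma spline_kernel_cell x y :
  spline_kernel m.+1 x y = cell_kernel (frac x) (y - (Num.floor x)%:~R).
Proof.
rewrite spline_kernelE; apply: eq_bigr => a _; congr (_ * cardinal_spline _).
by rewrite intrD rmorphN/= -pmulrn; ring.
Qed.

End Kernel.

(** * A maximal inequality for sums of independent variables *)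

Section SeqExpectation.
Context {R : realType} {Q : finType}.
Variable p : Q -> R.
Implicit Types F G : seq Q -> R.

(** Expectation of a functional of [n] independent draws with weights [p]; the
    recursion on the first draw is what the maximal inequality inducts on. *)
Fixpoint seq_exp n F : R :=
  if n is n'.+1 then \sum_a p a * seq_exp n' (fun s => F (a :: s)) else F [::].

Lemma eq_seq_exp n F G : F =1 G -> seq_exp n F = seq_exp n G.
Proof. by move=> /funext ->. Qed.

Lemma seq_exp_tuple n F :
  seq_exp n F = \sum_(t : n.-tuple Q) (\prod_(a <- t) p a) * F t.
Proof.
elim: n F => [|n IH] F.
  rewrite (big_pred1 [tuple]) => [/=|t]; first by rewrite big_nil mul1r.
  by apply/esym/eqP; exact: tuple0.
rewrite /=; under eq_bigr => a _ do rewrite IH mulr_sumr.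
rewrite pair_bigA/= (reindex (fun u : Q * n.-tuple Q => [tuple of u.1 :: u.2]))/=.
  by apply: eq_bigr => -[a t] _ /=; rewrite big_cons mulrA.
exists (fun t : n.+1.-tuple Q => (thead t, [tuple of behead t])).
  by move=> [a t] _; rewrite /= theadE; congr pair; apply: val_inj.
by move=> t _; rewrite /= [RHS]tuple_eta.
Qed.

Hypothesis p0 : forall a, 0 <= p a.

Lemma le_seq_exp n F G : (forall s, size s = n -> F s <= G s) ->
  seq_exp n F <= seq_exp n G.
Proof.
elim: n F G => [|n IH] F G FG; first exact: FG.
apply: ler_sum => a _; apply: ler_wpM2l => //.
by apply: IH => s sn; apply: FG; rewrite /= sn.
Qed.

Lemma seq_expZ n c F : seq_exp n (fun s => c * F s) = c * seq_exp n F.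
Proof.
elim: n F => [//|n IH] F /=; rewrite mulr_sumr; apply: eq_bigr => a _.
by rewrite IH mulrCA.
Qed.

Lemma seq_expD n F G :
  seq_exp n (fun s => F s + G s) = seq_exp n F + seq_exp n G.
Proof.
elim: n F G => [//|n IH] F G /=; rewrite -big_split/=; apply: eq_bigr => a _.
by rewrite IH mulrDr.
Qed.

Lemma seq_exp_prod n (h : Q -> R) :
  seq_exp n (fun s => \prod_(a <- s) h a) = (\sum_a p a * h a) ^+ n.
Proof.
elim: n => [|n IH]; first by rewrite /= big_nil expr0.
rewrite /= exprS mulr_suml; apply: eq_bigr => a _.
under eq_seq_exp do rewrite big_cons.
by rewrite seq_expZ IH mulrA.
Qed.

Lemma seq_exp_cst n c : seq_exp n (fun=> c) = c * (\sum_a p a) ^+ n.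
Proof.
have -> : (fun _ : seq Q => c) = (fun s => c * \prod_(a <- s) (fun=> 1) a).
  by apply/funext => s; rewrite big1// mulr1.
rewrite seq_expZ seq_exp_prod; congr (_ * _ ^+ _).
by apply: eq_bigr => a _; rewrite mulr1.
Qed.

(** The exponential minus its affine part: nonnegative, and of second order at
    the origin. *)
Definition phi (x : R) := expR x - 1 - x.

Lemma phi_ge0 x : 0 <= phi x.
Proof. by rewrite /phi; have := expR_ge1Dx x; lra. Qed.

Lemma phi_mono x y : 0 <= x -> x <= y -> phi x <= phi y.
Proof.
move=> x0 xy; rewrite /phi -[y](subrK x) expRD.
have := expR_ge1Dx (y - x); have := expR_ge1Dx x; nra.
Qed.

(** The walk started at [x] with steps [g] reaches the level [t]. *)
Fixpoint hits (g : Q -> R) (t x : R) (s : seq Q) : bool :=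
  (t <= x) || (if s is a :: s' then hits g t (x + g a) s' else false).

Lemma hitsP g t x s :
  reflect (exists2 k, (k <= size s)%N & t <= x + \sum_(a <- take k s) g a)
    (hits g t x s).
Proof.
elim: s x => [|a s IH] x /=.
  rewrite orbF; apply: (iffP idP) => [tx|[[|k]//]].
    by exists 0%N; rewrite // big_nil addr0.
  by rewrite big_nil addr0.
apply: (iffP orP) => [[tx|/IH[k ks H]]|[[|k] ks]].
- by exists 0%N; rewrite // big_nil addr0.
- by exists k.+1; rewrite //= big_cons addrA.
- by rewrite take0 big_nil addr0; left.
- by rewrite /= big_cons addrA => H; right; apply/IH; exists k.
Qed.

(** Maximal inequality.  Compensating the exponential by its affine part makes
    the bound vanish to first order with the variance, so that it can be summed
    over arbitrarily many rare cells. *)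
Lemma maximal_seq_exp n (g : Q -> R) lam t x : \sum_a p a = 1 ->
  \sum_a p a * g a = 0 -> 0 <= lam -> 0 <= t ->
  phi (lam * t) * seq_exp n (fun s => (hits g t x s)%:R) <=
  expR (lam * x) * (\sum_a p a * expR (lam * g a)) ^+ n - 1 - lam * x.
Proof.
move=> p1 g0 l0 t0; set A := \sum_a p a * expR (lam * g a).
have A1 : 1 <= A.
  have -> : 1 = \sum_a p a * (1 + lam * g a).
    under eq_bigr do rewrite mulrDr mulr1 mulrCA.
    by rewrite big_split/= p1 -mulr_sumr g0 mulr0 addr0.
  by apply: ler_sum => a _; rewrite ler_wpM2l// expR_ge1Dx.
elim: n x => [|n IH] x /=.
  rewrite expr0 mulr1 orbF; have [tx|tx] := leP t x; last by rewrite mulr0 phi_ge0.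
  by rewrite mulr1 phi_mono ?mulr_ge0 ?ler_wpM2l.
have [tx|tx] := leP t x.
  rewrite (eq_bigr p); last by move=> a _; rewrite /= seq_exp_cst p1 expr1n !mulr1.
  rewrite p1 mulr1 (@le_trans _ _ (phi (lam * x)))//.
    by rewrite phi_mono ?mulr_ge0 ?ler_wpM2l.
  by rewrite /phi !lerB// ler_peMr ?expR_ge0// exprn_ege1.
rewrite mulr_sumr.
apply: (@le_trans _ _ (\sum_a p a * (expR (lam * (x + g a)) * A ^+ n - 1 - lam * (x + g a)))).
  by apply: ler_sum => a _; rewrite mulrCA ler_wpM2l//; exact: IH.
rewrite le_eqVlt; apply/orP; left; apply/eqP.
rewrite (eq_bigr (fun a => expR (lam * x) * A ^+ n * (p a * expR (lam * g a)) - ((1 + lam * x) * p a + lam * (p a * g a)))); last first.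
  by move=> a _; rewrite (mulrDr lam) expRD; ring.
rewrite sumrB big_split/= -!mulr_sumr -/A p1 g0 exprSr; ring.
Qed.

End SeqExpectation.

Section ExpBounds.
Context {R : realType}.

Lemma expR_cvg (y : R) : series (exp_coeff y) @ \oo --> expR y.
Proof. by rewrite /expR/=; exact: is_cvg_series_exp_coeff. Qed.

Lemma exp_coeff_le (y : R) k : `|exp_coeff y k| <= exp_coeff `|y| k.
Proof. by rewrite /exp_coeff/= normrM normrX normfV normr_nat. Qed.

Lemma series_exp_coeff_le (y : R) n : 0 <= y -> series (exp_coeff y) n <= expR y.
Proof.
move=> y0; apply: (nondecreasing_cvgn_le _ (is_cvg_series_exp_coeff y)).
by apply: nondecreasing_series => k _ _; rewrite exp_coeff_ge0.
Qed.

(** Termwise comparison of the exponential series from the second order on. *)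
Lemma phi_le (y : R) : phi y <= y ^+ 2 / 2 * expR `|y|.
Proof.
have H : (fun n => series (exp_coeff y) n.+2 - 1 - y) @ \oo --> phi y.
  apply: cvgB; last exact: cvg_cst.
  apply: cvgB; last exact: cvg_cst.
  by have := @expR_cvg y; rewrite -(cvg_shiftn 2); under eq_fun do rewrite addn2.
have {}H : (fun n => \sum_(k < n) exp_coeff y k.+2) @ \oo --> phi y.
  rewrite (_ : (fun n => \sum_(k < n) _) = (fun n => series (exp_coeff y) n.+2 - 1 - y))//.
  apply/funext => n; symmetry.
  elim: n => [|n IH].
    rewrite big_ord0 !seriesSr /series/= big_geq// /exp_coeff/= expr0 expr1.
    by rewrite fact0 factS fact0 muln1 !divr1; ring.
  by rewrite seriesSr big_ord_recr/= -IH; ring.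
rewrite -(cvg_lim _ H)//; apply: limr_le; first by apply: cvgP H.
apply: nearW => n.
apply: (@le_trans _ _ (y ^+ 2 / 2 * \sum_(k < n) exp_coeff `|y| k)); last first.
  rewrite ler_wpM2l ?divr_ge0 ?sqr_ge0//.
  by have := series_exp_coeff_le n (normr_ge0 y); rewrite seriesEord.
rewrite mulr_sumr; apply: ler_sum => k _.
rewrite (le_trans (ler_norm _))// (le_trans (exp_coeff_le _ _))//.
rewrite /exp_coeff/= -[y ^+ 2]real_normK ?num_real// mulf_div -exprD add2n.
rewrite ler_wpM2l ?exprn_ge0// lef_pV2 ?posrE ?mulr_gt0 ?ltr0n ?fact_gt0//.
rewrite -natrM ler_nat !factS mulnA leq_pmul2r ?fact_gt0//.
exact: (@leq_mul 2 1).
Qed.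

End ExpBounds.

Section Sample.
Context {R : realType} {d : measure_display} {T : measurableType d}.
Variables (Pr : probability T R) (X : nat -> {RV Pr >-> R}) (P : probability R R).
Hypothesis iid : iid_with_law X P.

Section FiniteValued.
Context {Q : finType}.
Variable q : R -> Q.
Hypothesis mq : forall a, measurable (q @^-1` [set a]).

Definition weight (a : Q) : R := fine (P (q @^-1` [set a])).

Definition draws n w := [seq q (X i w) | i <- iota 0 n].

Lemma size_draws n w : size (draws n w) = n.
Proof. by rewrite size_map size_iota. Qed.

Lemma weight_ge0 a : 0 <= weight a.
Proof. by rewrite /weight fine_ge0. Qed.

Lemma EFin_weight a : (weight a)%:E = P (q @^-1` [set a]).
Proof. by rewrite fineK// fin_num_measure. Qed.

(** Independence turns the probability of a prescribed sequence of draws into a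
    product. *)
Lemma draws_event n (t : seq Q) : size t = n ->
  measurable [set w | draws n w = t] /\
  Pr [set w | draws n w = t] = (\prod_(a <- t) weight a)%:E.
Proof.
move=> tn; have [ind law] := iid.
case: (posnP n) => [n0|n0].
  rewrite n0 in tn *; have -> : t = [::] by apply: size0nil.
  have -> : [set w | draws 0 w = [::]] = setT by apply/seteqP; split.
  by rewrite big_nil probability_setT; split.
have [a0 _] : exists a0 : Q, True by case: t tn => [|a t] tn; [rewrite -tn in n0|exists a].
pose J := seq_fset tt (iota 0 n).
pose B i := q @^-1` [set nth a0 t i].
have E : [set w | draws n w = t] = \bigcap_(i in [set` J]) (X i @^-1` B i).
  apply/seteqP; split => w /=.
    move=> dt i /=; rewrite seq_fsetE mem_iota add0n => /andP[_ i_n].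
    by rewrite /B/= -dt (nth_map 0%N) ?size_iota// nth_iota.
  move=> H; apply: (@eq_from_nth _ a0); rewrite size_draws// => i i_n.
  rewrite (nth_map 0%N) ?size_iota// nth_iota//.
  by apply: H => /=; rewrite seq_fsetE mem_iota.
split.
  rewrite E; apply: fin_bigcap_measurable; first exact: finite_fset.
  move=> i _; rewrite -[X in measurable X]setTI.
  exact: (measurable_funPT (X i) measurableT _ (mq _)).
rewrite E ind; last by move=> i; exact: mq.
rewrite (perm_big (iota 0 n)); last first.
  apply: uniq_perm; rewrite ?iota_uniq ?fset_uniq// => i.
  by rewrite seq_fsetE.
rewrite (eq_bigr (fun i => (weight (nth a0 t i))%:E)); last first.
  move=> i _; rewrite EFin_weight -(law i)//.
by rewrite prodEFin -[in RHS](mkseq_nth a0 t) tn big_map.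
Qed.

Lemma integral_draws n (F : seq Q -> R) : (forall s, 0 <= F s) ->
  measurable_fun setT (fun w => F (draws n w)) /\
  (\int[Pr]_w (F (draws n w))%:E)%E = (seq_exp weight n F)%:E.
Proof.
move=> F0.
pose E (t : n.-tuple Q) := [set w | draws n w = t].
have mE t : measurable (E t) by have [] := @draws_event n t (size_tuple t).
have FE : (fun w => F (draws n w)) = (fun w => \sum_(t : n.-tuple Q) F t * \1_(E t) w).
  apply/funext => w.
  have sd : size (draws n w) == n by rewrite size_draws.
  rewrite (bigD1 (Tuple sd))//= indicE mem_set// mulr1 big1 ?addr0// => t.
  move=> td; rewrite indicE memNset ?mulr0//= => H; move: td; apply/negP/negPn/eqP.
  by apply: val_inj.
have mind t : measurable_fun setT (fun w => F (t : n.-tuple Q) * \1_(E t) w).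
  by apply: measurable_funM => //; exact: measurable_indic.
split; first by rewrite FE; apply: measurable_sum => t; exact: mind.
under eq_integral do rewrite (congr1 (fun h => h _) FE) -sumEFin.
rewrite ge0_integral_sum//; last 2 first.
- by move=> t; apply/measurable_EFinP; exact: mind.
- by move=> t w _; rewrite lee_fin mulr_ge0.
rewrite seq_exp_tuple -sumEFin; apply: eq_bigr => t _.
under eq_integral do rewrite EFinM.
rewrite ge0_integralZl//; last 2 first.
- by apply/measurable_EFinP; exact: measurable_indic.
- by rewrite lee_fin.
rewrite integral_indic// setIT EFinM muleC; congr (_ * _)%E.
by have [] := @draws_event n t (size_tuple t).
Qed.

Lemma Pr_draws n (A : pred (seq Q)) :
  measurable [set w | A (draws n w)] /\
  Pr [set w | A (draws n w)] = (seq_exp weight n (fun s => (A s)%:R))%:E.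
Proof.
have [mF <-] := integral_draws n (fun s => ler0n R (A s)).
have mA : measurable [set w | A (draws n w)].
  have -> : [set w | A (draws n w)] = setT `&` (fun w => (A (draws n w))%:R : R) @^-1` [set 1].
    apply/seteqP; split => w /=; first by move=> ->.
    by case: (A _) => //= -[_ /eqP]; rewrite eq_sym oner_eq0.
  exact: mF.
split => //; rewrite -[X in Pr X]setIT -integral_indic//.
apply: eq_integral => w _; rewrite indicE; congr (_%:R)%:E.
by case: (boolP (A _)) => Aw; [rewrite mem_set|rewrite memNset//; apply/negP].
Qed.

Lemma Rintegral_finite (h : Q -> R) :
  \int[P]_x h (q x) = \sum_a weight a * h a.
Proof.
have -> : (fun x => h (q x)) = (fun x => \sum_a h a * \1_(q @^-1` [set a]) x).
  apply/funext => x; rewrite (bigD1 (q x))//= indicE mem_set// mulr1 big1 ?addr0// => a.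
  by move=> ax; rewrite indicE memNset ?mulr0//= => H; rewrite H eqxx in ax.
have fP : (P setT < +oo)%E by rewrite probability_setT ltry.
rewrite Rintegral_bmf_sum//; last first.
  by move=> a; apply: bmfZ; exact: bmf_indic.
apply: eq_bigr => a _; rewrite Rintegral_bmfZ//; last exact: bmf_indic.
by rewrite mulrC /Rintegral integral_indic// setIT.
Qed.

Lemma bmf_finite (h : Q -> R) : bmf (fun x => h (q x)).
Proof.
have -> : (fun x => h (q x)) = (fun x => \sum_a h a * \1_(q @^-1` [set a]) x).
  apply/funext => x; rewrite (bigD1 (q x))//= indicE mem_set// mulr1 big1 ?addr0// => a.
  by move=> ax; rewrite indicE memNset ?mulr0//= => H; rewrite H eqxx in ax.
by apply: bmf_sum => a; apply: bmfZ; exact: bmf_indic.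
Qed.

Lemma sum_weight : \sum_a weight a = 1.
Proof.
have <- : \int[P]_x (1 : R) = 1 :> R.
  rewrite Rintegral_cst// mul1r; transitivity (fine (1%:E : \bar R)) => //.
  by congr fine; exact: probability_setT.
by rewrite (Rintegral_finite (fun=> 1)); apply: eq_bigr => a _; rewrite mulr1.
Qed.

End FiniteValued.

Local Notation EP f := (\int[P]_x f x).

Let finP : (P setT < +oo)%E. Proof. by rewrite probability_setT ltry. Qed.

Lemma EP_cst (c : R) : EP (fun=> c) = c.
Proof.
rewrite Rintegral_cst// -[RHS]mulr1; congr (_ * _).
transitivity (fine (1%:E : \bar R)) => //.
by congr fine; exact: probability_setT.
Qed.

Lemma EP_norm_le (f : R -> R) K : bmf f -> (forall x, `|f x| <= K) -> `|EP f| <= K.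
Proof.
move=> bf fK; rewrite (le_trans (normr_Rintegral_le _ finP bf (fun x _ => fK x)))//.
have -> : fine (P setT) = 1.
  by transitivity (fine (1%:E : \bar R)) => //; congr fine; exact: probability_setT.
by rewrite mulr1.
Qed.

(** A bounded measurable function is uniformly close to a simple function, so
    that sums over the sample reduce to sums over draws from a finite set. *)
Lemma exists_discretization (f : R -> R) (K del : R) : 0 < del ->
  measurable_fun [set: R] f -> (forall x, `|f x| <= K) ->
  exists (M : nat) (q : R -> 'I_M.+1) (v : 'I_M.+1 -> R),
    (forall a, measurable (q @^-1` [set a])) /\
    forall x, `|f x - v (q x)| <= del.
Proof.
move=> d0 mf fK; pose M := Num.truncn (2 * K / del).
have fK0 x : 0 <= f x + K /\ f x + K <= 2 * K.
  by have := fK x; rewrite ler_norml; lra.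
pose idx x := Num.truncn ((f x + K) / del).
have idxP x : (idx x)%:R <= (f x + K) / del < (idx x).+1%:R.
  by apply: truncn_itv; rewrite divr_ge0//; [case: (fK0 x)|exact: ltW].
have idxM x : (idx x < M.+1)%N.
  rewrite ltnS; apply: le_truncn; rewrite ler_pM2r ?invr_gt0//; by case: (fK0 x).
exists M, (fun x => inord (idx x)), (fun a => del * a%:R - K); split.
  move=> a.
  have -> : (fun x => inord (idx x) : 'I_M.+1) @^-1` [set a] =
      setT `&` f @^-1` `[del * a%:R - K, del * a.+1%:R - K[.
    apply/seteqP; split => x /=; rewrite in_itv/=.
      move=> <-; rewrite inordK//; split => //; have := idxP x.
      by rewrite ler_pdivlMr// ltr_pdivrMr// -natr1; lra.
    move=> [_ H]; apply: val_inj; rewrite /= inordK//; apply: truncn_def.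
    by rewrite ler_pdivlMr// ltr_pdivrMr//; lra.
  by apply: mf => //; exact: measurable_itv.
move=> x; rewrite inordK//; have := idxP x.
rewrite ler_pdivlMr// ltr_pdivrMr// -natr1 ler_norml; nra.
Qed.

Definition devsum (f : R -> R) n w := \sum_(i < n) (f (X i w) - EP f).

Lemma measurable_devsum f n : measurable_fun setT f ->
  measurable_fun setT (devsum f n).
Proof.
move=> mf; apply: measurable_sum => i; apply: measurable_funB => //.
by apply: (measurableT_comp mf); exact: measurable_funPT (X i).
Qed.

Definition max_event (f : R -> R) N t := [set w | exists2 n, (n <= N)%N & t <= devsum f n w].

Lemma measurable_max_event f N t : measurable_fun setT f ->
  measurable (max_event f N t).
Proof.
move=> mf.
have -> : max_event f N t = \bigcup_(n in `I_N.+1) (setT `&` devsum f n @^-1` `[t, +oo[).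
  apply/seteqP; split => w /=.
    by move=> [n nN H]; exists n => //=; rewrite in_itv/= H.
  by move=> [n /= nN [_]]; rewrite in_itv/= andbT => H; exists n.
by apply: bigcup_measurable => n _; apply: measurable_devsum.
Qed.

(** The centring survives the discretization: the values [g] have mean zero for
    the weights, at the cost of doubling the error. *)
Lemma discretized_draws (f : R -> R) (K del : R) : 0 < del -> measurable_fun [set: R] f ->
  (forall x, `|f x| <= K) ->
  exists (M : nat) (q : R -> 'I_M.+1) (g : 'I_M.+1 -> R),
    [/\ forall a, measurable (q @^-1` [set a]),
        \sum_a weight q a * g a = 0 &
        forall x, `|(f x - EP f) - g (q x)| <= 2 * del].
Proof.
move=> d0 mf fK; have [M [q [v [mq fv]]]] := exists_discretization d0 mf fK.
have bf : bmf f by split => //; exists K.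
have bv : bmf (fun x => v (q x)) by exact: bmf_finite.
pose c := \sum_a weight q a * v a; exists M, q, (fun a => v a - c); split => //.
  under eq_bigr do rewrite mulrBr.
  by rewrite sumrB -mulr_suml sum_weight// mul1r subrr.
move=> x.
have fc : `|EP f - c| <= del.
  rewrite /c -(Rintegral_finite mq) -Rintegral_bmfB//; apply: EP_norm_le => //.
  exact: bmfB.
have -> : f x - EP f - (v (q x) - c) = (f x - v (q x)) - (EP f - c) by ring.
by rewrite (le_trans (ler_normB _ _))//; have := fv x; lra.
Qed.

Lemma draws_sum n (M : nat) (q : R -> 'I_M.+1) (g : 'I_M.+1 -> R) (del : R) f k w :
  (k <= n)%N -> (forall x, `|(f x - EP f) - g (q x)| <= del) ->
  `|devsum f k w - \sum_(a <- take k (draws q n w)) g a| <= k%:R * del.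
Proof.
move=> kn H; rewrite /draws -map_take take_iota (minn_idPl kn) big_map.
have -> : iota 0 k = index_iota 0 k by rewrite /index_iota subn0.
rewrite big_mkord /devsum -sumrB (le_trans (ler_norm_sum _ _ _))//.
rewrite (le_trans (_ : _ <= \sum_(i < k) del))//.
  by apply: ler_sum => i _; exact: H.
by rewrite sumr_const card_ord -[leLHS]mulr_natl.
Qed.

Definition mgf (f : R -> R) (lam : R) := EP (fun x => expR (lam * (f x - EP f))).

Lemma bmf_center (f : R -> R) : bmf f -> bmf (fun x => f x - EP f).
Proof. by move=> bf; apply: bmfB => //; exact: bmf_cst. Qed.

Lemma bmf_expR (f : R -> R) : bmf f -> bmf (fun x => expR (f x)).
Proof.
move=> [mf [M fM]]; split; first exact: measurableT_comp.
exists (expR M) => x; rewrite ger0_norm ?expR_ge0// ler_expR.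
by rewrite (le_trans (ler_norm _)).
Qed.

Lemma le_EP (f g : R -> R) : bmf f -> bmf g -> (forall x, f x <= g x) -> EP f <= EP g.
Proof. by move=> bf bg fg; apply: (le_Rintegral_bmf measurableT finP). Qed.

Lemma discretized_mgf (M : nat) (q : R -> 'I_M.+1) (g : 'I_M.+1 -> R) (e lam : R) (f : R -> R) :
  bmf f -> (forall a, measurable (q @^-1` [set a])) -> 0 <= lam ->
  (forall x, `|(f x - EP f) - g (q x)| <= e) ->
  \sum_a weight q a * expR (lam * g a) <= expR (lam * e) * mgf f lam.
Proof.
move=> bf mq l0 H; rewrite -(Rintegral_finite mq).
have b1 : bmf (fun x => expR (lam * (f x - EP f))).
  by apply: bmf_expR; apply: bmfZ; exact: bmf_center.
rewrite /mgf -Rintegral_bmfZ//; apply: le_EP.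
- by exact: (bmf_finite mq (fun a => expR (lam * g a))).
- exact: bmfZ.
- move=> x; rewrite -expRD ler_expR -mulrDr ler_wpM2l//.
  by have := H x; rewrite ler_norml; lra.
Qed.

(** The discretization step tends to zero. *)
Lemma limit_ineq (A B : R) N (lam t p : R) : 0 < t -> 0 <= A ->
  (forall e, 0 < e -> e * N%:R <= t ->
    phi (lam * (t - e * N%:R)) * p <= (expR (lam * e) * A) ^+ N - B) ->
  phi (lam * t) * p <= A ^+ N - B.
Proof.
move=> t0 A0 H.
pose e k : R := t / N.+1%:R * k.+1%:R^-1.
have N0 : 0 < N.+1%:R :> R by rewrite ltr0n.
have e0 k : 0 < e k by rewrite /e mulr_gt0 ?divr_gt0// invr_gt0 ltr0n.
have eN k : e k * N%:R <= t.
  have : k.+1%:R^-1 <= 1 :> R by rewrite invf_le1 ?ler1n ?ltr0n.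
  have : 0 <= k.+1%:R^-1 :> R by rewrite invr_ge0 ler0n.
  have : N%:R / N.+1%:R <= 1 :> R by rewrite ler_pdivrMr// mul1r ler_nat.
  have : 0 <= N%:R / N.+1%:R :> R by rewrite divr_ge0 ?ler0n.
  rewrite /e; set x := k.+1%:R^-1; have -> : t / N.+1%:R * x * N%:R = t * (N%:R / N.+1%:R * x) by ring.
  by move=> y0 y1 x0 x1; rewrite ler_piMr ?(ltW t0)// mulr_ile1.
have ce : e @ \oo --> 0.
  by rewrite -[X in _ --> X](mulr0 (t / N.+1%:R)); apply: cvgMr; exact: cvg_harmonic.
have cexp (c : R) : (fun k => expR (c * e k)) @ \oo --> (1 : R).
  rewrite -[X in _ --> X](@expR0 R) -(mulr0 c).
  by apply: continuous_cvg; [exact: continuous_expR|exact: cvgMr].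
have H1 k : phi (lam * (t - e k * N%:R)) * p <= expR (lam * N%:R * e k) * A ^+ N - B.
  have := H _ (e0 k) (eN k); rewrite exprMn -expRM_natl.
  by have -> : N%:R * (lam * e k) = lam * N%:R * e k by ring.
have c1 : (fun k => expR (lam * N%:R * e k) * A ^+ N - B) @ \oo --> A ^+ N - B.
  apply: cvgB; last exact: cvg_cst.
  by rewrite -[X in _ --> X]mul1r; apply: cvgMl; exact: cexp.
have ct : (fun k => lam * (t - e k * N%:R)) @ \oo --> lam * t.
  rewrite -[X in _ --> lam * X]subr0 -[X in _ --> lam * (_ - X)](mul0r N%:R).
  by apply: cvgMr; apply: cvgB; [exact: cvg_cst|exact: cvgMl].
have c2 : (fun k => phi (lam * (t - e k * N%:R)) * p) @ \oo --> phi (lam * t) * p.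
  apply: cvgMl; apply: cvgB => //; apply: cvgB; last exact: cvg_cst.
  by apply: continuous_cvg => //; exact: continuous_expR.
by apply: ler_cvg_to c2 c1 _; apply: nearW => k; exact: H1.
Qed.

Lemma maximal_tail (f : R -> R) N (lam t : R) : bmf f -> 0 <= lam -> 0 < t ->
  phi (lam * t) * fine (Pr (max_event f N t)) <= mgf f lam ^+ N - 1.
Proof.
move=> bf l0 t0; have [mf [K fK]] := bf.
have m0 : 0 <= mgf f lam.
  by apply: Rintegral_ge0 => x _; exact: expR_ge0.
apply: limit_ineq => // e e0 eN.
have e20 : 0 < e / 2 by rewrite divr_gt0.
have [M [q [g [mq g0 qg]]]] := discretized_draws e20 mf fK.
rewrite mulrC divfK ?pnatr_eq0// in qg.
have w0 := weight_ge0 q; have w1 := sum_weight mq.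
have te0 : 0 <= t - e * N%:R by rewrite subr_ge0.
have [mE PE] := Pr_draws mq N (hits g (t - e * N%:R) 0).
have sub : max_event f N t `<=` [set w | hits g (t - e * N%:R) 0 (draws q N w)].
  move=> w [k kN tk]; apply/hitsP; exists k; rewrite ?size_draws// add0r.
  have := draws_sum w kN qg.
  have : k%:R * e <= e * N%:R by rewrite mulrC ler_wpM2l ?(ltW e0)// ler_nat.
  by rewrite ler_norml; lra.
have PrE : fine (Pr (max_event f N t)) <= seq_exp (weight q) N (fun s => (hits g (t - e * N%:R) 0 s)%:R).
  rewrite -lee_fin -PE fineK ?fin_num_measure//; last exact: measurable_max_event.
  by apply: le_measure => //; rewrite inE//; exact: measurable_max_event.
apply: le_trans (ler_wpM2l (phi_ge0 _) PrE) _.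
apply: le_trans (maximal_seq_exp w0 N _ w1 g0 l0 te0) _.
rewrite mulr0 expR0 mul1r subr0 lerB// lerXn2r// ?nnegrE.
- by apply: sumr_ge0 => a _; rewrite mulr_ge0// expR_ge0.
- by rewrite mulr_ge0// expR_ge0.
- exact: discretized_mgf.
Qed.

(** The variance enters linearly in the exponent, and the boundedness of [f] only
    through a factor tending to one with [lam]. *)
Lemma mgf_le (f : R -> R) (K v lam : R) : bmf f -> (forall x, `|f x| <= K) ->
  EP (fun x : R => f x ^+ 2) <= v -> 0 <= lam ->
  1 <= mgf f lam /\
  mgf f lam <= expR (lam ^+ 2 / 2 * expR (2 * K * lam) * v).
Proof.
move=> bf fK fv l0; have bc := bmf_center bf.
have E0 : EP (fun x => f x - EP f) = 0.
  by rewrite Rintegral_bmfB ?EP_cst ?subrr//; exact: bmf_cst.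
have bl : bmf (fun x => lam * (f x - EP f)) by exact: bmfZ.
have be : bmf (fun x => expR (lam * (f x - EP f))) by exact: bmf_expR.
have bc2 : bmf (fun x => (f x - EP f) ^+ 2) by exact: bmfX.
have bf2 : bmf (fun x => f x ^+ 2) by exact: bmfX.
have b1l : bmf (fun x => 1 + lam * (f x - EP f)) by apply: bmfD => //; exact: bmf_cst.
have E1 : EP (fun x => 1 + lam * (f x - EP f)) = 1.
  rewrite (Rintegral_bmfD _ finP (bmf_cst 1) bl)// EP_cst.
  by rewrite (Rintegral_bmfZ _ finP _ bc)// E0 mulr0 addr0.
split.
  rewrite -[leLHS]E1; apply: le_EP => // x; exact: expR_ge1Dx.
have var : EP (fun x => (f x - EP f) ^+ 2) <= v.
  apply: le_trans fv.
  have -> : (fun x => (f x - EP f) ^+ 2) = (fun x => f x ^+ 2 - (2 * EP f * f x - EP f ^+ 2)).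
    by apply/funext => x; ring.
  have b2 : bmf (fun x => 2 * EP f * f x) by exact: bmfZ.
  have b3 : bmf (fun x => 2 * EP f * f x - EP f ^+ 2) by exact: (bmfB b2 (bmf_cst _)).
  rewrite (Rintegral_bmfB measurableT finP bf2 b3).
  rewrite (Rintegral_bmfB _ finP b2 (bmf_cst _))// EP_cst.
  rewrite (Rintegral_bmfZ _ finP _ bf)// gerBl.
  by have -> : 2 * EP f * EP f - EP f ^+ 2 = EP f ^+ 2 by [ring]; rewrite sqr_ge0.
pose c := lam ^+ 2 / 2 * expR (2 * K * lam).
have c0 : 0 <= c by rewrite /c mulr_ge0 ?expR_ge0// divr_ge0 ?sqr_ge0.
apply: (@le_trans _ _ (EP (fun x => (1 + lam * (f x - EP f)) + c * (f x - EP f) ^+ 2))).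
  apply: le_EP => //; first by apply: bmfD => //; exact: bmfZ.
  move=> x; have := phi_le (lam * (f x - EP f)); rewrite /phi.
  have : (lam * (f x - EP f)) ^+ 2 / 2 * expR `|lam * (f x - EP f)| <= c * (f x - EP f) ^+ 2.
    move: (fK x) (EP_norm_le bf fK); rewrite /c; move: (f x) (EP f) => y z yK zK.
    have -> : (lam * (y - z)) ^+ 2 / 2 * expR `|lam * (y - z)| =
      lam ^+ 2 / 2 * (expR `|lam * (y - z)| * (y - z) ^+ 2) by ring.
    rewrite -[leRHS]mulrA ler_wpM2l ?divr_ge0 ?sqr_ge0// ler_wpM2r ?sqr_ge0//.
    rewrite ler_expR normrM (ger0_norm l0) mulrC ler_wpM2r//.
    by rewrite (le_trans (ler_normB _ _))//; lra.
  lra.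
rewrite (Rintegral_bmfD measurableT finP b1l (bmfZ c bc2)).
rewrite E1 (Rintegral_bmfZ _ finP _ bc2)//.
apply: le_trans (expR_ge1Dx _); rewrite lerD2l ler_wpM2l//.
Qed.

Lemma EP_opp (f : R -> R) : bmf f -> EP (fun x => - f x) = - EP f.
Proof.
move=> bf; have := Rintegral_bmfZ measurableT finP (-1) bf.
by rewrite mulN1r => <-; apply: eq_Rintegral => x _; rewrite mulN1r.
Qed.

Lemma devsumN (f : R -> R) n w : bmf f -> devsum (fun x => - f x) n w = - devsum f n w.
Proof.
move=> bf; rewrite /devsum -sumrN; apply: eq_bigr => i _.
by rewrite EP_opp// opprK opprB addrC.
Qed.

Definition abs_max_event (f : R -> R) N t :=
  [set w | exists2 n, (n <= N)%N & t <= `|devsum f n w|].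

(** Bernstein-type bound for the maximum over all sample sizes up to [N]. *)
Lemma abs_maximal_tail (f : R -> R) (K v : R) N (lam t : R) : bmf f -> (forall x, `|f x| <= K) ->
  EP (fun x : R => f x ^+ 2) <= v -> 0 < lam -> 0 < t ->
  measurable (abs_max_event f N t) /\
  (Pr (abs_max_event f N t) <=
   (2 * (expR (lam ^+ 2 / 2 * expR (2 * K * lam) * (N%:R * v)) - 1) / phi (lam * t))%:E)%E.
Proof.
move=> bf fK fv l0 t0.
have bN : bmf (fun x => - f x) by exact: bmfN.
have E : abs_max_event f N t = max_event f N t `|` max_event (fun x => - f x) N t.
  apply/seteqP; split => w.
    move=> [n nN]; rewrite ler_normr => /orP[H|H]; [left|right]; exists n => //.
    by rewrite devsumN.
  move=> [[n nN H]|[n nN H]]; exists n => //; first by rewrite (le_trans H)// ler_norm.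
  by rewrite devsumN// in H; rewrite (le_trans H)// ler_normr lexx orbT.
have mm g : bmf g -> measurable (max_event g N t).
  by move=> [mg _]; exact: measurable_max_event.
rewrite E; split; first by apply: measurableU; exact: mm.
apply: (le_trans (measureU2 _ (mm _ bf) (mm _ bN))).
have lt0 : 0 < lam * t by rewrite mulr_gt0.
have phi0 : 0 < phi (lam * t) by rewrite /phi; have := expR_gt1Dx (lt0r_neq0 lt0); lra.
have one g : bmf g -> (forall x, `|g x| <= K) -> EP (fun x => g x ^+ 2) <= v ->
    (Pr (max_event g N t) <= ((expR (lam ^+ 2 / 2 * expR (2 * K * lam) * (N%:R * v)) - 1) / phi (lam * t))%:E)%E.
  move=> bg gK gv; rewrite -[X in (X <= _)%E]fineK ?fin_num_measure//; last exact: mm.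
  rewrite lee_fin ler_pdivlMr// mulrC (le_trans (maximal_tail N bg (ltW l0) t0))//.
  have [m1 m2] := mgf_le bg gK gv (ltW l0).
  rewrite lerB//; set c := lam ^+ 2 / 2 * _ in m2 *.
  have -> : c * (N%:R * v) = N%:R * (c * v) by ring.
  rewrite expRM_natl.
  rewrite lerXn2r// ?nnegrE ?expR_ge0//; first by rewrite (le_trans ler01).
rewrite -mulrA mulrDl mul1r EFinD leeD ?one//.
- by move=> x; rewrite normrN.
- by under eq_Rintegral do rewrite sqrrN.
Qed.

End Sample.

(** * Cell sums at one level *)

Ltac nonneg := repeat first
  [ done | assumption | apply: ltW; assumption | exact: ler0n | exact: ler01
  | exact: expR_ge0 | exact: sqr_ge0 | exact: sqrtr_ge0 | exact: normr_ge0
  | apply: mulr_ge0 | apply: divr_ge0 | rewrite invr_ge0 | apply: addr_ge0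
  | apply: exprn_ge0 | exact: powR_ge0 ].

Section CountableUnion.
Context {R : realType} {d : measure_display} {T : measurableType d}.
Variable mu : {measure set T -> \bar R}.

Lemma nneseries_le (u : nat -> \bar R) (v : nat -> R) (M : R) :
  (forall i, 0 <= u i)%E -> (forall i, u i <= (v i)%:E)%E ->
  (forall n, \sum_(i < n) v i <= M) -> (\sum_(i <oo) u i <= M%:E)%E.
Proof.
move=> u0 uv vM; apply: lime_le; first by apply: is_cvg_nneseries => i _ _.
apply: nearW => n; rewrite big_mkord (@le_trans _ _ (\sum_(i < n) (v i)%:E)%E)//.
  by apply: lee_sum => i _.
by rewrite sumEFin lee_fin.
Qed.

Lemma measure_bigcup_le (F : nat -> set T) (v : nat -> R) (M : R) :
  (forall i, measurable (F i)) -> (forall i, (mu (F i) <= (v i)%:E)%E) ->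
  (forall n, \sum_(i < n) v i <= M) -> (mu (\bigcup_i F i) <= M%:E)%E.
Proof.
move=> mF Fv vM; apply: le_trans (nneseries_le _ Fv vM) => //.
by apply: measure_sigma_subadditive => //; exact: bigcup_measurable.
Qed.

End CountableUnion.

Section LebesgueLine.
Context {R : realType}.

Let idm : measurable_fun setT (idfun : measurableTypeR R -> R).
Proof. exact: measurable_id. Qed.

(** Lebesgue measure carried by the measurable structure on [R] on which laws
    of real random variables live. *)
Definition lebesgue_line : {measure set R -> \bar R} :=
  measure_function_pushforward__canonical__measure_function_Measure
    (@lebesgue_measure R) idm.

Lemma integral_lebesgue_line (f : R -> \bar R) :
  measurable_fun setT f -> (forall x, 0 <= f x)%E ->
  (\int[lebesgue_line]_x f x = \int[lebesgue_measure]_x f x)%E.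
Proof.
by move=> mf f0; rewrite [LHS](@ge0_integral_pushforward _ _ _ _ _ _ idm).
Qed.

End LebesgueLine.

Section Density.
Context {R : realType}.
Local Notation mu := (@lebesgue_measure R).
Variables (P : probability R R) (p0 : R -> R).
Hypothesis dens : has_bounded_density P p0.
Local Notation M0 := (density_norm p0).

Let mp0 : measurable_fun setT p0. Proof. by case: dens. Qed.
Let p00 x : 0 <= p0 x. Proof. by case: dens. Qed.
Let Pp0 A : measurable A -> P A = (\int[mu]_(x in A) (p0 x)%:E)%E.
Proof. by case: dens => _ _ _; apply. Qed.

Let esup := ess_sup mu (abse \o (EFin \o p0)).

Let muT : (0 < mu [set: R])%E.
Proof.
apply: (@lt_le_trans _ _ (mu `]0, 1])).
  by rewrite itvoc_mu// subr0 lte_fin.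
by apply: le_measure; rewrite ?inE.
Qed.

Let esupE : ('N[mu]_+oo[EFin \o p0])%E = esup.
Proof. by rewrite unlock muT. Qed.

Let esup_ge0 : (0 <= esup)%E.
Proof. by apply: ess_sup_gee => //; apply: aeW => x /=; rewrite lee_fin. Qed.

Let esup_fin : esup = M0%:E.
Proof.
rewrite /density_norm esupE fineK// ge0_fin_numE//.
case: dens => _ _ [M pM] _; apply: (@le_lt_trans _ _ M%:E); last exact: ltry.
apply/ess_supP; apply: aeW => x /=.
by rewrite lee_fin ger0_norm.
Qed.

Lemma density_norm_ge0 : 0 <= M0.
Proof. by rewrite -lee_fin -esup_fin. Qed.

Lemma density_norm_ae : {ae mu, forall x, p0 x <= M0}.
Proof.
have := ess_sup_ge mu (abse \o (EFin \o p0)); apply: filterS => x.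
by rewrite -/esup esup_fin /= lee_fin ger0_norm.
Qed.

Lemma density_measure_le A : measurable A -> (P A <= M0%:E * mu A)%E.
Proof.
move=> mA; rewrite Pp0//.
have -> : (M0%:E * mu A = \int[mu]_(x in A) M0%:E)%E by rewrite integral_cst.
apply: ae_ge0_le_integral => //.
- by move=> x _; rewrite lee_fin.
- by apply/measurable_EFinP; exact: measurable_funTS.
- by move=> x _; rewrite lee_fin density_norm_ge0.
- have [N [mN N0 sub]] := density_norm_ae; exists N; split => // x /= H.
  by apply: sub => /= h; apply: H => _; rewrite lee_fin.
Qed.

Lemma density_gt_measure c : c < M0 -> (0 < mu [set x | (c < p0 x)%R])%E.
Proof.
move=> cM; rewrite lt_neqAle measure_ge0 andbT eq_sym; apply/eqP => H.
have : (esup <= (Order.max c 0)%:E)%E.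
  apply/ess_supP; exists [set x | c < p0 x]; split => //.
    rewrite -[X in measurable X]setTI -preimage_itvoy; apply: mp0 => //.
  move=> x /=; apply: contra_notP => /negP; rewrite -leNgt lee_fin ger0_norm// le_max => ->.
  by [].
rewrite esup_fin lee_fin le_max leNgt cM/= => M00.
have PT := density_measure_le measurableT.
have M0E : M0 = 0 by apply/eqP; rewrite eq_le M00 density_norm_ge0.
by move: PT; rewrite M0E mul0e [X in (X <= _)%E]probability_setT lee_fin ler10.
Qed.

Local Notation EP f := (\int[P]_x f x).

Let finP : (P setT < +oo)%E. Proof. by rewrite probability_setT ltry. Qed.

Lemma bmf_rescale (g : R -> R) (a b : R) : bmf g -> bmf (fun x : R => g (a * x - b)).
Proof.
move=> [mg [M gM]]; split; last by exists M.
by apply: (measurableT_comp mg); exact: affine_measurable.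
Qed.

(** At resolution [a] the rescaled law is dominated by Lebesgue measure with
    constant [M0 / a]. *)
Lemma EP_rescale_le (g : R -> R) (a b s : R) : 0 < a -> bmf g -> (forall x, 0 <= g x) ->
  (\int[mu]_x (g x)%:E <= s%:E)%E -> EP (fun x => g (a * x - b)) <= M0 / a * s.
Proof.
move=> a0 bg g0 gs; have bg' := bmf_rescale a b bg.
rewrite -lee_fin EFin_Rintegral_bmf//.
pose f : R -> \bar R := fun x => (g (a * x - b))%:E.
have mf : measurable_fun setT f by apply/measurable_EFinP; case: bg'.
have f0 x : (0 <= f x)%E by rewrite lee_fin.
pose nu := mscale (NngNum density_norm_ge0) lebesgue_line.
have H : (\int[P]_x f x <= \int[nu]_x f x)%E.
  apply: ge0_le_measure_integral => // S mS; exact: density_measure_le.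
apply: (le_trans H).
rewrite ge0_integral_mscale// integral_lebesgue_line//.
have mg : measurable_fun setT (fun x => (g x)%:E) by apply/measurable_EFinP; case: bg.
rewrite /f (@ge0_integral_affine R a (- b) (fun x => (g x)%:E))//.
rewrite /= muleA -EFinM [leRHS]EFinM lee_wpmul2l// lee_fin.
by apply: divr_ge0; [exact: density_norm_ge0 | exact: ltW].
Qed.

End Density.

Section Upper.
Context {R : realType} {d : measure_display} {T : measurableType d}.
Variables (Pr : probability T R) (X : nat -> {RV Pr >-> R}) (P : probability R R).
Hypothesis iid : iid_with_law X P.
Local Notation mu := (@lebesgue_measure R).
Variable p0 : R -> R.
Hypothesis dens : has_bounded_density P p0.
Local Notation M0 := (density_norm p0).
Local Notation EP f := (\int[P]_x f x).

Definition cell_fun (g : R -> R) (j : nat) (k : int) : R -> R :=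
  fun x => g (2 ^+ j * x - k%:~R).

Section OneFunction.
Variables (g : R -> R) (K s B : R) (e : nat -> int).
Hypotheses (bg : bmf g) (gK : forall x, `|g x| <= K) (s0 : 0 <= s) (B0 : 0 <= B).
Hypothesis gs : (\int[mu]_x (g x ^+ 2)%:E <= s%:E)%E.
Hypothesis gB : forall (l : seq int) z, uniq l -> \sum_(k <- l) g (z - k%:~R) ^+ 2 <= B.
Hypothesis einj : injective e.

Let K0 : 0 <= K. Proof. by rewrite (le_trans _ (gK 0)). Qed.

Lemma bmf_cell j k : bmf (cell_fun g j k).
Proof. exact: bmf_rescale. Qed.

(** A cell at level [j] has variance of order [2 ^ (- j)]. *)
Lemma EP_cell_le j k : EP (fun x => cell_fun g j k x ^+ 2) <= M0 / 2 ^+ j * s.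
Proof.
have a0 : 0 < 2 ^+ j :> R by rewrite exprn_gt0.
exact: (EP_rescale_le dens k%:~R a0 (bmfX 2 bg) (fun x => sqr_ge0 (g x)) gs).
Qed.

(** There are infinitely many cells, but their second moments have a finite sum
    that does not depend on the level. *)
Lemma sum_EP_cell_le j n :
  \sum_(i < n) EP (fun x => cell_fun g j (e i) x ^+ 2) <= B.
Proof.
have finP : (P setT < +oo)%E by rewrite probability_setT ltry.
have b2 k : bmf (fun x => cell_fun g j k x ^+ 2) by apply: bmfX; exact: bmf_cell.
rewrite -(@Rintegral_bmf_sum _ _ _ P setT measurableT finP _ (index_enum 'I_n) (fun (i : 'I_n) x => cell_fun g j (e i) x ^+ 2))//.
rewrite -[leRHS](EP_cst P); apply: le_EP.
- by apply: bmf_sum => i.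
- exact: bmf_cst.
- move=> x; have := gB (2 ^+ j * x) (l := [seq e i | i <- iota 0 n]).
  rewrite map_inj_uniq// iota_uniq => /(_ isT); apply: le_trans.
  by rewrite big_map -(big_mkord xpredT (fun i => cell_fun g j (e i) x ^+ 2)) /index_iota subn0.
Qed.

Definition cells_event j N t := \bigcup_i abs_max_event X P (cell_fun g j (e i)) N t.

Lemma phi_ge_expR (x : R) : 2 <= x -> expR x / 4 <= phi x.
Proof.
move=> x2; have x1 : 1 <= x by lra.
have h : 1 + x / 2 <= expR (x / 2) by exact: expR_ge1Dx.
have e2 : expR x = expR (x / 2) ^+ 2 by rewrite expr2 -expRD; congr expR; field.
rewrite /phi e2; nra.
Qed.

Lemma expR_sub1_le (y : R) : expR y - 1 <= y * expR y.
Proof.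
have := expR_ge1Dx (- y); rewrite expRN.
have : 0 < expR y by exact: expR_gt0.
move: (expR y) => z z0; rewrite -(ler_pM2r z0) mulVf ?gt_eqF//; lra.
Qed.

(** Summing the Bernstein bound over the cells: [expR y - 1 <= y * expR y] keeps
    one factor linear in the variance of each cell, which is summable, and bounds
    the other factors by those of the worst cell. *)
Lemma cells_tail j N (lam t : R) : 0 < lam -> 2 <= lam * t ->
  let c := lam ^+ 2 / 2 * expR (2 * K * lam) in
  measurable (cells_event j N t) /\
  (Pr (cells_event j N t) <=
   (8 * (c * N%:R * B) * expR (c * N%:R * (M0 / 2 ^+ j * s) - lam * t))%:E)%E.
Proof.
move=> l0 lt2 c.
have t0 : 0 < t by rewrite -(pmulr_rgt0 _ l0); lra.
have c0 : 0 <= c by rewrite /c mulr_ge0 ?expR_ge0// divr_ge0 ?sqr_ge0.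
pose v i := EP (fun x => cell_fun g j (e i) x ^+ 2).
have tail i := abs_maximal_tail iid N (bmf_cell j (e i)) (fun x => gK _) (lexx (v i)) l0 t0.
split; first by apply: bigcup_measurable => i _; have [] := tail i.
pose w i := 8 * (c * N%:R) * expR (c * N%:R * (M0 / 2 ^+ j * s) - lam * t) * v i.
have phi0 : 0 < phi (lam * t).
  by apply: lt_le_trans (phi_ge_expR lt2); rewrite divr_gt0// expR_gt0.
apply: (measure_bigcup_le (v := w)).
- by move=> i; have [] := tail i.
- move=> i; have [_ H] := tail i; apply: (le_trans H); rewrite lee_fin.
  rewrite ler_pdivrMr// /w -/c.
  have v0 : 0 <= v i by apply: Rintegral_ge0 => x _; rewrite sqr_ge0.
  have y0 : 0 <= c * (N%:R * v i) by apply: mulr_ge0 => //; apply: mulr_ge0 => //; exact: ler0n.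
  apply: (@le_trans _ _ (2 * (c * (N%:R * v i) * expR (c * N%:R * (M0 / 2 ^+ j * s))))).
    rewrite ler_pM2l// (le_trans (expR_sub1_le _))// ler_wpM2l//.
    rewrite ler_expR mulrA; apply: ler_wpM2l; last exact: EP_cell_le.
    by apply: mulr_ge0 => //; exact: ler0n.
  apply: (@le_trans _ _ (8 * (c * N%:R) * expR (c * N%:R * (M0 / 2 ^+ j * s) - lam * t) * v i * (expR (lam * t) / 4))).
    rewrite expRD expRN le_eqVlt; apply/orP; left; apply/eqP.
    by field; rewrite gt_eqF// expR_gt0.
  apply: ler_wpM2l; last exact: phi_ge_expR.
  apply: mulr_ge0 => //; apply: mulr_ge0; last exact: expR_ge0.
  by apply: mulr_ge0 => //; apply: mulr_ge0 => //; exact: ler0n.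
- move=> n; rewrite /w -mulr_sumr.
  have -> : 8 * (c * N%:R * B) * expR (c * N%:R * (M0 / 2 ^+ j * s) - lam * t) =
    8 * (c * N%:R) * expR (c * N%:R * (M0 / 2 ^+ j * s) - lam * t) * B by ring.
  apply: ler_wpM2l; last exact: sum_EP_cell_le.
  apply: mulr_ge0; last exact: expR_ge0.
  by apply: mulr_ge0 => //; apply: mulr_ge0 => //; exact: ler0n.
Qed.


Lemma slack_exists (A th : R) : 0 <= A < th ->
  exists2 del, 0 < del <= 1 & A * (1 + del) ^+ 2 <= th.
Proof.
move=> /andP[A0 Ath].
exists (Order.min 1 ((th - A) / (3 * A + 3))).
  by rewrite ge_min lexx/= andbT lt_min ltr01/= divr_gt0 ?subr_gt0//; lra.
set del := Order.min _ _.
have d1 : del <= 1 by rewrite ge_min lexx.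
have d2 : del * (3 * A + 3) <= th - A.
  by rewrite -ler_pdivlMr; [rewrite ge_min lexx orbT | lra].
have d0 : 0 <= del by rewrite le_min ler01/= divr_ge0// ?subr_ge0; lra.
clearbody del; nra.
Qed.

Lemma linear_le_expR (k y : R) : 0 < k -> y <= k^-1 * expR (k * y).
Proof.
move=> k0; rewrite -(ler_pM2l k0) mulrA divff ?gt_eqF// mul1r.
by apply: le_trans (expR_ge1Dx _); rewrite lerDr.
Qed.

Lemma exp2_expR j : 2 ^+ j = expR (ln 2 * j%:R) :> R.
Proof. by rewrite expRM_natr lnK// posrE. Qed.

(** The constant [2 ln 2] balances the number [2 ^ j] of cells against the
    Gaussian tail of one cell sum. *)
Lemma level_tail (x : R) : 0 < x -> 2 * ln 2 * (M0 * s) < x ^+ 2 ->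
  exists del eta ka C : R, exists j0 : nat,
    [/\ 0 < del, 0 < eta, 0 < ka, 0 <= C &
    forall (j N : nat) (N' : R), (j0 <= j)%N -> 0 < N' -> N%:R <= (1 + del) * N' ->
      j%:R * 2 ^+ j <= eta * N' ->
      let E := cells_event j N (x * Num.sqrt (j%:R * N' / 2 ^+ j)) in
      measurable E /\ (Pr E <= (C * expR (- (ka * j%:R)))%:E)%E].
Proof.
move=> x0 hx; set A := M0 * s.
have l2 : 0 < ln 2 :> R by rewrite ln_gt0// ltr1n.
have A0 : 0 <= A by apply: mulr_ge0 => //; exact: density_norm_ge0 dens.
(* [th] lies strictly between the variance and the value that it may not
   exceed, which leaves room for the corrections. *)
pose th := (A + x ^+ 2 / (2 * ln 2)) / 2.
have x20 : 0 < x ^+ 2 by rewrite exprn_gt0.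
have Ax : A < x ^+ 2 / (2 * ln 2) by rewrite ltr_pdivlMr ?mulr_gt0// mulrC.
have Ath : A < th by rewrite /th; lra.
have th0 : 0 < th by lra.
have thx : th < x ^+ 2 / (2 * ln 2) by rewrite /th; lra.
pose ka0 := x ^+ 2 / (2 * th) - ln 2.
have ka00 : 0 < ka0.
  rewrite subr_gt0 ltr_pdivlMr ?mulr_gt0//; move: thx; rewrite ltr_pdivlMr ?mulr_gt0//; lra.
have [del /andP[d0 d1] hd] : exists2 del, 0 < del <= 1 & A * (1 + del) ^+ 2 <= th.
  by apply: slack_exists; rewrite A0.
(* The tilt that is optimal for the variance [th]. *)
pose q := x / th.
have q0 : 0 < q by rewrite divr_gt0.
pose reta := ln (1 + del) / (2 * (K + 1) * q).
have ld : 0 < ln (1 + del) by rewrite ln_gt0// ltrDl.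
have K1 : 0 < K + 1 by rewrite (le_lt_trans K0)// ltrDl.
have reta0 : 0 < reta by apply: divr_gt0 => //; apply: mulr_gt0 => //; exact: mulr_gt0.
exists del, (reta ^+ 2), (ka0 / 2), (16 * B * q ^+ 2 * (2 / ka0)), (Num.truncn (2 / (x ^+ 2 / th))).+1.
split => //.
- by rewrite exprn_gt0.
- by rewrite divr_gt0.
- by nonneg.
move=> j N N' jj N'0 NN' jN'.
have p0' : 0 < 2 ^+ j :> R by rewrite exprn_gt0.
have jR : 0 < j%:R :> R by rewrite ltr0n; apply: leq_ltn_trans jj.
have jbig : 2 <= x ^+ 2 / th * j%:R.
  have xt : 0 < x ^+ 2 / th by rewrite divr_gt0.
  move: jj; rewrite truncn_lt_nat; last by nonneg.
  by rewrite ltr_pdivrMr// [ltRHS]mulrC => h; apply: ltW.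
pose u := Num.sqrt (j%:R * 2 ^+ j / N').
pose v := Num.sqrt (j%:R * N' / 2 ^+ j).
have uv : u * v = j%:R.
  rewrite /u /v -sqrtrM; last by nonneg.
  have -> : j%:R * 2 ^+ j / N' * (j%:R * N' / 2 ^+ j) = j%:R ^+ 2 :> R.
    by field; rewrite !gt_eqF.
  by rewrite sqrtr_sqr ger0_norm// ltW.
have u2 : u ^+ 2 = j%:R * 2 ^+ j / N'.
  by rewrite sqr_sqrtr//; nonneg.
have u0 : 0 < u by rewrite sqrtr_gt0 divr_gt0// mulr_gt0.
have ureta : u <= reta.
  rewrite -(ger0_norm (ltW reta0)) -sqrtr_sqr ler_wsqrtr// ler_pdivrMr//.
pose lam := q * u.
have lam0 : 0 < lam by rewrite mulr_gt0.
have lamt : lam * (x * v) = x ^+ 2 / th * j%:R.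
  by rewrite -uv /lam /q; field; rewrite gt_eqF.
have lt2 : 2 <= lam * (x * v) by rewrite lamt.
have [mE PE] := cells_tail j N lam0 lt2.
split; first exact: mE.
apply: (le_trans PE); rewrite lee_fin.
set c := lam ^+ 2 / 2 * _.
have cN : c * N%:R <= q ^+ 2 / 2 * (j%:R * 2 ^+ j) * (1 + del) ^+ 2.
  have e1 : expR (2 * K * lam) <= 1 + del.
    rewrite -[leRHS]lnK ?posrE ?addr_gt0// ler_expR /lam.
    apply: (@le_trans _ _ (2 * (K + 1) * q * reta)).
      rewrite mulrA; apply: ler_pM => //; [by nonneg | by nonneg |].
      by rewrite ler_pM2r// ler_pM2l// lerDl.
    by rewrite /reta mulrCA divff ?mulr1// gt_eqF//; apply: mulr_gt0 => //; exact: mulr_gt0.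
  have c1 : c <= q ^+ 2 / 2 * u ^+ 2 * (1 + del).
    have lu : lam ^+ 2 = q ^+ 2 * u ^+ 2 by rewrite /lam exprMn.
    have lu' : q ^+ 2 / 2 * u ^+ 2 = lam ^+ 2 / 2 by rewrite lu mulrAC.
    by rewrite lu' /c; apply: ler_wpM2l => //; nonneg.
  apply: (@le_trans _ _ (q ^+ 2 / 2 * u ^+ 2 * (1 + del) * ((1 + del) * N'))).
    by apply: ler_pM => //; rewrite /c; nonneg.
  rewrite u2 le_eqVlt; apply/orP; left; apply/eqP.
  by field; rewrite gt_eqF.
have c0 : 0 <= c * N%:R.
  by apply: mulr_ge0 (ler0n _ _); rewrite /c; nonneg.
have ex : c * N%:R * (M0 / 2 ^+ j * s) - lam * (x * v) <= - (ka0 + ln 2) * j%:R.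
  have -> : M0 / 2 ^+ j * s = A / 2 ^+ j by rewrite /A mulrAC.
  have h : c * N%:R * (A / 2 ^+ j) <= q ^+ 2 / 2 * j%:R * th.
    apply: (@le_trans _ _ (q ^+ 2 / 2 * (j%:R * 2 ^+ j) * (1 + del) ^+ 2 * (A / 2 ^+ j))).
      by apply: ler_wpM2r cN; nonneg.
    have -> : q ^+ 2 / 2 * (j%:R * 2 ^+ j) * (1 + del) ^+ 2 * (A / 2 ^+ j) =
      q ^+ 2 / 2 * j%:R * (A * (1 + del) ^+ 2) by field; rewrite gt_eqF.
    by apply: ler_wpM2l => //; nonneg.
  rewrite lamt; apply: (@le_trans _ _ (q ^+ 2 / 2 * j%:R * th - x ^+ 2 / th * j%:R)).
    by rewrite lerD2r.
  rewrite le_eqVlt; apply/orP; left; apply/eqP.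
  by rewrite /q /ka0; field; rewrite gt_eqF.
have d4 : (1 + del) ^+ 2 <= 4.
  have -> : 4 = (1 + 1) ^+ 2 :> R by ring.
  by apply: lerXn2r; rewrite ?nnegrE ?lerD2l//; nonneg.
apply: (@le_trans _ _ (8 * (q ^+ 2 / 2 * (j%:R * 2 ^+ j) * 4 * B) * expR (- (ka0 + ln 2) * j%:R))).
  apply: ler_pM => //.
  - by nonneg.
  - rewrite ler_pM2l// ler_wpM2r//; apply: (le_trans cN).
    by apply: ler_wpM2l => //; nonneg.
  - by rewrite ler_expR.
have -> : expR (- (ka0 + ln 2) * j%:R) = expR (- (ka0 * j%:R)) / 2 ^+ j.
  by rewrite exp2_expR -expRN -expRD; congr expR; ring.
have -> : expR (- (ka0 * j%:R)) = expR (- (ka0 / 2 * j%:R)) ^+ 2.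
  by rewrite expr2 -expRD; congr expR; field.
have jl : j%:R <= 2 / ka0 * expR (ka0 / 2 * j%:R).
  by rewrite -[2 / ka0]invf_div; apply: linear_le_expR; rewrite divr_gt0.
have e0 : 0 < expR (- (ka0 / 2 * j%:R)) by exact: expR_gt0.
have jl' : j%:R * expR (- (ka0 / 2 * j%:R)) <= 2 / ka0.
  by rewrite expRN ler_pdivrMr ?expR_gt0.
have -> : 8 * (q ^+ 2 / 2 * (j%:R * 2 ^+ j) * 4 * B) *
  (expR (- (ka0 / 2 * j%:R)) ^+ 2 / 2 ^+ j) =
  16 * B * q ^+ 2 * (j%:R * expR (- (ka0 / 2 * j%:R))) * expR (- (ka0 / 2 * j%:R)).
  by field; rewrite gt_eqF.
apply: ler_wpM2r; first exact: ltW.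
apply: ler_wpM2l => //.
by nonneg.
Qed.

End OneFunction.
End Upper.

(** * Upper bound: blocks of sample sizes *)

Section Levels.
Context {R : realType}.
Variables (tau : R) (j : nat -> nat).
Hypothesis adm : admissible_levels tau j.

Lemma levels_ge j0 : \forall n \near \oo, (j0 <= j n)%N.
Proof.
case: adm => _ /cvgryPge /(_ j0%:R) h _ _ _.
by apply: filterS h => n; rewrite ler_nat.
Qed.

Lemma levels_gt0 : \forall n \near \oo, (0 < n)%N /\ (0 < j n)%N.
Proof.
case: adm => j0 _ _ _ _; near=> n.
by have n0 : (0 < n)%N by [near: n; exact: nbhs_infty_gt]; split=> //; exact: j0.
Unshelve. all: by end_near. Qed.

Lemma levels_small (eta : R) : 0 < eta ->
  \forall n \near \oo, (j n)%:R * 2 ^+ j n <= eta * n%:R.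
Proof.
move=> e0; case: adm => _ _ /cvgryPge /(_ eta^-1) h _ _.
near=> n.
have [n0 jn0] : (0 < n)%N /\ (0 < j n)%N by near: n; exact: levels_gt0.
have : eta^-1 <= n%:R / ((j n)%:R * 2 ^+ j n) by near: n.
rewrite ler_pdivlMr; last by rewrite mulr_gt0 ?ltr0n// exprn_gt0.
by rewrite ler_pdivrMl.
Unshelve. all: by end_near. Qed.

Lemma near_le_ln (M : R) : \forall n \near \oo, M <= ln n%:R.
Proof.
near=> n; have : ((Num.truncn (expR M)).+1 <= n)%N by near: n; exact: nbhs_infty_ge.
rewrite -(ler_nat R) => /(lt_le_trans (truncnS_gt (expR M))) /ltW h.
rewrite -[leLHS]expRK ler_ln ?posrE ?expR_gt0//.
by apply: lt_le_trans h; exact: expR_gt0.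
Unshelve. all: by end_near. Qed.

(** The assumption [j n / ln (ln n) --> +oo], in the form in which it is used. *)
Lemma levels_lnln (D : R) : \forall n \near \oo, D * ln (ln n%:R) <= (j n)%:R.
Proof.
case: adm => _ _ _ /cvgryPge /(_ D) h _.
near=> n.
have l0 : 0 < ln (ln n%:R) :> R.
  apply: ln_gt0; apply: (@lt_le_trans _ _ 2); first by rewrite ltr1n.
  by near: n; exact: near_le_ln.
have : D <= (j n)%:R / ln (ln n%:R) by near: n.
by rewrite ler_pdivlMr.
Unshelve. all: by end_near. Qed.

End Levels.

Section Blocks.
Context {R : realType}.

Lemma sum_inv_sqr_le n : \sum_(k < n) (k.+1%:R ^- 2) <= 2 :> R.
Proof.
case: n => [|n]; first by rewrite big_ord0.
apply: (@le_trans _ _ (2 - n.+1%:R^-1)); last by rewrite gerBl invr_ge0.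
elim: n => [|n IH].
  by rewrite big_ord_recr big_ord0 /= add0r expr1n invr1; lra.
rewrite big_ord_recr/=.
have h : n.+2%:R ^- 2 <= n.+1%:R^-1 - n.+2%:R^-1 :> R.
  have p : 0 < n.+1%:R :> R by rewrite ltr0n.
  rewrite -[n.+2]addn1 natrD; move: (n.+1%:R) p => y y0.
  have y1 : 0 < y + 1 by rewrite addr_gt0.
  have -> : y^-1 - (y + 1)^-1 = (y * (y + 1))^-1 by field; rewrite !gt_eqF.
  by rewrite lef_pV2 ?posrE ?exprn_gt0 ?mulr_gt0// expr2 ler_pM2r// lerDl.
by apply: le_trans (lerD IH h) _; rewrite addrA subrK.
Qed.

Lemma block_exists (a : R) n : 1 < a -> (0 < n)%N ->
  exists k, a ^+ k <= n%:R < a ^+ k.+1.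
Proof.
move=> a1 n0.
have ex : exists k, n%:R < a ^+ k.
  have d0 : 0 < a - 1 by rewrite subr_gt0.
  exists (Num.truncn (n%:R / (a - 1))).+1.
  have h k : 1 + k%:R * (a - 1) <= a ^+ k.
    elim: k => [|k IH]; first by rewrite mul0r addr0 expr0.
    rewrite exprS -natr1; have k0 := ler0n R k.
    have : a * (1 + k%:R * (a - 1)) <= a * a ^+ k by rewrite ler_pM2l//; lra.
    apply: le_trans; have : 0 <= k%:R * (a - 1) ^+ 2 by rewrite mulr_ge0// sqr_ge0.
    by move: k0 => _ h; rewrite -subr_ge0; apply: le_trans h _; rewrite le_eqVlt; apply/orP; left; apply/eqP; ring.
  apply: lt_le_trans (h _).
  have : n%:R / (a - 1) < (Num.truncn (n%:R / (a - 1))).+1%:R by exact: truncnS_gt.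
  by rewrite ltr_pdivrMr// => /lt_trans; apply; rewrite ltrDr.
have [k hk hmin] := ex_minnP ex.
case: k hk hmin => [|k] hk hmin.
  by move: hk; rewrite expr0 ltrn1 ltnNge n0.
exists k; rewrite hk andbT leNgt; apply/negP => /hmin.
by rewrite ltnn.
Qed.

End Blocks.

Section BorelCantelli.
Context {R : realType} {d : measure_display} {T : measurableType d}.
Variable Pr : probability T R.

(** First Borel-Cantelli lemma. *)
Lemma eventually_not (E : nat -> set T) (v : nat -> R) (M : R) :
  (forall k, measurable (E k)) -> (forall k, (Pr (E k) <= (v k)%:E)%E) ->
  (forall n, \sum_(i < n) v i <= M) ->
  {ae Pr, forall w, exists K, forall k, (K <= k)%N -> ~ E k w}.
Proof.
move=> mE Ev vM; exists (lim_sup_set E); split.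
- apply: bigcap_measurable => // n _.
  by apply: bigcup_measurable => k _.
- apply: lim_sup_set_cvg0 => //.
  by apply: le_lt_trans (ltry M); apply: (nneseries_le _ Ev vM).
- move=> w /= H n _; apply: contrapT => H2; apply: H; exists n => k nk Ek.
  by apply: H2; exists k.
Qed.

End BorelCantelli.

Section UpperCells.
Context {R : realType} {d : measure_display} {T : measurableType d}.
Variables (Pr : probability T R) (X : nat -> {RV Pr >-> R}) (P : probability R R).
Hypothesis iid : iid_with_law X P.
Local Notation mu := (@lebesgue_measure R).
Variable p0 : R -> R.
Hypothesis dens : has_bounded_density P p0.
Local Notation M0 := (density_norm p0).
Variables (tau : R) (j : nat -> nat).
Hypothesis adm : admissible_levels tau j.

(** Blocks [a ^ k <= n < a ^ k.+1] of sample sizes; within a block all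
    the levels above a threshold of order [ln k] are controlled at once, with
    summable probabilities, and the growth of [j n / ln (ln n)] places the level
    [j n] above the threshold, [k] being of order [ln n]. *)
Lemma upper_cells_nat (g : R -> R) (K s B x : R) (e : nat -> int) :
  bmf g -> (forall z, `|g z| <= K) -> 0 <= s -> 0 <= B ->
  (\int[mu]_z (g z ^+ 2)%:E <= s%:E)%E ->
  (forall (l : seq int) z, uniq l -> \sum_(k <- l) g (z - k%:~R) ^+ 2 <= B) ->
  injective e -> 0 < x -> 2 * ln 2 * (M0 * s) < x ^+ 2 ->
  {ae Pr, forall w, \forall n \near \oo, forall i,
    `|devsum X P (cell_fun g (j n) (e i)) n w| <=
      x * Num.sqrt ((j n)%:R * n%:R / 2 ^+ j n)}.
Proof.
move=> bg gK s0 B0 gs gB einj x0 hx.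
have [del [eta [ka [C [j0 [d0 e0 ka0 C0 tail]]]]]] :=
  level_tail iid dens bg gK s0 B0 gs gB einj x0 hx.
pose a := 1 + del; have a1 : 1 < a by rewrite ltrDl.
have ap k : 0 < a ^+ k by rewrite exprn_gt0// (lt_trans _ a1).
(* The second condition makes [expR (- (ka * i))] at most [k.+1 ^- 2] times a
   geometric term in [i], summable over the blocks and the levels. *)
pose cond k i := [&& (j0 <= i)%N, 4 * ln k.+1%:R <= ka * i%:R &
  i%:R * 2 ^+ i <= eta * a ^+ k].
pose F k i := if cond k i then cells_event X P g e i (Num.truncn (a * a ^+ k))
    (x * Num.sqrt (i%:R * a ^+ k / 2 ^+ i)) else set0.
pose rho := expR (- (ka / 2)).
have rho01 : 0 <= rho < 1 by rewrite expR_ge0/= -expR0 ltr_expR oppr_lt0 divr_gt0.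
pose v k i := C * k.+1%:R ^- 2 * rho ^+ i.
have HF k i : measurable (F k i) /\ (Pr (F k i) <= (v k i)%:E)%E.
  rewrite /F; case: ifP => [/and3P[c1 c2 c3]|_]; last first.
    by split => //; rewrite measure0 lee_fin /v; nonneg.
  have hN : (Num.truncn (a * a ^+ k))%:R <= (1 + del) * a ^+ k.
    by rewrite -truncn_ge_nat//; apply: mulr_ge0; apply: ltW => //; exact: lt_trans a1.
  have [mE PE] := tail i (Num.truncn (a * a ^+ k)) (a ^+ k) c1 (ap k) hN c3.
  split => //; apply: (le_trans PE); rewrite lee_fin /v -mulrA.
  apply: ler_wpM2l => //.
  have -> : - (ka * i%:R) = - (ka / 2 * i%:R) + - (ka / 2) * i%:R by field.
  rewrite expRD [expR (- (ka / 2) * _)]expRM_natr -/rho.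
  apply: ler_wpM2r; first by nonneg.
  have -> : k.+1%:R ^- 2 = expR (- (2 * ln k.+1%:R)) :> R.
    by rewrite expRN mulrC expRM_natr lnK// posrE.
  by rewrite ler_expR lerN2; lra.
pose E k := \bigcup_i F k i.
pose M := C * (1 - rho)^-1.
have rho1 : 0 < 1 - rho by rewrite subr_gt0; case/andP: rho01.
have HE : {ae Pr, forall w, exists K, forall k, (K <= k)%N -> ~ E k w}.
  apply: (@eventually_not _ _ _ _ _ (fun k => M * k.+1%:R ^- 2) (M * 2)).
  - by move=> k; apply: bigcup_measurable => i _; case: (HF k i).
  - move=> k; apply: (measure_bigcup_le (v := v k)).
    + by move=> i; case: (HF k i).
    + by move=> i; case: (HF k i).
    + move=> n; rewrite -mulr_sumr /M [leRHS]mulrAC.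
      by apply: ler_wpM2l; [nonneg | exact: geometric_sum_le].
  - by move=> n; rewrite -mulr_sumr; apply: ler_wpM2l (sum_inv_sqr_le n); rewrite /M; nonneg.
apply: filterS HE => w [k0 Hk0].
have la : 0 < ln a by rewrite ln_gt0.
near=> n => i; apply/ltW.
have n0 : (0 < n)%N by near: n; exact: nbhs_infty_gt.
have [k /andP[kn nk]] := block_exists a1 n0.
have nkN : a ^+ k0 <= n%:R.
  have : ((Num.truncn (a ^+ k0)).+1 <= n)%N by near: n; exact: nbhs_infty_ge.
  by rewrite -(ler_nat R) => /(lt_le_trans (truncnS_gt _)) /ltW.
have kk0 : (k0 <= k)%N.
  rewrite -ltnS; have := le_lt_trans nkN nk.
  by rewrite ltr_eXn2l.
have jj0 : (j0 <= j n)%N by near: n; exact: levels_ge adm _.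
have c3 : (j n)%:R * 2 ^+ j n <= eta * a ^+ k.
  have : (j n)%:R * 2 ^+ j n <= (eta / a) * n%:R.
    by near: n; apply: (levels_small adm); rewrite divr_gt0// (lt_trans _ a1).
  move=> h; apply: (le_trans h).
  have -> : eta * a ^+ k = eta / a * a ^+ k.+1.
    by rewrite exprS mulrA divfK// gt_eqF// (lt_trans _ a1).
  by apply: ler_wpM2l (ltW nk); rewrite divr_ge0// ltW// (lt_trans _ a1).
have c2 : 4 * ln k.+1%:R <= ka * (j n)%:R.
  have ln2 : 2 <= ln n%:R :> R by near: n; exact: near_le_ln.
  have ln3 : 2 / ln a <= ln n%:R by near: n; exact: near_le_ln.
  have h1 : 8 / ka * ln (ln n%:R) <= (j n)%:R by near: n; exact: levels_lnln adm _.
  have kl : k%:R * ln a <= ln n%:R.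
    by rewrite mulr_natl -lnXn ?ler_ln ?posrE ?ltr0n// (lt_trans _ a1).
  have kl2 : k.+1%:R <= ln n%:R ^+ 2 :> R.
    have : k%:R <= ln n%:R / ln a by rewrite ler_pdivlMr.
    have : ln n%:R / ln a <= ln n%:R * (ln n%:R / 2).
      by apply: ler_wpM2l; [lra | rewrite ler_pdivlMr// [leLHS]mulrC].
    move=> hA hB; have := le_trans hB hA; rewrite -[k.+1%:R]natr1; move: ln2.
    move: (ln n%:R) (k%:R : R) => y z y2 hz.
    have y4 : 2 * 2 <= y * y by apply: ler_pM.
    by rewrite expr2; lra.
  have : ln k.+1%:R <= 2 * ln (ln n%:R) :> R.
    rewrite mulr_natl -lnXn; last by lra.
    by rewrite ler_ln ?posrE ?ltr0n// exprn_gt0//; lra.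
  move: h1; rewrite mulrAC ler_pdivrMr//; lra.
rewrite ltNge; apply/negP => H.
apply: (Hk0 _ kk0); exists (j n) => //; rewrite /F /cond jj0 c2 c3 /=.
exists i => //; exists n.
  by rewrite truncn_ge_nat; [rewrite -exprS; exact: ltW | nonneg].
apply: le_trans H; apply: ler_wpM2l; first exact: ltW.
by apply: ler_wsqrtr; apply: ler_wpM2r; [nonneg | apply: ler_wpM2l].
Unshelve. all: by end_near. Qed.

End UpperCells.

(** * Upper bound: the supremum over all phases *)

Section Law.
Context {R : realType} {d : measure_display} {T : measurableType d}.
Variables (Pr : probability T R) (X : nat -> {RV Pr >-> R}) (P : probability R R).
Hypothesis iid : iid_with_law X P.
Local Notation EP f := (\int[P]_x f x).

Let finP : (P setT < +oo)%E. Proof. by rewrite probability_setT ltry. Qed.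
Let finPr : (Pr setT < +oo)%E. Proof. by rewrite probability_setT ltry. Qed.

Lemma bmf_sample (h : R -> R) i : bmf h -> bmf (fun w => h (X i w)).
Proof.
move=> [mh [M hM]]; split; last by exists M => w.
by apply: (measurableT_comp mh); exact: measurable_funP.
Qed.

Lemma law_expectation (h : R -> R) i : bmf h -> \int[Pr]_w h (X i w) = EP h.
Proof.
move=> bh; rewrite /Rintegral; congr fine.
have mh : measurable_fun setT (EFin \o h) by apply/measurable_EFinP; case: bh.
have -> : (\int[P]_x (h x)%:E = \int[distribution Pr (X i)]_x (EFin \o h) x)%E.
  by apply: eq_measure_integral => A mA _; have [_ H] := iid; symmetry; exact: H.
rewrite integral_distribution//.
by apply: (bmf_integrable measurableT finPr); exact: bmf_sample.
Qed.

Lemma devsum_sum (I : Type) (s : seq I) (c : I -> R) (h : I -> R -> R) n w :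
  (forall i, bmf (h i)) ->
  devsum X P (fun x : R => \sum_(i <- s) c i * h i x) n w =
  \sum_(i <- s) c i * devsum X P (h i) n w.
Proof.
move=> bh; rewrite /devsum.
rewrite (@Rintegral_bmf_sum _ _ _ P setT measurableT finP _ s (fun i x => c i * h i x)); last first.
  by move=> i; apply: bmfZ.
under [RHS]eq_bigr do rewrite mulr_sumr.
rewrite exchange_big/=; apply: eq_bigr => k _.
rewrite -sumrB; apply: eq_bigr => i _.
by rewrite (Rintegral_bmfZ measurableT finP)// mulrBr.
Qed.

Lemma mean_expectation (h : R -> R) n (c : R) : bmf h -> (0 < n)%N ->
  ('E_Pr[(fun w => n%:R^-1 * \sum_(i < n) c * h (X i w))%R] = (c * EP h)%:E)%E.
Proof.
move=> bh n0; rewrite unlock.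
have bs (i : 'I_n) : bmf (fun w => c * h (X i w)) by apply: bmfZ; exact: bmf_sample.
rewrite -(EFin_Rintegral_bmf measurableT finPr); last by apply: bmfZ; exact: bmf_sum.
rewrite (Rintegral_bmfZ measurableT finPr); last exact: bmf_sum.
rewrite (@Rintegral_bmf_sum _ _ _ Pr setT measurableT finPr _ (index_enum 'I_n) (fun (i : 'I_n) w => c * h (X i w)))//.
under eq_bigr => i _.
  rewrite (Rintegral_bmfZ measurableT finPr) ?law_expectation//; last exact: bmf_sample.
  over.
have -> : \sum_(i < n) c * EP h = n%:R * (c * EP h) by rewrite sumr_const card_ord [RHS]mulr_natl.
by rewrite mulKf// pnatr_eq0 -lt0n.
Qed.

End Law.

Section AllCells.
Context {R : realType} {d : measure_display} {T : measurableType d}.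
Variables (Pr : probability T R) (X : nat -> {RV Pr >-> R}) (P : probability R R).
Hypothesis iid : iid_with_law X P.
Local Notation mu := (@lebesgue_measure R).
Variable p0 : R -> R.
Hypothesis dens : has_bounded_density P p0.
Local Notation M0 := (density_norm p0).
Variables (tau : R) (j : nat -> nat).
Hypothesis adm : admissible_levels tau j.

(** The cells of nonnegative index and those of nonpositive index are enumerated
    separately. *)
Lemma upper_cells (rho : R) (g : R -> R) (s x : R) : 0 < rho < 1 -> localized rho g ->
  0 <= s -> (\int[mu]_z (g z ^+ 2)%:E <= s%:E)%E ->
  0 < x -> 2 * ln 2 * (M0 * s) < x ^+ 2 ->
  {ae Pr, forall w, \forall n \near \oo, forall k,
    `|devsum X P (cell_fun g (j n) k) n w| <=
      x * Num.sqrt ((j n)%:R * n%:R / 2 ^+ j n)}.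
Proof.
move=> rho01 lg s0 gs x0 hx.
have bg := localized_bmf rho01 lg; have [_ [K gK]] := bg.
have [B B0 gB] := localized_sum_sqr rho01 lg.
have i1 : injective Posz by move=> a b [].
have i2 : injective (fun i : nat => - i%:Z) by move=> a b /oppr_inj [].
have A1 := upper_cells_nat iid dens adm bg gK s0 B0 gs gB i1 x0 hx.
have A2 := upper_cells_nat iid dens adm bg gK s0 B0 gs gB i2 x0 hx.
apply: filterS2 A1 A2 => w h1 h2.
apply: filterS2 h1 h2 => n H1 H2 [k|k]; first exact: H1.
by rewrite NegzE; exact: H2.
Qed.

End AllCells.

Section Reduction.
Context {R : realType} {d : measure_display} {T : measurableType d}.
Variables (Pr : probability T R) (X : nat -> {RV Pr >-> R}) (P : probability R R).
Hypothesis iid : iid_with_law X P.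
Local Notation mu := (@lebesgue_measure R).
Variables (m : nat) (b : int -> R) (C rho : R).
Hypotheses (C0 : 0 <= C) (rho01 : 0 < rho < 1)
  (bC : forall k : int, `|b k| <= C * rho ^+ `|k|).
Hypothesis ab : forall k : int,
  \sum_(i < m.*2.+1) spline_gram m (i%:Z - m%:Z) * b (k + m%:Z - i%:Z) = (k == 0)%:R.

(** Sum over the cell [k] for a point at phase [u] in it. *)
Definition cellsum (u : R) (jj : nat) (k : int) n w :=
  devsum X P (cell_fun (cell_kernel m b u) jj k) n w.

Definition dualsum (jj : nat) (k : int) n w :=
  devsum X P (cell_fun (cardinal_spline m b) jj k) n w.

Let bdual : bmf (cardinal_spline m b).
Proof. by apply: (localized_bmf rho01); apply: (cardinal_spline_localized m C0 rho01 bC). Qed.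

Let bcell u : bmf (cell_kernel m b u).
Proof. by apply: (localized_bmf rho01); apply: (cell_kernel_localized m C0 rho01 bC). Qed.

(** The kernel is a combination of translates of the dual spline, so a cell sum is
    a combination of the [m + 1] dual sums nearby. *)
Lemma cellsumE u jj k n w : cellsum u jj k n w =
  \sum_(a < m.+1) bspline0 m.+1 (u + a%:R) * dualsum jj (k - a%:Z) n w.
Proof.
rewrite /cellsum /dualsum -devsum_sum; last by move=> a; exact: bmf_rescale.
congr (devsum X P _ n w); apply/funext => x; apply: eq_bigr => a _.
by congr (_ * cardinal_spline _ _ _); rewrite /cell_fun rmorphB/= opprB; ring.
Qed.

(** At [y] the centred estimator is the cell sum for the integer and fractional
    parts of [2 ^ j * y]. *)
Lemma estimator_centered jj n (y : R) w : (0 < n)%N ->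
  (`|(spline_estimator X m.+1 n jj y w)%:E - 'E_Pr[spline_estimator X m.+1 n jj y]|
  = (2 ^+ jj / n%:R * `|cellsum (frac (2 ^+ jj * y)) jj (Num.floor (2 ^+ jj * y)) n w|)%:E)%E.
Proof.
move=> n0; set u := frac _; set k := Num.floor _.
have E v : spline_estimator X m.+1 n jj y v =
    n%:R^-1 * \sum_(i < n) 2 ^+ jj * cell_fun (cell_kernel m b u) jj k (X i v).
  rewrite /spline_estimator; congr (_ * _); apply: eq_bigr => i _.
  by rewrite /spline_kernel_at (spline_kernel_cell C0 rho01 bC ab).
rewrite (_ : spline_estimator X m.+1 n jj y = fun v => n%:R^-1 * \sum_(i < n) 2 ^+ jj * cell_fun (cell_kernel m b u) jj k (X i v)); last exact/funext.
have bf : bmf (cell_fun (cell_kernel m b u) jj k) by exact: bmf_rescale.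
rewrite (mean_expectation iid)// -EFinB/=; congr EFin.
have n0' : n%:R != 0 :> R by rewrite pnatr_eq0 -lt0n.
have p0 : 0 <= 2 ^+ jj / n%:R :> R by rewrite divr_ge0.
rewrite -[in RHS](ger0_norm p0) -normrM; congr `|_|.
rewrite /cellsum /devsum sumrB sumr_const card_ord -mulr_sumr -mulr_natl.
by field.
Qed.

Lemma floor_fracK (u : R) (k : int) : 0 <= u < 1 ->
  Num.floor (u + k%:~R) = k /\ frac (u + k%:~R) = u.
Proof.
move=> /andP[u0 u1].
have fk : Num.floor (u + k%:~R) = k.
  by apply: floor_eqP; rewrite rmorphD/= lerDr u0/= addrC ltrD2l.
by split => //; rewrite /frac fk addrK.
Qed.

Lemma sup_centeredE jj n w : (0 < n)%N ->
  sup_centered Pr X m.+1 n jj w = ereal_sup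
    [set (2 ^+ jj / n%:R * `|cellsum p.1 jj p.2 n w|)%:E | p in [set p : R * int | 0 <= p.1 < 1]].
Proof.
move=> n0; congr ereal_sup; apply/seteqP; split => [_ [y _ <-]|_ [[u k]/= u01 <-]].
- exists (frac (2 ^+ jj * y), Num.floor (2 ^+ jj * y)); first exact: frac_itv.
  by rewrite estimator_centered.
- have [fk fu] := floor_fracK k u01.
  exists ((u + k%:~R) / 2 ^+ jj) => //; rewrite estimator_centered//.
  have -> : 2 ^+ jj * ((u + k%:~R) / 2 ^+ jj) = u + k%:~R.
    by rewrite mulrC divfK// gt_eqF// exprn_gt0.
  by rewrite fk fu.
Qed.

Lemma sum_ord_le n (f : 'I_n -> R) (x : R) : (forall i, f i <= x) ->
  \sum_i f i <= n%:R * x.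
Proof.
move=> fx; apply: (@le_trans _ _ (\sum_(i < n) x)); first exact: ler_sum.
by rewrite sumr_const card_ord mulr_natl.
Qed.

Lemma cellsum_dual_le (x : R) u jj n w : (forall k, `|dualsum jj k n w| <= x) ->
  forall k, `|cellsum u jj k n w| <= m.+1%:R * x.
Proof.
move=> H k; rewrite cellsumE (le_trans (ler_norm_sum _ _ _))//.
apply: sum_ord_le => a; rewrite normrM -[leRHS]mul1r; apply: ler_pM => //.
exact: normr_bspline_le1.
Qed.

(** B-splines are Lipschitz within the unit cell, hence so are the cell sums in
    the phase, with a constant controlled by the dual sums. *)
Lemma cellsum_lipschitz (x : R) u u' jj n w : (forall k, `|dualsum jj k n w| <= x) ->
  0 <= u < 1 -> 0 <= u' < 1 ->
  forall k, `|cellsum u jj k n w - cellsum u' jj k n w| <= m.+1%:R * (`|u - u'| * x).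
Proof.
move=> H u01 u01' k; rewrite !cellsumE -sumrB (le_trans (ler_norm_sum _ _ _))//.
apply: sum_ord_le => a; rewrite -mulrBl normrM; apply: ler_pM => //.
exact: bspline_lipschitz.
Qed.

Section AlmostSure.
Variable p0 : R -> R.
Hypothesis dens : has_bounded_density P p0.
Local Notation M0 := (density_norm p0).
Variables (tau : R) (j : nat -> nat).
Hypothesis adm : admissible_levels tau j.

(** The cell sums at a fixed phase [u] are controlled by their variance; the
    supremum over the phases is then reduced to a finite grid, the increments in
    [u] being bounded by the sums of the dual spline. *)
Lemma upper_sup (s x : R) : 0 <= s ->
  (forall u, 0 <= u < 1 -> (\int[mu]_z (cell_kernel m b u z ^+ 2)%:E <= s%:E)%E) ->
  0 < x -> 2 * ln 2 * (M0 * s) < x ^+ 2 ->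
  {ae Pr, forall w, \forall n \near \oo, forall u k, 0 <= u < 1 ->
    `|cellsum u (j n) k n w| <= x * Num.sqrt ((j n)%:R * n%:R / 2 ^+ j n)}.
Proof.
move=> s0 us x0 hx.
set c := 2 * ln 2 * (M0 * s) in hx *.
have M00 := density_norm_ge0 dens.
have l2 : 0 < ln 2 :> R by rewrite ln_gt0// ltr1n.
have c0 : 0 <= c by rewrite /c; nonneg.
pose x' := Num.sqrt ((c + x ^+ 2) / 2).
have x2 : 0 < x ^+ 2 by rewrite exprn_gt0.
have hx0 : 0 < (c + x ^+ 2) / 2 by rewrite divr_gt0//; lra.
have x'0 : 0 < x' by rewrite sqrtr_gt0.
have x'2 : x' ^+ 2 = (c + x ^+ 2) / 2 by rewrite sqr_sqrtr// ltW.
have x'x : x' < x.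
  rewrite -(ltr_pXn2r (n := 2))// ?nnegrE ?(ltW x'0) ?(ltW x0)// x'2; lra.
have ldual := cardinal_spline_localized m C0 rho01 bC.
have [s1 s10 gs1] := localized_sqr_integral rho01 ldual.
pose c1 := 2 * ln 2 * (M0 * s1).
have c10 : 0 <= c1 by rewrite /c1; nonneg.
pose x1 := 1 + c1.
have x10 : 0 < x1 by rewrite /x1; lra.
have hx1 : c1 < x1 ^+ 2 by rewrite /x1; nra.
(* With more than [q] grid points, the increments between neighbours stay below
   the gap between [x'] and [x]. *)
pose q := m.+1%:R * x1 / (x - x').
have q0 : 0 <= q by rewrite /q; apply: divr_ge0; [nonneg | rewrite subr_ge0 ltW].
pose Q := (Num.truncn q).+1.
have qQ : q < Q%:R by exact: truncnS_gt.
have Q0 : 0 < Q%:R :> R by rewrite ltr0n.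
have grid01 (i : 'I_Q) : 0 <= (i%:R / Q%:R : R) < 1.
  by apply/andP; split; [nonneg | rewrite ltr_pdivrMr// mul1r ltr_nat].
have A1 := upper_cells iid dens adm rho01 ldual s10 gs1 x10 hx1.
have A2 : {ae Pr, forall w, forall i : 'I_Q, \forall n \near \oo, forall k,
    `|cellsum (i%:R / Q%:R) (j n) k n w| <= x' * Num.sqrt ((j n)%:R * n%:R / 2 ^+ j n)}.
  apply: filter_forall => i.
  apply: (upper_cells iid dens adm rho01 _ s0 (us _ (grid01 i)) x'0).
    exact: (cell_kernel_localized m C0 rho01 bC).
  by rewrite x'2 -/c; lra.
apply: filterS2 A1 A2 => w h1 h2.
have h2' : \forall n \near \oo, forall (i : 'I_Q) k,
  `|cellsum (i%:R / Q%:R) (j n) k n w| <= x' * Num.sqrt ((j n)%:R * n%:R / 2 ^+ j n).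
  by apply: filter_forall => i; exact: h2.
apply: filterS2 h1 h2' => n H1 H2 u k u01.
have /andP[u0 u1] := u01.
set S := Num.sqrt _ in H1 H2 *.
have iQ : (Num.truncn (u * Q%:R) < Q)%N.
  by rewrite truncn_lt_nat; [rewrite -[ltRHS]mul1r ltr_pM2r | nonneg].
pose i := Ordinal iQ.
have iu : `|u - i%:R / Q%:R| <= Q%:R^-1.
  have := truncn_itv (mulr_ge0 u0 (ltW Q0)); rewrite -/(nat_of_ord i) => /andP[].
  have -> : Num.truncn (u * Q%:R) = i by [].
  rewrite -natr1 => a1 a2; rewrite ler_norml; apply/andP; split.
    apply: (@le_trans _ _ 0); first by rewrite oppr_le0 invr_ge0 ltW.
    by rewrite subr_ge0 ler_pdivrMr.
  by rewrite lerBlDr -[X in X + _]mul1r -mulrDl ler_pdivlMr// addrC; exact: ltW.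
have L := cellsum_lipschitz H1 u01 (grid01 i) k.
have -> : cellsum u (j n) k n w = cellsum (i%:R / Q%:R) (j n) k n w +
  (cellsum u (j n) k n w - cellsum (i%:R / Q%:R) (j n) k n w) by rewrite addrC subrK.
apply: le_trans (ler_normD _ _) _.
have -> : x * S = x' * S + (x - x') * S by rewrite -mulrDl addrC subrK.
apply: lerD (H2 i k) _; apply: le_trans L _.
have S0 : 0 <= S by exact: sqrtr_ge0.
have -> : m.+1%:R * (`|u - i%:R / Q%:R| * (x1 * S)) = `|u - i%:R / Q%:R| * (m.+1%:R * x1) * S by ring.
apply: ler_wpM2r => //; apply: (@le_trans _ _ (Q%:R^-1 * (m.+1%:R * x1))).
  by apply: ler_wpM2r => //; nonneg.
rewrite ler_pdivrMl//; move: qQ; rewrite /q ltr_pdivrMr ?subr_gt0// => /ltW.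
by [].
Qed.

End AlmostSure.

End Reduction.

(** * Lower bound: Poissonization *)

Section Exponential.
Context {R : realType}.

(** For [x <= N * ln 2] the first [N + 1] terms of the exponential series make up
    half of its sum: the remainder is compared with the series at [2 * x]. *)
Lemma exp_partial_ge (x : R) N : 0 <= x -> x <= N%:R * ln 2 ->
  expR x / 2 <= \sum_(k < N.+1) x ^+ k / k`!%:R.
Proof.
move=> x0 xN.
have key : expR x <= \sum_(k < N.+1) x ^+ k / k`!%:R + 2 ^- N.+1 * expR (2 * x).
  apply: (cvgn_le (@expR_cvg R x)) => n.
  have nn (y : R) k : 0 <= y -> 0 <= y ^+ k / k`!%:R by move=> y0; nonneg.
  apply: (@le_trans _ _ (\sum_(k < n + N.+1) x ^+ k / k`!%:R)).
    rewrite seriesEord big_split_ord/= lerDl; apply: sumr_ge0 => i _; exact: nn.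
  rewrite addnC big_split_ord/= lerD2l.
  apply: le_trans (ler_wpM2l _ (series_exp_coeff_le (N.+1 + n) _)); last 2 first.
  - by rewrite invr_ge0 exprn_ge0.
  - by nonneg.
  have -> : series (exp_coeff (2 * x)) (N.+1 + n)%N = \sum_(k < N.+1 + n) (2 * x) ^+ k / k`!%:R.
    by rewrite seriesEord.
  rewrite [in leRHS]big_split_ord/= mulrDr -[leLHS]add0r; apply: lerD.
    by apply: mulr_ge0; [nonneg | apply: sumr_ge0 => i _; apply: nn; nonneg].
  rewrite mulr_sumr; apply: ler_sum => i _.
  rewrite exprMn mulrA mulrA; apply: ler_wpM2r; first by nonneg.
  rewrite -[leLHS]mul1r; apply: ler_wpM2r; first by nonneg.
  rewrite mulrC ler_pdivlMr ?exprn_gt0// mul1r.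
  by apply: ler_weXn2l; [lra | exact: leq_addr].
have e2 : expR x <= 2 ^+ N by rewrite exp2_expR ler_expR mulrC.
have h : 2 ^- N.+1 * expR (2 * x) <= expR x / 2.
  have -> : expR (2 * x) = expR x * expR x by rewrite -expRD; congr expR; ring.
  rewrite mulrCA; apply: ler_wpM2l; first by nonneg.
  by rewrite exprS invfM -mulrA ler_piMr// ler_pdivrMl ?exprn_gt0// mulr1.
lra.
Qed.

(** Stirling's upper bound up to the polynomial factor. *)
Lemma factorial_le n : (0 < n)%N -> n`!%:R * expR n%:R <= expR 1 * n%:R * n%:R ^+ n :> R.
Proof.
case: n => // n _; elim: n => [|n IH].
  by rewrite (_ : 1`! = 1%N)// mul1r expr1 !mulr1.
set y : R := n.+1%:R in IH *.
have y0 : 0 < y by rewrite ltr0n.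
have yS : n.+2%:R = y + 1 by rewrite /y natr1.
have e1 : expR 1 * y ^+ n.+2 <= (y + 1) ^+ n.+2.
  have h : expR ((y + 1)^-1) <= (y + 1) / y.
    have := expR_ge1Dx (- (y + 1)^-1); rewrite expRN.
    have -> : 1 + - (y + 1)^-1 = y / (y + 1) by field; rewrite gt_eqF// addr_gt0.
    by rewrite -[X in _ -> _ <= X]invf_div => h; rewrite -lef_pV2 ?posrE ?invr_gt0 ?expR_gt0 ?divr_gt0 ?addr_gt0// invrK.
  have : expR ((y + 1)^-1) ^+ n.+2 <= ((y + 1) / y) ^+ n.+2.
    by apply: lerXn2r => //; rewrite nnegrE; nonneg.
  rewrite -expRM_natr yS mulVf; last by rewrite gt_eqF// addr_gt0.
  by rewrite expr_div_n ler_pdivlMr// exprn_gt0.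
rewrite factS natrM yS expRD.
have -> : (y + 1) * (n.+1)`!%:R * (expR y * expR 1) = (y + 1) * expR 1 * ((n.+1)`!%:R * expR y) by ring.
apply: (@le_trans _ _ ((y + 1) * expR 1 * (expR 1 * y * y ^+ n.+1))).
  by apply: ler_wpM2l IH; nonneg.
have -> : (y + 1) * expR 1 * (expR 1 * y * y ^+ n.+1) = (expR 1 * (y + 1)) * (expR 1 * y ^+ n.+2).
  by rewrite [y ^+ n.+2]exprS; ring.
by apply: ler_wpM2l e1; nonneg.
Qed.

End Exponential.

Section Poisson.
Context {R : realType} {Q : finType}.
Implicit Types (p : Q -> R) (F G : seq Q -> R) (A : Q -> bool).

Lemma pascal_sum n (u v : nat -> R) :
  \sum_(k < n.+2) 'C(n.+1, k)%:R * (u k * v (n.+1 - k)%N) =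
  \sum_(k < n.+1) 'C(n, k)%:R * (u k.+1 * v (n - k)%N) +
  \sum_(k < n.+1) 'C(n, k)%:R * (u k * v (n - k).+1).
Proof.
rewrite [LHS]big_ord_recl [X in _ = _ + X]big_ord_recl/= !bin0 !subn0 addrCA; congr (_ + _).
under eq_bigr => k _ do rewrite /bump/= add1n binS natrD mulrDl subSS.
rewrite big_split/= addrC; congr (_ + _).
rewrite big_ord_recr/= bin_small// mul0r addr0; apply: eq_bigr => k _.
by rewrite /bump/= add1n -subSn//.
Qed.

Definition on_block p A : Q -> R := fun a => p a * (A a)%:R.

(** Splitting the draws according to the block they fall in: binomial choice of
    the positions, and independence of the two subsequences. *)
Lemma seq_exp_split p A n F G :
  seq_exp p n (fun s => F (seq.filter A s) * G (seq.filter (fun a => ~~ A a) s)) =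
  \sum_(k < n.+1) 'C(n, k)%:R *
    (seq_exp (on_block p A) k F * seq_exp (on_block p (fun a => ~~ A a)) (n - k) G).
Proof.
pose B := fun a => ~~ A a; elim: n F G => [|n IH] F G.
  by rewrite big_ord_recr big_ord0/= add0r bin0 mul1r.
rewrite (pascal_sum n (fun k => seq_exp (on_block p A) k F) (fun k => seq_exp (on_block p B) k G)).
rewrite [LHS]/= (eq_bigr (fun a => on_block p A a * seq_exp p n (fun s => F (a :: seq.filter A s) * G (seq.filter B s)) + on_block p B a * seq_exp p n (fun s => F (seq.filter A s) * G (a :: seq.filter B s)))); last first.
  move=> a _; rewrite /on_block/B/=; case: (A a) => /=.
    by rewrite mulr1 mulr0 mul0r addr0.
  by rewrite mulr1 mulr0 mul0r add0r.
rewrite big_split/=; congr (_ + _).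
  under eq_bigr => a _ do rewrite (IH (fun s => F (a :: s)) G) mulr_sumr.
  rewrite exchange_big/=; apply: eq_bigr => k _; rewrite mulr_suml mulr_sumr.
  by apply: eq_bigr => a _; rewrite mulrCA !mulrA.
under eq_bigr => a _ do rewrite (IH F (fun s => G (a :: s))) mulr_sumr.
rewrite exchange_big/=; apply: eq_bigr => k _; rewrite !mulr_sumr.
by apply: eq_bigr => a _; rewrite mulrCA [X in _ * X]mulrCA.
Qed.

Lemma convolution_le N (u v : nat -> R) : (forall k, 0 <= u k) -> (forall k, 0 <= v k) ->
  \sum_(n < N) \sum_(k < n.+1) u k * v (n - k)%N <= (\sum_(k < N) u k) * (\sum_(k < N) v k).
Proof.
move=> u0 v0.
have E n : (n < N)%N -> \sum_(k < n.+1) u k * v (n - k)%N =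
    \sum_(k < N) u k * (v (n - k)%N * (k <= n)%:R).
  move=> nN; rewrite (big_ord_widen N (fun k => u k * v (n - k)%N))//.
  rewrite big_mkcond/=; apply: eq_bigr => k _; rewrite ltnS.
  by case: leqP => _; rewrite ?mulr1// !mulr0.
rewrite (eq_bigr (fun n : 'I_N => \sum_(k < N) u k * (v (n - k)%N * (k <= n)%:R))); last first.
  by move=> n _; exact: E.
rewrite exchange_big/= mulr_suml; apply: ler_sum => k _.
rewrite -mulr_sumr; apply: ler_wpM2l => //.
rewrite -(big_mkord xpredT (fun n => v (n - k)%N * (k <= n)%:R)).
rewrite (big_cat_nat _ (n := k))//=; last exact: ltnW.
rewrite big_nat big1 ?add0r; last by move=> i /andP[_ ik]; rewrite leqNgt ik mulr0.
rewrite -{1}[nat_of_ord k]add0n big_addn -(big_mkord xpredT v).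
rewrite [leRHS](big_cat_nat _ (n := (N - k)%N))//=; last exact: leq_subr.
rewrite ler_wpDr ?sumr_ge0//.
by apply: ler_sum => i _; rewrite addnK leq_addl mulr1.
Qed.

(** Partial sums of the expectation over a Poisson number of draws, without the
    normalising factor [expR (- z)]. *)
Definition poisson_exp p (z : R) N F := \sum_(n < N) z ^+ n / n`!%:R * seq_exp p n F.

Lemma seq_exp_ge0 p n F : (forall a, 0 <= p a) -> (forall s, 0 <= F s) -> 0 <= seq_exp p n F.
Proof.
move=> p0 F0; elim: n F F0 => [|n IH] F F0 /=; first exact: F0.
by apply: sumr_ge0 => a _; apply: mulr_ge0 => //; apply: IH.
Qed.

Lemma on_block_ge0 p A : (forall a, 0 <= p a) -> forall a, 0 <= on_block p A a.
Proof. by move=> p0 a; rewrite /on_block mulr_ge0. Qed.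

(** Disjoint blocks of symbols become independent after Poissonization. *)
Lemma poisson_exp_split p z N A F G : (forall a, 0 <= p a) -> 0 <= z ->
  (forall s, 0 <= F s) -> (forall s, 0 <= G s) ->
  poisson_exp p z N (fun s => F (seq.filter A s) * G (seq.filter (fun a => ~~ A a) s)) <=
  poisson_exp (on_block p A) z N F * poisson_exp (on_block p (fun a => ~~ A a)) z N G.
Proof.
move=> p0 z0 F0 G0; rewrite /poisson_exp.
pose u k := z ^+ k / k`!%:R * seq_exp (on_block p A) k F.
pose v k := z ^+ k / k`!%:R * seq_exp (on_block p (fun a => ~~ A a)) k G.
have zk k : 0 <= z ^+ k / k`!%:R by nonneg.
have u0 k : 0 <= u k by apply: mulr_ge0 => //; apply: seq_exp_ge0 => //; exact: on_block_ge0.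
have v0 k : 0 <= v k by apply: mulr_ge0 => //; apply: seq_exp_ge0 => //; exact: on_block_ge0.
apply: le_trans (convolution_le N u0 v0); apply: ler_sum => n _.
rewrite seq_exp_split mulr_sumr; apply: ler_sum => k _.
have kn : (k <= n)%N by rewrite -ltnS.
rewrite le_eqVlt; apply/orP; left; apply/eqP.
rewrite /u /v (_ : z ^+ n = z ^+ k * z ^+ (n - k)); last by rewrite -exprD subnKC.
have f0 i : i`!%:R != 0 :> R by rewrite pnatr_eq0 -lt0n fact_gt0.
have -> : 'C(n, k)%:R = n`!%:R / (k`!%:R * (n - k)`!%:R) :> R.
  by rewrite -(bin_fact kn) !natrM mulfK// mulf_neq0.
move: (seq_exp _ k F) (seq_exp _ (n - k) G) => U V.
by field; rewrite !f0.
Qed.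

Lemma poisson_exp_const p z N : (forall a, 0 <= p a) -> 0 <= z ->
  poisson_exp p z N (fun=> 1) <= expR (z * \sum_a p a).
Proof.
move=> p0 z0; apply: le_trans (series_exp_coeff_le N _); last first.
  by apply: mulr_ge0 => //; apply: sumr_ge0.
rewrite seriesEord; apply: ler_sum => n _; rewrite seq_exp_cst mul1r.
by rewrite /exp_coeff/= exprMn mulrAC.
Qed.

(** Iterating the splitting over the blocks; the symbols of no block contribute
    the exponential factor. *)
Lemma poisson_blocks p z N (tile : Q -> nat) M (F : nat -> seq Q -> R) :
  (forall a, 0 <= p a) -> 0 <= z -> (forall m s, 0 <= F m s) ->
  (forall m s, F m s = F m (seq.filter (fun a => tile a == m) s)) ->
  poisson_exp p z N (fun s => \prod_(m < M) F m s) <=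
  (\prod_(m < M) poisson_exp (on_block p (fun a => tile a == m)) z N (F m)) *
  expR (z * \sum_a p a * (M <= tile a)%:R).
Proof.
move=> + z0 F0 Fm; elim: M p => [|M IH] p p0.
  rewrite big_ord0 mul1r (_ : (fun s => _) = fun=> 1); last by apply/funext => s; rewrite big_ord0.
  rewrite (eq_bigr p) ?poisson_exp_const// => a _; by rewrite leq0n mulr1.
pose A a := tile a == M; pose G s := \prod_(m < M) F m s.
have G0 s : 0 <= G s by apply: prodr_ge0.
have GE s : G s = G (seq.filter (fun a => ~~ A a) s).
  apply: eq_bigr => m _; rewrite Fm [RHS]Fm -filter_predI; congr (F m _).
  apply: eq_filter => a /=; rewrite /A; case: eqP => //= ->.
  by rewrite ltn_eqF.
rewrite (_ : (fun s => _) = (fun s => F M (seq.filter A s) * G (seq.filter (fun a => ~~ A a) s))); last first.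
  by apply/funext => s; rewrite big_ord_recr/= -/(G s) GE -Fm mulrC.
apply: le_trans (poisson_exp_split _ _ p0 z0 (F0 M) G0) _.
rewrite big_ord_recr/= -mulrA [X in _ <= X]mulrCA; apply: ler_wpM2l.
  apply: sumr_ge0 => k _; apply: mulr_ge0; first by nonneg.
  by apply: seq_exp_ge0 => //; exact: on_block_ge0.
apply: le_trans (IH _ (on_block_ge0 _ p0)) _.
rewrite le_eqVlt; apply/orP; left; apply/eqP; congr (_ * expR (_ * _)).
  apply: eq_bigr => m _; congr poisson_exp; apply/funext => a; rewrite /on_block /A.
  by case: (tile a =P m) => [->|_]; rewrite ?mulr0// ltn_eqF//= mulr1.
apply: eq_bigr => a _; rewrite /on_block /A -mulrA; congr (_ * _).
by rewrite -natrM mulnb ltn_neqAle eq_sym.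
Qed.

(** A Poisson number of mean [n] equals [n] with probability at least
    [1 / (e * n)], so Poissonization loses at most a factor [e * n]. *)
Lemma blocks_bound p n (tile : Q -> nat) M (F : nat -> seq Q -> R) (beta : 'I_M -> R) :
  (forall a, 0 <= p a) -> \sum_a p a = 1 -> (0 < n)%N -> (forall m s, 0 <= F m s) ->
  (forall m s, F m s = F m (seq.filter (fun a => tile a == m) s)) ->
  (forall m : 'I_M, poisson_exp (on_block p (fun a => tile a == m)) n%:R n.+1 (F m) <=
    expR (n%:R * (\sum_a on_block p (fun a => tile a == m) a) - beta m)) ->
  seq_exp p n (fun s => \prod_(m < M) F m s) <= expR 1 * n%:R * expR (- \sum_m beta m).
Proof.
move=> p0 p1 n0 F0 Fm Fb.
have n0' : 0 < n%:R :> R by rewrite ltr0n.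
have f0 : 0 < n`!%:R :> R by rewrite ltr0n fact_gt0.
have H1 : n%:R ^+ n / n`!%:R * seq_exp p n (fun s => \prod_(m < M) F m s) <=
    poisson_exp p n%:R n.+1 (fun s => \prod_(m < M) F m s).
  rewrite /poisson_exp big_ord_recr/= lerDr; apply: sumr_ge0 => k _.
  apply: mulr_ge0; first by nonneg.
  by apply: seq_exp_ge0 => // s; exact: prodr_ge0.
have H2 := le_trans H1 (poisson_blocks n.+1 M p0 (ltW n0') F0 Fm).
have H3 : (\prod_(m < M) poisson_exp (on_block p (fun a => tile a == m)) n%:R n.+1 (F m)) *
    expR (n%:R * \sum_a p a * (M <= tile a)%:R) <= expR n%:R * expR (- \sum_m beta m).
  apply: (@le_trans _ _ ((\prod_(m < M) expR (n%:R * (\sum_a on_block p (fun a => tile a == m) a) - beta m)) * expR (n%:R * \sum_a p a * (M <= tile a)%:R))).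
    apply: ler_wpM2r; first exact: expR_ge0.
    apply: ler_prod => m _; rewrite Fb andbT; apply: sumr_ge0 => k _.
    apply: mulr_ge0; first by nonneg.
    by apply: seq_exp_ge0 => //; exact: on_block_ge0.
  rewrite -expR_sum -!expRD ler_expR sumrB -mulr_sumr addrAC -mulrDr.
  rewrite lerD2r -[leRHS]mulr1 ler_pM2l//.
  rewrite [leRHS](_ : _ = \sum_a p a)// exchange_big/= -big_split/=.
  apply: ler_sum => a _; rewrite /on_block -mulr_sumr -mulrDr ler_piMr//.
  case: (leqP M (tile a)) => Ma.
    rewrite big1 ?add0r// => m _; rewrite gtn_eqF// (leq_trans _ Ma)//.
  rewrite addr0 (bigD1 (Ordinal Ma))//= eqxx big1 ?addr0// => m mM.
  by apply/eqP; rewrite pnatr_eq0 eqb0 eq_sym; apply: contra mM => /eqP H; apply/eqP/val_inj.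
have H4 := le_trans H2 H3.
have H5 := factorial_le n0 (R := R).
have nn0 : 0 < n%:R ^+ n :> R by rewrite exprn_gt0.
move: H4; rewrite mulrAC ler_pdivrMr// -ler_pdivlMl// => H4; apply: (le_trans H4).
rewrite ler_pdivrMl// mulrAC [leRHS]mulrA; apply: ler_wpM2r; first exact: expR_ge0.
by rewrite mulrC [leRHS]mulrC.
Qed.

End Poisson.

(** * Lower bound: exponential tilting of one Poisson block *)

Section Tilting.
Context {R : realType} {Q : finType}.
Implicit Types (p : Q -> R) (h : Q -> R).

(** The three exponentials single out the window [t <= S <= t'] around the mean
    of the exponentially tilted law. *)
Lemma window_le_indicator (S t t' lam mu : R) : 0 <= lam -> 0 <= mu ->
  expR (- (lam * t')) * (expR (lam * S) - expR (mu * t + (lam - mu) * S) -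
    expR (- (mu * t') + (lam + mu) * S)) <= (t <= S)%R%:R.
Proof.
move=> l0 m0.
have e1 : expR (mu * t + (lam - mu) * S) = expR (mu * (t - S)) * expR (lam * S).
  by rewrite -expRD; congr expR; ring.
have e2 : expR (- (mu * t') + (lam + mu) * S) = expR (mu * (S - t')) * expR (lam * S).
  by rewrite -expRD; congr expR; ring.
rewrite e1 e2.
have f1 : 0 <= expR (mu * (t - S)) * expR (lam * S) by nonneg.
have f2 : 0 <= expR (mu * (S - t')) * expR (lam * S) by nonneg.
have g1 x : 0 <= x -> expR (lam * S) <= expR x * expR (lam * S).
  by move=> x0; rewrite ler_peMl ?expR_ge0// -expR0 ler_expR.
have [tS|St] := leP t S; last first.
  have := g1 (mu * (t - S)) (mulr_ge0 m0 _); rewrite subr_ge0 => /(_ (ltW St)) h.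
  by rewrite mulr_ge0_le0// ?expR_ge0//; lra.
have [St'|t'S] := leP S t'; last first.
  have := g1 (mu * (S - t')) (mulr_ge0 m0 _); rewrite subr_ge0 => /(_ (ltW t'S)) h.
  apply: (@le_trans _ _ 0) => //.
  by rewrite mulr_ge0_le0// ?expR_ge0//; lra.
apply: (@le_trans _ _ (expR (- (lam * t')) * expR (lam * S))).
  by apply: ler_wpM2l; [exact: expR_ge0 | lra].
by rewrite -expRD -expR0 ler_expR addrC subr_le0 ler_wpM2l.
Qed.

Lemma poisson_expD p z N F G :
  poisson_exp p z N (fun s => F s + G s) = poisson_exp p z N F + poisson_exp p z N G.
Proof.
by rewrite /poisson_exp -big_split/=; apply: eq_bigr => k _; rewrite seq_expD mulrDr.
Qed.

Lemma poisson_expZ p z N c F :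
  poisson_exp p z N (fun s => c * F s) = c * poisson_exp p z N F.
Proof.
rewrite /poisson_exp mulr_sumr; apply: eq_bigr => k _.
by rewrite seq_expZ mulrCA.
Qed.

Lemma le_poisson_exp p z N F G : (forall a, 0 <= p a) -> 0 <= z ->
  (forall s, F s <= G s) -> poisson_exp p z N F <= poisson_exp p z N G.
Proof.
move=> p0 z0 FG; apply: ler_sum => k _; apply: ler_wpM2l; first by nonneg.
by apply: le_seq_exp.
Qed.

Definition laplace p h (l : R) := \sum_a p a * expR (l * h a).

Lemma poisson_exp_laplace p h z N l :
  poisson_exp p z N (fun s => expR (l * \sum_(a <- s) h a)) =
  \sum_(k < N) (z * laplace p h l) ^+ k / k`!%:R.
Proof.
apply: eq_bigr => k _.
rewrite (eq_seq_exp _ _ (G := fun s => \prod_(a <- s) expR (l * h a))); last first.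
  by move=> s; rewrite mulr_sumr expR_sum.
by rewrite seq_exp_prod exprMn mulrAC.
Qed.

Lemma laplace_ge0 p h l : (forall a, 0 <= p a) -> 0 <= laplace p h l.
Proof. by move=> p0; apply: sumr_ge0 => a _; rewrite mulr_ge0// expR_ge0. Qed.

(** The window inequality bounds the event [t <= S] from below by exponential
    moments, which are explicit under a Poisson number of draws.  The hypothesis
    [laplace p h lam <= ln 2] makes the truncation of the Poisson sum harmless,
    and [1 - x <= expR (- x)] gives the bound on the complementary event. *)
Lemma block_tail p h n (t t' lam mu : R) : (forall a, 0 <= p a) -> 0 <= lam -> 0 <= mu ->
  laplace p h lam <= ln 2 ->
  poisson_exp p n%:R n.+1 (fun s => (\sum_(a <- s) h a < t)%R%:R) <=
  expR (n%:R * (\sum_a p a) - expR (- (n%:R * (\sum_a p a))) *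
    (expR (- (lam * t')) * (expR (n%:R * laplace p h lam) / 2 -
     expR (mu * t) * expR (n%:R * laplace p h (lam - mu)) -
     expR (- (mu * t')) * expR (n%:R * laplace p h (lam + mu))))).
Proof.
move=> p0 l0 m0 lap.
have n0 : 0 <= n%:R :> R by [].
set B := expR (- (lam * t')) * _; set e := n%:R * \sum_a p a.
pose G s : R := (t <= \sum_(a <- s) h a)%R%:R.
have BG : B <= poisson_exp p n%:R n.+1 G.
  pose W s := expR (- (lam * t')) * (expR (lam * \sum_(a <- s) h a) +
    ((- expR (mu * t)) * expR ((lam - mu) * \sum_(a <- s) h a) +
     (- expR (- (mu * t'))) * expR ((lam + mu) * \sum_(a <- s) h a))).
  apply: (@le_trans _ _ (poisson_exp p n%:R n.+1 W)); last first.
    apply: le_poisson_exp => // s; apply: le_trans (window_le_indicator _ t t' l0 m0).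
    by rewrite /W !expRD !mulNr addrA.
  rewrite /W poisson_expZ !poisson_expD !poisson_expZ !poisson_exp_laplace /B.
  apply: ler_wpM2l; first exact: expR_ge0.
  rewrite -addrA; apply: lerD.
    apply: exp_partial_ge; first by apply: mulr_ge0 => //; exact: laplace_ge0.
    exact: ler_wpM2l.
  have up l : \sum_(k < n.+1) (n%:R * laplace p h l) ^+ k / k`!%:R <= expR (n%:R * laplace p h l).
    apply: le_trans (series_exp_coeff_le n.+1 _); first by rewrite seriesEord.
    by apply: mulr_ge0 => //; exact: laplace_ge0.
  by rewrite !mulNr; apply: lerB; rewrite ?lerN2; apply: ler_wpM2l; rewrite ?expR_ge0.
have E : poisson_exp p n%:R n.+1 (fun s => (\sum_(a <- s) h a < t)%R%:R) + poisson_exp p n%:R n.+1 G <= expR e.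
  rewrite -poisson_expD; apply: le_trans (poisson_exp_const n.+1 p0 n0).
  by apply: le_poisson_exp => // s; rewrite /G; case: ltP => _; rewrite ?addr0 ?add0r.
have E2 : expR e - B <= expR (e - expR (- e) * B).
  have := expR_ge1Dx (- (expR (- e) * B)).
  rewrite -(ler_pM2l (expR_gt0 e)) -expRD => h1; apply: le_trans h1.
  by rewrite mulrDr mulr1 mulrN mulrA -expRD subrr expR0 mul1r.
by apply: le_trans E2; lra.
Qed.

(** Cumulant function of the compound Poisson sum, centred at its mean. *)
Definition cumulant p h n (l : R) := n%:R * \sum_a p a * phi (l * h a).

Lemma cumulantE p h n l : n%:R * laplace p h l =
  n%:R * (\sum_a p a) + l * (n%:R * \sum_a p a * h a) + cumulant p h n l.
Proof.
rewrite /cumulant /laplace [l * _]mulrCA -!mulrDr; congr (_ * _).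
rewrite mulr_sumr -!big_split/=; apply: eq_bigr => a _; rewrite /phi; ring.
Qed.

(** The bound of [block_tail] with thresholds measured from the block mean. *)
Lemma block_tail_centered p h n (tau tau' lam mu : R) : (forall a, 0 <= p a) ->
  0 <= lam -> 0 <= mu -> laplace p h lam <= ln 2 ->
  forall e : R, e = n%:R * (\sum_a p a * h a) ->
  poisson_exp p n%:R n.+1 (fun s => (\sum_(a <- s) h a < tau + e)%R%:R) <=
  expR (n%:R * (\sum_a p a) - expR (cumulant p h n lam - lam * tau') *
    (1 / 2 - expR (mu * tau + cumulant p h n (lam - mu) - cumulant p h n lam) -
     expR (- (mu * tau') + cumulant p h n (lam + mu) - cumulant p h n lam))).
Proof.
move=> p0 l0 m0 lap e eE.
apply: le_trans (block_tail n _ (tau' + e) p0 l0 m0 lap) _.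
rewrite le_eqVlt; apply/orP; left; apply/eqP; congr (expR (_ - _)).
rewrite !cumulantE -eE; set s := n%:R * _.
move: (cumulant p h n lam) (cumulant p h n (lam - mu)) (cumulant p h n (lam + mu)) => L0 L1 L2.
clear lap eE; clearbody s.
set a := expR (L0 - _); set u := expR (- s); set w := expR (- (lam * _)).
set X0 := expR (s + _ + L0); set X1 := expR (s + _ + L1); set X2 := expR (s + _ + L2).
set Y1 := expR (mu * (tau + e)); set Y2 := expR (- (mu * _)).
have E0 : u * (w * X0) = a by rewrite -!expRD; congr expR; ring.
have E1 : u * (w * (Y1 * X1)) = a * expR (mu * tau + L1 - L0).
  by rewrite -!expRD; congr expR; ring.
have E2 : u * (w * (Y2 * X2)) = a * expR (- (mu * tau') + L2 - L0).
  by rewrite -!expRD; congr expR; ring.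
have -> : u * (w * (X0 / 2 - Y1 * X1 - Y2 * X2)) =
  u * (w * X0) / 2 - u * (w * (Y1 * X1)) - u * (w * (Y2 * X2)).
  by clear; clearbody u w X0 X1 X2 Y1 Y2; field.
by rewrite E0 E1 E2 !mulrBr div1r.
Qed.

Lemma phi_ge_pos (z : R) : 0 <= z -> z ^+ 2 / 2 <= phi z.
Proof.
move=> z0; have := series_exp_coeff_le 3 z0.
have -> : series (exp_coeff z) 3 = \sum_(k < 3) z ^+ k / k`!%:R by rewrite seriesEord.
rewrite !big_ord_recr big_ord0/= expr0 expr1.
rewrite (_ : 0`! = 1%N)// (_ : 1`! = 1%N)// (_ : 2`! = 2%N)// !divr1 add0r /phi.
by move: (z ^+ 2 / 2) (expR z) => u v; lra.
Qed.

Lemma phi_ge_neg (z : R) : 0 <= z <= 1 -> z ^+ 2 / 2 * expR (- z) <= phi (- z).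
Proof.
move=> /andP[z0 z1].
have E : phi (- z) = expR (- z) * (z ^+ 2 + (z - 1) * phi z).
  have e1 : expR (- z) * expR z = 1 by rewrite -expRD addNr expR0.
  rewrite /phi.
  have -> : expR (- z) * (z ^+ 2 + (z - 1) * (expR z - 1 - z)) =
    (expR (- z) * expR z) * (z - 1) + expR (- z) by ring.
  by rewrite e1; ring.
rewrite E mulrC; apply: ler_wpM2l; first exact: expR_ge0.
have p1 := phi_le z; rewrite (ger0_norm z0) in p1.
have e2 : (1 - z) * expR z <= 1.
  by rewrite -ler_pdivlMr ?expR_gt0// mul1r -expRN; exact: expR_ge1Dx.
have p2 : (1 - z) * phi z <= z ^+ 2 / 2.
  apply: (@le_trans _ _ ((1 - z) * (z ^+ 2 / 2 * expR z))).
    by apply: ler_wpM2l => //; rewrite subr_ge0.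
  rewrite mulrCA -[leRHS]mulr1; apply: ler_wpM2l => //; nonneg.
lra.
Qed.

Lemma phi_ge (y : R) : `|y| <= 1 -> y ^+ 2 / 2 * expR (- `|y|) <= phi y.
Proof.
have [y0|y0] := leP 0 y.
  rewrite ger0_norm// => _; apply: le_trans (phi_ge_pos y0).
  by rewrite ler_piMr ?expR_le1 ?oppr_le0//; nonneg.
rewrite ltr0_norm// => y1; have := @phi_ge_neg (- y).
by rewrite opprK sqrrN; apply; rewrite y1 oppr_ge0 ltW.
Qed.

Lemma cumulant_le p h n l (K V : R) : (forall a, 0 <= p a) -> (forall a, p a != 0 -> `|h a| <= K) ->
  n%:R * (\sum_a p a * h a ^+ 2) <= V ->
  cumulant p h n l <= l ^+ 2 / 2 * expR (`|l| * K) * V.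
Proof.
move=> p0 hK hV; apply: (@le_trans _ _ (l ^+ 2 / 2 * expR (`|l| * K) * (n%:R * (\sum_a p a * h a ^+ 2)))); last first.
  by apply: ler_wpM2l => //; nonneg.
rewrite mulrCA; apply: ler_wpM2l => //; rewrite mulr_sumr; apply: ler_sum => a _.
have [->|pa] := eqVneq (p a) 0; first by rewrite !mul0r mulr0.
rewrite mulrCA; apply: ler_wpM2l => //; apply: le_trans (phi_le _) _.
have -> : (l * h a) ^+ 2 / 2 * expR `|l * h a| = l ^+ 2 / 2 * h a ^+ 2 * expR `|l * h a| by rewrite exprMn; ring.
rewrite [leRHS]mulrAC; apply: ler_wpM2l; first by nonneg.
by rewrite ler_expR normrM ler_wpM2l// hK.
Qed.

Lemma cumulant_ge p h n l (K V : R) : (forall a, 0 <= p a) -> (forall a, p a != 0 -> `|h a| <= K) ->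
  `|l| * K <= 1 -> 0 <= V -> V <= n%:R * (\sum_a p a * h a ^+ 2) ->
  l ^+ 2 / 2 * expR (- (`|l| * K)) * V <= cumulant p h n l.
Proof.
move=> p0 hK lK V0 hV; apply: (@le_trans _ _ (l ^+ 2 / 2 * expR (- (`|l| * K)) * (n%:R * (\sum_a p a * h a ^+ 2)))).
  by apply: ler_wpM2l => //; nonneg.
rewrite mulrCA; apply: ler_wpM2l => //; rewrite mulr_sumr; apply: ler_sum => a _.
have [->|pa] := eqVneq (p a) 0; first by rewrite !mul0r mulr0.
rewrite mulrCA; apply: ler_wpM2l => //.
have lh : `|l * h a| <= `|l| * K by rewrite normrM ler_wpM2l// hK.
apply: le_trans (phi_ge (le_trans lh lK)).
have -> : (l * h a) ^+ 2 / 2 * expR (- `|l * h a|) = l ^+ 2 / 2 * h a ^+ 2 * expR (- `|l * h a|) by rewrite exprMn; ring.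
rewrite [leLHS]mulrAC; apply: ler_wpM2l; first by nonneg.
by rewrite ler_expR lerN2.
Qed.

End Tilting.

Section Tuning.
Context {R : realType}.

(** Slopes [a := x ^ 2 / v], tilt [x * (1 + del) / v] and window
    [x, x * (1 + 2 * del)]: the window captures the tilted mean, and the two
    exponential corrections are negligible. *)
Lemma tilt_tuning (x v del J L0 L1 L2 : R) (eps := del ^+ 2 / 36) (a := x ^+ 2 / v)
    (y := x * (1 + del) / v) (z := x * del / v) (x' := x * (1 + 2 * del)) :
  0 < x -> 0 < v -> 0 < del <= 1 -> 0 <= J ->
  (1 - eps) * (y ^+ 2 / 2 * v * J) <= L0 ->
  L1 <= (1 + eps) * ((y - z) ^+ 2 / 2 * v * J) ->
  L2 <= (1 + eps) * ((y + z) ^+ 2 / 2 * v * J) ->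
  [/\ - (a * (1 / 2 + 4 * del)) * J <= L0 - y * x' * J,
      z * x * J + L1 - L0 <= - (a * (del ^+ 2 / 4)) * J &
      - (z * x' * J) + L2 - L0 <= - (a * (del ^+ 2 / 4)) * J].
Proof.
move=> x0 v0 /andP[d0 d1] J0 h0 h1 h2.
have vn : v != 0 by rewrite gt_eqF.
have a0 : 0 < a by rewrite divr_gt0// exprn_gt0.
have aJ : 0 <= a * J by rewrite mulr_ge0// ltW.
have Ey : y ^+ 2 / 2 * v * J = a * J * ((1 + del) ^+ 2 / 2) by rewrite /y /a; field.
have E1 : (y - z) ^+ 2 / 2 * v * J = a * J * (1 / 2) by rewrite /y /z /a; field.
have E2 : (y + z) ^+ 2 / 2 * v * J = a * J * ((1 + 2 * del) ^+ 2 / 2) by rewrite /y /z /a; field.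
have F0 : y * x' * J = a * J * ((1 + del) * (1 + 2 * del)) by rewrite /y /x' /a; field.
have F1 : z * x * J = a * J * del by rewrite /z /a; field.
have F2 : z * x' * J = a * J * (del * (1 + 2 * del)) by rewrite /z /x' /a; field.
have G c : - (a * c) * J = a * J * (- c) by ring.
rewrite Ey in h0; rewrite E1 in h1; rewrite E2 in h2.
rewrite !G F0 F1 F2.
have d2 : 0 <= del ^+ 2 by exact: sqr_ge0.
have d21 : del ^+ 2 <= del by rewrite expr2 ler_piMl// ltW.
have d20 : del ^+ 2 <= 1 by lra.
have e1 : eps <= del / 36 by rewrite /eps ler_pM2r// invr_gt0.
have e0 : 0 <= eps by rewrite /eps; nonneg.
have m c1 c2 : c1 <= c2 -> a * J * c1 <= a * J * c2 by move=> c12; exact: ler_wpM2l.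
split.
- apply: (@le_trans _ _ ((1 - eps) * (a * J * ((1 + del) ^+ 2 / 2)) - a * J * ((1 + del) * (1 + 2 * del)))); last by lra.
  have -> : (1 - eps) * (a * J * ((1 + del) ^+ 2 / 2)) - a * J * ((1 + del) * (1 + 2 * del)) =
    a * J * ((1 - eps) * ((1 + del) ^+ 2 / 2) - (1 + del) * (1 + 2 * del)) by ring.
  apply: m.
  have : eps * (1 + del) ^+ 2 <= del / 36 * 4.
    apply: ler_pM => //; first exact: sqr_ge0.
    by have -> : (1 + del) ^+ 2 = 1 + 2 * del + del ^+ 2 by [ring]; lra.
  have -> : (1 - eps) * ((1 + del) ^+ 2 / 2) - (1 + del) * (1 + 2 * del) =
    - (1 / 2) - 2 * del - 3 / 2 * del ^+ 2 - eps * (1 + del) ^+ 2 / 2 by field.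
  move: (eps * _) => w; lra.
- apply: (@le_trans _ _ (a * J * del + (1 + eps) * (a * J * (1 / 2)) - (1 - eps) * (a * J * ((1 + del) ^+ 2 / 2)))); first by lra.
  have -> : a * J * del + (1 + eps) * (a * J * (1 / 2)) - (1 - eps) * (a * J * ((1 + del) ^+ 2 / 2)) =
    a * J * (del + (1 + eps) * (1 / 2) - (1 - eps) * ((1 + del) ^+ 2 / 2)) by ring.
  apply: m.
  have -> : del + (1 + eps) * (1 / 2) - (1 - eps) * ((1 + del) ^+ 2 / 2) =
    - (del ^+ 2 / 2) + eps * (1 + (1 + del) ^+ 2) / 2 by field.
  have : eps * (1 + (1 + del) ^+ 2) <= eps * 5.
    apply: ler_wpM2l => //.
    by have -> : (1 + del) ^+ 2 = 1 + 2 * del + del ^+ 2 by [ring]; lra.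
  rewrite /eps; move: (_ * (1 + _)) => w; lra.
- apply: (@le_trans _ _ (- (a * J * (del * (1 + 2 * del))) + (1 + eps) * (a * J * ((1 + 2 * del) ^+ 2 / 2)) - (1 - eps) * (a * J * ((1 + del) ^+ 2 / 2)))); first by lra.
  have -> : - (a * J * (del * (1 + 2 * del))) + (1 + eps) * (a * J * ((1 + 2 * del) ^+ 2 / 2)) - (1 - eps) * (a * J * ((1 + del) ^+ 2 / 2)) =
    a * J * (- (del * (1 + 2 * del)) + (1 + eps) * ((1 + 2 * del) ^+ 2 / 2) - (1 - eps) * ((1 + del) ^+ 2 / 2)) by ring.
  apply: m.
  have -> : - (del * (1 + 2 * del)) + (1 + eps) * ((1 + 2 * del) ^+ 2 / 2) - (1 - eps) * ((1 + del) ^+ 2 / 2) =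
    - (del ^+ 2 / 2) + eps * ((1 + 2 * del) ^+ 2 + (1 + del) ^+ 2) / 2 by field.
  have : eps * ((1 + 2 * del) ^+ 2 + (1 + del) ^+ 2) <= eps * 13.
    apply: ler_wpM2l => //.
    by have -> : (1 + 2 * del) ^+ 2 + (1 + del) ^+ 2 = 2 + 6 * del + 5 * del ^+ 2 by [ring]; lra.
  rewrite /eps; move: (_ * (_ + _)) => w; lra.
Qed.

End Tuning.

(** * Lower bound: joint event over disjoint tiles *)

Section Tiles.
Context {R : realType} {d : measure_display} {T : measurableType d}.
Variables (Pr : probability T R) (X : nat -> {RV Pr >-> R}) (P : probability R R).
Hypothesis iid : iid_with_law X P.
Local Notation EP f := (\int[P]_x f x).

Let finP : (P setT < +oo)%E. Proof. by rewrite probability_setT ltry. Qed.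

Variables (f : R -> R) (K : R) (tile : R -> nat).
Hypotheses (bf : bmf f) (fK : forall x, `|f x| <= K).
Hypothesis mtile : forall m, measurable (tile @^-1` [set m]).

Definition tile_part (m : nat) : R -> R := fun x => f x * (tile x == m)%:R.

Definition tile_prob (m : nat) : R := EP (fun x => (tile x == m)%:R).


Lemma tile_indic m : (fun x => (tile x == m)%:R) = \1_(tile @^-1` [set m]) :> (R -> R).
Proof.
apply/funext => x; rewrite indicE; case: eqP => [tm|tm]; first by rewrite mem_set.
by rewrite memNset.
Qed.

Lemma bmf_tile m : bmf (fun x => (tile x == m)%:R : R).
Proof. by rewrite tile_indic; exact: bmf_indic. Qed.

Lemma bmf_tile_part m : bmf (tile_part m).
Proof. by apply: bmfM => //; exact: bmf_tile. Qed.

(** Reduction of the joint event over all tiles to a Poisson bound within one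
    tile, for weights on a finite set obtained by discretizing the values of
    [f]. *)
Lemma tiles_event_le (n M : nat) (thr0 thr del beta : R) :
  (0 < n)%N -> 0 < del <= 1 -> thr0 + 2 * (n%:R * del) <= thr ->
  (forall (m : nat) (Q : finType) (p h : Q -> R), (m < M)%N -> (forall a, 0 <= p a) ->
    (forall a, p a != 0 -> `|h a| <= K + 1) -> \sum_a p a = tile_prob m ->
    `|\sum_a p a * h a ^+ 2 - EP (fun x => tile_part m x ^+ 2)| <= del * (2 * K + 1) ->
    poisson_exp p n%:R n.+1
      (fun s => (\sum_(a <- s) h a < thr + n%:R * \sum_a p a * h a)%R%:R) <=
    expR (n%:R * (\sum_a p a) - beta)) ->
  (Pr [set w | forall m, (m < M)%N -> (devsum X P (tile_part m) n w < thr0)%R] <=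
    (expR 1 * n%:R * expR (- (M%:R * beta)))%:E)%E.
Proof.
move=> n0 /andP[d0 d1] thr01 H.
have K0 : 0 <= K by rewrite (le_trans _ (fK 0)).
have [D [q0 [v [mq0 fv]]]] := exists_discretization d0 (proj1 bf) fK.
(* One symbol records the tile, with [M] for all the tiles out of range, and the
   discretized value. *)
pose Q : finType := ('I_M.+1 * 'I_D.+1)%type.
pose q (x : R) : Q := (inord (minn (tile x) M), q0 x).
have mq (a : Q) : measurable (q @^-1` [set a]).
  have -> : q @^-1` [set a] = (if (a.1 < M)%N then tile @^-1` [set (a.1 : nat)]
      else ~` \bigcup_(m in `I_M) (tile @^-1` [set m])) `&` q0 @^-1` [set a.2].
    apply/seteqP; split => x /=; rewrite /q.
      move=> <- /=; split => //; rewrite inordK ?ltnS ?geq_minr//.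
      case: (ltnP (tile x) M) => tM.
        by rewrite tM.
      by rewrite ltnn /= => -[m/= mM xm]; move: tM; rewrite xm leqNgt mM.
    move=> [ha qa]; rewrite qa; case: a ha qa => a1 a2 /= ha qa; congr pair.
    apply/val_inj; rewrite /= inordK ?ltnS ?geq_minr//.
    case: ifP ha => [aM /= ->|aM /= ha]; first by rewrite (minn_idPl (ltnW aM)).
    have tM : (M <= tile x)%N by rewrite leqNgt; apply/negP => tM; apply: ha; exists (tile x).
    rewrite (minn_idPr tM); apply/eqP; rewrite eqn_leq leqNgt aM/=.
    by rewrite -ltnS; exact: ltn_ord.
  apply: measurableI => //; case: ifP => _; first exact: mtile.
  by apply: measurableC; apply: bigcup_measurable => m _.
pose p := weight P q.
have p0 a : 0 <= p a by exact: weight_ge0.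
have p1 : \sum_a p a = 1 by exact: sum_weight.
pose tl (a : Q) : nat := a.1.
have tlq x m : (m < M)%N -> (tl (q x) == m) = (tile x == m).
  move=> mM; rewrite /tl /q /= inordK ?ltnS ?geq_minr//.
  case: (ltnP (tile x) M) => tM; first by [].
  by rewrite !gtn_eqF// (leq_trans mM).
pose h m (a : Q) := v a.2 * (tl a == m)%:R.
have hf m x : (m < M)%N -> `|h m (q x) - tile_part m x| <= del.
  move=> mM; rewrite /h /tile_part tlq// -mulrBl normrM distrC.
  have fvx : `|f x - v (q x).2| <= del by exact: (fv x).
  rewrite -[leRHS]mulr1; apply: ler_pM => //.
  by rewrite normr_nat; case: (_ == _).
have sumE m (g : Q -> R) : (m < M)%N ->
    \sum_a on_block p (fun a => tl a == m) a * g a = EP (fun x => (tile x == m)%:R * g (q x)).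
  move=> mM; under eq_bigr do rewrite /on_block -mulrA.
  rewrite -(Rintegral_finite P mq (fun a => (tl a == m)%:R * g a)).
  by apply: eq_Rintegral => x _; rewrite tlq.
pose e m := n%:R * \sum_a on_block p (fun a => tl a == m) a * h m a.
pose F (m : nat) (s : seq Q) : R := (\sum_(a <- s) h m a < thr + e m)%R%:R.
have F0 m s : 0 <= F m s by exact: ler0n.
have Fm m s : F m s = F m (seq.filter (fun a => tl a == m) s).
  rewrite /F big_filter [in RHS]big_mkcond/=; congr ((_ < _)%R%:R).
  by apply: eq_bigr => a _; rewrite /h; case: eqP => // _; rewrite mulr0.
have Fb (m : 'I_M) : poisson_exp (on_block p (fun a => tl a == m)) n%:R n.+1 (F m) <=
    expR (n%:R * (\sum_a on_block p (fun a => tl a == m) a) - (fun=> beta) m).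
  apply: (H m _ _ (h m)) => //.
  - exact: on_block_ge0.
  - move=> a; rewrite /on_block mulf_eq0 negb_or => /andP[pa _].
    have [x qx] : exists x, q x = a.
      apply: contrapT => Hx; move/eqP: pa; apply; rewrite /p /weight.
      rewrite (_ : q @^-1` [set a] = set0) ?measure0//.
      by apply/seteqP; split => x //= xa; apply: Hx; exists x.
    have := hf m x (ltn_ord m); rewrite qx => hx.
    have fx : `|tile_part m x| <= K.
      rewrite /tile_part normrM -[leRHS]mulr1; apply: ler_pM => //.
      by rewrite normr_nat; case: (_ == _).
    rewrite -(subrK (tile_part m x) (h m a)) addrC; apply: le_trans (ler_normD _ _) _.
    by apply: lerD => //; exact: le_trans d1.
  - transitivity (\sum_a on_block p (fun a => tl a == m) a * (fun=> 1) a).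
      by apply: eq_bigr => a _; rewrite mulr1.
    rewrite (sumE m (fun=> 1) (ltn_ord m)) /tile_prob.
    by apply: eq_Rintegral => x _; rewrite mulr1.
  - rewrite (sumE m (fun a => h m a ^+ 2) (ltn_ord m)).
    have bh : bmf (fun x => (tile x == m)%:R * h m (q x) ^+ 2).
      apply: bmfM; first exact: bmf_tile.
      by apply: bmfX; exact: (bmf_finite mq).
    rewrite -(Rintegral_bmfB measurableT finP bh); last by apply: bmfX; exact: bmf_tile_part.
    apply: EP_norm_le; first by apply: bmfB => //; apply: bmfX; exact: bmf_tile_part.
    move=> x; rewrite /h tlq ?ltn_ord// /tile_part; case: eqP => [_|_]; last first.
      by rewrite !mulr0 mul0r expr0n subrr normr0; nonneg.
    rewrite !mulr1 mul1r subr_sqr normrM; apply: ler_pM => //.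
      by rewrite distrC; exact: fv.
    rewrite (_ : v (q0 x) + f x = (v (q0 x) - f x) + 2 * f x); last by ring.
    apply: le_trans (ler_normD _ _) _; rewrite [leRHS]addrC; apply: lerD.
      by rewrite distrC (le_trans (fv x)).
    by rewrite normrM ger0_norm// ler_pM2l.
have LB := blocks_bound p0 p1 n0 F0 Fm Fb.
have Eb : \sum_(m < M) beta = M%:R * beta by rewrite sumr_const card_ord mulr_natl.
rewrite Eb in LB.
pose A (s : seq Q) := [forall m : 'I_M, \sum_(a <- s) h m a < thr + e m].
have FA s : \prod_(m < M) F m s = (A s)%:R.
  rewrite /A; case: forallP => [Hs|Hs].
    by rewrite big1// => m _; rewrite /F Hs.
  have [m Hm] : exists m : 'I_M, ~~ (\sum_(a <- s) h m a < thr + e m).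
    by apply: contrapT => H2; apply: Hs => m; apply: contrapT => /negP H3; apply: H2; exists m.
  by rewrite (bigD1 m)//= /F (negbTE Hm) mul0r.
have [mA PA] := Pr_draws iid mq n A.
apply: (@le_trans _ _ (Pr [set w | A (draws X q n w)])); last first.
  by rewrite PA lee_fin -(eq_seq_exp _ _ FA).
have mE : measurable [set w | forall m, (m < M)%N -> devsum X P (tile_part m) n w < thr0].
  have -> : [set w | forall m, (m < M)%N -> devsum X P (tile_part m) n w < thr0] =
      \bigcap_(m in `I_M) (setT `&` devsum X P (tile_part m) n @^-1` `]-oo, thr0[).
    apply/seteqP; split => w /= Hw m mM.
      by split => //; rewrite /= in_itv/=; exact: Hw.
    by have [_] := Hw m mM; rewrite /= in_itv/=.
  apply: bigcap_measurableType => m _.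
  apply: measurable_devsum => //; exact: (proj1 (bmf_tile_part m)).
apply: le_measure; rewrite ?inE//.
move=> w /= Hw; apply/forallP => m.
have := Hw m (ltn_ord m); rewrite /devsum /draws big_map.
have -> : iota 0 n = index_iota 0 n by rewrite /index_iota subn0.
rewrite big_mkord sumrB sumr_const card_ord -[X in _ - X]mulr_natl => h1.
have bhq : bmf (fun x => h m (q x)) by exact: (bmf_finite mq).
have he : `|EP (fun x => h m (q x)) - EP (tile_part m)| <= del.
  rewrite -(Rintegral_bmfB measurableT finP bhq (bmf_tile_part m)).
  apply: EP_norm_le; first by apply: bmfB => //; exact: bmf_tile_part.
  by move=> x; exact: hf.
have eE : e m = n%:R * EP (fun x => h m (q x)).
  rewrite /e sumE//; congr (_ * _); apply: eq_Rintegral => x _.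
  by rewrite /h tlq//; case: (_ == _); rewrite ?mul1r ?mulr0.
have hs : \sum_(i < n) h m (q (X i w)) <= \sum_(i < n) tile_part m (X i w) + n%:R * del.
  rewrite -lerBlDl -sumrB.
  apply: (@le_trans _ _ (\sum_(i < n) del)); last by rewrite sumr_const card_ord mulr_natl.
  by apply: ler_sum => i _; apply: le_trans (ler_norm _) (hf m _ (ltn_ord m)).
apply: le_lt_trans hs _; rewrite eE.
have : n%:R * EP (tile_part m) <= n%:R * (EP (fun x => h m (q x)) + del).
  apply: ler_wpM2l => //; rewrite -lerBlDl -normrN opprB in he *.
  by apply: le_trans he; exact: ler_norm.
rewrite mulrDr; move: h1 thr01; lra.
Qed.

End Tiles.

Section LevelTuning.
Context {R : realType}.

Lemma sqrt_levels (jj : nat) (n : nat) : (0 < n)%N ->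
  let sg : R := Num.sqrt (jj%:R * 2 ^+ jj / n%:R) in
  let S : R := Num.sqrt (jj%:R * n%:R / 2 ^+ jj) in
  sg * S = jj%:R /\ sg ^+ 2 * (n%:R / 2 ^+ jj) = jj%:R.
Proof.
move=> n0 sg S; have n0' : 0 < n%:R :> R by rewrite ltr0n.
have p0 : 0 < 2 ^+ jj :> R by rewrite exprn_gt0.
split.
  rewrite /sg /S -sqrtrM; last by nonneg.
  have -> : jj%:R * 2 ^+ jj / n%:R * (jj%:R * n%:R / 2 ^+ jj) = jj%:R ^+ 2 :> R.
    by field; rewrite !gt_eqF.
  by rewrite sqrtr_sqr ger0_norm.
rewrite /sg sqr_sqrtr; last by nonneg.
by field; rewrite !gt_eqF.
Qed.

Lemma expR_le_inv (w : R) : w < 1 -> expR w <= (1 - w)^-1.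
Proof.
move=> w1; have := expR_ge1Dx (- w); rewrite expRN => h.
by rewrite -lef_pV2 ?posrE ?expR_gt0 ?invr_gt0 ?subr_gt0// invrK.
Qed.

(** The tilt is [y * sg] with [sg] of order [sqrt (j * 2 ^ j / n)], hence small,
    so that the cumulants are Gaussian up to a factor [1 + eps]; the tuning then
    gives the three exponents. *)
Lemma block_numeric (x v del K : R) (eps := del ^+ 2 / 36) (a := x ^+ 2 / v) :
  0 < x -> 0 < v -> 0 < del <= 1 -> 0 <= K ->
  exists eta : R, exists2 J0 : nat, 0 < eta &
  forall (n jj : nat) (Q : finType) (p h : Q -> R),
    (0 < n)%N -> (J0 <= jj)%N -> jj%:R * 2 ^+ jj <= eta * n%:R ->
    (forall a, 0 <= p a) -> (forall a, p a != 0 -> `|h a| <= K + 1) ->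
    \sum_a p a <= ln 2 / 2 ->
    (1 - eps / 2) * (v / 2 ^+ jj) <= \sum_a p a * h a ^+ 2 <= (1 + eps / 2) * (v / 2 ^+ jj) ->
    poisson_exp p n%:R n.+1
      (fun s => (\sum_(a <- s) h a < x * Num.sqrt (jj%:R * n%:R / 2 ^+ jj) +
         n%:R * \sum_a p a * h a)%R%:R) <=
    expR (n%:R * (\sum_a p a) - expR (- (a * (1 / 2 + 4 * del)) * jj%:R) / 4).
Proof.
move=> x0 v0 d01 K0; have /andP[d0 d1] := d01.
have a0 : 0 < a by rewrite divr_gt0// exprn_gt0.
have e0 : 0 < eps by rewrite divr_gt0// exprn_gt0.
have e1 : eps <= 1.
  rewrite ler_pdivrMr// mul1r (le_trans _ (_ : 1 <= 36)) ?ler1n//.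
  by rewrite expr_le1// ltW.
pose y := x * (1 + del) / v; pose z := x * del / v; pose x' := x * (1 + 2 * del).
have z0 : 0 < z by rewrite divr_gt0// mulr_gt0.
have yz : y - z = x / v by rewrite /y /z; field; rewrite gt_eqF.
have yz0 : 0 < y - z by rewrite yz divr_gt0.
have y0 : 0 < y by lra.
have K1 : 0 < K + 1 by lra.
have yle : y <= y + z by lra.
pose w := eps / 8.
have w0 : 0 < w by rewrite divr_gt0.
have w8 : w <= 1 / 8 by rewrite /w; lra.
(* As long as [sg <= reta], every tilt in use times [K + 1] is at most [w]. *)
pose reta := w / ((y + z) * (K + 1)).
have yz1 : 0 < (y + z) * (K + 1) by rewrite mulr_gt0// addr_gt0.
have reta0 : 0 < reta by rewrite divr_gt0.
exists (reta ^+ 2), (Num.truncn (ln 8 / (a * (del ^+ 2 / 4)))).+1; first by rewrite exprn_gt0.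
move=> n jj Q p h n0 jJ jn p0 hK pl /andP[V1 V2].
have n0' : 0 < n%:R :> R by rewrite ltr0n.
have q0 : 0 < 2 ^+ jj :> R by rewrite exprn_gt0.
have [sgS sg2] := sqrt_levels jj n0.
move: sgS sg2; set sg := Num.sqrt _; set S := Num.sqrt _ => sgS sg2.
have sg0 : 0 <= sg by exact: sqrtr_ge0.
have sgr : sg <= reta.
  rewrite -(ger0_norm (ltW reta0)) -sqrtr_sqr ler_wsqrtr// ler_pdivrMr//.
have small l : 0 <= l -> l <= y + z -> `|l * sg| * (K + 1) <= w.
  move=> l0 ly; rewrite ger0_norm; last by rewrite mulr_ge0.
  apply: (@le_trans _ _ ((y + z) * reta * (K + 1))).
    by apply: ler_wpM2r; [exact: ltW | apply: ler_pM].
  by rewrite /reta mulrAC mulrC divfK// gt_eqF.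
have nV (b : R) : n%:R * (b * (v / 2 ^+ jj)) = b * v * (n%:R / 2 ^+ jj) by ring.
have up l : 0 <= l -> l <= y + z -> cumulant p h n (l * sg) <= (1 + eps) * (l ^+ 2 / 2 * v * jj%:R).
  move=> l0 ly; have nV2 : n%:R * (\sum_a p a * h a ^+ 2) <= n%:R * ((1 + eps / 2) * (v / 2 ^+ jj)) by rewrite ler_pM2l.
  apply: le_trans (cumulant_le (l * sg) p0 hK nV2) _.
  rewrite nV exprMn.
  have ex : expR (`|l * sg| * (K + 1)) <= (1 - w)^-1.
    apply: (@le_trans _ _ (expR w)); first by rewrite ler_expR small.
    by apply: expR_le_inv; lra.
  have w1 : 0 < 1 - w by lra.
  have ex2 : expR (`|l * sg| * (K + 1)) * (1 + eps / 2) <= 1 + eps.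
    apply: (@le_trans _ _ ((1 - w)^-1 * (1 + eps / 2))).
      by apply: ler_wpM2r => //; lra.
    rewrite ler_pdivrMl// /w; have : eps ^+ 2 <= eps by rewrite expr2 ler_piMl// ltW.
    by rewrite expr2; lra.
  have -> : l ^+ 2 * sg ^+ 2 / 2 * expR (`|l * sg| * (K + 1)) * ((1 + eps / 2) * v * (n%:R / 2 ^+ jj)) =
    (expR (`|l * sg| * (K + 1)) * (1 + eps / 2)) * (l ^+ 2 / 2 * v * (sg ^+ 2 * (n%:R / 2 ^+ jj))) by ring.
  by rewrite sg2; apply: ler_wpM2r => //; nonneg.
have lo : (1 - eps) * (y ^+ 2 / 2 * v * jj%:R) <= cumulant p h n (y * sg).
  have V10 : 0 <= n%:R * ((1 - eps / 2) * (v / 2 ^+ jj)).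
    by apply: mulr_ge0 => //; apply: mulr_ge0; [lra | nonneg].
  have nV1 : n%:R * ((1 - eps / 2) * (v / 2 ^+ jj)) <= n%:R * (\sum_a p a * h a ^+ 2) by rewrite ler_pM2l.
  have sm := small y (ltW y0) yle.
  have s1 : `|y * sg| * (K + 1) <= 1 by lra.
  apply: le_trans (cumulant_ge p0 hK s1 V10 nV1).
  rewrite nV [(y * sg) ^+ 2]exprMn.
  have ex : 1 - w <= expR (- (`|y * sg| * (K + 1))).
    by apply: le_trans (expR_ge1Dx _); lra.
  have ex2 : 1 - eps <= expR (- (`|y * sg| * (K + 1))) * (1 - eps / 2).
    apply: (@le_trans _ _ ((1 - w) * (1 - eps / 2))).
      have : 0 <= w * eps by nonneg.
      by rewrite /w; lra.
    by apply: ler_wpM2r => //; lra.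
  have -> : y ^+ 2 * sg ^+ 2 / 2 * expR (- (`|y * sg| * (K + 1))) * ((1 - eps / 2) * v * (n%:R / 2 ^+ jj)) =
    (expR (- (`|y * sg| * (K + 1))) * (1 - eps / 2)) * (y ^+ 2 / 2 * v * (sg ^+ 2 * (n%:R / 2 ^+ jj))) by ring.
  by rewrite sg2; apply: ler_wpM2r => //; nonneg.
have yzy : y - z <= y + z by lra.
have U1 := up (y - z) (ltW yz0) yzy.
have yz2 : 0 <= y + z by lra.
have U2 := up (y + z) yz2 (lexx _).
have [T0 T1 T2] := tilt_tuning x0 v0 d01 (ler0n R jj) lo U1 U2.
have lap : laplace p h (y * sg) <= ln 2.
  apply: (@le_trans _ _ (\sum_a p a * 2)); last by rewrite -mulr_suml; lra.
  apply: ler_sum => b _; have [->|pb] := eqVneq (p b) 0; first by rewrite !mul0r.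
  apply: ler_wpM2l => //.
  have sm := small y (ltW y0) yle.
  apply: (@le_trans _ _ (expR w)).
    rewrite ler_expR (le_trans (ler_norm _))// normrM; apply: le_trans sm.
    by apply: ler_wpM2l => //; exact: hK.
  apply: (@le_trans _ _ (1 - w)^-1); first by apply: expR_le_inv; lra.
  by rewrite -[leRHS]invrK lef_pV2 ?posrE//; lra.
have ysg0 : 0 <= y * sg by rewrite mulr_ge0// ltW.
have zsg0 : 0 <= z * sg by rewrite mulr_ge0// ltW.
have BT := block_tail_centered (n := n) (x * S) (x' * S) p0 ysg0 zsg0 lap erefl.
apply: (le_trans BT).
rewrite ler_expR lerB//.
have <- : (y - z) * sg = y * sg - z * sg by ring.
have <- : (y + z) * sg = y * sg + z * sg by ring.
have -> : y * sg * (x' * S) = y * x' * jj%:R by rewrite -sgS; ring.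
have -> : z * sg * (x * S) = z * x * jj%:R by rewrite -sgS; ring.
have -> : z * sg * (x' * S) = z * x' * jj%:R by rewrite -sgS; ring.
have j8 : expR (- (a * (del ^+ 2 / 4)) * jj%:R) <= 1 / 8.
  have -> : 1 / 8 = expR (- ln 8) :> R by rewrite expRN lnK ?posrE// div1r.
  rewrite ler_expR mulNr lerN2.
  have ad : 0 < a * (del ^+ 2 / 4) by rewrite mulr_gt0// divr_gt0// exprn_gt0.
  move: jJ; rewrite truncn_lt_nat; last by apply: divr_ge0; [rewrite ln_ge0// ler1n | exact: ltW].
  by rewrite ltr_pdivrMr// mulrC => /ltW.
apply: ler_pM; [exact: expR_ge0 | by rewrite invr_ge0 | by rewrite ler_expR |].
rewrite -ler_expR in T1; rewrite -ler_expR in T2.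
have := le_trans T1 j8; have := le_trans T2 j8.
by move: (expR _) (expR (_ + _ - _)) => u1 u2; lra.
Qed.

End LevelTuning.

Section LowerLevel.
Context {R : realType} {d : measure_display} {T : measurableType d}.
Variables (Pr : probability T R) (X : nat -> {RV Pr >-> R}) (P : probability R R).
Hypothesis iid : iid_with_law X P.
Local Notation EP f := (\int[P]_x f x).

(** The discretization step is chosen so small that it affects neither the
    thresholds, where [x0 < x] leaves room, nor the second moments. *)
Lemma lower_level (x0 x v del K : R) (a := x ^+ 2 / v) :
  0 <= x0 < x -> 0 < v -> 0 < del <= 1 -> 0 <= K ->
  exists eta : R, exists2 J0 : nat, 0 < eta &
  forall (n jj M : nat) (f : R -> R) (tile : R -> nat),
    (0 < n)%N -> (0 < jj)%N -> (J0 <= jj)%N -> jj%:R * 2 ^+ jj <= eta * n%:R ->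
    bmf f -> (forall z, `|f z| <= K) -> (forall m, measurable (tile @^-1` [set m])) ->
    (forall m, (m < M)%N -> tile_prob P tile m <= ln 2 / 2) ->
    (forall m, (m < M)%N -> (1 - del ^+ 2 / 144) * (v / 2 ^+ jj) <=
       EP (fun z => tile_part f tile m z ^+ 2) <= v / 2 ^+ jj) ->
  (Pr [set w | forall m, (m < M)%N ->
      (devsum X P (tile_part f tile m) n w < x0 * Num.sqrt (jj%:R * n%:R / 2 ^+ jj))%R] <=
    (expR 1 * n%:R * expR (- (M%:R * (expR (- (a * (1 / 2 + 4 * del)) * jj%:R) / 4))))%:E)%E.
Proof.
move=> /andP[x00 x0x] v0 d01 K0; have /andP[d0 d1] := d01.
have xp : 0 < x by exact: le_lt_trans x0x.
have [eta [J0 e0 H]] := block_numeric xp v0 d01 K0.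
exists eta, J0 => // n jj M f tile n0 j0 jJ jn bf fK mtile tp tv.
have n0' : 0 < n%:R :> R by rewrite ltr0n.
have q0 : 0 < 2 ^+ jj :> R by rewrite exprn_gt0.
have K1 : 0 < 2 * K + 1 by lra.
set S := Num.sqrt _ in H *.
have S0 : 0 < S by rewrite sqrtr_gt0 divr_gt0// mulr_gt0// ltr0n.
pose eps := del ^+ 2 / 144.
have ep0 : 0 < eps by rewrite divr_gt0// exprn_gt0.
pose c1 := (x - x0) * S / (2 * n%:R).
pose c2 := eps * (v / 2 ^+ jj) / (2 * K + 1).
have c10 : 0 < c1 by rewrite divr_gt0 ?mulr_gt0// subr_gt0.
have c20 : 0 < c2 by rewrite divr_gt0 ?mulr_gt0// divr_gt0.
pose dd := Order.min 1 (Order.min c1 c2).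
have dd0 : 0 < dd <= 1 by rewrite ge_min lexx andbT /= !lt_min ltr01 c10 c20.
have ddc1 : dd <= c1 by rewrite !ge_min lexx orbT.
have ddc2 : dd <= c2 by rewrite !ge_min lexx !orbT.
apply: (tiles_event_le iid bf fK mtile n0 dd0 (thr := x * S)).
  have : n%:R * dd <= n%:R * c1 by rewrite ler_pM2l.
  have -> : n%:R * c1 = (x - x0) * S / 2 by rewrite /c1; field; rewrite gt_eqF.
  by rewrite mulrBl; lra.
move=> m Q p h mM p0 hK pE pV.
apply: H => //.
- by rewrite pE tp.
have dc : dd * (2 * K + 1) <= eps * (v / 2 ^+ jj) by rewrite -ler_pdivlMr.
have := le_trans pV dc; rewrite ler_norml => /andP[h1 h2].
have /andP[h3 h4] := tv _ mM.
have e2 : del ^+ 2 / 36 / 2 = 2 * eps by rewrite /eps; field.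
rewrite e2; move: h1 h2 h3 h4; rewrite -/eps !mulrBl !mulrDl !mul1r.
have vp : 0 <= eps * (v / 2 ^+ jj) by apply: mulr_ge0; nonneg.
by move: (eps * _) vp => u u0 *; apply/andP; split; lra.
Qed.

End LowerLevel.

(** * Lower bound: tiles of nearly maximal mass *)

Section Intervals.
Context {R : realType}.
Local Notation mu := (@lebesgue_measure R).
Variables (P : probability R R) (p0 : R -> R).
Hypothesis dens : has_bounded_density P p0.
Local Notation M0 := (density_norm p0).

(** Lebesgue measure being an infimum over countable covers by intervals, a
    bound on the law of intervals extends to measurable sets. *)
Lemma interval_domination (c : R) (A : set R) : 0 <= c ->
  (forall a b : R, a < b -> (P `]a, b]%classic <= (c * (b - a))%:E)%E) ->
  measurable A -> (mu A < +oo)%E -> (P A <= c%:E * mu A)%E.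
Proof.
move=> c0 H mA muA.
have fA : mu A \is a fin_num by rewrite ge0_fin_numE.
apply/lee_addgt0Pr => e e0.
have e1 : 0 < e / (c + 1) by rewrite divr_gt0// ltr_wpDl.
have /ereal_inf_lt[z [/= F [mF AF] Fz zDe]] : (mu A < mu A + (e / (c + 1))%:E)%E.
  by rewrite lte_spaddre ?lte_fin.
have Fk k : measurable (F k : set R) /\ (P (F k) <= c%:E * wlength idfun (F k))%E.
  have /ocitvP[->|[[a b] /= ab ->]] : ocitv (F k) by exact: mF.
    by rewrite wlength0 mule0 measure0; split => //; exact: measurable0.
  split; first exact: measurable_itv.
  by rewrite wlength_itv_bnd ?(ltW ab)//= -EFinM; exact: H.
apply: (@le_trans _ _ (\sum_(k <oo) P (F k))%E).
  by apply: measure_sigma_subadditive => // k; case: (Fk k).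
apply: (@le_trans _ _ (\sum_(k <oo) c%:E * wlength idfun (F k))%E).
  by apply: lee_nneseries => [//|k _]; case: (Fk k).
rewrite nneseriesZl//.
rewrite Fz; apply: (@le_trans _ _ (c%:E * (mu A + (e / (c + 1))%:E))%E).
  by apply: lee_wpmul2l; [rewrite lee_fin | exact: ltW].
rewrite muleDr ?fin_num_adde_defl// -EFinM; apply: leeD => //.
rewrite lee_fin mulrCA ger_pMr// ler_pdivrMr ?mul1r ?lerDl//.
by rewrite ltr_wpDl.
Qed.

(** Otherwise the domination on intervals would extend to the set where the
    density exceeds a constant above [c], which has positive measure. *)
Lemma interval_mass (c : R) : 0 <= c -> c < M0 ->
  exists a b : R, a < b /\ ((c * (b - a))%:E < P `]a, b]%classic)%E.
Proof.
move=> c0 cM; apply: contrapT => H.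
have {}H a b : a < b -> (P `]a, b]%classic <= (c * (b - a))%:E)%E.
  by move=> ab; rewrite leNgt; apply/negP => H2; apply: H; exists a, b.
pose c' := (c + M0) / 2.
have cc' : c < c' by rewrite /c'; lra.
have c'M : c' < M0 by rewrite /c'; lra.
have c'0 : 0 < c' by lra.
have mup := density_gt_measure dens c'M.
set A := [set x | _] in mup.
have [mp0 _ _ Pp0] := dens.
have mA : measurable A.
  by rewrite -[X in measurable X]setTI /A -preimage_itvoy; apply: mp0.
have low : (c'%:E * mu A <= P A)%E.
  rewrite Pp0//.
  have -> : (c'%:E * mu A = \int[mu]_(x in A) c'%:E)%E by rewrite integral_cst.
  apply: ge0_le_integral => //.
  - by move=> x _; rewrite lee_fin ltW.
  - by apply/measurable_EFinP; exact: measurable_funTS.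
  - by move=> x /= Ax; rewrite lee_fin ltW.
have fA : (mu A < +oo)%E.
  rewrite ltNge leye_eq; apply/negP => /eqP E; move: low.
  rewrite E gt0_muley ?lte_fin// leye_eq => /eqP E2.
  by have := probability_le1 P mA; rewrite E2.
have hi := interval_domination c0 H mA fA.
have := le_trans low hi.
rewrite lee_pmul2r ?lee_fin ?ge0_fin_numE//.
by rewrite leNgt cc'.
Qed.

End Intervals.

Section GoodTiles.
Context {R : realType}.
Local Notation mu := (@lebesgue_measure R).
Variables (P : probability R R) (p0 : R -> R).
Hypothesis dens : has_bounded_density P p0.
Local Notation M0 := (density_norm p0).
Local Notation EP f := (\int[P]_x f x).
Variable L : nat.
Hypothesis L0 : (0 < L)%N.

Let finP : (P setT < +oo)%E. Proof. by rewrite probability_setT ltry. Qed.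
Let LR : 0 < L%:R :> R. Proof. by rewrite ltr0n. Qed.

(** Tiles are the intervals of length [2 * L / 2 ^ j]; in the scale of the level,
    each is a translate of this window by a multiple of [2 * L]. *)
Definition window : set R := `[- L%:R, L%:R[%classic.

Definition tile_index (j : nat) (x : R) : int :=
  Num.floor ((2 ^+ j * x + L%:R) / (2 * L%:R)).

Definition tile_center (k : int) : int := (2 * L)%:Z * k.

Lemma tile_indexE j x k : (tile_index j x == k)%:R =
  cell_fun (\1_window : R -> R) j (tile_center k) x :> R.
Proof.
have L2 : 0 < 2 * L%:R :> R by rewrite mulr_gt0.
rewrite /cell_fun indicE; congr (nat_of_bool _)%:R; apply/idP/idP => [/eqP <-|].
  rewrite inE /window /= in_itv/=.
  have /andP[] := floor_itv ((2 ^+ j * x + L%:R) / (2 * L%:R) : R).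
  rewrite -/(tile_index j x) /tile_center ler_pdivlMr// ltr_pdivrMr//.
  rewrite !rmorphM rmorphD/= -pmulrn natrM; move: (_%:~R) => k' h1 h2.
  by apply/andP; split; lra.
rewrite inE /window /= in_itv/= /tile_center !rmorphM/= -pmulrn natrM => /andP[h1 h2].
apply/eqP; apply: floor_eqP; rewrite ler_pdivlMr// ltr_pdivrMr// rmorphD/=.
by move: (k%:~R) h1 h2 => k' h1 h2; apply/andP; split; lra.
Qed.

Lemma bmf_window : bmf (\1_window : R -> R).
Proof. by apply: bmf_indic; exact: measurable_itv. Qed.

Lemma integral_window : (\int[mu]_x (\1_window x)%:E <= (2 * L%:R)%:E)%E.
Proof.
have W : mu window = (2 * L%:R)%:E.
  rewrite /window lebesgue_measure_itv/= lte_fin ifT; last by rewrite gtrN.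
  by rewrite -EFinB; congr EFin; ring.
rewrite integral_indic//; last exact: measurable_itv.
by rewrite setIT -W.
Qed.

Lemma measurable_tile j k : measurable (tile_index j @^-1` [set k]).
Proof.
rewrite (_ : _ @^-1` _ = cell_fun (\1_window : R -> R) j (tile_center k) @^-1` [set 1]).
  rewrite -[X in measurable X]setTI.
  have [mf _] := bmf_rescale (2 ^+ j) (tile_center k)%:~R bmf_window.
  by apply: mf => //; exact: measurable_set1.
apply/seteqP; split => x /=; rewrite -tile_indexE; first by move=> ->; rewrite eqxx.
by case: eqP => // _ /eqP; rewrite eq_sym oner_eq0.
Qed.

Lemma tile_prob_le j k : EP (fun x => (tile_index j x == k)%:R) <= M0 / 2 ^+ j * (2 * L%:R).
Proof.
under eq_Rintegral do rewrite tile_indexE.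
apply: (EP_rescale_le dens); first by rewrite exprn_gt0.
- exact: bmf_window.
- by move=> x; rewrite indicE.
- exact: integral_window.
Qed.

Lemma bmf_tile_index j k : bmf (fun x => (tile_index j x == k)%:R : R).
Proof.
rewrite (_ : (fun x => _) = cell_fun (\1_window : R -> R) j (tile_center k)).
  by apply: bmf_rescale; exact: bmf_window.
by apply/funext => x; rewrite tile_indexE.
Qed.

(** The tiles meeting an interval of nearly maximal mass carry that mass together,
    and none of them exceeds the maximum, so a fixed proportion of them must come
    close to it. *)
Lemma good_tiles (eta : R) : 0 < eta <= 1 / 4 -> 0 < M0 ->
  exists c : R, exists2 J : nat, 0 < c & forall j, (J <= j)%N ->
  exists gs : seq int, [/\ uniq gs, c * 2 ^+ j <= (size gs)%:R &
    forall k, k \in gs -> (1 - 3 * eta) * (M0 / 2 ^+ j * (2 * L%:R)) <=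
      EP (fun x => (tile_index j x == k)%:R)].
Proof.
move=> /andP[e0 e1] M00.
have c0 : 0 <= (1 - 2 * eta) * M0 by apply: mulr_ge0; lra.
have cM : (1 - 2 * eta) * M0 < M0 by rewrite gtr_pMl//; lra.
have [a [b [ab Pab]]] := interval_mass dens c0 cM.
have ba : 0 < b - a by rewrite subr_gt0.
have L2 : 0 < 2 * L%:R :> R by rewrite mulr_gt0.
pose c := eta * (b - a) / (4 * L%:R).
have cp : 0 < c by rewrite divr_gt0 ?mulr_gt0.
exists c, (Num.truncn (2 / c)).+1 => // j jJ.
have q0 : 0 < 2 ^+ j :> R by rewrite exprn_gt0.
pose w : R := 2 * L%:R / 2 ^+ j.
have w0 : 0 < w by rewrite divr_gt0.
have Mw k : EP (fun x => (tile_index j x == k)%:R) <= M0 * w.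
  apply: le_trans (tile_prob_le _ _) _.
  by rewrite le_eqVlt; apply/orP; left; apply/eqP; rewrite /w; field; rewrite gt_eqF.
pose ka := tile_index j a; pose kb := tile_index j b.
have mono x y : x <= y -> tile_index j x <= tile_index j y.
  by move=> xy; apply: le_floor; rewrite ler_pM2r ?invr_gt0// lerD2r ler_pM2l.
have kab : ka <= kb by apply: mono; exact: ltW.
pose N := `|kb - ka|%N.+1.
pose ks := [seq ka + i%:Z | i <- iota 0 N].
have uks : uniq ks by rewrite map_inj_uniq ?iota_uniq// => i i' /addrI [].
pose t k := EP (fun x => (tile_index j x == k)%:R).
pose good k := (1 - 3 * eta) * (M0 * w) <= t k.
exists [seq k <- ks | good k]; split.
- exact: filter_uniq.
- have cover : fine (P `]a, b]%classic) <= \sum_(k <- ks) t k.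
    rewrite -(@Rintegral_bmf_sum _ _ _ P setT measurableT finP _ ks (fun k x => (tile_index j x == k)%:R)); last first.
      by move=> k; exact: bmf_tile_index.
    have -> : fine (P `]a, b]%classic) = EP (\1_`]a, b]%classic).
      rewrite /Rintegral integral_indic ?setIT//.
    apply: le_EP.
    + by apply: bmf_indic; exact: measurable_itv.
    + by apply: bmf_sum => k; exact: bmf_tile_index.
    + move=> x; rewrite indicE; case: (boolP (x \in _)) => [|_]; last by apply: sumr_ge0.
      rewrite inE/= in_itv/= => /andP[ax xb].
      have kx : tile_index j x \in ks.
        have h1 : ka <= tile_index j x by apply: mono; exact: ltW.
        have h2 : tile_index j x <= kb by exact: mono.
        apply/mapP; exists `|tile_index j x - ka|%N.
          rewrite mem_iota add0n /N /=; move: h1 h2 kab; clear; lia.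
        by move: h1; clear; lia.
      rewrite (bigD1_seq _ kx uks)/= eqxx lerDl; exact: sumr_ge0.
  (* Bad tiles miss a proportion [3 * eta] of the largest mass, while the interval
     as a whole misses only [2 * eta]. *)
  have split_sum : \sum_(k <- ks) t k <= (size [seq k <- ks | good k])%:R * (M0 * w) +
      N%:R * ((1 - 3 * eta) * (M0 * w)).
    rewrite (bigID good)/= -big_filter; apply: lerD.
      apply: (@le_trans _ _ (\sum_(k <- [seq k <- ks | good k]) (M0 * w))).
        by apply: ler_sum => k _; exact: Mw.
      by rewrite big_const_seq count_predT iter_addr_0 mulr_natl.
    apply: (@le_trans _ _ (\sum_(k <- ks) ((1 - 3 * eta) * (M0 * w)))).
      rewrite big_mkcond; apply: ler_sum => k _; case: ifP => [|_].
        by rewrite /good -ltNge => /ltW.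
      by apply: mulr_ge0; [lra | rewrite mulr_ge0// ltW].
    by rewrite big_const_seq count_predT iter_addr_0 size_map size_iota [leRHS]mulr_natl.
  have NW : N%:R * w <= (b - a) + 2 * w.
    have hb : kb%:~R <= (2 ^+ j * b + L%:R) / (2 * L%:R) :> R by exact: floor_le.
    have ha : (2 ^+ j * a + L%:R) / (2 * L%:R) < ka%:~R + 1 :> R.
      have /andP[_] := floor_itv ((2 ^+ j * a + L%:R) / (2 * L%:R) : R).
      by rewrite rmorphD.
    have Nk : N%:R = kb%:~R - ka%:~R + 1 :> R.
      rewrite -natr1; congr (_ + 1); rewrite -rmorphB/= pmulrn.
      by congr (_%:~R); move: kab; clear; lia.
    have : N%:R <= (b - a) / w + 2.
      rewrite Nk; have -> : (b - a) / w = (2 ^+ j * b + L%:R) / (2 * L%:R) - (2 ^+ j * a + L%:R) / (2 * L%:R).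
        by rewrite /w; field; rewrite !gt_eqF.
      by lra.
    by move=> h; apply: le_trans (ler_wpM2r (ltW w0) h) _; rewrite mulrDl divfK ?gt_eqF.
  have fP : (P `]a, b]%classic) \is a fin_num by apply: fin_num_measure; exact: measurable_itv.
  have Pab' : (1 - 2 * eta) * M0 * (b - a) <= fine (P `]a, b]%classic).
    by rewrite -lee_fin fineK// ltW.
  set S := (size _)%:R in split_sum *.
  have H1 := le_trans Pab' (le_trans cover split_sum).
  have H2 : eta * (b - a) <= (S + 2) * w.
    have H3 : N%:R * ((1 - 3 * eta) * (M0 * w)) <= (1 - 3 * eta) * M0 * (b - a + 2 * w).
      have -> : N%:R * ((1 - 3 * eta) * (M0 * w)) = (1 - 3 * eta) * M0 * (N%:R * w) by ring.
      by apply: ler_wpM2l => //; apply: mulr_ge0; lra.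
    have H4 : M0 * (eta * (b - a)) <= M0 * (S * w + 2 * (1 - 3 * eta) * w).
      have : (1 - 2 * eta) * M0 * (b - a) <= S * (M0 * w) + (1 - 3 * eta) * M0 * (b - a + 2 * w).
        by apply: le_trans H1 _; rewrite lerD2l.
      by move: (b - a) => z; lra.
    move: H4; rewrite ler_pM2l// => H4; apply: le_trans H4 _.
    have : 0 <= eta * w by rewrite mulr_ge0// ltW.
    by lra.
  have c2 : 2 <= c * 2 ^+ j.
    move: jJ; rewrite truncn_lt_nat; last by rewrite divr_ge0// ltW.
    rewrite ltr_pdivrMr// => h; apply/ltW; apply: lt_le_trans h _.
    by rewrite mulrC ler_pM2l// -natrX ler_nat ltnW// ltn_expl.
  have : eta * (b - a) / w <= S + 2 by rewrite ler_pdivrMr.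
  have -> : eta * (b - a) / w = 2 * (c * 2 ^+ j).
    by rewrite /w /c; field; rewrite !gt_eqF.
  by lra.
- move=> k; rewrite mem_filter => /andP[gk _]; move: gk; rewrite /good.
  have -> : M0 / 2 ^+ j * (2 * L%:R) = M0 * w by rewrite /w; field; rewrite gt_eqF.
  by [].
Qed.

End GoodTiles.

Section LowerProb.
Context {R : realType} {d : measure_display} {T : measurableType d}.
Variables (Pr : probability T R) (X : nat -> {RV Pr >-> R}) (P : probability R R).
Hypothesis iid : iid_with_law X P.
Local Notation mu := (@lebesgue_measure R).
Local Notation EP f := (\int[P]_x f x).
Variable p0 : R -> R.
Hypothesis dens : has_bounded_density P p0.
Local Notation M0 := (density_norm p0).
Variables (tau : R) (j : nat -> nat).
Hypothesis adm : admissible_levels tau j.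
Variable L : nat.
Hypothesis L0 : (0 < L)%N.

Let finP : (P setT < +oo)%E. Proof. by rewrite probability_setT ltry. Qed.

Section OneWindow.
Variables (g : R -> R) (K s : R).
Hypotheses (bg : bmf g) (gK : forall z, `|g z| <= K).
Hypothesis supp : forall z, g z = g z * \1_(window L) z.
Hypothesis gs : (\int[mu]_z (g z ^+ 2)%:E = s%:E)%E.

Let K0 : 0 <= K. Proof. by rewrite (le_trans _ (gK 0)). Qed.
Let LR : 0 < L%:R :> R. Proof. by rewrite ltr0n. Qed.

Let cellE jj k x : cell_fun g jj (tile_center L k) x =
  cell_fun g jj (tile_center L k) x * (tile_index L jj x == k)%:R.
Proof. by rewrite tile_indexE// /cell_fun -supp. Qed.

(** Bounding the second moment of [g] from below amounts to bounding from above
    that of the nonnegative deficit [K ^ 2 * \1_window - g ^ 2]. *)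
Lemma window_deficit :
  (\int[mu]_z (K ^+ 2 * \1_(window L) z - g z ^+ 2)%:E <= (K ^+ 2 * (2 * L%:R) - s)%:E)%E.
Proof.
have g2K z : g z ^+ 2 <= K ^+ 2 * \1_(window L) z.
  rewrite supp exprMn -[g z ^+ 2]real_normK ?num_real//; apply: ler_pM; rewrite ?sqr_ge0//.
    by apply: lerXn2r => //; rewrite nnegrE.
  by rewrite indicE; case: (_ \in _) => /=; rewrite ?expr1n// expr0n.
have m1 : measurable_fun setT (fun z => (K ^+ 2 * \1_(window L) z - g z ^+ 2)%:E).
  apply/measurable_EFinP; have [] // : bmf (fun z => K ^+ 2 * \1_(window L) z - g z ^+ 2).
  by apply: bmfB; [apply: bmfZ; exact: bmf_window | exact: bmfX].
have m2 : measurable_fun setT (fun z => (g z ^+ 2)%:E).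
  by apply/measurable_EFinP; have [] := bmfX 2 bg.
have E : (\int[mu]_z (K ^+ 2 * \1_(window L) z - g z ^+ 2)%:E + s%:E =
    \int[mu]_z (K ^+ 2 * \1_(window L) z)%:E)%E.
  rewrite -gs -ge0_integralD//.
  - by apply: eq_integral => z _; rewrite -EFinD subrK.
  - by move=> z _; rewrite lee_fin subr_ge0.
  - by move=> z _; rewrite lee_fin sqr_ge0.
rewrite EFinB leeBrDr// E.
under eq_integral do rewrite EFinM.
rewrite ge0_integralZl//.
- rewrite [leRHS]EFinM; apply: lee_wpmul2l; last exact: integral_window.
  by rewrite lee_fin sqr_ge0.
- by apply/measurable_EFinP; case: (bmf_window L (R := R)).
- by rewrite lee_fin sqr_ge0.
Qed.

(** The deficit has expectation at most [M0 / 2 ^ jj] times its integral, and the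
    mass of the tile turns this into a lower bound on the second moment. *)
Lemma good_tile_moment (jj : nat) (k : int) (eta : R) :
  (1 - 3 * eta) * (M0 / 2 ^+ jj * (2 * L%:R)) <= EP (fun x => (tile_index L jj x == k)%:R) ->
  M0 / 2 ^+ jj * (s - 6 * eta * K ^+ 2 * L%:R) <=
    EP (fun x => cell_fun g jj (tile_center L k) x ^+ 2).
Proof.
move=> H; have q0 : 0 < 2 ^+ jj :> R by rewrite exprn_gt0.
pose h z : R := K ^+ 2 * \1_(window L) z - g z ^+ 2.
have bh : bmf h by apply: bmfB; [apply: bmfZ; exact: bmf_window | exact: bmfX].
have h0 z : 0 <= h z.
  rewrite subr_ge0 supp exprMn -[g z ^+ 2]real_normK ?num_real//; apply: ler_pM; rewrite ?sqr_ge0//.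
    by apply: lerXn2r => //; rewrite nnegrE.
  by rewrite indicE; case: (_ \in _) => /=; rewrite ?expr1n// expr0n.
have H1 := EP_rescale_le dens (tile_center L k)%:~R q0 bh h0 window_deficit.
have bt := bmf_tile_index L0 jj k (R := R).
have -> : EP (fun x => cell_fun g jj (tile_center L k) x ^+ 2) =
    K ^+ 2 * EP (fun x => (tile_index L jj x == k)%:R) -
    EP (fun x => h (2 ^+ jj * x - (tile_center L k)%:~R)).
  rewrite -(Rintegral_bmfZ measurableT finP)// -(Rintegral_bmfB measurableT finP).
  - by apply: eq_Rintegral => x _; rewrite tile_indexE// /h /cell_fun; ring.
  - exact: bmfZ.
  - exact: bmf_rescale.
have H2 : K ^+ 2 * ((1 - 3 * eta) * (M0 / 2 ^+ jj * (2 * L%:R))) <=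
   K ^+ 2 * EP (fun x => (tile_index L jj x == k)%:R).
  by apply: ler_wpM2l => //; exact: sqr_ge0.
have -> : M0 / 2 ^+ jj * (s - 6 * eta * K ^+ 2 * L%:R) =
  K ^+ 2 * ((1 - 3 * eta) * (M0 / 2 ^+ jj * (2 * L%:R))) -
  M0 / 2 ^+ jj * (K ^+ 2 * (2 * L%:R) - s) by ring.
exact: lerB.
Qed.

(** As [j n / ln (ln n) --> +oo], the exponential [expR (ka * j n)] exceeds any
    power of [ln n], hence beats the factor [n] lost in the Poissonization. *)
Lemma rate_limit (ka c e : R) : 0 < ka -> 0 < c -> 0 < e ->
  \forall n \near \oo, expR 1 * n%:R * expR (- (c * expR (ka * (j n)%:R))) <= e.
Proof.
move=> ka0 c0 e0; near=> n.
have n0 : (0 < n)%N by near: n; exact: nbhs_infty_gt.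
have nR : 0 < n%:R :> R by rewrite ltr0n.
have ln1 : 1 <= ln n%:R :> R by near: n; exact: near_le_ln.
have ln2 : 2 / c <= ln n%:R :> R by near: n; exact: near_le_ln.
have ln3 : 1 - ln e <= ln n%:R :> R by near: n; exact: near_le_ln.
have jn : 2 / ka * ln (ln n%:R) <= (j n)%:R by near: n; exact: levels_lnln adm _.
rewrite -[X in _ * X * _]lnK ?posrE// -!expRD -[leRHS]lnK ?posrE// ler_expR.
have y2 : ln n%:R ^+ 2 <= expR (ka * (j n)%:R).
  rewrite -[X in X ^+ 2]lnK ?posrE; last by lra.
  rewrite -expRM_natl ler_expR.
  by move: jn; rewrite mulrAC ler_pdivrMr// mulrC [(j n)%:R * _]mulrC.
have y3 : 2 * ln n%:R <= c * expR (ka * (j n)%:R).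
  apply: (@le_trans _ _ (c * ln n%:R ^+ 2)); last by rewrite ler_pM2l.
  rewrite expr2 mulrA; apply: ler_wpM2r; first by lra.
  by rewrite mulrC -ler_pdivrMr.
by move: (expR (ka * _)) y2 y3 => w; lra.
Unshelve. all: by end_near. Qed.

(** All cell sums being small forces those of the good tiles to be small, an
    event to which the bound for disjoint tiles applies.  The number of good tiles
    is of order [2 ^ j], against a Gaussian tail [2 ^ (- a * j / (2 * ln 2))] with
    [a < 2 * ln 2]. *)
Lemma lower_prob (x0 e : R) : 0 < M0 -> 0 < s -> 0 <= x0 -> x0 ^+ 2 < 2 * ln 2 * (M0 * s) -> 0 < e ->
  \forall n \near \oo, exists2 E, measurable E /\ (Pr E <= e%:E)%E &
    [set w | forall k, devsum X P (cell_fun g (j n) k) n w <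
       x0 * Num.sqrt ((j n)%:R * n%:R / 2 ^+ j n)] `<=` E.
Proof.
move=> M00 s0 x00 hx e0.
have l2 : 0 < ln 2 :> R by rewrite ln_gt0// ltr1n.
pose v := M0 * s; have v0 : 0 < v by rewrite mulr_gt0.
pose x2 := (x0 ^+ 2 + 2 * ln 2 * v) / 2; pose x := Num.sqrt x2.
have x20 : 0 < x2.
  by rewrite divr_gt0// ltr_wpDl ?sqr_ge0// !mulr_gt0.
have xE : x ^+ 2 = x2 by rewrite sqr_sqrtr// ltW.
have xp : 0 < x by rewrite sqrtr_gt0.
have x0x : x0 < x.
  rewrite -(ltr_pXn2r (n := 2))// ?nnegrE ?(ltW xp)// xE /x2.
  by move: hx; rewrite -/v; lra.
pose a := x ^+ 2 / v.
have a0 : 0 < a by rewrite divr_gt0// exprn_gt0.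
have a2 : a < 2 * ln 2.
  by rewrite ltr_pdivrMr// xE /x2; move: hx; rewrite -/v; lra.
pose g0 := ln 2 - a / 2; have g00 : 0 < g0 by rewrite /g0; lra.
pose del := Order.min 1 (g0 / (8 * a)).
have d0 : 0 < del by rewrite lt_min ltr01 divr_gt0// mulr_gt0.
have d1 : del <= 1 by rewrite ge_min lexx.
have d2 : 8 * a * del <= g0.
  rewrite [leLHS]mulrC -ler_pdivlMr; last by rewrite mulr_gt0.
  by rewrite ge_min lexx orbT.
(* The number [2 ^ j] of tiles exceeds the inverse of the tail by the factor
   [expR (ka * j)]. *)
pose ka := ln 2 - a * (1 / 2 + 4 * del).
have ka0 : 0 < ka by rewrite /ka; move: d2 g00; rewrite /g0; lra.
have KL : 0 <= K ^+ 2 * L%:R by nonneg.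
pose dl := del ^+ 2 / 144.
have dl0 : 0 < dl by rewrite divr_gt0// exprn_gt0.
pose eta := Order.min (1 / 4) (dl * s / (6 * (K ^+ 2 * L%:R) + 1)).
have eta0 : 0 < eta by rewrite lt_min !divr_gt0 ?mulr_gt0//; lra.
have eta1 : eta <= 1 / 4 by rewrite ge_min lexx.
have eta2 : 6 * eta * K ^+ 2 * L%:R <= dl * s.
  have h : eta * (6 * (K ^+ 2 * L%:R) + 1) <= dl * s.
    by rewrite -ler_pdivlMr; [rewrite ge_min lexx orbT | lra].
  by apply: le_trans h; rewrite mulrDr mulr1 -[leLHS]addr0; apply: lerD; [lra | exact: ltW].
have eta01 : 0 < eta <= 1 / 4 by rewrite eta0.
have [c [J c0 HJ]] := good_tiles dens L0 eta01 M00.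
have x0x' : 0 <= x0 < x by rewrite x00.
have d01 : 0 < del <= 1 by rewrite d0.
have [et [J0 et0 HL]] := lower_level iid x0x' v0 d01 K0.
have c40 : 0 < c / 4 by rewrite divr_gt0.
near=> n.
have [n0 jn0] : (0 < n)%N /\ (0 < j n)%N by near: n; exact: levels_gt0 adm.
have jJ : (J <= j n)%N by near: n; exact: levels_ge adm _.
have jJ0 : (J0 <= j n)%N by near: n; exact: levels_ge adm _.
have jJ1 : ((Num.truncn (M0 * (4 * L%:R) / ln 2)).+1 <= j n)%N by near: n; exact: levels_ge adm _.
have jn : (j n)%:R * 2 ^+ j n <= et * n%:R by near: n; exact: levels_small adm _ et0.
have rl : expR 1 * n%:R * expR (- (c / 4 * expR (ka * (j n)%:R))) <= e.
  by near: n; exact: rate_limit.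
set jj := j n in jn0 jJ jJ0 jJ1 jn rl *.
have q0 : 0 < 2 ^+ jj :> R by rewrite exprn_gt0.
have [gl [ugl szgl goodgl]] := HJ jj jJ.
pose M := size gl.
pose tile (z : R) := index (tile_index L jj z) gl.
(* The cell functions of distinct tiles have disjoint supports, so that one
   function carries them all. *)
pose f (x : R) := \sum_(k <- gl) cell_fun g jj (tile_center L k) x.
have fE z : f z = if tile_index L jj z \in gl then cell_fun g jj (tile_center L (tile_index L jj z)) z else 0.
  rewrite /f; case: ifP => [kx|kx].
    rewrite (bigD1_seq _ kx ugl)/= big1 ?addr0// => k kk.
    by rewrite cellE eq_sym (negbTE kk) mulr0.
  rewrite big_seq big1// => k kgl; rewrite cellE; case: eqP => [E|_]; last by rewrite mulr0.
  by rewrite E kgl in kx.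
have bf : bmf f by apply: bmf_sum => k; exact: bmf_rescale.
have fK z : `|f z| <= K.
  by rewrite fE; case: ifP => _; [exact: gK | rewrite normr0].
have tileE m z : (m < M)%N -> (tile z == m) = (tile_index L jj z == nth 0 gl m).
  move=> mM; rewrite /tile; apply/eqP/eqP => [zm|->]; last by rewrite index_uniq.
  by rewrite -zm nth_index// -index_mem zm.
have gl_nth m : (m < M)%N -> nth 0 gl m \in gl by move=> mM; exact: mem_nth.
have mtile m : measurable (tile @^-1` [set m]).
  have mlow i : (i < M)%N -> measurable (tile @^-1` [set i]).
    move=> iM; rewrite (_ : _ @^-1` _ = tile_index L jj @^-1` [set nth 0 gl i]).
      exact: measurable_tile.
    by apply/seteqP; split => z /= /eqP; rewrite ?tileE// => /eqP // h; apply/eqP; rewrite tileE//; apply/eqP.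
  have [mM|Mm] := ltnP m M; first exact: mlow.
  have [mE|mM] := eqVneq m M.
    rewrite (_ : _ @^-1` _ = ~` \bigcup_(i in `I_M) (tile @^-1` [set i])).
      by apply: measurableC; apply: bigcup_measurable => i /= iM; exact: mlow.
    apply/seteqP; split => z /=.
      by rewrite mE => xM [i /= iM xi]; move: iM; rewrite -xi xM ltnn.
    move=> H; apply/eqP; rewrite mE eqn_leq index_size/= leqNgt.
    by apply/negP => xM; apply: H; exists (tile z).
  rewrite (_ : _ @^-1` _ = set0); first exact: measurable0.
  apply/seteqP; split => z //= xm; move: mM; rewrite eqn_leq Mm andbT.
  by rewrite -xm index_size.
have partE m : (m < M)%N -> tile_part f tile m = cell_fun g jj (tile_center L (nth 0 gl m)).
  move=> mM; apply/funext => z; rewrite /tile_part tileE// fE [RHS]cellE.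
  by case: eqP => [->|_]; rewrite ?mulr0// gl_nth.
have probE m : (m < M)%N -> tile_prob P tile m = EP (fun z => (tile_index L jj z == nth 0 gl m)%:R).
  by move=> mM; apply: eq_Rintegral => z _; rewrite tileE.
have tp m : (m < M)%N -> tile_prob P tile m <= ln 2 / 2.
  move=> mM; rewrite probE//; apply: le_trans (tile_prob_le dens L0 _ _) _.
  move: jJ1; rewrite truncn_lt_nat; last by apply: divr_ge0; nonneg.
  rewrite ltr_pdivrMr// => h.
  have j2 : jj%:R <= 2 ^+ jj :> R by rewrite -natrX ler_nat ltnW// ltn_expl.
  rewrite mulrAC ler_pdivrMr//.
  have : jj%:R * ln 2 <= 2 ^+ jj * ln 2 :> R by rewrite ler_pM2r.
  by move: (2 ^+ jj) h => w; lra.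
have tv m : (m < M)%N -> (1 - del ^+ 2 / 144) * (v / 2 ^+ jj) <=
       EP (fun z => tile_part f tile m z ^+ 2) <= v / 2 ^+ jj.
  move=> mM; rewrite partE//; apply/andP; split; last first.
    rewrite /v mulrAC.
    have gs' : (\int[mu]_z (g z ^+ 2)%:E <= s%:E)%E by rewrite gs.
    exact: (EP_rescale_le dens _ q0 (bmfX 2 bg) (fun z => sqr_ge0 (g z)) gs').
  apply: le_trans (good_tile_moment (goodgl _ (gl_nth _ mM))).
  have -> : (1 - del ^+ 2 / 144) * (v / 2 ^+ jj) = M0 / 2 ^+ jj * (s - dl * s).
    by rewrite /v /dl; ring.
  apply: ler_wpM2l; first by nonneg.
  by rewrite lerB.
have HP := HL n jj M f tile n0 jn0 jJ0 jn bf fK mtile tp tv.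
exists [set w | forall m, (m < M)%N -> devsum X P (tile_part f tile m) n w <
    x0 * Num.sqrt (jj%:R * n%:R / 2 ^+ jj)]; last first.
  by move=> w /= Hw m mM; rewrite partE//; exact: Hw.
split.
  set S := x0 * _.
  rewrite (_ : [set w | _] = \bigcap_(m in `I_M) (setT `&` devsum X P (tile_part f tile m) n @^-1` `]-oo, S[)).
    apply: bigcap_measurableType => m _.
    apply: measurable_devsum => //; exact: (proj1 (bmf_tile_part bf mtile m)).
  apply/seteqP; split => w /= Hw m mM.
    by split => //; rewrite /= in_itv/=; exact: Hw.
  by have [_] := Hw m mM; rewrite /= in_itv/=.
apply: le_trans HP _; rewrite lee_fin; apply: le_trans rl.
apply: ler_wpM2l; first by nonneg.
rewrite ler_expR lerN2 -/a.
have -> : expR (- (a * (1 / 2 + 4 * del)) * jj%:R) = expR (ka * jj%:R) / 2 ^+ jj.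
  by rewrite exp2_expR -expRN -expRD /ka; congr expR; ring.
have -> : c / 4 * expR (ka * jj%:R) = c * 2 ^+ jj * (expR (ka * jj%:R) / 2 ^+ jj / 4).
  by field; rewrite gt_eqF.
by apply: ler_wpM2r => //; nonneg.
Unshelve. all: by end_near. Qed.

End OneWindow.

End LowerProb.

(** * Lower bound: almost sure form *)

Section Negligible.
Context {R : realType} {d : measure_display} {T : measurableType d}.
Variable Pr : probability T R.

Lemma negligible_small (A : set T) :
  (forall e : R, 0 < e -> exists2 E, measurable E /\ (Pr E <= e%:E)%E & A `<=` E) ->
  Pr.-negligible A.
Proof.
move=> H.
have /choice[E HE] : forall i : nat, exists E, (measurable E /\ (Pr E <= (i.+1%:R^-1 : R)%:E)%E) /\ A `<=` E.
  move=> i; have [|E mE AE] := H (i.+1%:R^-1); first by rewrite invr_gt0.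
  by exists E.
have mI : measurable (\bigcap_i E i).
  by apply: bigcap_measurable => // i _; case: (HE i) => -[].
exists (\bigcap_i E i); split => //.
  apply/eqP; rewrite eq_le measure_ge0 andbT; apply/lee_addgt0Pr => e e0; rewrite add0e.
  pose i := Num.truncn e^-1.
  have [[mE PE] _] := HE i.
  apply: (@le_trans _ _ (Pr (E i))).
    by apply: le_measure; rewrite ?inE//; exact: bigcap_inf.
  apply: (le_trans PE); rewrite lee_fin invf_ple ?posrE//.
  by apply/ltW; exact: truncnS_gt.
by move=> w Aw i _; have [_] := HE i; apply.
Qed.

(** For a limit superior it is enough that the probabilities of the exceptional
    events tend to zero. *)
Lemma frequently_ae (B : nat -> set T) :
  (forall e : R, 0 < e -> \forall n \near \oo, exists2 E, measurable E /\ (Pr E <= e%:E)%E & B n `<=` E) ->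
  {ae Pr, forall w, forall N, exists2 n, (N <= n)%N & ~ B n w}.
Proof.
move=> H.
apply: (@negligibleS _ _ _ _ (\bigcup_N \bigcap_(n in [set n | (N <= n)%N]) B n)).
  move=> w /= Hw; apply: contrapT => H2; apply: Hw => N; apply: contrapT => H3.
  apply: H2; exists N => // n /= Nn; apply: contrapT => H4; apply: H3.
  by exists n.
apply: negligible_bigcup => N; apply: negligible_small => e e0.
have [M _ HM] := H e e0.
have [|E mE BE] := HM (maxn N M); first by rewrite /= leq_maxr.
by exists E => // w Bw; apply/BE/Bw; rewrite /= leq_maxl.
Qed.

End Negligible.

Section LowerCells.
Context {R : realType} {d : measure_display} {T : measurableType d}.
Variables (Pr : probability T R) (X : nat -> {RV Pr >-> R}) (P : probability R R).
Hypothesis iid : iid_with_law X P.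
Local Notation mu := (@lebesgue_measure R).
Local Notation EP f := (\int[P]_x f x).
Variable p0 : R -> R.
Hypothesis dens : has_bounded_density P p0.
Local Notation M0 := (density_norm p0).
Variables (tau : R) (j : nat -> nat).
Hypothesis adm : admissible_levels tau j.

(** The total mass is one. *)
Lemma density_norm_gt0 : 0 < M0.
Proof.
rewrite lt_neqAle (density_norm_ge0 dens) andbT eq_sym; apply/eqP => M00.
have := density_measure_le dens measurableT.
by rewrite M00 mul0e [X in (X <= _)%E]probability_setT lee_fin ler10.
Qed.

Section OneFunction.
Variables (rho : R) (g : R -> R).
Hypotheses (rho01 : 0 < rho < 1) (lg : localized rho g).

Let rho0 : 0 <= rho. Proof. by case/andP: rho01 => /ltW. Qed.
Let rho1 : rho <= 1. Proof. by case/andP: rho01 => _ /ltW. Qed.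

Lemma localized_integral_norm : exists2 B : R, 0 <= B & (\int[mu]_z (`|g z|)%:E <= B%:E)%E.
Proof.
pose h z := Num.sqrt `|g z|.
have sr01 : 0 < Num.sqrt rho < 1.
  case/andP: rho01 => r0 r1; rewrite sqrtr_gt0 r0/=.
  by rewrite -[ltRHS]sqrtr1 ltr_sqrt.
have lh : localized (Num.sqrt rho) h.
  have [mg [C [C0 gC]]] := lg; split.
    apply: (@measurableT_comp _ _ _ _ _ _ (@Num.sqrt R)).
      by apply: continuous_measurable_fun; exact: sqrt_continuous.
    exact: measurableT_comp.
  exists (Num.sqrt C); split => [|z]; first exact: sqrtr_ge0.
  rewrite ger0_norm ?sqrtr_ge0// /h.
  have -> : Num.sqrt rho ^+ `|Num.floor z| = Num.sqrt (rho ^+ `|Num.floor z|).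
    by elim: `|_|%N => [|n IH]; rewrite ?expr0 ?sqrtr1// !exprS IH sqrtrM.
  by rewrite -sqrtrM//; apply: ler_wsqrtr.
have [B B0 hB] := localized_sqr_integral sr01 lh.
exists B => //; apply: le_trans hB; rewrite le_eqVlt; apply/orP; left; apply/eqP.
by apply: eq_integral => z _; rewrite /h sqr_sqrtr.
Qed.

(** Truncating a localized function to a large window costs little in square
    norm. *)
Lemma window_tail (r : R) : 0 < r -> exists2 L : nat, (0 < L)%N &
  (\int[mu]_z ((g z - g z * \1_(window L) z) ^+ 2)%:E <= r%:E)%E.
Proof.
move=> r0; have [B B0 gB] := localized_integral_norm.
have [mg [C [C0 gC]]] := lg.
have c0 : 0 < r / (C * B + 1) by rewrite divr_gt0// ltr_wpDl// mulr_ge0.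
have [L L0 hL] : exists2 L : nat, (0 < L)%N & rho ^+ L <= r / (C * B + 1).
  have h : (fun n => rho ^+ n) @ \oo --> (0 : R).
    by apply: cvg_expr; rewrite ger0_norm//; case/andP: rho01.
  have /cvgr0Pnorm_le /(_ _ c0) [N _ HN] := h.
  exists N.+1 => //; apply: le_trans (ler_norm _) _; apply: HN; exact: leqnSn.
exists L => //.
have pw z : (g z - g z * \1_(window L) z) ^+ 2 <= (C * rho ^+ L) * `|g z|.
  rewrite indicE; case: (boolP (z \in _)) => zw /=.
    by rewrite mulr1 subrr expr0n/=; apply: mulr_ge0 => //; nonneg.
  rewrite mulr0 subr0 -[g z ^+ 2]real_normK ?num_real// expr2.
  apply: ler_wpM2r => //; apply: le_trans (gC z) _; apply: ler_wpM2l => //.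
  apply: ler_wiXn2l => //.
  have zw' : ~ (- L%:R <= z < L%:R) by move=> h; move/negP: zw; apply; rewrite inE /window/= in_itv.
  have [Lz|zL] := leP L%:R z.
    have : L%:Z <= Num.floor z by rewrite floor_ge_int.
    by clear; lia.
  have {}zw' : z < - L%:R by rewrite ltNge; apply/negP => h; apply: zw'; rewrite h zL.
  have : Num.floor z < - L%:Z by rewrite floor_lt_int rmorphN.
  by clear; lia.
apply: (@le_trans _ _ (\int[mu]_z ((C * rho ^+ L)%:E * (`|g z|)%:E))%E).
  apply: ge0_le_integral => //.
  - by move=> z _; rewrite lee_fin sqr_ge0.
  - apply/measurable_EFinP; apply: measurable_funX; apply: measurable_funB => //.
    apply: measurable_funM => //; exact: (proj1 (bmf_window L (R := R))).
  - apply/measurable_EFinP; apply: measurable_funM => //; exact: measurableT_comp.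
  - by move=> z _; rewrite -EFinM lee_fin.
rewrite ge0_integralZl//; first last.
- by rewrite lee_fin; nonneg.
- by apply/measurable_EFinP; exact: measurableT_comp.
apply: (@le_trans _ _ ((C * rho ^+ L)%:E * B%:E)%E).
  by apply: lee_wpmul2l => //; rewrite lee_fin; nonneg.
rewrite -EFinM lee_fin mulrAC; apply: (@le_trans _ _ (C * B * (r / (C * B + 1)))).
  by apply: ler_wpM2l => //; exact: mulr_ge0.
rewrite mulrA ler_pdivrMr; last by rewrite ltr_wpDl// mulr_ge0.
by rewrite mulrC; apply: ler_wpM2l; [exact: ltW | lra].
Qed.

(** The function is cut to a window; the sums of its tail are controlled by the
    upper bound, with a small constant. *)
Lemma lower_cells (s x : R) : (\int[mu]_z (g z ^+ 2)%:E = s%:E)%E ->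
  0 <= x -> x ^+ 2 < 2 * ln 2 * (M0 * s) ->
  {ae Pr, forall w, forall N, exists2 n, (N <= n)%N &
    exists k, x * Num.sqrt ((j n)%:R * n%:R / 2 ^+ j n) <=
      devsum X P (cell_fun g (j n) k) n w}.
Proof.
move=> gs x0 hx.
have l2 : 0 < ln 2 :> R by rewrite ln_gt0// ltr1n.
have M00 := density_norm_gt0.
pose q := 2 * ln 2 * M0; have q0 : 0 < q by rewrite !mulr_gt0.
have hx' : x ^+ 2 < q * s by rewrite /q -mulrA.
pose e := (q * s - x ^+ 2) / (4 * (x + 1 + q * s)).
have qs0 : 0 < q * s by apply: le_lt_trans hx'; exact: sqr_ge0.
have den : 0 < 4 * (x + 1 + q * s) by lra.
have e0 : 0 < e by rewrite divr_gt0// subr_gt0.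
have e1 : e <= 1 / 4.
  by rewrite ler_pdivrMr//; have := sqr_ge0 x; lra.
have eE : e * (4 * (x + 1 + q * s)) = q * s - x ^+ 2 by rewrite /e divfK// gt_eqF.
pose r := Order.min (e ^+ 2 / (2 * q)) ((q * s - x ^+ 2) / (2 * q) / 2).
have q2 : 0 < 2 * q by rewrite mulr_gt0.
have r0 : 0 < r.
  by rewrite lt_min; apply/andP; split; rewrite !divr_gt0 ?exprn_gt0 ?subr_gt0.
have r1 : q * r < e ^+ 2.
  apply: (@le_lt_trans _ _ (q * (e ^+ 2 / (2 * q)))).
    by rewrite ler_pM2l// ge_min lexx.
  have -> : q * (e ^+ 2 / (2 * q)) = e ^+ 2 / 2 by field; rewrite gt_eqF.
  by have := exprn_gt0 2 e0; lra.
have r2 : q * r <= (q * s - x ^+ 2) / 4.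
  apply: (@le_trans _ _ (q * ((q * s - x ^+ 2) / (2 * q) / 2))).
    by rewrite ler_pM2l// ge_min lexx orbT.
  by rewrite le_eqVlt; apply/orP; left; apply/eqP; field; rewrite gt_eqF.
have [L L0 tail] := window_tail r0.
pose gL z := g z * \1_(window L) z.
pose gT z := g z - gL z.
have bg := localized_bmf rho01 lg.
have bL : bmf gL by apply: bmfM => //; exact: bmf_window.
have lT : localized rho gT.
  have [mg [C [C0 gC]]] := lg; split.
    by apply: measurable_funB => //; case: bL.
  exists C; split => // z; rewrite /gT /gL indicE; case: (_ \in _) => /=.
    by rewrite mulr1 subrr normr0; nonneg.
  by rewrite mulr0 subr0.
have bT := localized_bmf rho01 lT.
have [_ [K gLK]] := bL.
have suppL z : gL z = gL z * \1_(window L) z.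
  by rewrite /gL -mulrA indicE -natrM mulnb andbb.
have m2 h : bmf h -> measurable_fun setT (fun z => (h z ^+ 2)%:E).
  by move=> bh; apply/measurable_EFinP; case: (bmfX 2 bh).
have sum2 : (\int[mu]_z (gL z ^+ 2)%:E + \int[mu]_z (gT z ^+ 2)%:E = s%:E)%E.
  rewrite -ge0_integralD//; try exact: m2; last 2 first.
  - by move=> z _; rewrite lee_fin sqr_ge0.
  - by move=> z _; rewrite lee_fin sqr_ge0.
  rewrite -gs; apply: eq_integral => z _; rewrite -EFinD; congr EFin.
  by rewrite /gT /gL indicE; case: (_ \in _) => /=; ring.
have T0 : (0 <= \int[mu]_z (gT z ^+ 2)%:E)%E by apply: integral_ge0 => z _; rewrite lee_fin sqr_ge0.
have L0' : (0 <= \int[mu]_z (gL z ^+ 2)%:E)%E by apply: integral_ge0 => z _; rewrite lee_fin sqr_ge0.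
have fT : (\int[mu]_z (gT z ^+ 2)%:E)%E \is a fin_num.
  by rewrite ge0_fin_numE//; apply: le_lt_trans tail _; exact: ltry.
pose sL := s - fine (\int[mu]_z (gT z ^+ 2)%:E)%E.
have LE : (\int[mu]_z (gL z ^+ 2)%:E = sL%:E)%E.
  by rewrite /sL EFinB fineK// -sum2 addeK.
have sLr : s - r <= sL by rewrite lerD2l lerN2 -lee_fin fineK.
pose x1 := x + e.
have x10 : 0 <= x1 by rewrite addr_ge0// ltW.
have x12 : x1 ^+ 2 < q * sL.
  apply: (@lt_le_trans _ _ (q * (s - r))); last by rewrite ler_pM2l.
  rewrite mulrBr /x1.
  have -> : (x + e) ^+ 2 = x ^+ 2 + e * (2 * x + e) by ring.
  have : e * (2 * x + e) <= e * (4 * (x + 1 + q * s)) / 2.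
    by rewrite -mulrA; apply: ler_wpM2l; [exact: ltW | lra].
  by rewrite eE; move: (e * (2 * x + e)) => z; lra.
have sL0 : 0 < sL by rewrite -(pmulr_rgt0 _ q0); apply: le_lt_trans x12; exact: sqr_ge0.
have hq z : q * z = 2 * ln 2 * (M0 * z) by rewrite /q -mulrA.
rewrite hq in x12.
have A1 : {ae Pr, forall w, forall N, exists2 n, (N <= n)%N & ~ [set w | forall k,
    devsum X P (cell_fun gL (j n) k) n w < x1 * Num.sqrt ((j n)%:R * n%:R / 2 ^+ j n)] w}.
  apply: frequently_ae => e' e'0.
  exact: (lower_prob iid dens adm L0 bL gLK suppL LE M00 sL0 x10 x12 e'0).
rewrite hq in r1.
have A2 := upper_cells iid dens adm rho01 lT (ltW r0) tail e0 r1.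
apply: filterS2 A1 A2 => w h1 [N0 _ h2] N.
have [n nN Hn] := h1 (maxn N N0).
exists n; first by apply: leq_trans nN; exact: leq_maxl.
have [k Hk] : exists k, x1 * Num.sqrt ((j n)%:R * n%:R / 2 ^+ j n) <= devsum X P (cell_fun gL (j n) k) n w.
  apply: contrapT => H; apply: Hn => k; rewrite ltNge; apply/negP => H2; apply: H.
  by exists k.
exists k.
have nN0 : (N0 <= n)%N by apply: leq_trans nN; exact: leq_maxr.
have Ht := h2 n nN0 k.
have -> : devsum X P (cell_fun g (j n) k) n w =
    devsum X P (cell_fun gL (j n) k) n w + devsum X P (cell_fun gT (j n) k) n w.
  rewrite -[RHS]mul1r mulrDr; have := @devsum_sum _ _ _ Pr X P bool [:: true; false] (fun=> 1)
    (fun i => if i then cell_fun gL (j n) k else cell_fun gT (j n) k) n w.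
  rewrite !big_cons !big_nil !addr0 => <-.
    congr (devsum X P _ n w); apply/funext => z; rewrite !big_cons big_nil addr0 !mul1r.
    by rewrite /cell_fun /gT [RHS]addrC subrK.
  by case; exact: bmf_rescale.
move: Ht; rewrite ler_norml => /andP[Ht _]; move: Hk; rewrite /x1 mulrDl; lra.
Qed.

End OneFunction.

End LowerCells.

(** * The limit superior *)

Section Constant.
Context {R : realType}.
Local Notation mu := (@lebesgue_measure R).

(** The column of index [0] of the inverse, which is a Toeplitz matrix as well. *)
Definition gram_seq (m : nat) : int -> R := fun k => gram_inv m.+1 k 0.

Lemma gram_seq_spec m : exists C rho : R,
  [/\ 0 <= C, 0 < rho < 1, forall k, `|gram_seq m k| <= C * rho ^+ `|k| &
   forall k : int, \sum_(i < m.*2.+1) spline_gram m (i%:Z - m%:Z) * gram_seq m (k + m%:Z - i%:Z)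
     = (k == 0)%:R].
Proof.
have [b [C [rho [C0 rho01 bC ab]]]] := gram_inverse_seq m (R := R).
exists C, rho; suff -> : gram_seq m = b by [].
by apply/funext => k; rewrite /gram_seq (gram_invE C0 rho01 bC ab) subr0.
Qed.

Definition phase_variance m (u : R) : R :=
  fine (\int[mu]_z (cell_kernel m (gram_seq m) u z ^+ 2)%:E)%E.

(** Largest squared norm of the kernel [kappa y] over [y]; by translation it is
    enough to let [y] range over the unit cell. *)
Definition kernel_variance m : R := sup [set phase_variance m u | u in [set u | 0 <= u < 1]].

Lemma phase_variance_bound m : exists2 B : R, 0 <= B & forall u,
  (\int[mu]_z (cell_kernel m (gram_seq m) u z ^+ 2)%:E <= B%:E)%E.
Proof.
have [C [rho [C0 rho01 bC ab]]] := gram_seq_spec m.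
have ld := cardinal_spline_localized m C0 rho01 bC.
have la (a : nat) : localized rho (fun z => `|cardinal_spline m (gram_seq m) (z + a%:R)|).
  have [mf [D [D0 fD]]] := localized_shift rho01 a%:Z ld.
  split; first exact: measurableT_comp.
  by exists D; split => // z; rewrite normr_id; exact: fD.
have lenv := localized_sum m.+1 la.
have [B B0 hB] := localized_sqr_integral rho01 lenv.
exists B => // u; apply: le_trans hB; apply: ge0_le_integral => //.
- by move=> z _; rewrite lee_fin sqr_ge0.
- apply/measurable_EFinP; apply: measurable_funX.
  exact: (proj1 (cell_kernel_localized m C0 rho01 bC u)).
- by apply/measurable_EFinP; apply: measurable_funX; exact: (proj1 lenv).
- move=> z _; rewrite lee_fin -[leLHS]real_normK ?num_real//.
  apply: lerXn2r; rewrite ?nnegrE//; first by apply: sumr_ge0.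
  apply: le_trans (ler_norm_sum _ _ _) _; apply: ler_sum => a _.
  by rewrite normrM -[leRHS]mul1r; apply: ler_wpM2r => //; exact: normr_bspline_le1.
Qed.

Lemma phase_varianceE m u :
  (\int[mu]_z (cell_kernel m (gram_seq m) u z ^+ 2)%:E = (phase_variance m u)%:E)%E.
Proof.
have [B B0 hB] := phase_variance_bound m.
rewrite /phase_variance fineK// ge0_fin_numE; first by apply: le_lt_trans (hB u) _; exact: ltry.
by apply: integral_ge0 => z _; rewrite lee_fin sqr_ge0.
Qed.

Lemma kernel_variance_has_sup m : has_sup [set phase_variance m u | u in [set u | 0 <= u < 1]].
Proof.
have [B B0 hB] := phase_variance_bound m; split.
  by exists (phase_variance m 0), 0 => //=; rewrite lexx ltr01.
by exists B => _ [u _ <-]; rewrite -lee_fin -phase_varianceE.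
Qed.

Lemma phase_variance_ge0 m u : 0 <= phase_variance m u.
Proof.
rewrite -lee_fin -phase_varianceE.
by apply: integral_ge0 => z _; rewrite lee_fin sqr_ge0.
Qed.

Lemma phase_variance_le m u : 0 <= u < 1 -> phase_variance m u <= kernel_variance m.
Proof. by move=> u01; apply: (sup_upper_bound (kernel_variance_has_sup m)); exists u. Qed.

Lemma kernel_variance_ge0 m : 0 <= kernel_variance m.
Proof.
apply: le_trans (phase_variance_ge0 m 0) (phase_variance_le _ _).
by rewrite lexx ltr01.
Qed.

(** Each of the [2 ^ j] cells has a Gaussian tail of variance at most [M0] times
    the kernel variance; [2 * ln 2 * j] is twice the logarithm of their number. *)
Definition limsup_constant (M0 : R) (r : nat) : R :=
  Num.sqrt (2 * ln 2 * (M0 * kernel_variance r.-1)).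

End Constant.

Section Limsup.
Context {R : realType} {d : measure_display} {T : measurableType d}.
Variables (Pr : probability T R) (X : nat -> {RV Pr >-> R}) (P : probability R R).
Hypothesis iid : iid_with_law X P.
Local Notation mu := (@lebesgue_measure R).
Variable p0 : R -> R.
Hypothesis dens : has_bounded_density P p0.
Local Notation M0 := (density_norm p0).
Variables (tau : R) (j : nat -> nat).
Hypothesis adm : admissible_levels tau j.
Variable m : nat.

Local Notation cs := (cellsum X P m (gram_seq m)).
Local Notation S n := (Num.sqrt ((j n)%:R * n%:R / 2 ^+ j n) : R).

(** The normalisation of the theorem is that of the cell sums. *)
Lemma scaling_cells n : (0 < n)%N -> (0 < j n)%N ->
  scaling j n * (2 ^+ j n / n%:R) * S n = 1.
Proof.
move=> n0 j0; have nR : 0 < n%:R :> R by rewrite ltr0n.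
have jR : 0 < (j n)%:R :> R by rewrite ltr0n.
have q0 : 0 < 2 ^+ j n :> R by rewrite exprn_gt0.
rewrite /scaling mulrAC -sqrtrM; last by nonneg.
have -> : n%:R / (2 ^+ j n * (j n)%:R) * ((j n)%:R * n%:R / 2 ^+ j n) = (n%:R / 2 ^+ j n) ^+ 2 :> R.
  by field; rewrite !gt_eqF.
rewrite sqrtr_sqr ger0_norm; last by nonneg.
by field; rewrite !gt_eqF.
Qed.

Lemma scaling_ge0 n : 0 <= scaling j n :> R. Proof. exact: sqrtr_ge0. Qed.

Lemma scaled_le (x : R) n w : (0 < n)%N -> (0 < j n)%N ->
  (forall u k, 0 <= u < 1 -> `|cs u (j n) k n w| <= x * S n) ->
  ((scaling j n)%:E * sup_centered Pr X m.+1 n (j n) w <= x%:E)%E.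
Proof.
move=> n0 j0 H; have [C [rho [C0 rho01 bC ab]]] := gram_seq_spec m (R := R).
have -> : x%:E = ((scaling j n)%:E * (2 ^+ j n / n%:R * (x * S n))%:E)%E.
  rewrite -EFinM; congr EFin.
  have -> : scaling j n * (2 ^+ j n / n%:R * (x * S n)) = x * (scaling j n * (2 ^+ j n / n%:R) * S n) by ring.
  by rewrite scaling_cells// mulr1.
apply: lee_wpmul2l; first by rewrite lee_fin scaling_ge0.
rewrite (sup_centeredE iid C0 rho01 bC ab)//; apply: ge_ereal_sup => _ [[u k] /= u01 <-].
by rewrite lee_fin; apply: ler_wpM2l; [nonneg | exact: H].
Qed.

Lemma scaled_ge (x : R) n w u k : (0 < n)%N -> (0 < j n)%N -> 0 <= u < 1 ->
  x * S n <= `|cs u (j n) k n w| ->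
  (x%:E <= (scaling j n)%:E * sup_centered Pr X m.+1 n (j n) w)%E.
Proof.
move=> n0 j0 u01 H; have [C [rho [C0 rho01 bC ab]]] := gram_seq_spec m (R := R).
have -> : x%:E = ((scaling j n)%:E * (2 ^+ j n / n%:R * (x * S n))%:E)%E.
  rewrite -EFinM; congr EFin.
  have -> : scaling j n * (2 ^+ j n / n%:R * (x * S n)) = x * (scaling j n * (2 ^+ j n / n%:R) * S n) by ring.
  by rewrite scaling_cells// mulr1.
apply: lee_wpmul2l; first by rewrite lee_fin scaling_ge0.
rewrite (sup_centeredE iid C0 rho01 bC ab)//.
apply: (@le_trans _ _ (2 ^+ j n / n%:R * `|cs u (j n) k n w|)%:E).
  by rewrite lee_fin; apply: ler_wpM2l; [nonneg | exact: H].
by apply: ereal_sup_ubound; exists (u, k).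
Qed.

Lemma limsup_le (x : R) : 0 < x -> 2 * ln 2 * (M0 * kernel_variance m) < x ^+ 2 ->
  {ae Pr, forall w,
    (limn_esup (fun n => (scaling j n)%:E * sup_centered Pr X m.+1 n (j n) w) <= x%:E)%E}.
Proof.
move=> x0 hx; have [C [rho [C0 rho01 bC ab]]] := gram_seq_spec m (R := R).
have us u : 0 <= u < 1 ->
    (\int[mu]_z (cell_kernel m (gram_seq m) u z ^+ 2)%:E <= (kernel_variance m)%:E)%E.
  by move=> u01; rewrite phase_varianceE lee_fin phase_variance_le.
have A := upper_sup iid C0 rho01 bC dens adm (kernel_variance_ge0 m) us x0 hx.
apply: filterS A => w H.
apply: ge_ereal_inf.
exists (ereal_sup [set ((scaling j n)%:E * sup_centered Pr X m.+1 n (j n) w)%E | n in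
  [set n | ((scaling j n)%:E * sup_centered Pr X m.+1 n (j n) w <= x%:E)%E]]).
  eexists; last by [].
  near=> n; have [n0 j0] : (0 < n)%N /\ (0 < j n)%N by near: n; exact: levels_gt0 adm.
  by apply: scaled_le => // u k u01; move: u k u01; near: n.
by apply: ge_ereal_sup => _ [n /= h <-].
Unshelve. all: by end_near. Qed.

(** A single phase of nearly largest variance is enough. *)
Lemma limsup_ge (x : R) : 0 <= x -> x ^+ 2 < 2 * ln 2 * (M0 * kernel_variance m) ->
  {ae Pr, forall w,
    (x%:E <= limn_esup (fun n => (scaling j n)%:E * sup_centered Pr X m.+1 n (j n) w))%E}.
Proof.
move=> x0 hx; have [C [rho [C0 rho01 bC ab]]] := gram_seq_spec m (R := R).
have l2 : 0 < ln 2 :> R by rewrite ln_gt0// ltr1n.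
have M00 := density_norm_gt0 dens.
have q0 : 0 < 2 * ln 2 * M0 by rewrite !mulr_gt0.
have [_ [u u01 <-] hu] : exists2 s, [set phase_variance m u | u in [set u | 0 <= u < 1]] s &
    x ^+ 2 / (2 * ln 2 * M0) < s.
  apply: sup_gt; first by case: (kernel_variance_has_sup m (R := R)).
  by rewrite ltr_pdivrMr// [ltRHS]mulrC -[ltRHS]mulrA; exact: hx.
have hx' : x ^+ 2 < 2 * ln 2 * (M0 * phase_variance m u).
  by move: hu; rewrite ltr_pdivrMr// [X in _ < X -> _]mulrC -[X in _ < X -> _]mulrA.
have lg := cell_kernel_localized m C0 rho01 bC u.
have A := lower_cells iid dens adm rho01 lg (phase_varianceE m u) x0 hx'.
apply: filterS A => w H; apply: le_ereal_inf_tmp => _ [V VF <-].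
have [N _ HN] := filterI VF (levels_gt0 adm).
have [n nN [k Hk]] := H N.
have [Vn [n0 j0]] := HN n nN.
apply: (@le_trans _ _ ((scaling j n)%:E * sup_centered Pr X m.+1 n (j n) w)%E).
  apply: (scaled_ge n0 j0 u01 (k := k)).
  by apply: le_trans Hk _; exact: ler_norm.
by apply: ereal_sup_ubound; exists n.
Qed.

Lemma limsup_nonneg w :
  (0 <= limn_esup (fun n => (scaling j n)%:E * sup_centered Pr X m.+1 n (j n) w))%E.
Proof.
apply: le_ereal_inf_tmp => _ [V VF <-]; have [n Vn] := filter_ex VF.
apply: (@le_trans _ _ ((scaling j n)%:E * sup_centered Pr X m.+1 n (j n) w)%E).
  apply: mule_ge0; first by rewrite lee_fin scaling_ge0.
  apply: le_trans (ereal_sup_ubound _); last by exists 0.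
  exact: abse_ge0.
by apply: ereal_sup_ubound; exists n.
Qed.

Lemma limsup_centered :
  {ae Pr, forall w,
    limn_esup (fun n => (scaling j n)%:E * sup_centered Pr X m.+1 n (j n) w)%E =
    (limsup_constant M0 m.+1)%:E}.
Proof.
set c := limsup_constant M0 m.+1.
pose q := 2 * ln 2 * (M0 * kernel_variance m).
have q0 : 0 <= q.
  have M00 := density_norm_ge0 dens; have := kernel_variance_ge0 m (R := R) => V0.
  by rewrite /q; apply: mulr_ge0; [apply: mulr_ge0 => //; exact: ln_ge0 (ler1n _ 2) | exact: mulr_ge0].
have c0 : 0 <= c by exact: sqrtr_ge0.
have c2 : c ^+ 2 = q by rewrite /c /limsup_constant sqr_sqrtr.
have up i : {ae Pr, forall w,
    (limn_esup (fun n => (scaling j n)%:E * sup_centered Pr X m.+1 n (j n) w) <= (c + i.+1%:R^-1)%:E)%E}.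
  have i0 : 0 < i.+1%:R^-1 :> R by rewrite invr_gt0.
  apply: limsup_le; first by rewrite ltr_wpDl.
  rewrite -/q -c2; apply: ltrXn2r => //; last by rewrite ltrDl.
have lo i : {ae Pr, forall w,
    ((c - i.+1%:R^-1)%:E <= limn_esup (fun n => (scaling j n)%:E * sup_centered Pr X m.+1 n (j n) w))%E}.
  have i0 : 0 < i.+1%:R^-1 :> R by rewrite invr_gt0.
  have [h|h] := leP 0 (c - i.+1%:R^-1).
    apply: limsup_ge => //; rewrite -/q -c2; apply: ltrXn2r => //.
    by rewrite gtrBl.
  apply: aeW => w; apply: le_trans (limsup_nonneg w); rewrite lee_fin; exact: ltW.
apply: filterS2 (ae_foralln up) (ae_foralln lo) => w Hu Hl.
have small (e : R) : 0 < e -> exists i : nat, i.+1%:R^-1 <= e.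
  move=> e0; exists (Num.truncn e^-1); rewrite invf_ple ?posrE//.
  by apply/ltW; exact: truncnS_gt.
apply/eqP; rewrite eq_le; apply/andP; split.
- apply/lee_addgt0Pr => e /small [i ie]; apply: le_trans (Hu i) _.
  by rewrite -EFinD lee_fin lerD2l.
- apply/lee_subgt0Pr => e /small [i ie]; apply: le_trans (Hl i).
  by rewrite -EFinB lee_fin lerD2l lerN2.
Qed.

End Limsup.

(** * Moments of the deviation *)

Section Integrals.
Context {R : realType} {d : measure_display} {T : measurableType d}.
Variable mu : {measure set T -> \bar R}.

(** Monotonicity of the integral for arbitrary nonnegative functions, as it is a
    supremum over the simple functions below. *)
Lemma ge0_le_integral_any (f g : T -> \bar R) : (forall x, 0 <= f x)%E ->
  (forall x, f x <= g x)%E -> (\int[mu]_x f x <= \int[mu]_x g x)%E.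
Proof.
move=> f0 fg; rewrite !ge0_integralTE//; last by move=> x; exact: le_trans (fg x).
by apply: ereal_sup_le => _ [h /= hf <-]; exists h => //= x; exact: le_trans (fg x).
Qed.

End Integrals.

Section Exponentials.
Context {R : realType}.

Lemma expR_limit_le (x y : R) : 0 <= y -> (forall e, 0 < e -> x <= expR e * y) -> x <= y.
Proof.
move=> y0 H; rewrite leNgt; apply/negP => yx.
have [y00|yn0] := eqVneq y 0.
  by have := H 1 ltr01; rewrite y00 mulr0 leNgt -y00 yx.
have yp : 0 < y by rewrite lt_neqAle eq_sym yn0.
have x0 : 0 < x by exact: lt_trans yx.
have l0 : 0 < ln (x / y) by rewrite ln_gt0// ltr_pdivlMr// mul1r.
have := H (ln (x / y) / 2) (divr_gt0 l0 (ltr0Sn _ 1)).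
rewrite leNgt => /negP; apply.
apply: (@lt_le_trans _ _ (expR (ln (x / y)) * y)).
  by rewrite ltr_pM2r// ltr_expR; lra.
by rewrite lnK ?posrE ?divr_gt0// divfK// gt_eqF.
Qed.

(** The sum of [phi] at [y] and [- y]: it controls the exponential of [|y|] while
    its expectation is linear in the variance, hence summable over the cells. *)
Definition psi (y : R) := expR y + expR (- y) - 2.

Lemma psiE y : psi y = phi y + phi (- y).
Proof. by rewrite /psi /phi; ring. Qed.

Lemma psi_ge0 y : 0 <= psi y.
Proof. by rewrite psiE addr_ge0// phi_ge0. Qed.

Lemma psi_ge_expR y : 2 <= `|y| -> expR `|y| / 4 <= psi y.
Proof.
move=> y2; apply: (le_trans (phi_ge_expR y2)); rewrite psiE.
have [y0|y0] := leP 0 y; first by rewrite ger0_norm// lerDl phi_ge0.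
by rewrite ltr0_norm// lerDr phi_ge0.
Qed.

(** Values of [y / J] up to [A] contribute [A ^ p]; beyond, [psi y] is at least
    [expR y / 4], and the factor [expR (- (A * J))] is what it costs to replace
    [(y / J) ^ p] by [psi y]. *)
Lemma powR_psi_le (A p J y : R) : 2 <= A -> 0 <= p -> 1 <= J -> 0 <= y ->
  (y / J) `^ p <= A `^ p + 4 * ((Num.truncn p).+1`!%:R * expR A) * expR (- (A * J)) * psi y.
Proof.
move=> A2 p0 J1 y0; have J0 : 0 < J by lra.
have [yA|Ay] := leP (y / J) A.
  apply: (@le_trans _ _ (A `^ p)); last first.
    by rewrite lerDl; apply: mulr_ge0; [nonneg | exact: psi_ge0].
  by apply: ge0_ler_powR => //; rewrite nnegrE ?divr_ge0//; lra.
have y2 : A * J < y by rewrite -ltr_pdivlMr.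
have AJ : 2 <= A * J by rewrite -[leLHS]mulr1; apply: ler_pM => //; lra.
apply: (@le_trans _ _ (4 * ((Num.truncn p).+1`!%:R * expR A) * expR (- (A * J)) * psi y)); last first.
  by rewrite lerDr powR_ge0.
set N := (Num.truncn p).+1.
have yJ1 : 1 <= y / J by lra.
have pN : p <= N%:R by apply/ltW; exact: truncnS_gt.
have yJ : y / J <= A + (y - A * J).
  rewrite -lerBlDl.
  have -> : y / J - A = (y - A * J) / J by field; rewrite gt_eqF.
  by rewrite ler_pdivrMr// ler_peMr// subr_ge0 ltW.
have h1 : (y / J) `^ p <= (y / J) ^+ N.
  by rewrite -powR_mulrn; [exact: ler_powR | lra].
have h2 : (y / J) ^+ N <= (A + (y - A * J)) ^+ N.
  by apply: lerXn2r => //; rewrite nnegrE; lra.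
have h3 : (A + (y - A * J)) ^+ N <= N`!%:R * expR (A + (y - A * J)).
  have z0 : 0 <= A + (y - A * J) by lra.
  have := expR_ge1Dxn (Num.truncn p) z0; rewrite -/N => h.
  have f0 : 0 < N`!%:R :> R by rewrite ltr0n fact_gt0.
  rewrite [leRHS]mulrC -ler_pdivrMr//; apply: le_trans h; by rewrite lerDr.
have h4 : expR y <= 4 * psi y.
  have := @psi_ge_expR y; rewrite ger0_norm// => /(_ (le_trans AJ (ltW y2))); lra.
apply: (le_trans (le_trans h1 (le_trans h2 h3))).
have -> : A + (y - A * J) = A + - (A * J) + y by ring.
rewrite !expRD.
have -> : 4 * (N`!%:R * expR A) * expR (- (A * J)) * psi y =
  N`!%:R * (expR A * expR (- (A * J)) * (4 * psi y)) by ring.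
apply: ler_wpM2l => //; apply: ler_wpM2l => //; nonneg.
Qed.

End Exponentials.

Section Moments.
Context {R : realType} {d : measure_display} {T : measurableType d}.
Variables (Pr : probability T R) (X : nat -> {RV Pr >-> R}) (P : probability R R).
Hypothesis iid : iid_with_law X P.
Local Notation mu := (@lebesgue_measure R).
Local Notation EP f := (\int[P]_x f x).

Lemma integral_expR_devsum (f : R -> R) n (lam : R) : bmf f -> 0 <= lam ->
  (\int[Pr]_w (expR (lam * devsum X P f n w))%:E <= (mgf P f lam ^+ n)%:E)%E.
Proof.
move=> bf l0; have [mf [K fK]] := bf.
have m0 : 0 <= mgf P f lam by apply: Rintegral_ge0 => x _; exact: expR_ge0.
have key (e : R) : 0 < e -> (\int[Pr]_w (expR (lam * devsum X P f n w))%:E <=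
    (expR (2 * (lam * n%:R * e)) * mgf P f lam ^+ n)%:E)%E.
  move=> e0; have e2 : 0 < e / 2 by rewrite divr_gt0.
  have [M [q [g [mq _ H]]]] := discretized_draws P e2 mf fK.
  have {}H x : `|(f x - EP f) - g (q x)| <= e by rewrite (le_trans (H x))//; lra.
  pose F s := expR (lam * n%:R * e) * \prod_(a <- s) expR (lam * g a).
  have F0 s : 0 <= F s by apply: mulr_ge0; [exact: expR_ge0 | apply: prodr_ge0 => a _; exact: expR_ge0].
  have [mF IF] := integral_draws iid mq n F0.
  apply: (@le_trans _ _ (\int[Pr]_w (F (draws X q n w))%:E)%E).
    apply: ge0_le_integral_any => w; first by rewrite lee_fin expR_ge0.
    rewrite lee_fin /F -expR_sum -expRD ler_expR -mulr_sumr -mulrA -mulrDr.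
    apply: ler_wpM2l => //; rewrite addrC -lerBlDl.
    have := draws_sum X w (leqnn n) H.
    rewrite take_oversize ?size_draws// => h.
    by apply: le_trans h; exact: ler_norm.
  rewrite IF lee_fin /F seq_expZ seq_exp_prod.
  have -> : expR (2 * (lam * n%:R * e)) * mgf P f lam ^+ n =
     expR (lam * n%:R * e) * (expR (lam * e) * mgf P f lam) ^+ n.
    rewrite exprMn -expRM_natl [RHS]mulrA -expRD; congr (expR _ * _); ring.
  apply: ler_wpM2l; first exact: expR_ge0.
  apply: lerXn2r; rewrite ?nnegrE.
  - by apply: sumr_ge0 => a _; apply: mulr_ge0; [exact: weight_ge0 | exact: expR_ge0].
  - by apply: mulr_ge0 => //; exact: expR_ge0.
  - exact: discretized_mgf.
have I0 : (0 <= \int[Pr]_w (expR (lam * devsum X P f n w))%:E)%E.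
  by apply: integral_ge0 => w _; rewrite lee_fin expR_ge0.
have If : (\int[Pr]_w (expR (lam * devsum X P f n w))%:E)%E \is a fin_num.
  by rewrite ge0_fin_numE//; apply: le_lt_trans (key 1 ltr01) _; exact: ltry.
rewrite -(fineK If) lee_fin; apply: expR_limit_le; first by nonneg.
move=> e e0; rewrite -lee_fin fineK//.
pose c := 2 * (lam * n%:R) + 1.
have ln0 : 0 <= lam * n%:R by nonneg.
have c0 : 0 < c by rewrite /c; lra.
apply: le_trans (key (e / c) _) _; first by rewrite divr_gt0.
rewrite lee_fin; apply: ler_wpM2r; first by nonneg.
rewrite ler_expR.
have -> : 2 * (lam * n%:R * (e / c)) = 2 * (lam * n%:R) * e / c by ring.
rewrite ler_pdivrMr// [leRHS]mulrC; apply: ler_wpM2r; first exact: ltW.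
by rewrite /c lerDl.
Qed.

Lemma integral_psi_devsum (f : R -> R) (K v : R) n (lam : R) : bmf f -> (forall x, `|f x| <= K) ->
  EP (fun x => f x ^+ 2) <= v -> 0 <= lam ->
  forall th : R, th = n%:R * (lam ^+ 2 / 2 * expR (2 * K * lam) * v) ->
  (\int[Pr]_w (psi (lam * devsum X P f n w))%:E <= (2 * (expR th - 1))%:E)%E.
Proof.
move=> bf fK fv l0 th thE; have [mf _] := bf.
have bfN : bmf (fun x => - f x) by exact: bmfN.
have fKN x : `|- f x| <= K by rewrite normrN.
have fvN : EP (fun x => (- f x) ^+ 2) <= v.
  by under eq_Rintegral do rewrite sqrrN.
have [_ h1] := mgf_le bf fK fv l0.
have [_ h2] := mgf_le bfN fKN fvN l0.
have pw g : 0 <= mgf P g lam -> mgf P g lam <= expR (lam ^+ 2 / 2 * expR (2 * K * lam) * v) ->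
    mgf P g lam ^+ n <= expR th.
  move=> g0 gl; rewrite thE expRM_natl; apply: lerXn2r => //; rewrite nnegrE//; exact: expR_ge0.
have m0 g : 0 <= mgf P g lam by apply: Rintegral_ge0 => x _; exact: expR_ge0.
have I1 := integral_expR_devsum n bf l0.
have I2 := integral_expR_devsum n bfN l0.
have ml : measurable_fun setT (fun w => lam * devsum X P f n w).
  by apply: measurable_funM => //; exact: measurable_devsum.
have E : (\int[Pr]_w (psi (lam * devsum X P f n w))%:E + 2%:E =
   \int[Pr]_w (expR (lam * devsum X P f n w))%:E + \int[Pr]_w (expR (lam * devsum X P (fun x => - f x) n w))%:E)%E.
  have me g : measurable_fun setT g -> measurable_fun setT (fun w => (expR (lam * devsum X P g n w))%:E).
    move=> mg; apply/measurable_EFinP; apply: measurableT_comp => //.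
    by apply: measurable_funM => //; exact: measurable_devsum.
  have -> : 2%:E = (\int[Pr]_w (2%:E : \bar R))%E.
    by rewrite integral_cst// [X in (_ * X)%E]probability_setT mule1.
  rewrite -!ge0_integralD//.
  - apply: eq_integral => w _; rewrite -!EFinD; congr EFin.
    by rewrite /psi devsumN// mulrN subrK.
  - exact: me.
  - by apply: me; case: bfN.
  - by move=> w _; rewrite lee_fin psi_ge0.
  - apply/measurable_EFinP; rewrite /psi; apply: measurable_funB => //.
    apply: measurable_funD; apply: measurableT_comp => //.
    exact: measurableT_comp.
have -> : 2 * (expR th - 1) = expR th + expR th - 2 by ring.
rewrite [leRHS]EFinB leeBrDr// E EFinD; apply: leeD.
- by apply: le_trans I1 _; rewrite lee_fin pw.
- by apply: le_trans I2 _; rewrite lee_fin pw.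
Qed.

End Moments.

Section DualConstants.
Context {R : realType}.
Local Notation mu := (@lebesgue_measure R).

Lemma dual_constants m : exists K B s : R, [/\ 0 <= K, 0 <= B, 0 <= s &
  [/\ forall z, `|cardinal_spline m (gram_seq m) z| <= K,
   forall (l : seq int) z, uniq l -> \sum_(k <- l) cardinal_spline m (gram_seq m) (z - k%:~R) ^+ 2 <= B &
   (\int[mu]_z (cardinal_spline m (gram_seq m) z ^+ 2)%:E <= s%:E)%E]].
Proof.
have [C [rho [C0 rho01 bC ab]]] := gram_seq_spec m (R := R).
have ld := cardinal_spline_localized m C0 rho01 bC.
have [_ [K hK]] := localized_bmf rho01 ld.
have [B B0 hB] := localized_sum_sqr rho01 ld.
have [s s0 hs] := localized_sqr_integral rho01 ld.
by exists K, B, s; split => //; rewrite (le_trans _ (hK 0)).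
Qed.

End DualConstants.

(** Bound for the [p]-th moment of the deviation in units of its order, for a
    density of norm [M] and a dual spline bounded by [K], with square integral
    [s] and square sums over the cells at most [B]. *)
Definition moment_const {R : realType} (M K B s p : R) : R :=
  let A := expR (2 * K) * M * s / 2 + 2 in
  A `^ p + 4 * ((Num.truncn p).+1`!%:R * expR A) * (2 * (expR (2 * K) * B)).

Section LpBound.
Context {R : realType} {d : measure_display} {T : measurableType d}.
Variables (Pr : probability T R) (X : nat -> {RV Pr >-> R}) (P : probability R R).
Hypothesis iid : iid_with_law X P.
Local Notation mu := (@lebesgue_measure R).
Local Notation EP f := (\int[P]_x f x).
Variable p0 : R -> R.
Hypothesis dens : has_bounded_density P p0.
Local Notation M0 := (density_norm p0).
Variables (m : nat) (K B s : R).
Local Notation dual := (cardinal_spline m (gram_seq m) : R -> R).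
Hypotheses (K0 : 0 <= K) (B0 : 0 <= B) (s0 : 0 <= s).
Hypothesis dualK : forall z, `|dual z| <= K.
Hypothesis dualB : forall (l : seq int) z, uniq l -> \sum_(k <- l) dual (z - k%:~R) ^+ 2 <= B.
Hypothesis duals : (\int[mu]_z (dual z ^+ 2)%:E <= s%:E)%E.

Let bdual : bmf dual.
Proof.
have [C [rho [C0 rho01 bC ab]]] := gram_seq_spec m (R := R).
exact: (localized_bmf rho01 (cardinal_spline_localized m C0 rho01 bC)).
Qed.

Let B1 := expR (2 * K) * M0 * s / 2.
Let A := B1 + 2.

Let M00 : 0 <= M0. Proof. exact: density_norm_ge0 dens. Qed.
Let B10 : 0 <= B1. Proof. by rewrite /B1; nonneg. Qed.

(** The expectations of [psi] at the dual sums add up to at most [j * 2 ^ j]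
    times an exponential of [j]. *)
Lemma psi_series_le (jj n : nat) (e : nat -> int) (lam : R) : injective e ->
  0 <= lam <= 1 -> n%:R * lam ^+ 2 = jj%:R * 2 ^+ jj ->
  (\int[Pr]_w (\sum_(i <oo) (psi (lam * dualsum X P m (gram_seq m) jj (e i) n w))%:E) <=
   (expR (2 * K) * B * (jj%:R * 2 ^+ jj * expR (B1 * jj%:R)))%:E)%E.
Proof.
move=> einj /andP[l0 l1] nl.
have q0 : 0 < 2 ^+ jj :> R by rewrite exprn_gt0.
have bc k : bmf (cell_fun dual jj k) by exact: bmf_rescale.
pose v i := EP (fun x => cell_fun dual jj (e i) x ^+ 2).
have v0 i : 0 <= v i by apply: Rintegral_ge0 => x _; rewrite sqr_ge0.
rewrite integral_nneseries//; last 2 first.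
- move=> i; apply/measurable_EFinP.
  have ml : measurable_fun setT (fun w => lam * dualsum X P m (gram_seq m) jj (e i) n w).
    by apply: measurable_funM => //; apply: measurable_devsum; case: (bc (e i)).
  rewrite /psi; apply: measurable_funB => //.
  apply: measurable_funD; apply: measurableT_comp => //.
  exact: measurableT_comp.
- by move=> i w _; rewrite lee_fin psi_ge0.
pose E2 := expR (2 * K); pose eB := expR (B1 * jj%:R).
apply: (nneseries_le (v := fun i => E2 * (jj%:R * 2 ^+ jj * eB) * v i)).
- by move=> i; apply: integral_ge0 => w _; rewrite lee_fin psi_ge0.
- move=> i; have := integral_psi_devsum iid (n := n) (bc (e i)) (fun x => dualK _) (lexx (v i)) l0 erefl.
  set th := n%:R * _ => H; apply: (le_trans H); rewrite lee_fin.
  have eK : expR (2 * K * lam) <= E2 by rewrite ler_expR ler_piMr// mulr_ge0.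
  have thE : th <= jj%:R * 2 ^+ jj / 2 * E2 * v i.
    have -> : th = n%:R * lam ^+ 2 / 2 * expR (2 * K * lam) * v i by rewrite /th; ring.
    rewrite nl; apply: ler_wpM2r => //; apply: ler_wpM2l => //; nonneg.
  have th0 : 0 <= th by rewrite /th; nonneg.
  have vs : v i <= M0 / 2 ^+ jj * s.
    exact: (EP_rescale_le dens _ q0 (bmfX 2 bdual) (fun x => sqr_ge0 (dual x)) duals).
  have thB : th <= B1 * jj%:R.
    apply: (le_trans thE); apply: (@le_trans _ _ (jj%:R * 2 ^+ jj / 2 * E2 * (M0 / 2 ^+ jj * s))).
      by apply: ler_wpM2l => //; rewrite /E2; nonneg.
    rewrite le_eqVlt; apply/orP; left; apply/eqP.
    by rewrite /B1 -/E2; field; rewrite gt_eqF.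
  apply: (@le_trans _ _ (2 * (th * expR th))).
    by rewrite ler_pM2l//; exact: expR_sub1_le.
  apply: (@le_trans _ _ (2 * (jj%:R * 2 ^+ jj / 2 * E2 * v i * eB))).
    by rewrite ler_pM2l//; apply: ler_pM; rewrite ?expR_ge0 ?ler_expR.
  rewrite le_eqVlt; apply/orP; left; apply/eqP; clearbody E2 eB; move: (v i) => vi; by field.
- move=> N; rewrite -mulr_sumr.
  have -> : E2 * B * (jj%:R * 2 ^+ jj * eB) = E2 * (jj%:R * 2 ^+ jj * eB) * B by ring.
  apply: ler_wpM2l; first by rewrite /E2 /eB; nonneg.
  exact: (sum_EP_cell_le P bdual dualB einj).
Qed.

Variables (jj n : nat) (p : R).
Hypotheses (n0 : (0 < n)%N) (j0 : (0 < jj)%N) (jn : (jj * 2 ^ jj <= n)%N) (p1 : 1 <= p).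
Local Notation S := (Num.sqrt (jj%:R * n%:R / 2 ^+ jj) : R).

(** The supremum of the dual sums is raised to the power [p] by [powR_psi_le] and
    the maximum over the cells is bounded by the sum of [psi]; with [A] large the
    factor [expR (- (A * j))] absorbs the sum of their expectations. *)
Lemma sup_centered_dominated : exists G : T -> \bar R,
  [/\ measurable_fun setT G, (forall w, 0 <= G w)%E,
      (forall w, sup_centered Pr X m.+1 n jj w `^ p <= G w)%E &
      (\int[Pr]_w G w <= ((2 ^+ jj / n%:R * (m.+1%:R * S)) `^ p * moment_const M0 K B s p)%:E)%E].
Proof.
have nR : 0 < n%:R :> R by rewrite ltr0n.
have jR : 0 < jj%:R :> R by rewrite ltr0n.
have q0 : 0 < 2 ^+ jj :> R by rewrite exprn_gt0.
have pp : 0 < p by exact: lt_le_trans ltr01 p1.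
have [lS l2] := sqrt_levels jj n0 (R := R).
move: lS l2; set lam := Num.sqrt _ => lS l2.
have S0 : 0 < S by rewrite sqrtr_gt0 divr_gt0// mulr_gt0.
have lam0 : 0 < lam by rewrite sqrtr_gt0 divr_gt0// mulr_gt0.
have lam01 : 0 <= lam <= 1.
  rewrite (ltW lam0)/= -[leRHS]sqrtr1 ler_wsqrtr// ler_pdivrMr// mul1r.
  by rewrite -natrX -natrM ler_nat.
have nl : n%:R * lam ^+ 2 = jj%:R * 2 ^+ jj.
  by rewrite -l2; field; rewrite gt_eqF.
have A2 : 2 <= A by rewrite /A lerDr.
have J1 : 1 <= jj%:R :> R by rewrite ler1n.
pose c4 := 4 * ((Num.truncn p).+1`!%:R * expR A) * expR (- (A * jj%:R)).
have c40 : 0 <= c4 by rewrite /c4; nonneg.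
pose D k w := dualsum X P m (gram_seq m) jj k n w.
have mpsi k : measurable_fun setT (fun w => (psi (lam * D k w))%:E).
  apply/measurable_EFinP.
  have ml : measurable_fun setT (fun w => lam * D k w).
    apply: measurable_funM => //; apply: measurable_devsum.
    by have [] : bmf (cell_fun dual jj k) by exact: bmf_rescale.
  rewrite /psi; apply: measurable_funB => //.
  apply: measurable_funD; apply: measurableT_comp => //.
  exact: measurableT_comp.
pose e1 (i : nat) : int := i%:Z; pose e2 (i : nat) : int := - i%:Z.
have i1 : injective e1 by move=> a b [].
have i2 : injective e2 by move=> a b /oppr_inj [].
pose W e w := (\sum_(i <oo) (psi (lam * D (e i) w))%:E)%E.
have W0 e w : (0 <= W e w)%E by apply: nneseries_ge0 => i _ _; rewrite lee_fin psi_ge0.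
have mW e : measurable_fun setT (W e).
  apply: ge0_emeasurable_sum => // i w _ _; by rewrite lee_fin psi_ge0.
pose G w := ((A `^ p)%:E + c4%:E * (W e1 w + W e2 w))%E.
have G0 w : (0 <= G w)%E.
  apply: adde_ge0; first by rewrite lee_fin powR_ge0.
  by apply: mule_ge0; [rewrite lee_fin | exact: adde_ge0].
have termW e i w : ((psi (lam * D (e i) w))%:E <= W e w)%E.
  rewrite /W (nneseriesD1 (n := i))//; last by move=> k _; rewrite lee_fin psi_ge0.
  by rewrite leeDl//; apply: nneseries_ge0 => k _ _; rewrite lee_fin psi_ge0.
have GD k w : ((((lam * `|D k w|) / jj%:R) `^ p)%R%:E <= G w)%E.
  have h : ((lam * `|D k w|) / jj%:R) `^ p <= A `^ p + c4 * psi (lam * D k w).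
    have -> : psi (lam * D k w) = psi (lam * `|D k w|).
      have [D0|D0] := leP 0 (D k w); first by rewrite ger0_norm.
      by rewrite ltr0_norm// mulrN /psi opprK [expR (- _) + _]addrC.
    by apply: powR_psi_le => //; [exact: ltW | apply: mulr_ge0 => //; exact: ltW].
  apply: (@le_trans _ _ (A `^ p + c4 * psi (lam * D k w))%:E); first by rewrite lee_fin.
  rewrite EFinD; apply: leeD => //; rewrite EFinM; apply: lee_wpmul2l; first by rewrite lee_fin.
  case: k {h} => k.
    by apply: le_trans (termW e1 k w) _; rewrite leeDl.
  by rewrite NegzE; apply: le_trans (termW e2 k.+1 w) _; rewrite leeDr.
set kap := 2 ^+ jj / n%:R * (m.+1%:R * S).
have kap0 : 0 <= kap by rewrite /kap; nonneg.
have sup0 w : (0 <= sup_centered Pr X m.+1 n jj w)%E.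
  apply: le_trans (ereal_sup_ubound _); last by exists 0.
  exact: abse_ge0.
have pointwise w : (sup_centered Pr X m.+1 n jj w `^ p <= (kap `^ p)%:E * G w)%E.
  have [kap00|kapn] := eqVneq (kap `^ p) 0.
    exfalso; move/eqP: kap00; rewrite powR_eq0 => /andP[/eqP k0 _].
    have : 0 < kap by rewrite /kap; apply: mulr_gt0; [rewrite divr_gt0 | rewrite mulr_gt0].
    by rewrite k0 ltxx.
  have kp : 0 < kap `^ p by rewrite lt_neqAle eq_sym kapn powR_ge0.
  case EG : (G w) => [r| |]; last 2 first.
  - by rewrite gt0_muley ?lte_fin// leey.
  - by have := G0 w; rewrite EG.
  have r0 : 0 <= r by rewrite -lee_fin -EG.
  have Dk k : `|D k w| <= r `^ p^-1 * S.
    have := GD k w; rewrite EG lee_fin => h.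
    have h0 : 0 <= lam * `|D k w| / jj%:R by nonneg.
    have : (lam * `|D k w| / jj%:R) <= r `^ p^-1.
      have -> : lam * `|D k w| / jj%:R = ((lam * `|D k w| / jj%:R) `^ p) `^ p^-1.
        by rewrite -powRrM divff ?powRr1// gt_eqF.
      by apply: ge0_ler_powR => //; rewrite ?nnegrE ?powR_ge0// invr_ge0 ltW.
    by rewrite ler_pdivrMr// => h1; rewrite -(ler_pM2l lam0) [leRHS]mulrCA lS.
  have [C [rho [C0 rho01 bC ab]]] := gram_seq_spec m (R := R).
  have sup_le : (sup_centered Pr X m.+1 n jj w <= (kap * r `^ p^-1)%:E)%E.
    rewrite (sup_centeredE iid C0 rho01 bC ab)//; apply: ge_ereal_sup => _ [[u k] /= _ <-].
    have -> : kap * r `^ p^-1 = 2 ^+ jj / n%:R * (m.+1%:R * (r `^ p^-1 * S)) by rewrite /kap; ring.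
    rewrite lee_fin; apply: ler_wpM2l; first by nonneg.
    have Dk' l : `|dualsum X P m (gram_seq m) jj l n w| <= r `^ p^-1 * S by exact: Dk.
    by have := cellsum_dual_le C0 rho01 bC u Dk' k.
  case ES : (sup_centered Pr X m.+1 n jj w) sup_le => [t| |]; last 2 first.
  - by rewrite leye_eq.
  - by have := sup0 w; rewrite ES.
  rewrite lee_fin => tk; have t0 : 0 <= t by rewrite -lee_fin -ES.
  rewrite poweR_EFin -EFinM lee_fin.
  have -> : kap `^ p * r = (kap * r `^ p^-1) `^ p.
    by rewrite [RHS]powRM ?powR_ge0// -powRrM mulVf ?powRr1// gt_eqF.
  by apply: ge0_ler_powR => //; rewrite ?nnegrE ?mulr_ge0 ?powR_ge0//; exact: ltW.
have mWW : measurable_fun setT (fun w => c4%:E * (W e1 w + W e2 w))%E.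
  by apply: measurable_funeM; exact: emeasurable_funD.
exists (fun w => (kap `^ p)%:E * G w)%E; split => //.
- by apply: measurable_funeM; exact: emeasurable_funD.
- by move=> w; apply: mule_ge0; rewrite ?lee_fin ?powR_ge0.
rewrite ge0_integralZl//; last 2 first.
- by apply: emeasurable_funD.
- by rewrite lee_fin powR_ge0.
rewrite EFinM; apply: lee_wpmul2l; first by rewrite lee_fin powR_ge0.
rewrite ge0_integralD//; last 2 first.
- by move=> w _; rewrite lee_fin powR_ge0.
- by move=> w _; apply: mule_ge0; [rewrite lee_fin | exact: adde_ge0].
rewrite integral_cst// [X in (_ * X)%E]probability_setT mule1.
rewrite ge0_integralZl//; last 2 first.
- exact: emeasurable_funD.
- by move=> w _; exact: adde_ge0.
rewrite ge0_integralD//.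
have P1 := psi_series_le i1 lam01 nl; have P2 := psi_series_le i2 lam01 nl.
rewrite /moment_const -/B1 -/A EFinD; apply: leeD => //.
set b0 := expR (2 * K) * B * _ in P1 P2.
apply: (@le_trans _ _ (c4%:E * (b0%:E + b0%:E))%E).
  have P1' : (\int[Pr]_x W e1 x <= b0%:E)%E by exact: P1.
  have P2' : (\int[Pr]_x W e2 x <= b0%:E)%E by exact: P2.
  have P12 := leeD P1' P2'.
  by apply: (lee_wpmul2l _ P12); rewrite lee_fin.
rewrite -EFinD -EFinM lee_fin /c4 /b0.
(* [A - B1 = 2] leaves [expR (- (2 * j))], which beats [j * 2 ^ j]. *)
have key : expR (- (A * jj%:R)) * (jj%:R * 2 ^+ jj * expR (B1 * jj%:R)) <= 1.
  have -> : - (A * jj%:R) = - (B1 * jj%:R) + (- jj%:R - jj%:R) by rewrite /A; ring.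
  rewrite !expRD !expRN.
  have e1' : jj%:R <= expR jj%:R :> R by apply: le_trans (expR_ge1Dx _); rewrite lerDr.
  have e2' : 2 ^+ jj <= expR jj%:R :> R.
    rewrite exp2_expR ler_expR ler_piMl//.
    by have := @le_ln1Dx R 1; rewrite (_ : 1 + 1 = 2 :> R)//; apply; lra.
  have eB0 : expR (B1 * jj%:R) != 0 by rewrite gt_eqF// expR_gt0.
  have ej0 : 0 < expR jj%:R :> R by exact: expR_gt0.
  have -> : (expR (B1 * jj%:R))^-1 * ((expR jj%:R)^-1 / expR jj%:R) * (jj%:R * 2 ^+ jj * expR (B1 * jj%:R)) =
    (jj%:R * 2 ^+ jj) / (expR jj%:R * expR jj%:R) by field; rewrite eB0 gt_eqF.
  by rewrite ler_pdivrMr ?mulr_gt0// mul1r; apply: ler_pM.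
set ee := expR (- (A * jj%:R)) in key *; set bb := jj%:R * 2 ^+ jj * _ in key *.
set c := 4 * _.
have -> : c * ee * (expR (2 * K) * B * bb + expR (2 * K) * B * bb) =
  c * (2 * (expR (2 * K) * B)) * (ee * bb) by ring.
rewrite ler_piMr//; rewrite /c; nonneg.
Qed.

Lemma Lnorm_sup_centered :
  ('N[Pr]_p%:E[sup_centered Pr X m.+1 n jj] <=
    (2 ^+ jj / n%:R * (m.+1%:R * S) * moment_const M0 K B s p `^ p^-1)%:E)%E.
Proof.
have pp : 0 < p by exact: lt_le_trans ltr01 p1.
have mc0 : 0 <= moment_const M0 K B s p.
  by rewrite /moment_const -/B1 -/A; apply: addr_ge0; [exact: powR_ge0 | nonneg].
set kap := 2 ^+ jj / n%:R * (m.+1%:R * S).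
have kap0 : 0 <= kap by rewrite /kap; nonneg.
rewrite unlock/=.
have -> : (\int[Pr]_w (`|sup_centered Pr X m.+1 n jj w| `^ p) =
    \int[Pr]_w (sup_centered Pr X m.+1 n jj w `^ p))%E.
  apply: eq_integral => w _; rewrite gee0_abs//.
  apply: le_trans (ereal_sup_ubound _); last by exists 0.
  exact: abse_ge0.
have -> : kap * moment_const M0 K B s p `^ p^-1 = (kap `^ p * moment_const M0 K B s p) `^ p^-1.
  rewrite [RHS]powRM ?powR_ge0// -powRrM divff ?powRr1// gt_eqF//.
rewrite -poweR_EFin; apply: gt0_ler_poweR.
- by rewrite invr_ge0 ltW.
- rewrite in_itv/= leey andbT; apply: integral_ge0 => w _; exact: poweR_ge0.
- by rewrite in_itv/= leey andbT lee_fin mulr_ge0 ?powR_ge0.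
- have [G [_ _ fG GI]] := sup_centered_dominated.
  apply: (le_trans (ge0_le_integral_any Pr _ fG)) => // w; exact: poweR_ge0.
Qed.

End LpBound.

Section LpTools.
Context {R : realType} {d : measure_display} {T : measurableType d}.
Variable Pr : probability T R.

Lemma Lnorm_le_cst (f : T -> \bar R) (c p : R) : 1 <= p -> 0 <= c ->
  (forall w, 0 <= f w <= c%:E)%E -> ('N[Pr]_p%:E[f] <= c%:E)%E.
Proof.
move=> p1 c0 fc; have pp : 0 < p by exact: lt_le_trans ltr01 p1.
rewrite unlock/=.
have -> : c = (c `^ p) `^ p^-1 by rewrite -powRrM divff ?powRr1// gt_eqF.
rewrite -poweR_EFin; apply: gt0_ler_poweR.
- by rewrite invr_ge0 ltW.
- rewrite in_itv/= leey andbT; apply: integral_ge0 => w _; exact: poweR_ge0.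
- by rewrite in_itv/= leey andbT lee_fin powR_ge0.
have -> : ((c `^ p)%:E = \int[Pr]_w (c `^ p)%:E)%E.
  by rewrite integral_cst// [X in (_ * X)%E]probability_setT mule1.
apply: ge0_le_integral_any => w; first exact: poweR_ge0.
have /andP[f0 fw] := fc w; rewrite gee0_abs// -poweR_EFin.
apply: gt0_ler_poweR => //; first exact: ltW.
- by rewrite in_itv/= leey andbT.
- by rewrite in_itv/= leey andbT lee_fin.
Qed.

(** Triangle inequality up to a constant.  The suprema over uncountably many
    points enter only through the measurable majorant [G] of [f ^ p]. *)
Lemma Lnorm_shift_le (f g G : T -> \bar R) (a be p : R) : 1 <= p -> 0 <= a -> 0 <= be ->
  (forall w, 0 <= f w)%E -> (forall w, 0 <= g w)%E ->
  (forall w, g w <= f w + be%:E)%E ->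
  measurable_fun setT G -> (forall w, 0 <= G w)%E -> (forall w, f w `^ p <= G w)%E ->
  (\int[Pr]_w G w <= (a `^ p)%:E)%E ->
  ('N[Pr]_p%:E[g] <= (4 * (a + be))%:E)%E.
Proof.
move=> p1 a0 be0 f0 g0 gf mG G0 fG GI; have pp : 0 < p by exact: lt_le_trans ltr01 p1.
have ab0 : 0 <= a + be by exact: addr_ge0.
rewrite unlock/=.
have -> : 4 * (a + be) = ((4 * (a + be)) `^ p) `^ p^-1 by rewrite -powRrM divff ?powRr1 ?mulr_ge0// gt_eqF.
rewrite -poweR_EFin; apply: gt0_ler_poweR.
- by rewrite invr_ge0 ltW.
- rewrite in_itv/= leey andbT; apply: integral_ge0 => w _; exact: poweR_ge0.
- by rewrite in_itv/= leey andbT lee_fin powR_ge0.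
pose M := a + be.
have two : 2 * (2 `^ p * M `^ p) <= (4 * M) `^ p.
  have -> : 4 * M = 2 * (2 * M) by ring.
  rewrite powRM ?mulr_ge0// powRM//; apply: ler_wpM2r.
    by apply: mulr_ge0; exact: powR_ge0.
  by rewrite -[leLHS]powRr1//; apply: ler_powR => //; rewrite ler1n.
have p2 : 0 < 2 `^ p :> R by exact: powR_gt0.
pose h w := ((2 `^ p)%:E * (G w + (be `^ p)%:E))%E.
have gh w : (`|g w| `^ p <= h w)%E.
  apply: (@le_trans _ _ ((2 `^ p)%:E * (f w `^ p + (be `^ p)%:E))%E); last first.
    by apply: lee_wpmul2l; [rewrite lee_fin ltW | exact: leeD].
  rewrite gee0_abs//.
  case Ef : (f w) => [r| |]; last 2 first.
  - rewrite poweRyr ?gt_eqF// gt0_muley ?lte_fin ?leey//.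
  - by have := f0 w; rewrite Ef.
  have r0 : 0 <= r by rewrite -lee_fin -Ef.
  have := gf w; rewrite Ef -EFinD; case Eg : (g w) => [t| |]; last 2 first.
  - by rewrite leye_eq.
  - by have := g0 w; rewrite Eg.
  rewrite lee_fin => tr; have t0 : 0 <= t by rewrite -lee_fin -Eg.
  rewrite !poweR_EFin -EFinD -EFinM lee_fin.
  apply: (@le_trans _ _ ((2 * Order.max r be) `^ p)).
    apply: ge0_ler_powR; rewrite ?nnegrE//; [exact: ltW | |].
      by rewrite mulr_ge0// le_max r0.
    apply: (le_trans tr); have h1 : r <= Order.max r be by rewrite le_max lexx.
    have h2 : be <= Order.max r be by rewrite le_max lexx orbT.
    by move: h1 h2; move: (Order.max r be) => x; lra.
  rewrite powRM// ?le_max ?r0//; apply: ler_wpM2l; first exact: ltW.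
  have [rb|rb] := leP r be; first by rewrite lerDr powR_ge0.
  by rewrite lerDl powR_ge0.
apply: (le_trans (ge0_le_integral_any Pr _ gh)); first by move=> w; exact: poweR_ge0.
rewrite ge0_integralZl//; last 2 first.
- exact: emeasurable_funD.
- by move=> w _; apply: adde_ge0; rewrite ?lee_fin ?powR_ge0.
rewrite ge0_integralD//; last by move=> w _; rewrite lee_fin powR_ge0.
rewrite integral_cst// [X in (_ + _ * X)%E]probability_setT mule1.
apply: (@le_trans _ _ ((2 `^ p)%:E * ((a `^ p)%:E + (be `^ p)%:E))%E).
  by apply: lee_wpmul2l; [rewrite lee_fin ltW | exact: leeD].
rewrite -EFinD -EFinM lee_fin (le_trans _ two)// mulrCA; apply: ler_wpM2l; first exact: ltW.
have -> : 2 * M `^ p = M `^ p + M `^ p by ring.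
by apply: lerD; apply: ge0_ler_powR; rewrite ?nnegrE ?lerDl ?lerDr//; exact: ltW.
Qed.

End LpTools.

Section Crude.
Context {R : realType} {d : measure_display} {T : measurableType d}.
Variables (Pr : probability T R) (X : nat -> {RV Pr >-> R}) (P : probability R R).
Hypothesis iid : iid_with_law X P.

(** Each cell sum of the dual spline has [n] terms, each at most [2 * K]; this
    serves the sample sizes [n] with [n < j n * 2 ^ j n], which are finitely many. *)
Lemma sup_centered_crude (m : nat) (K : R) (jj n : nat) w : 0 <= K ->
  (forall z, `|cardinal_spline m (gram_seq m) z| <= K) -> (0 < n)%N ->
  (sup_centered Pr X m.+1 n jj w <= (2 ^+ jj * (m.+1%:R * (2 * K)))%:E)%E.
Proof.
move=> K0 dK n0.
have [C [rho [C0 rho01 bC ab]]] := gram_seq_spec m (R := R).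
have bd : bmf (cardinal_spline m (gram_seq m) : R -> R).
  exact: (localized_bmf rho01 (cardinal_spline_localized m C0 rho01 bC)).
have bc k : bmf (cell_fun (cardinal_spline m (gram_seq m)) jj k : R -> R) by exact: bmf_cell.
have D k : `|dualsum X P m (gram_seq m) jj k n w| <= n%:R * (2 * K).
  rewrite /dualsum /devsum (le_trans (ler_norm_sum _ _ _))//.
  apply: sum_ord_le => i; apply: (le_trans (ler_normB _ _)).
  rewrite mulr_natl mulr2n; apply: lerD; first exact: dK.
  by apply: EP_norm_le => // x; exact: dK.
rewrite (sup_centeredE iid C0 rho01 bC ab)//; apply: ge_ereal_sup => _ [[u k]/= u01 <-].
rewrite lee_fin.
apply: (@le_trans _ _ (2 ^+ jj / n%:R * (m.+1%:R * (n%:R * (2 * K))))).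
  apply: ler_wpM2l; first by nonneg.
  exact: (cellsum_dual_le C0 rho01 bC u D k).
rewrite le_eqVlt; apply/orP; left; apply/eqP.
have nR : (n%:R : R) != 0 by rewrite pnatr_eq0 -lt0n.
by field.
Qed.

End Crude.

(** * Expectations as integrals against the density *)

Section SigmaFinite.
Context {R : realType}.

Lemma lebesgue_line_sigma_finite : sigma_finite [set: R] (@lebesgue_line R).
Proof.
exists (fun k : nat => `] (- k%:R)%R, k%:R]%classic); first by rewrite bigcup_itvT.
move=> k; split => //.
rewrite [X in (X < _)%E](_ : _ = @lebesgue_measure R `](- k%:R), k%:R]%classic)//.
exact: itvoc_fin.
Qed.

(** Lebesgue measure on the structure that carries laws, as a sigma-finite
    measure, so that the Radon-Nikodym theorem applies to a law. *)
Definition sigma_line : set R -> \bar R := lebesgue_line.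
HB.instance Definition _ := Measure.copy sigma_line lebesgue_line.
HB.instance Definition _ := @Measure_isSigmaFinite.Build _ R R sigma_line lebesgue_line_sigma_finite.
End SigmaFinite.

Section DensityExpectation.
Context {R : realType}.
Variables (P : probability R R) (p0 : R -> R).
Hypothesis dens : has_bounded_density P p0.
Local Notation mu := (@lebesgue_measure R).
Local Notation line := (@sigma_line R).

Let dominated : P `<< line.
Proof.
apply/null_content_dominatesP => A mA A0.
apply/eqP; rewrite eq_le measure_ge0 andbT.
by apply: (le_trans (density_measure_le dens mA)); rewrite [X in (_ * X)%E]A0 mule0.
Qed.

Let integral_line (f : R -> \bar R) :
  measurable_fun setT f -> (forall x, 0 <= f x)%E ->
  (\int[line]_x f x = \int[mu]_x f x)%E.
Proof. exact: integral_lebesgue_line. Qed.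

(** The density agrees almost everywhere with the Radon-Nikodym derivative. *)
Lemma integral_density (g : R -> R) : bmf g -> (forall x, 0 <= g x) ->
  (\int[P]_x (g x)%:E = \int[mu]_x (g x * p0 x)%:E)%E.
Proof.
move=> bg g0; have [mp0 p00 _ PE] := dens.
have finP : (P setT < +oo)%E by rewrite [X in (X < _)%E]probability_setT ltry.
have ig : P.-integrable setT (EFin \o g) by apply: bmf_integrable.
rewrite -(Radon_Nikodym_change_of_variables dominated measurableT ig).
have mg : measurable_fun setT (fun x => (g x * p0 x)%:E).
  by apply/measurable_EFinP; apply: measurable_funM => //; case: bg.
rewrite -integral_line//; last by move=> x; rewrite lee_fin mulr_ge0.
apply: ae_eq_integral => //.
  apply: emeasurable_funM; first by apply/measurable_EFinP; case: bg.
  by apply: (measurable_int line); exact: Radon_Nikodym_integrable.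
under [X in ae_eq _ _ _ X]eq_fun do rewrite EFinM.
apply: ae_eqe_mul2l.
apply: integral_ae_eq => //.
- exact: Radon_Nikodym_integrable.
- exact/measurable_EFinP.
move=> A _ mA; rewrite -Radon_Nikodym_integral//.
rewrite [RHS]integral_mkcond integral_line.
- by rewrite -[RHS]integral_mkcond -PE.
- apply: (measurable_restrictT _ _).1 => //; exact/measurable_EFinP/measurable_funTS.
- by move=> x; rewrite patchE; case: ifP; rewrite ?lee_fin.
Qed.
End DensityExpectation.

(** * Scalar products of splines with B-splines *)

Section Moments.
Context {R : realType}.
Variable m : nat.
Local Notation mu := (@lebesgue_measure R).
Local Notation N := (@bspline0 R m.+1).
Local Notation cell q := `](q - 1)%:~R, (q + m.+1%:Z)%:~R]%classic.

Lemma bsplineZ_range (x : R) (k : int) : bspline k m.+1 x != 0 ->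
  k%:~R <= x /\ x < k%:~R + m.+1%:R.
Proof.
move=> H; split; rewrite leNgt || rewrite ltNge; apply/negP => h; move/negP: H; apply; apply/eqP; apply: bsplineZ_supp.
- by left; rewrite subr_lt0.
- by right; rewrite lerBrDl.
Qed.

(** A spline seen from one of its knots is a sum over the fixed window of
    B-splines whose supports meet the one in question. *)
Lemma cardinal_spline_window (v : int -> R) (q : int) (a b : nat) (z : R) :
  (q - a%:Z)%:~R + m%:R <= z -> z < (q - a%:Z)%:~R + b%:R ->
  cardinal_spline m v z = \sum_(i < b) v (q + (i%:Z - a%:Z)) * bspline (q + (i%:Z - a%:Z)) m.+1 z.
Proof.
move=> z1 z2.
pose s := [seq q + (i%:Z - a%:Z) | i <- iota 0 b].
have us : uniq s by rewrite map_inj_uniq ?iota_uniq// => i i' /addrI /addIr [].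
have D := @cardinal_spline_hasZ R m v z.
rewrite (hasZ_unique D (hasZ_fin us _)); last first.
  move=> l; rewrite mulf_eq0 negb_or => /andP[_ /bsplineZ_range[l1 l2]].
  have l3 : (q - a%:Z)%:~R < (l + 1)%:~R :> R.
    rewrite [ltRHS]intrD -(ltrD2r m%:R); apply: (le_lt_trans z1).
    by apply: (lt_le_trans l2); rewrite -natr1; lra.
  have l4 : l%:~R < (q - a%:Z + b%:Z)%:~R :> R.
    by rewrite [ltRHS]intrD; apply: (le_lt_trans l1); rewrite -pmulrn.
  move: l3 l4; rewrite !ltr_int => l3 l4.
  have l5 : l = q + ((absz (l - q + a%:Z)%R)%:Z - a%:Z) by move: l3; clear; lia.
  rewrite [X in X \in _]l5; apply: (map_f (fun i : nat => q + (i%:Z - a%:Z))); rewrite mem_iota/= add0n.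
  by move: l3 l4; clear; lia.
by rewrite /s big_map -{1}(subn0 b) -/(index_iota 0 b) big_mkord.
Qed.

Lemma spline_moments (v : int -> R) (q : int) :
  \int[mu]_(z in cell q) (N (z - q%:~R) * cardinal_spline m v z) =
  \sum_(i < m.*2.+1) spline_gram m (i%:Z - m%:Z) * v (q + (i%:Z - m%:Z)).
Proof.
transitivity (\int[mu]_(z in cell q) (\sum_(i <- index_enum 'I_m.*2.+1)
    v (q + (i%:Z - m%:Z)) * (bspline q m.+1 z * bspline (q + (i%:Z - m%:Z)) m.+1 z))).
  apply: eq_Rintegral => z _; rewrite -/(bspline q m.+1 z).
  have [->|nz] := eqVneq (bspline q m.+1 z) 0.
    by rewrite mul0r big1// => i _; rewrite mul0r mulr0.
  have [z1 z2] := bsplineZ_range nz.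
  rewrite (@cardinal_spline_window v q m m.*2.+1) ?mulr_sumr.
  - by apply: eq_bigr => i _; ring.
  - by rewrite intrB -pmulrn subrK.
  - rewrite intrB -pmulrn (lt_le_trans z2)// -addrA lerD2l -addnn -addnS natrD addrA addNr add0r//.
rewrite Rintegral_bmf_sum//; last 2 first.
- exact: itvoc_fin.
- by move=> i; apply: bmfZ; apply: bmfM; exact: bmf_bsplineZ.
apply: eq_bigr => i _; rewrite Rintegral_bmfZ//; last 2 first.
- exact: itvoc_fin.
- by apply: bmfM; exact: bmf_bsplineZ.
rewrite mulrC; congr (_ * _).
have -> : spline_gram m (i%:Z - m%:Z) = gram m.+1 q (q + (i%:Z - m%:Z)) :> R.
  by rewrite gram_toeplitz; congr spline_gram; ring.
rewrite /gram (RintegralT_itvoc (a := (q - 1)%:~R) (b := (q + m.+1%:Z)%:~R))// => x qx; rewrite [X in X * _]bsplineZ_supp ?mul0r//.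
case: qx => qx; [left|right]; [rewrite subr_lt0 | rewrite lerBrDl].
- by apply: (le_lt_trans qx); rewrite ltr_int; clear; lia.
- by apply: ltW; move: qx; rewrite intrD -pmulrn.
Qed.

End Moments.

(** * Bias in terms of spline approximation *)

Section Transfer.
Context {R : realType}.
Local Notation mu := (@lebesgue_measure R).
Variables (P : probability R R) (p0 : R -> R).
Hypothesis dens : has_bounded_density P p0.
Local Notation EP f := (\int[P]_x f x).
Variables (m : nat) (b : int -> R) (C rho : R).
Hypotheses (C0 : 0 <= C) (rho01 : 0 < rho < 1).
Hypothesis bC : forall k, `|b k| <= C * rho ^+ `|k|%N.
Hypothesis ab : forall k,
  \sum_(i < m.*2.+1) spline_gram m (i%:Z - m%:Z) * b (k + m%:Z - i%:Z) = (k == 0)%:R.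
Local Notation N := (@bspline0 R m.+1).
Local Notation dual := (cardinal_spline m b).
Local Notation cell q := `](q - 1)%:~R, (q + m.+1%:Z)%:~R]%classic.

Lemma hasZ_opp (u : int -> R) s : hasZ u s -> hasZ (fun k => u (- k)) s.
Proof.
rewrite /hasZ (_ : psumZ (fun k => u (- k)) = psumZ u)//.
apply/funext => n; rewrite /psumZ [RHS](reindex_inj rev_ord_inj)/=.
apply: eq_bigr => i _; congr u; rewrite subSS.
by have := ltn_ord i; clear; lia.
Qed.

(** The coefficient functionals read off the coefficients of any spline with
    bounded coefficients: the Gram matrix and its inverse cancel. *)
Lemma spline_biorthogonality (v : int -> R) (V : R) (l : int) :
  (forall k, `|v k| <= V) ->
  hasZ (fun k => b k * \int[mu]_(z in cell (l + k)) (N (z - (l + k)%:~R) * cardinal_spline m v z)) (v l).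
Proof.
move=> vV.
have H := @convZ_gram R m b C rho C0 rho01 bC ab (fun l' => v (l - l')) V 0 (fun k => vV _).
have {H} := hasZ_opp H; rewrite subr0.
rewrite (_ : (fun k => _) = (fun k => b k * \int[mu]_(z in cell (l + k)) (N (z - (l + k)%:~R) * cardinal_spline m v z)))//.
apply/funext => k; rewrite spline_moments opprK add0r; congr (_ * _).
apply: eq_bigr => i _; congr (_ * v _); ring.
Qed.

(** In the scale of the level the coefficient functionals are local averages of
    the density. *)
Lemma EP_bspline (j : nat) (q : int) :
  2 ^+ j * EP (cell_fun N j q) =
  \int[mu]_(z in cell q) (N (z - q%:~R) * p0 (z / 2 ^+ j)).
Proof.
have a0 : 0 < 2 ^+ j :> R by rewrite exprn_gt0.
have [mp0 p00 [M pM] PE] := dens.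
have bg : bmf (cell_fun N j q) by apply: bmf_cell; exact: bmf_bspline.
have bp : bmf (fun z : R => p0 (z / 2 ^+ j)).
  split; last by exists M => x; rewrite ger0_norm.
  apply: (measurableT_comp mp0) => /=; exact: measurable_funM.
have bN : bmf (fun z : R => N (z - q%:~R)) by apply: bmf_shift; exact: bmf_bspline.
have bh := bmfM bN bp.
rewrite -RintegralT_itvoc; last first.
  move=> x qx; rewrite (_ : N _ = 0) ?mul0r//.
  apply: (@bsplineZ_supp R m x q); case: qx => qx; [left|right]; [rewrite subr_lt0 | rewrite lerBrDl].
    by apply: (le_lt_trans qx); rewrite ltr_int; clear; lia.
  by apply: ltW; move: qx; rewrite intrD -pmulrn.
rewrite /Rintegral.
have mh : measurable_fun setT (fun z : R => (N (z - q%:~R) * p0 (z / 2 ^+ j))%:E).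
  by apply/measurable_EFinP; case: bh.
have h0 (z : R) : (0 <= (N (z - q%:~R) * p0 (z / 2 ^+ j))%:E)%E.
  by rewrite lee_fin mulr_ge0// bspline_ge0.
set I := (\int[mu]_x _)%E.
have aI : (\int[mu]_x (cell_fun N j q x * p0 x)%:E = ((2 ^+ j)^-1)%:E * I)%E.
  rewrite -(ge0_integral_affine 0 a0 mh h0); apply: eq_integral => x _.
  by rewrite addr0 [2 ^+ j * x / _]mulrC mulKf ?gt_eqF.
have -> : I = ((2 ^+ j)%:E * \int[P]_x (cell_fun N j q x)%:E)%E.
  rewrite (integral_density dens)//; last by move=> x; exact: bspline_ge0.
  by rewrite aI muleA -EFinM divff ?mul1e// gt_eqF.
rewrite fineM//; apply: integrable_fin_num => //; apply: bmf_integrable => //.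
by rewrite [X in (X < _)%E]probability_setT ltry.
Qed.

Let finP : (P setT < +oo)%E.
Proof. by rewrite [X in (X < _)%E]probability_setT ltry. Qed.

Let bdual : bmf dual.
Proof. by apply: (localized_bmf rho01); apply: (cardinal_spline_localized m C0 rho01 bC). Qed.

(** The truncated dual splines converge uniformly and the law is finite, so the
    expectation may be taken term by term. *)
Lemma dual_expectation_hasZ (j : nat) (l : int) :
  hasZ (fun k => b k * (2 ^+ j * EP (cell_fun N j (l + k)))) (2 ^+ j * EP (cell_fun dual j l)).
Proof.
have bN q : bmf (cell_fun N j q) by apply: bmf_cell; exact: bmf_bspline.
have a0 : 0 < 2 ^+ j :> R by rewrite exprn_gt0.
have E n : psumZ (fun k => b k * (2 ^+ j * EP (cell_fun N j (l + k)))) n =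
    2 ^+ j * EP (fun x => dual_partial m b n (2 ^+ j * x - l%:~R)).
  rewrite psumZE (_ : (fun x => dual_partial m b n _) =
      (fun x => \sum_(k <- zrange n) b k * cell_fun N j (l + k) x)); last first.
    apply/funext => x; apply: eq_bigr => k _; congr (_ * N _).
    by rewrite rmorphD/=; ring.
  rewrite (Rintegral_bmf_sum measurableT finP); last by move=> k; apply: bmfZ.
  rewrite mulr_sumr; apply: eq_bigr => k _.
  by rewrite (Rintegral_bmfZ measurableT finP)//; ring.
have bpart n : bmf (fun x : R => dual_partial m b n (2 ^+ j * x - l%:~R)).
  apply: (bmf_rescale (2 ^+ j) l%:~R); apply: bmf_sum => k; apply: bmfZ.
  by apply: bmf_shift; exact: bmf_bspline.
have bd : bmf (cell_fun dual j l) by exact: bmf_cell.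
apply/cvgrPdist_lt => e e0.
have [n0 _ Hn] : \forall n \near \oo, 2 ^+ j * (C * rho ^+ n) < e.
  have H : 2 ^+ j * (C * rho ^+ n) @[n --> \oo] --> (0 : R).
    rewrite -(mulr0 (2 ^+ j)) -[X in _ * X](mulr0 C); apply: cvgMr; apply: cvgMr.
    by apply: cvg_expr; rewrite ger0_norm//; case/andP: rho01 => // /ltW.
  by apply: (cvgr_lt 0 H).
exists n0 => // n n0n /=; rewrite E -mulrBr -(Rintegral_bmfB measurableT finP)// normrM ger0_norm ?ltW//.
apply: le_lt_trans (Hn n n0n); rewrite ler_pM2l//; apply: EP_norm_le; first exact: bmfB.
by move=> x; exact: cardinal_spline_approx.
Qed.

Lemma bmf_cardinal_spline (v : int -> R) (V : R) : (forall k, `|v k| <= V) ->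
  bmf (cardinal_spline m v).
Proof.
move=> vV; split.
  apply: (@measurable_fun_cvg _ _ _ setT (fun n z => psumZ (fun k => v k * bspline k m.+1 z) n)).
    move=> n; rewrite /psumZ; apply: (proj1 _).
    by apply: bmf_sum => i; apply: bmfZ; exact: bmf_bsplineZ.
  by move=> z _; exact: cardinal_spline_hasZ.
exists (m.+1%:R * V) => z; rewrite (le_trans (ler_norm_sum _ _ _))//.
apply: sum_ord_le => a; rewrite normrM -[leRHS]mulr1; apply: ler_pM => //.
exact: normr_bspline_le1.
Qed.

(** The coefficients of the expected estimator are within a constant of those
    of any spline approximating the density, by biorthogonality. *)
Lemma coefficient_transfer (j : nat) (v : int -> R) (V A : R) (l : int) :
  (forall k, `|v k| <= V) -> 0 <= A ->
  (forall z, `|p0 (z / 2 ^+ j) - cardinal_spline m v z| <= A) ->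
  `|2 ^+ j * EP (cell_fun dual j l) - v l| <= C * (2 / (1 - rho)) * (A * m.+2%:R).
Proof.
move=> vV A0 fA; have [mp0 p00 [M pM] PE] := dens.
pose f k := b k * (2 ^+ j * EP (cell_fun N j (l + k))).
pose g k := b k * \int[mu]_(z in cell (l + k)) (N (z - (l + k)%:~R) * cardinal_spline m v z).
have H : psumZ f n - psumZ g n @[n --> \oo] --> 2 ^+ j * EP (cell_fun dual j l) - v l.
  exact: cvgB (@dual_expectation_hasZ j l) (@spline_biorthogonality v V l vV).
apply: (cvgn_norm_le H) => n; rewrite !psumZE -sumrB.
apply: (le_trans (ler_norm_sum _ _ _)).
apply: (@le_trans _ _ (\sum_(k <- zrange n) (C * rho ^+ `|k - 0|%N) * (A * m.+2%:R))); last first.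
  rewrite -mulr_suml -mulr_sumr; apply: ler_wpM2r; first by nonneg.
  by apply: ler_wpM2l => //; apply: sum_uniq_geometric => //; exact: zrange_uniq.
apply: ler_sum => k _; rewrite subr0 /f /g -mulrBr normrM; apply: ler_pM => //.
rewrite EP_bspline.
have bN : bmf (fun z : R => N (z - (l + k)%:~R)) by apply: bmf_shift; exact: bmf_bspline.
have bp : bmf (fun z : R => p0 (z / 2 ^+ j)).
  split; last by exists M => x; rewrite ger0_norm.
  by apply: (measurableT_comp mp0) => /=; exact: measurable_funM.
have bs := bmf_cardinal_spline vV.
have itv : (l + k - 1)%:~R <= (l + k + m.+1%:Z)%:~R :> R.
  by rewrite ler_int; clear; lia.
rewrite -Rintegral_bmfB//; last 3 first.
- exact: itvoc_fin.
- exact: bmfM.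
- exact: bmfM.
have -> : m.+2%:R = (l + k + m.+1%:Z)%:~R - (l + k - 1)%:~R :> R.
  by rewrite -intrB pmulrn; congr _%:~R; clear; lia.
apply: normr_Rintegral_itvoc => //.
  by apply: bmfB; exact: bmfM.
move=> x _ _; rewrite -mulrBr normrM -[leRHS]mul1r; apply: ler_pM => //.
exact: normr_bspline_le1.
Qed.

(** Bias of the estimator in terms of the distance, at the scale of the level,
    from the density to splines with bounded coefficients. *)
Lemma kernel_bias (j : nat) (v : int -> R) (V A : R) (y : R) :
  (forall k, `|v k| <= V) -> 0 <= A ->
  (forall z, `|p0 (z / 2 ^+ j) - cardinal_spline m v z| <= A) ->
  `|2 ^+ j * EP (cell_fun (cell_kernel m b (frac (2 ^+ j * y))) j (Num.floor (2 ^+ j * y))) - p0 y| <=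
  (m.+1%:R * (C * (2 / (1 - rho)) * m.+2%:R) + 1) * A.
Proof.
move=> vV A0 fA; set u := frac _; set k := Num.floor _.
have bN a : bmf (cell_fun dual j (k - a)) by exact: bmf_cell.
have -> : 2 ^+ j * EP (cell_fun (cell_kernel m b u) j k) =
    \sum_(a < m.+1) N (u + a%:R) * (2 ^+ j * EP (cell_fun dual j (k - a%:Z))).
  rewrite (_ : cell_fun _ _ _ = fun x => \sum_(a <- index_enum 'I_m.+1) N (u + a%:R) * cell_fun dual j (k - a%:Z) x); last first.
    apply/funext => x; apply: eq_bigr => a _.
    by congr (_ * cardinal_spline _ _ _); rewrite /cell_fun rmorphB/= opprB; ring.
  rewrite (Rintegral_bmf_sum measurableT finP); last by move=> a; apply: bmfZ.
  rewrite mulr_sumr; apply: eq_bigr => a _.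
  by rewrite (Rintegral_bmfZ measurableT finP)//; ring.
have := fA (2 ^+ j * y); rewrite [X in p0 X]mulrC mulKf ?gt_eqF ?exprn_gt0//.
rewrite /cardinal_spline -/u -/k => py.
have T : `|\sum_(a < m.+1) N (u + a%:R) * (2 ^+ j * EP (cell_fun dual j (k - a%:Z))) -
    \sum_(a < m.+1) v (k - a%:Z) * N (u + a%:R)| <= m.+1%:R * (C * (2 / (1 - rho)) * (A * m.+2%:R)).
  rewrite -sumrB (le_trans (ler_norm_sum _ _ _))//; apply: sum_ord_le => a.
  rewrite [v _ * _]mulrC -mulrBr normrM -[leRHS]mul1r; apply: ler_pM => //.
    exact: normr_bspline_le1.
  exact: (@coefficient_transfer j v V A).
move: T py; set e1 := \sum_(a < _) _; set e2 := \sum_(a < _) _ => T py.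
rewrite (_ : e1 - p0 y = (e1 - e2) - (p0 y - e2)); last by ring.
apply: (le_trans (ler_normB _ _)); apply: (le_trans (lerD T py)).
by rewrite le_eqVlt; apply/orP; left; apply/eqP; ring.
Qed.

End Transfer.

(** * Spline approximation of smooth functions *)

Section Primitive.
Context {R : realType}.
Local Notation mu := (@lebesgue_measure R).

Lemma newton_leibniz (F f : R -> R) (x y : R) : x <= y -> continuous f ->
  (forall z, is_derive z (1 : R) F (f z)) -> F y - F x = \int[mu]_(z in `]x, y]) f z.
Proof.
rewrite le_eqVlt => /predU1P[<- _ _|xy cf dF].
  by rewrite set_itv_ge ?Rintegral_set0 ?subrr// bnd_simp ltxx.
have cF : continuous F by move=> z; apply/differentiable_continuous/derivable1_diffP.
have -> : \int[mu]_(z in `]x, y]) f z = \int[mu]_(z in `[x, y]) f z.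
  rewrite /Rintegral integral_itv_obnd_cbnd//; apply/measurable_EFinP/measurable_funTS.
  exact: continuous_measurable_fun.
rewrite /Rintegral (@continuous_FTC2 R f F)//.
- exact: continuous_subspaceT.
- split.
  + by move=> z _; have [] := dF z.
  + exact/cvg_at_right_filter/cF.
  + exact/cvg_at_left_filter/cF.
- by move=> z _; rewrite derive1E; have [_ ->] := dF z.
Qed.

Variable m : nat.

Lemma cardinal_splineB (v w : int -> R) z :
  cardinal_spline m (fun k => v k - w k) z = cardinal_spline m v z - cardinal_spline m w z.
Proof. by rewrite /cardinal_spline -sumrB; apply: eq_bigr => a _; rewrite mulrBl. Qed.

(** A B-spline of order [m + 2] has derivative [N - N (. - 1)], with [N] of
    order [m + 1]; summation by parts moves the difference to the coefficients. *)
Lemma cardinal_spline_primitive (V : int -> R) (x y : R) : x <= y -> y <= x + 1 ->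
  cardinal_spline m.+1 V y - cardinal_spline m.+1 V x =
  \int[mu]_(z in `]x, y]) cardinal_spline m (fun k => V k - V (k - 1)) z.
Proof.
move=> xy yx; pose q := Num.floor x; pose l (i : nat) := q + (i%:Z - m.+1%:Z).
have /andP[qx xq] : q%:~R <= x < (q + 1)%:~R by rewrite floor_itv ?num_real.
have W z : x <= z -> z <= y -> (q - m.+1%:Z)%:~R + m.+1%:R <= z /\ z < (q - m.+1%:Z)%:~R + m.+3%:R.
  move=> xz zy; rewrite pmulrn [m.+3%:R]pmulrn -!intrD.
  rewrite (_ : q - m.+1%:Z + m.+1%:Z = q); last by ring.
  rewrite (_ : q - m.+1%:Z + m.+3%:Z = q + 2); last by clear; lia.
  split; first exact: le_trans xz.
  by move: xq; rewrite !intrD; move: zy yx; clear; lra.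
have E z : x <= z -> z <= y ->
    cardinal_spline m.+1 V z = \sum_(i <- index_enum 'I_m.+3) V (l i) * bspline0 m.+2 (z - (l i)%:~R).
  by move=> xz zy; have [w1 w2] := W z xz zy; exact: cardinal_spline_window.
rewrite !E ?lexx// -sumrB.
have bd (i : nat) : bmf (fun z : measurableTypeR R => bspline0 m.+1 (z - (l i)%:~R) - bspline0 m.+1 (z - (l i)%:~R - 1)).
  apply: bmfB; first exact: bmf_shift (bmf_bspline m).
  by have := @bmf_shift R _ (- (l i)%:~R - 1) (bmf_bspline m); under eq_fun do rewrite addrA.
transitivity (\sum_(i <- index_enum 'I_m.+3) \int[mu]_(z in `]x, y]) (V (l i) * (bspline0 m.+1 (z - (l i)%:~R) - bspline0 m.+1 (z - (l i)%:~R - 1)))).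
  apply: eq_bigr => i _; rewrite -mulrBr bspline_diff_shift//.
  by rewrite Rintegral_bmfZ//; do ?[exact: itvoc_fin | exact: bd].
rewrite -Rintegral_bmf_sum//; last 2 first.
- exact: itvoc_fin.
- by move=> i; apply: bmfZ; exact: bd.
apply: eq_Rintegral => z; rewrite inE/= in_itv/= => /andP[/ltW xz zy].
have [w1 w2] := W z xz zy.
have qz : q%:~R <= z by exact: le_trans xz.
have zq : z < q%:~R + 2.
  by move: xq zy yx; rewrite intrD; clear; lra.
rewrite cardinal_splineB.
rewrite (@cardinal_spline_window R m V q m.+1 m.+3 z)//; last first.
  by apply: le_trans w1; rewrite lerD2l ler_nat.
(* The translated coefficients are seen through the window starting one knot
   later. *)
rewrite (@cardinal_spline_window R m (fun k => V (k - 1)) q m m.+3 z); last 2 first.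
- by rewrite intrB -pmulrn subrK.
- by rewrite intrB -pmulrn -[m.+3]addn3 natrD; move: zq; clear; lra.
rewrite -sumrB; apply: eq_bigr => i _.
have -> : q + (i%:Z - m%:Z) = l i + 1 by rewrite /l; clear; lia.
by rewrite addrK -/(l i) -mulrBr /bspline/= [(l i + 1)%:~R]intrD opprD addrA.
Qed.
End Primitive.

Section Approximation.
Context {R : realType}.
Local Notation mu := (@lebesgue_measure R).

(** Chaining along [n] steps of length at most one. *)
Lemma chain_le (F : R -> R) (om : R) (n : nat) (x y : R) :
  (forall x y, `|x - y| <= 1 -> `|F x - F y| <= om) ->
  `|x - y| <= n%:R -> `|F x - F y| <= n%:R * om.
Proof.
move=> Fo; elim: n x y => [|n IH] x y.
  by rewrite normr_le0 subr_eq0 => /eqP ->; rewrite subrr normr0 mul0r.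
rewrite -natr1 => xy.
have n1 : 0 < n%:R + 1 :> R by rewrite natr1 ltr0n.
pose z := y + (x - y) / (n%:R + 1).
have zy : `|z - y| <= 1.
  by rewrite /z addrC addKr normrM normfV (gtr0_norm n1) ler_pdivrMr// mul1r.
have xz : `|x - z| <= n%:R.
  have -> : x - z = (x - y) * (n%:R / (n%:R + 1)) by rewrite /z; field; rewrite gt_eqF.
  rewrite normrM (ger0_norm (divr_ge0 _ (ltW n1)))// mulrA ler_pdivrMr// mulrC.
  by apply: ler_wpM2l.
rewrite (_ : F x - F y = (F x - F z) + (F z - F y)); last by ring.
by rewrite (le_trans (ler_normD _ _))// mulrDl mul1r lerD ?IH ?Fo.
Qed.

Lemma bspline_frac_unity m (z : R) : \sum_(a < m.+1) bspline0 m.+1 (frac z + a%:R) = 1.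
Proof. by rewrite bspline_unity// frac_itv. Qed.

(** By partition of unity the error is an average of increments of [F] between
    [z] and the [m + 1] knots before it. *)
Lemma quasi_interpolation m (F : R -> R) (om : R) : 0 <= om ->
  (forall x y, `|x - y| <= 1 -> `|F x - F y| <= om) ->
  forall z, `|F z - cardinal_spline m (fun k => F k%:~R) z| <= m.+1%:R * om.
Proof.
move=> om0 Fo z.
have -> : F z - cardinal_spline m (fun k => F k%:~R) z =
    \sum_(a < m.+1) (F z - F (Num.floor z - a%:Z)%:~R) * bspline0 m.+1 (frac z + a%:R).
  under [RHS]eq_bigr do rewrite mulrBl.
  by rewrite sumrB -mulr_sumr bspline_frac_unity mulr1.
rewrite (le_trans (ler_norm_sum _ _ _))//.
have -> : m.+1%:R * om = \sum_(a < m.+1) m.+1%:R * om * bspline0 m.+1 (frac z + a%:R).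
  by rewrite -mulr_sumr bspline_frac_unity mulr1.
apply: ler_sum => a _.
rewrite normrM [X in _ * X <= _]ger0_norm ?bspline_ge0//; apply: ler_wpM2r; first exact: bspline_ge0.
apply: (chain_le Fo).
have -> : z - (Num.floor z - a%:Z)%:~R = frac z + a%:R.
  by rewrite /frac intrB -pmulrn; ring.
have /andP[f0 f1] := frac_itv z.
rewrite ger0_norm; last by rewrite addr_ge0.
apply: (@le_trans _ _ (1 + a%:R)).
  by rewrite lerD2r ltW.
by rewrite nat1r ler_nat.
Qed.

(** The spline is bounded because [F] is, and local stability bounds its
    coefficients in turn. *)
Lemma approximant_bounded m (F : R -> R) (v : int -> R) (M A : R) :
  (forall z, `|F z| <= M) -> (forall z, `|F z - cardinal_spline m v z| <= A) ->
  exists V : R, forall k, `|v k| <= V.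
Proof.
move=> FM FA; have [K K1 HK] := spline_stability m (R := R).
exists (K * (M + A)) => k.
have := HK (fun a => v (k - a%:Z)) (M + A) _ 0 isT; rewrite subr0; apply=> x x01.
have := FA (x + k%:~R); have := FM (x + k%:~R).
have fl : Num.floor (x + k%:~R) = k by exact: floor_frac.
rewrite /cardinal_spline fl (_ : frac _ = x); last by rewrite /frac fl addrK.
set S := \sum_(a < _) _ => F1 F2.
rewrite (_ : S = F (x + k%:~R) - (F (x + k%:~R) - S)); last by ring.
by rewrite (le_trans (ler_normB _ _))// lerD.
Qed.

(** The functions [G 0, ..., G s] are successive derivatives, bounded and
    continuous.  A chain, unlike iterated derivation, is easily shifted and
    rescaled. *)
Definition smooth_chain (s : nat) (G : nat -> R -> R) :=
  (forall a x, (a < s)%N -> is_derive x (1 : R) (G a) (G a.+1 x)) /\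
  (forall a, (a <= s)%N -> continuous (G a) /\ exists M : R, forall x, `|G a x| <= M).

(** A sequence over the integers with prescribed backward differences. *)
Definition primitiveZ (v : int -> R) (k : int) : R :=
  match k with
  | Posz n => \sum_(i < n.+1) v i%:Z
  | Negz n => - \sum_(i < n) v (- i.+1%:Z)
  end.

Lemma primitiveZ_diff v k : primitiveZ v k - primitiveZ v (k - 1) = v k.
Proof.
case: k => [[|n]|n].
- rewrite (_ : Posz 0 - 1 = Negz 0)//= big_ord0 oppr0 subr0.
  by rewrite big_ord1.
- rewrite (_ : Posz n.+1 - 1 = Posz n); last by clear; lia.
  have -> : primitiveZ v n.+1 = primitiveZ v n + v n.+1 by rewrite /primitiveZ big_ord_recr.
  by rewrite addrC addKr.
- rewrite (_ : Negz n - 1 = Negz n.+1); last by clear; lia.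
  by rewrite /= opprK big_ord_recr/= addrA addNr add0r.
Qed.

(** Induction on the smoothness: a spline close to the derivative has as
    primitive a spline whose difference with the function varies slowly, so
    that quasi-interpolation corrects it. *)
Lemma spline_approximation (s m : nat) (G : nat -> R -> R) (om : R) : (s <= m)%N ->
  0 <= om -> smooth_chain s G ->
  (forall x y, `|x - y| <= 1 -> `|G s x - G s y| <= om) ->
  exists2 v : int -> R, (exists V : R, forall k, `|v k| <= V) &
    forall z, `|G 0%N z - cardinal_spline m v z| <= m.+1%:R ^+ s.+1 * om.
Proof.
elim: s m G => [|s IH] m G sm om0 [dG cG] Gom.
  have H := quasi_interpolation m om0 Gom.
  have [_ [M GM]] := cG 0%N isT.
  by exists (fun k => G 0%N k%:~R); rewrite ?expr1//; exact: approximant_bounded GM H.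
case: m sm => // m sm.
have ch : smooth_chain s (fun a => G a.+1).
  by split=> [a x|a] h; [exact: dG | exact: cG].
have [v [V vV] Hv] := IH m _ sm om0 ch Gom.
pose A := m.+1%:R ^+ s.+1 * om; pose U := primitiveZ v.
have A0 : 0 <= A by rewrite mulr_ge0// exprn_ge0.
have [c1 [M1 GM1]] := cG 1%N isT.
have b1 : bmf (G 1%N) by split; [exact: continuous_measurable_fun | exists M1].
have bv := bmf_cardinal_spline m vV.
pose F z := G 0%N z - cardinal_spline m.+1 U z.
have Fom' x y : y <= x -> x <= y + 1 -> `|F x - F y| <= A.
  move=> yx xy.
  have -> : F x - F y = \int[mu]_(z in `]y, x]) (G 1%N z - cardinal_spline m v z).
    rewrite Rintegral_bmfB//; last exact: itvoc_fin.
    rewrite -(newton_leibniz yx c1 (fun z => dG 0%N z isT)).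
    have -> : cardinal_spline m v = cardinal_spline m (fun k => U k - U (k - 1)).
      by congr cardinal_spline; apply/funext => k; rewrite primitiveZ_diff.
    by rewrite -cardinal_spline_primitive// /F; ring.
  have := @normr_Rintegral_itvoc R (fun z => G 1%N z - cardinal_spline m v z) y x A (bmfB b1 bv) yx.
  move=> /(_ (fun z _ _ => Hv z)) /le_trans; apply.
  by rewrite ler_piMr// lerBlDl.
have Fom x y : `|x - y| <= 1 -> `|F x - F y| <= A.
  have [xy|xy] := leP y x.
    by rewrite ger0_norm ?subr_ge0// lerBlDl => ?; exact: Fom'.
  rewrite distrC (distrC (F x)) => h; apply: Fom'; first exact: ltW.
  by move: h; rewrite gtr0_norm ?subr_gt0// lerBlDl.
have H := quasi_interpolation m.+1 A0 Fom.
(* The sum [U + F], written as a difference for the sake of [cardinal_splineB]. *)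
pose w k := U k - (- F k%:~R).
have E z : G 0%N z - cardinal_spline m.+1 w z = F z - cardinal_spline m.+1 (fun k => F k%:~R) z.
  rewrite cardinal_splineB /F; have -> : cardinal_spline m.+1 (fun k => - F k%:~R) z = - cardinal_spline m.+1 (fun k => F k%:~R) z.
    by rewrite /cardinal_spline -sumrN; apply: eq_bigr => a _; rewrite mulNr.
  by rewrite /F; ring.
have Hw z : `|G 0%N z - cardinal_spline m.+1 w z| <= m.+2%:R ^+ s.+2 * om.
  rewrite E (le_trans (H z))// exprS -mulrA; apply: ler_wpM2l => //.
  by apply: ler_wpM2r => //; rewrite ler_pXn2r ?nnegrE// ler_nat.
have [_ [M0 GM0]] := cG 0%N isT.
by exists w => //; exact: approximant_bounded GM0 Hw.
Qed.

End Approximation.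

(** * Approximation of Hoelder densities *)

Section Smoothness.
Context {R : realType}.
Local Notation mu := (@lebesgue_measure R).

Lemma Cnat_chain (s : nat) (f : R -> R) : Cnat s f -> smooth_chain s (fun a => derive1n a f).
Proof.
move=> [df cf]; split=> [a x h|a h].
  by apply: is_derive_eq; [exact/derivableP/df | rewrite derive1nS derive1E].
have [[M fM] uf] := cf a h; split; last by exists M.
move=> x; apply/cvg_entourageP => E eE; have H := uf E eE.
by apply: (filterS _ (nbhs_entourage x H)) => y; rewrite /xsection/= inE.
Qed.

Lemma bounded_derivative_lipschitz (F f : R -> R) (M x y : R) : continuous f ->
  (forall z, `|f z| <= M) -> (forall z, is_derive z (1 : R) F (f z)) ->
  `|F x - F y| <= M * `|x - y|.
Proof.
move=> cf fM dF; have bf : bmf f by split; [exact: continuous_measurable_fun | exists M].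
have H a b : b <= a -> `|F a - F b| <= M * (a - b).
  move=> ba; rewrite (newton_leibniz ba cf dF).
  by apply: normr_Rintegral_itvoc.
have [xy|/ltW xy] := leP y x; first by rewrite [X in _ <= _ * X]ger0_norm ?subr_ge0// H.
by rewrite distrC (distrC x) [X in _ <= _ * X]ger0_norm ?subr_ge0// H.
Qed.

(** Integer smoothness [t] is used as [t - 1] derivatives the last of which is
    Lipschitz, which treats it as the Hoelder case with exponent one. *)
Lemma Cspace_holder (t : R) (f : R -> R) (m : nat) : 0 < t -> t <= m.+1%:R -> Cspace t f ->
  exists s L, [/\ (s <= m)%N, 0 <= L, s%:R <= t, smooth_chain s (fun a => derive1n a f) &
    forall x y, `|derive1n s f x - derive1n s f y| <= L * `|x - y| `^ (t - s%:R)].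
Proof.
move=> t0 tm [Cf Hf]; set k := Num.truncn t in Cf Hf.
have /andP[kt tk] := truncn_itv (ltW t0); rewrite -/k in kt tk.
have [tE|tn] := eqVneq t k%:R.
  have k0 : (0 < k)%N by rewrite -(ltr_nat R) -tE.
  have [dG cG] := Cnat_chain Cf.
  have [c1 [M fM]] := cG k (leqnn k).
  have M0 : 0 <= M by exact: le_trans (fM 0).
  exists k.-1, M; split.
  - by rewrite -ltnS prednK// -(ler_nat R) -tE.
  - exact: M0.
  - by rewrite tE ler_nat leq_pred.
  - by split=> [a x|a] h; [apply: dG | apply: cG]; move: h k0; clear; lia.
  - move=> x y; have -> : t - k.-1%:R = 1.
      by rewrite tE -[in k%:R](prednK k0) -natr1; ring.
    rewrite powRr1//; apply: (bounded_derivative_lipschitz _ _ c1 fM) => z.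
    by have := dG k.-1 z; rewrite prednK//; apply.
have [L HL] := Hf tn.
exists k, `|L|; split.
- by rewrite -ltnS -(ltr_nat R); apply: lt_le_trans tm; rewrite lt_neqAle eq_sym tn.
- exact: normr_ge0.
- exact: kt.
- exact: Cnat_chain.
move=> x y; have [->|xy] := eqVneq x y; first by rewrite subrr normr0 mulr_ge0 ?powR_ge0.
have d0 : 0 < `|x - y| `^ (t - k%:R) by rewrite powR_gt0 ?normr_gt0 ?subr_eq0.
by rewrite -ler_pdivrMr//; apply: le_trans (HL x y xy) (ler_norm _).
Qed.

Lemma rescaled_chain (s : nat) (G : nat -> R -> R) (h : R) : smooth_chain s G ->
  smooth_chain s (fun a z => h ^+ a * G a (z * h)).
Proof.
move=> [dG cG]; split=> [a x|a] sa.
  have Dh : is_derive x (1 : R) (fun z : R => z * h) h.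
    rewrite (_ : (fun z : R => z * h) = (id : R -> R) * cst h)//.
    apply: is_derive_eq.
    by rewrite scaler0 add0r /GRing.scale/= mulr1.
  have D := @is_derive1_comp R (G a) (fun z : R => z * h) x _ h (dG a (x * h) sa) Dh.
  have -> : h ^+ a.+1 * G a.+1 (x * h) = h ^+ a *: (G a.+1 (x * h) * h).
    by rewrite /GRing.scale/= exprSr; ring.
  exact: (is_deriveZ (f := G a \o (fun z : R => z * h)) (h ^+ a) D).
have [ca [M GM]] := cG a sa; split.
  move=> x; apply: cvgM; first exact: cvg_cst.
  apply: (@continuous_comp _ _ _ (fun z : R => z * h) (G a)); last exact: ca.
  by apply: cvgM; [exact: cvg_id | exact: cvg_cst].
by exists (`|h ^+ a| * M) => x; rewrite normrM; apply: ler_wpM2l.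
Qed.

(** At the scale [h := 2 ^ (- j)] the last derivative of [f (h * .)] has increments
    of order [h ^ s * h ^ (t - s)] between points at distance at most one. *)
Lemma smooth_spline_approximation (t : R) (f : R -> R) (m : nat) : 0 < t -> t <= m.+1%:R ->
  Cspace t f -> exists2 A : R, 0 <= A & forall j : nat, exists2 v : int -> R,
    (exists V : R, forall k, `|v k| <= V) &
    forall z, `|f (z / 2 ^+ j) - cardinal_spline m v z| <= A * 2 `^ (- t * j%:R).
Proof.
move=> t0 tm Cf; have [s [L [sm L0 st ch Hol]]] := Cspace_holder t0 tm Cf.
exists (m.+1%:R ^+ s.+1 * L); first by rewrite mulr_ge0// exprn_ge0.
move=> j; pose h : R := (2 ^+ j)^-1.
have h0 : 0 < h by rewrite invr_gt0 exprn_gt0.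
have hE : h `^ t = 2 `^ (- t * j%:R).
  rewrite /h -powR_inv1 ?exprn_ge0// -powR_mulrn// -!powRrM; congr (_ `^ _); ring.
have Gom x y : `|x - y| <= 1 ->
    `|h ^+ s * derive1n s f (x * h) - h ^+ s * derive1n s f (y * h)| <= L * h `^ t.
  move=> xy; rewrite -mulrBr normrM (ger0_norm (exprn_ge0 _ (ltW h0))).
  have -> : h `^ t = h ^+ s * h `^ (t - s%:R).
    rewrite -powR_mulrn ?ltW// -powRD ?subrKC// ?gt_eqF ?implybT//.
  rewrite mulrCA; apply: ler_wpM2l; first by rewrite exprn_ge0 ?ltW.
  apply: (le_trans (Hol _ _)); apply: ler_wpM2l => //.
  apply: ge0_ler_powR; rewrite ?nnegrE ?subr_ge0//; first exact: ltW.
  by rewrite -mulrBl normrM (gtr0_norm h0) ler_piMl//; exact: ltW.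
have om0 : 0 <= L * h `^ t by rewrite mulr_ge0 ?powR_ge0.
have [v vV Hv] := spline_approximation sm om0 (rescaled_chain h ch) Gom.
by exists v => // z; have := Hv z; rewrite expr0 mul1r mulrA -hE.
Qed.

End Smoothness.

(** * Total error *)

Section Assembly.
Context {R : realType} {d : measure_display} {T : measurableType d}.
Variables (Pr : probability T R) (X : nat -> {RV Pr >-> R}) (P : probability R R).
Hypothesis iid : iid_with_law X P.
Variable p0 : R -> R.
Hypothesis dens : has_bounded_density P p0.
Local Notation EP f := (\int[P]_x f x).
Variable m : nat.

Definition kernel_mean (jj : nat) (y : R) : R :=
  2 ^+ jj * EP (cell_fun (cell_kernel m (gram_seq m) (frac (2 ^+ jj * y))) jj (Num.floor (2 ^+ jj * y))).

Lemma estimator_expectation (jj n : nat) (y : R) : (0 < n)%N ->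
  ('E_Pr[spline_estimator X m.+1 n jj y] = (kernel_mean jj y)%:E)%E.
Proof.
move=> n0; rewrite /kernel_mean; set u := frac _; set k := Num.floor _.
have [C [rho [C0 rho01 bC ab]]] := gram_seq_spec m (R := R).
rewrite (_ : spline_estimator X m.+1 n jj y = fun v => n%:R^-1 * \sum_(i < n) 2 ^+ jj * cell_fun (cell_kernel m (gram_seq m) u) jj k (X i v)).
  rewrite (mean_expectation iid)//; apply: bmf_cell.
  exact: (localized_bmf rho01 (cell_kernel_localized m C0 rho01 bC u)).
apply/funext => v; rewrite /spline_estimator; congr (_ * _); apply: eq_bigr => i _.
by rewrite /spline_kernel_at (spline_kernel_cell C0 rho01 bC ab).
Qed.

Lemma sup_error_le (jj n : nat) (be : R) w : (0 < n)%N ->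
  (forall y, `|kernel_mean jj y - p0 y| <= be) ->
  (sup_error p0 X m.+1 n jj w <= sup_centered Pr X m.+1 n jj w + be%:E)%E.
Proof.
move=> n0 Hbe; apply: ge_ereal_sup => _ [y _ <-].
have := Hbe y; set e := kernel_mean _ _ => He.
apply: (@le_trans _ _ (`|spline_estimator X m.+1 n jj y w - e|%:E + be%:E)%E).
  rewrite -EFinD lee_fin (_ : _ - p0 y = (spline_estimator X m.+1 n jj y w - e) + (e - p0 y)); last by ring.
  by rewrite (le_trans (ler_normD _ _))// lerD2l.
apply: leeD => //; apply: ereal_sup_ubound; exists y => //.
by rewrite estimator_expectation//.
Qed.

(** The kernel reproduces splines with bounded coefficients, so the bias is a
    constant times the distance from the density to such splines. *)
Lemma smooth_bias (t : R) : 0 < t -> t <= m.+1%:R -> Cspace t p0 ->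
  exists2 A : R, 0 <= A & forall jj y,
  `|kernel_mean jj y - p0 y|
    <= A * 2 `^ (- t * jj%:R).
Proof.
move=> t0 tm Cp; have [A A0 HA] := smooth_spline_approximation t0 tm Cp.
have [C [rho [C0 rho01 bC ab]]] := gram_seq_spec m (R := R).
have r1 : 0 <= (1 - rho)^-1 by case/andP: rho01 => _ /ltW r1; rewrite invr_ge0 subr_ge0.
exists ((m.+1%:R * (C * (2 / (1 - rho)) * m.+2%:R) + 1) * A).
  by apply: mulr_ge0 => //; apply: addr_ge0 => //; nonneg.
move=> jj y; have [v [V vV] Hv] := HA jj.
rewrite -mulrA; apply: (kernel_bias dens C0 rho01 bC ab _ vV) => //.
by rewrite mulr_ge0// powR_ge0.
Qed.

Variables (tau : R) (j : nat -> nat).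
Hypothesis adm : admissible_levels tau j.

Lemma scaling_rate n : (0 < n)%N -> (0 < j n)%N -> scaling j n * rate j n = 1 :> R.
Proof.
move=> n0 j0; have nR : 0 < n%:R :> R by rewrite ltr0n.
have jR : 0 < (j n)%:R :> R by rewrite ltr0n.
have q0 : 0 < 2 ^+ j n :> R by rewrite exprn_gt0.
rewrite /scaling /rate -sqrtrM; last by nonneg.
rewrite (_ : _ * _ = 1) ?sqrtr1//; field; rewrite !gt_eqF//.
Qed.

Lemma cells_rate n : (0 < n)%N -> (0 < j n)%N ->
  2 ^+ j n / n%:R * Num.sqrt ((j n)%:R * n%:R / 2 ^+ j n) = rate j n :> R.
Proof.
move=> n0 j0; have := scaling_cells n0 j0 (R := R); set S := Num.sqrt _ => E.
have : scaling j n * rate j n * (2 ^+ j n / n%:R * S) = rate j n.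
  by rewrite mulrC mulrA [_ / _ * S * _]mulrC mulrA E mul1r.
by rewrite scaling_rate// mul1r.
Qed.

Lemma limn_esup_lt_near (u : nat -> \bar R) (x : R) : (limn_esup u < x%:E)%E ->
  \forall n \near \oo, (u n <= x%:E)%E.
Proof.
move=> /ereal_inf_lt[_ [A FA <-] Ax].
by apply: filterS FA => n An; apply: le_trans (ltW Ax); apply: ereal_sup_ubound; exists n.
Qed.

Lemma sup_centered_ge0 n jj w : (0 <= sup_centered Pr X m.+1 n jj w)%E.
Proof. by apply: le_trans (ereal_sup_ubound _); last (by exists 0); exact: abse_ge0. Qed.

Lemma sup_error_ge0 n jj w : (0 <= sup_error p0 X m.+1 n jj w)%E.
Proof. by apply: le_trans (ereal_sup_ubound _); last (by exists 0); rewrite lee_fin. Qed.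

(** The deviation is eventually at most [c + 1] times its rate, with [c] its limit
    superior. *)
Lemma sup_error_ae (t A : R) : 0 <= A ->
  (forall jj y,
  `|kernel_mean jj y - p0 y|
    <= A * 2 `^ (- t * jj%:R)) ->
  {ae Pr, forall w, bigO_seq (fun n => sup_error p0 X m.+1 n (j n) w)
     (fun n => rate j n + 2 `^ (- t * (j n)%:R))}.
Proof.
move=> A0 HA; apply: filterS (limsup_centered iid dens adm m) => w.
set c := limsup_constant _ _ => Hw.
have c0 : 0 <= c by exact: sqrtr_ge0.
exists (c + 1 + A).
have : \forall n \near \oo, ((scaling j n)%:E * sup_centered Pr X m.+1 n (j n) w <= (c + 1)%:E)%E.
  by apply: (@limn_esup_lt_near (fun n => (scaling j n)%:E * sup_centered Pr X m.+1 n (j n) w)%E); rewrite Hw lte_fin ltrDl.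
apply: filterS2 (levels_gt0 adm) => n [n0 j0] Hn.
rewrite gee0_abs; last exact: sup_error_ge0.
apply: (le_trans (sup_error_le w n0 (HA (j n)))).
have r0 : 0 <= rate j n :> R by exact: sqrtr_ge0.
have E : sup_centered Pr X m.+1 n (j n) w =
    ((rate j n)%:E * ((scaling j n)%:E * sup_centered Pr X m.+1 n (j n) w))%E.
  by rewrite muleA -EFinM mulrC scaling_rate// mul1e.
apply: (@le_trans _ _ ((rate j n)%:E * (c + 1)%:E + (A * 2 `^ (- t * (j n)%:R))%:E)%E).
  by apply: leeD => //; rewrite E; apply: lee_wpmul2l; rewrite ?lee_fin.
rewrite -EFinM -EFinD lee_fin.
have q0 : 0 <= 2 `^ (- t * (j n)%:R) :> R by exact: powR_ge0.
have := mulr_ge0 A0 r0; have := mulr_ge0 c0 q0.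
by move: q0; set q := 2 `^ _ => q0 h1 h2; lra.
Qed.

Lemma moment_const_ge0 (M K B s p : R) : 0 <= B -> 0 <= moment_const M K B s p.
Proof. by move=> B0; rewrite /moment_const; apply: addr_ge0; [exact: powR_ge0 | nonneg]. Qed.

Lemma sup_error_Lp (t A p : R) : 0 <= A -> 1 <= p ->
  (forall jj y,
  `|kernel_mean jj y - p0 y|
    <= A * 2 `^ (- t * jj%:R)) ->
  bigO_seq (fun n => ('N[Pr]_p%:E[sup_error p0 X m.+1 n (j n)])%E)
     (fun n => rate j n + 2 `^ (- t * (j n)%:R)).
Proof.
move=> A0 p1 HA; have pp : 0 < p by exact: lt_le_trans ltr01 p1.
have [K [B [s [K0 B0 s0 [dK dB ds]]]]] := dual_constants m (R := R).
pose c := m.+1%:R * moment_const (density_norm p0) K B s p `^ p^-1.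
have mc0 := @moment_const_ge0 (density_norm p0) K B s p B0.
have c0 : 0 <= c by rewrite /c mulr_ge0// powR_ge0.
exists (4 * (c + A)).
have small := @levels_small R tau j adm 1 ltr01.
apply: filterS2 (levels_gt0 adm) small => n [n0 j0] jn.
have {}jn : (j n * 2 ^ j n <= n)%N by rewrite -(ler_nat R) natrM natrX -[leRHS]mul1r.
rewrite gee0_abs; last exact: Lnorm_ge0.
have r0 : 0 <= rate j n :> R by exact: sqrtr_ge0.
have q0 : 0 <= 2 `^ (- t * (j n)%:R) :> R by exact: powR_ge0.
have [G [mG G0 fG GI]] := sup_centered_dominated iid dens K0 B0 s0 dK dB ds n0 j0 jn p1.
apply: (@le_trans _ _ (4 * (rate j n * c + A * 2 `^ (- t * (j n)%:R)))%:E); last first.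
  rewrite lee_fin -mulrA ler_pM2l//.
  have := mulr_ge0 A0 r0; have := mulr_ge0 c0 q0.
  by move: q0; set q := 2 `^ _ => q0 h1 h2; lra.
apply: (Lnorm_shift_le p1 _ _ _ _ _ mG G0 fG) => //.
- exact: mulr_ge0.
- exact: mulr_ge0.
- by move=> w; exact: sup_centered_ge0.
- by move=> w; exact: sup_error_ge0.
- by move=> w; exact: sup_error_le.
apply: (le_trans GI); rewrite lee_fin le_eqVlt; apply/orP; left; apply/eqP.
set S := Num.sqrt _.
have -> : 2 ^+ j n / n%:R * (m.+1%:R * S) = m.+1%:R * rate j n by rewrite -cells_rate// /S; ring.
have -> : rate j n * c = m.+1%:R * rate j n * moment_const (density_norm p0) K B s p `^ p^-1.
  by rewrite /c; ring.
rewrite [RHS]powRM ?powR_ge0//; last exact: mulr_ge0.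
by rewrite -powRrM mulVf ?gt_eqF// powRr1.
Qed.

End Assembly.

(** * The theorem *)

(** The sample sizes with [n < j n * 2 ^ j n] are finitely many for every
    admissible sequence of levels, whence a bound depending on the sequence. *)
Lemma sparse_levels_bound (R : realType) (j : nat -> nat) (K : R) : exists D : R, 0 <= D /\
  forall tau : R, admissible_levels tau j -> forall n, (0 < n)%N ->
    ~~ (j n * 2 ^ j n <= n)%N -> scaling j n * (2 ^+ j n * K) <= D.
Proof.
have [[tau adm]|nadm] := pselect (exists tau : R, admissible_levels tau j); last first.
  by exists 0; split => // tau adm; case: nadm; exists tau.
have [N _ HN] := levels_small adm (ltr01 : 0 < 1 :> R).
exists (\sum_(n < N) `|scaling j n * (2 ^+ j n * K)|); split; first exact: sumr_ge0.
move=> _ _ n _ jn; have nN : (n < N)%N.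
  rewrite ltnNge; apply: contra jn => Nn; have := HN n Nn.
  by rewrite mul1r -natrX -natrM ler_nat.
apply: (le_trans (ler_norm _)); rewrite (bigD1 (Ordinal nN))//= lerDl.
exact: sumr_ge0.
Qed.

Theorem theorem1 (R : realType) :
  exists (C : R -> nat -> R -> R)
         (C' : R -> nat -> R -> R -> R)
         (C'' : (nat -> nat) -> R -> nat -> R -> R -> R),
  forall (r : nat) (tau : R) (j : nat -> nat),
    (1 <= r)%N -> 0 < tau -> admissible_levels tau j ->
  forall (d : measure_display) (T : measurableType d) (Pr : probability T R)
    (X : nat -> {RV Pr >-> R}) (P : probability R R) (p0 : R -> R),
    has_bounded_density P p0 -> iid_with_law X P ->
  [/\ {ae Pr, forall w,
        limn_esup (fun n =>
          ((scaling j n)%:E * sup_centered Pr X r n (j n) w)%E)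
        = (C (density_norm p0) r tau)%:E},
      forall p : R, 1 <= p ->
        (forall n, (0 < n)%N -> (j n * 2 ^ j n <= n)%N ->
          ((scaling j n)%:E * 'N[Pr]_p%:E[sup_centered Pr X r n (j n)]
            <= (C' (density_norm p0) r p tau)%:E)%E) /\
        (ereal_sup [set ((scaling j n)%:E
                         * 'N[Pr]_p%:E[sup_centered Pr X r n (j n)])%E
                   | n in [set n | (0 < n)%N]]
          <= (C'' j (density_norm p0) r p tau)%:E)%E &
      forall t : R, 0 < t -> t <= r%:R -> Cspace t p0 ->
        {ae Pr, forall w,
          bigO_seq (fun n => sup_error p0 X r n (j n) w)
                   (fun n => rate j n + 2 `^ (- t * (j n)%:R))} /\
        (forall p : R, 1 <= p ->
          bigO_seq (fun n => ('N[Pr]_p%:E[sup_error p0 X r n (j n)])%E)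
                   (fun n => rate j n + 2 `^ (- t * (j n)%:R)))].
Proof.
have dual m : exists KBs : R * R * R, [/\ 0 <= KBs.1.1, 0 <= KBs.1.2, 0 <= KBs.2 &
  [/\ forall z, `|cardinal_spline m (gram_seq m) z| <= KBs.1.1,
   forall (l : seq int) z, uniq l -> \sum_(k <- l) cardinal_spline m (gram_seq m) (z - k%:~R) ^+ 2 <= KBs.1.2 &
   (\int[lebesgue_measure]_z (cardinal_spline m (gram_seq m) z ^+ 2)%:E <= KBs.2%:E)%E]].
  by have [K [B [s H]]] := dual_constants m (R := R); exists (K, B, s).
have {dual} [c Hc] := choice dual.
have [D HD] := choice (fun jK : (nat -> nat) * R => sparse_levels_bound jK.1 jK.2).
pose C' M0 r p (_ : R) := r%:R * moment_const M0 (c r.-1).1.1 (c r.-1).1.2 (c r.-1).2 p `^ p^-1.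
exists (fun M0 r _ => limsup_constant M0 r), C',
  (fun j M0 r p tau => C' M0 r p tau + D (j, r%:R * (2 * (c r.-1).1.1))).
case=> [//|m] tau j _ tau0 adm d T Pr X P p0 dens iid.
have [K0 B0 s0 [dK dB ds]] := Hc m.
set K := (c m).1.1 in K0 dK *.
have j0 n : (0 < n)%N -> (0 < j n)%N by case: adm => + _ _ _ _; apply.
have sc0 n : (0 <= (scaling j n)%:E :> \bar R)%E by rewrite lee_fin scaling_ge0.
split; first exact: (limsup_centered iid dens adm m).
- move=> p p1.
  have C0 : 0 <= C' (density_norm p0) m.+1 p tau.
    by rewrite /C' mulr_ge0// powR_ge0.
  have dense n : (0 < n)%N -> (j n * 2 ^ j n <= n)%N ->
      ((scaling j n)%:E * 'N[Pr]_p%:E[sup_centered Pr X m.+1 n (j n)]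
            <= (C' (density_norm p0) m.+1 p tau)%:E)%E.
    move=> n0 jn.
    have H := Lnorm_sup_centered iid dens K0 B0 s0 dK dB ds n0 (j0 n n0) jn p1.
    apply: (le_trans (lee_wpmul2l (sc0 n) H)); rewrite -EFinM lee_fin.
    have E := scaling_cells n0 (j0 n n0) (R := R).
    rewrite le_eqVlt; apply/orP; left; apply/eqP.
    have arr (a q S v w : R) : a * (q * (v * S) * w) = a * q * S * (v * w) by ring.
    by rewrite arr E mul1r.
  split=> //; apply: ge_ereal_sup => _ [n /= n0 <-].
  have [jn|jn] := boolP (j n * 2 ^ j n <= n)%N.
    apply: (le_trans (dense n n0 jn)); rewrite lee_fin lerDl.
    by have [] := HD (j, m.+1%:R * (2 * K)).
  have [_ /(_ _ adm n n0 jn) /= HDn] := HD (j, m.+1%:R * (2 * K)).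
  apply: (@le_trans _ _ ((scaling j n)%:E * (2 ^+ j n * (m.+1%:R * (2 * K)))%:E)%E).
    apply: lee_wpmul2l => //; apply: Lnorm_le_cst => //; first by nonneg.
    by move=> w; rewrite sup_centered_ge0/=; exact: (sup_centered_crude iid).
  by rewrite -EFinM lee_fin (le_trans HDn)// lerDr.
- move=> t t0 tm Ct; have [A A0 HA] := smooth_bias dens t0 tm Ct.
  split; first exact: (sup_error_ae iid dens adm A0 HA).
  by move=> p p1; exact: (sup_error_Lp iid dens adm A0 p1 HA).
Qed.
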